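(* Let $1<p\le\infty$ and let $X$ be a separable Banach space. Then the following conditions are equivalent. (i) $\mathcal{K}(X\oplus_p X)$ is an $M$-ideal in $\mathcal{L}(X\oplus_p X)$. (ii) $X$ has the metric compact approximation property, has property $(m_p)$, and does not contain a copy of $\ell_1$. (iii) $X$ has the metric compact approximation property and is almost isometric to a subspace of an $\ell_p$-sum of finite-dimensional spaces when $p<\infty$, respectively to a subspace of $c_0$ when $p=\infty$.
   Context: $\mathcal{L}(Z)$ is the Banach space of bounded linear operators on $Z$, $\mathcal{K}(Z)$ its subspace of compact operators; $X\oplus_pX$ is $X\times X$ with norm $\|(x,y)\|=\|(\|x\|,\|y\|)\|_p$, with $\|\cdot\|_p$ the $\ell_p$-norm on $\mathbb{R}^2$. A closed subspace $J$ of a Banach space $E$ is an $M$-ideal in $E$ if there is a subspace $V\subset E^*$ with $E^*=J^\perp\oplus_1 V$, i.e. every $e^*\in E^*$ is uniquely $e^*=j+v$ with $j\in J^\perp$ (annihilator of $J$), $v\in V$, and $\|e^*\|=\|j\|+\|v\|$. A separable Banach space $X$ has property $(m_p)$ if $\limsup_n\|x+x_n\|=\|(\|x\|,\limsup_n\|x_n\|)\|_p$ whenever $x\in X$ and $x_n\to0$ weakly in $X$. $X$ has the metric compact approximation property if there is a net of compact operators on $X$ of norm at most $1$ converging strongly (pointwise in norm) to the identity. A copy of $\ell_1$ is a closed subspace isomorphic to $\ell_1$. If $\mathfrak{Y}$ is a class of Banach spaces, $X$ is almost isometric to a member of $\mathfrak{Y}$ if for every $\varepsilon>0$ there is $Y_\varepsilon\in\mathfrak{Y}$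 whose Banach–Mazur distance to $X$ is less than $1+\varepsilon$. (Here $\mathfrak{Y}$ is the class of subspaces of $\ell_p$-sums of sequences of finite-dimensional Banach spaces, resp. of subspaces of $c_0$.) *)

(* Defs.v *)
From HB Require Import structures.
From mathcomp Require Import all_boot all_order all_algebra.
From mathcomp Require Import complex.
From mathcomp Require Import all_classical all_reals all_analysis.
From mathcomp Require Import ring.

Set Implicit Arguments.
Unset Strict Implicit.
Unset Printing Implicit Defensive.

Import Order.TTheory GRing.Theory Num.Theory.
Import numFieldNormedType.Exports.

Local Open Scope classical_set_scope.
Local Open Scope ring_scope.

(** Banach spaces are real or complex: everything below is uniform in
    [kfield R k], which is [R] or [R[i]]. Norms in a [normedModType K] take
    values in [K]; [rnorm] is the same norm seen in [R]. *)

Variant scalar_kind := real_scalars | complex_scalars.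

Definition kfield (R : realType) (k : scalar_kind) : numFieldType :=
  match k with
  | real_scalars => R
  | complex_scalars => R[i]
  end.

Section Scalars.
Context {R : realType} {k : scalar_kind}.
Notation K := (kfield R k).

Definition kRe : K -> R :=
  match k return kfield R k -> R with
  | real_scalars => fun x => x
  | complex_scalars => fun z => complex.Re z
  end.

Definition kofR : R -> K :=
  match k return R -> kfield R k with
  | real_scalars => fun x => x
  | complex_scalars => fun x => (x%:C)%C
  end.

Lemma kofRK x : kRe (kofR x) = x.
Proof. by rewrite /kRe /kofR; case: k. Qed.

Lemma kofR0 : kofR 0 = 0.
Proof. by rewrite /kofR; case: k. Qed.

Lemma kofRD x y : kofR (x + y) = kofR x + kofR y.
Proof. by rewrite /kofR; case: k => //; rewrite rmorphD. Qed.

Lemma kofRM x y : kofR (x * y) = kofR x * kofR y.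
Proof. by rewrite /kofR; case: k => //; rewrite rmorphM. Qed.

Lemma kofR_le x y : (kofR x <= kofR y) = (x <= y).
Proof. by rewrite /kofR; case: k => //=; rewrite lecR. Qed.

Lemma kReK (z : K) : 0 <= z -> kofR (kRe z) = z.
Proof.
move: z; rewrite /kofR /kRe; case: k => //= -[a b]; rewrite lecE/= => /andP[/eqP -> _].
by [].
Qed.

Lemma kofR_inj : injective kofR.
Proof. by move=> x y /(congr1 kRe); rewrite !kofRK. Qed.

Section RealNorm.
Context {E : normedZmodType K}.

Definition rnorm (x : E) : R := kRe `|x|.

Lemma rnormE x : kofR (rnorm x) = `|x|.
Proof. by rewrite kReK. Qed.

Lemma rnorm_ge0 x : 0 <= rnorm x.
Proof. by rewrite -kofR_le rnormE kofR0. Qed.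

Lemma rnorm0 : rnorm 0 = 0.
Proof. by apply: kofR_inj; rewrite rnormE normr0 kofR0. Qed.

Lemma rnorm_eq0 x : rnorm x = 0 -> x = 0.
Proof. by move=> /(congr1 kofR); rewrite rnormE kofR0 => /normr0_eq0. Qed.

Lemma rnormD x y : rnorm (x + y) <= rnorm x + rnorm y.
Proof. by rewrite -kofR_le kofRD !rnormE ler_normD. Qed.
End RealNorm.

Lemma rnormZ (E : normedModType K) (a : K) (x : E) :
  rnorm (a *: x) = rnorm a * rnorm x.
Proof. by apply: kofR_inj; rewrite kofRM !rnormE normrZ. Qed.

Lemma rnorm_le (E F : normedModType K) (x : E) (y : F) :
  (`|x| <= `|y|) = (rnorm x <= rnorm y).
Proof. by rewrite -kofR_le !rnormE. Qed.

End Scalars.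

Section BoundedOperators.
Context {R : realType} {k : scalar_kind}.
Notation K := (kfield R k).
Variables X Y : normedModType K.

Definition bop_pred : {pred X -> Y} :=
  mem [set T : X -> Y | linear T /\ continuous T].

Record bop := Bop { bop_fun :> X -> Y ; bop_proof : bop_fun \in bop_pred }.

HB.instance Definition _ := [isSub for bop_fun].
HB.instance Definition _ := [Choice of bop by <:].

Lemma bop_submod_closed : submod_closed bop_pred.
Proof.
split.
  rewrite inE; split=> [a x y|x]; first by rewrite scaler0 addr0.
  exact: cvg_cst.
move=> a f g; rewrite !inE => -[lf cf] [lg cg]; split.
  move=> b x y; rewrite !fctE lf lg !scalerDr !scalerA mulrC -!addrA.
  by congr (_ + _); rewrite addrCA.
move=> x; apply: cvgD; last exact: cg.
by apply: cvgZr; exact: cf.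
Qed.

HB.instance Definition _ :=
  GRing.isSubmodClosed.Build K (X -> Y) bop_pred bop_submod_closed.
HB.instance Definition _ := [SubChoice_isSubLmodule of bop by <:].

End BoundedOperators.

Section OperatorNorm.
Context {R : realType} {k : scalar_kind}.
Notation K := (kfield R k).
Context {X Y : normedModType K}.
Implicit Types T S : bop X Y.

Lemma bop_linear T : linear T.
Proof. by have := bop_proof T; rewrite inE => -[]. Qed.

Lemma bop_continuous T : continuous T.
Proof. by have := bop_proof T; rewrite inE => -[]. Qed.

HB.instance Definition _ T :=
  GRing.isLinear.Build K X Y *:%R (bop_fun T) (bop_linear T).

Definition opnorm T : R := sup [set rnorm (T x) | x in [set x | `|x| <= 1]].

Lemma opnorm_nonempty T :
  [set rnorm (T x) | x in [set x | `|x| <= 1]] !=set0.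
Proof. by exists (rnorm (T 0)); exists 0; rewrite //= normr0 ler01. Qed.

Lemma opnorm_has_ubound T :
  has_ubound [set rnorm (T x) | x in [set x | `|x| <= 1]].
Proof.
have /(@continuous_linear_bounded _ _ _ 0 T) : {for 0, continuous T}.
  exact: bop_continuous.
move=> /linear_boundedP /pinfty_ex_gt0[M M0 TM].
exists (kRe M) => _ [x /= x1 <-]; rewrite -(kofR_le (k := k)) rnormE kReK; last exact: ltW.
have TMx : `|T x| <= M * `|x| := TM x.
by apply: (le_trans TMx); rewrite -[leRHS]mulr1 ler_pM2l.
Qed.

Lemma opnorm_ge0 T : 0 <= opnorm T.
Proof.
apply: (le_trans (rnorm_ge0 (T 0))); apply: ub_le_sup.
  exact: opnorm_has_ubound.
by exists 0; rewrite //= normr0 ler01.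
Qed.

Lemma opnormP T x : rnorm (T x) <= opnorm T * rnorm x.
Proof.
have [->|x0] := eqVneq x 0; first by rewrite linear0 !rnorm0 mulr0.
have nx0 : `|x| != 0 by rewrite normr_eq0.
have -> : x = `|x| *: (`|x|^-1 *: x) by rewrite scalerA mulfV// scale1r.
set y := _ *: x.
have y1 : `|y| = 1 by rewrite normrZ normfV normr_id mulVf.
have ry1 : rnorm y = 1.
  by apply: (@kofR_inj _ k); rewrite rnormE y1 /kofR; case: (k).
clearbody y; rewrite linearZ/= !rnormZ mulrCA ler_wpM2l ?rnorm_ge0// ry1 mulr1.
by apply: ub_le_sup; [exact: opnorm_has_ubound|exists y => //=; rewrite y1].
Qed.

Lemma opnorm_le T (M : R) : 0 <= M ->
  (forall x, rnorm (T x) <= M * rnorm x) -> opnorm T <= M.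
Proof.
move=> M0 TM; apply: ge_sup; first exact: opnorm_nonempty.
move=> _ [x /= x1 <-]; apply: (le_trans (TM x)).
rewrite -[leRHS]mulr1 ler_wpM2l//.
rewrite -(kofR_le (k := k)) rnormE (le_trans x1)//.
by rewrite /kofR; case: (k).
Qed.

Lemma opnormD T S : opnorm (T + S) <= opnorm T + opnorm S.
Proof.
apply: opnorm_le => [|x]; first by rewrite addr_ge0 ?opnorm_ge0.
by rewrite mulrDl (le_trans (rnormD _ _))// lerD// opnormP.
Qed.

Lemma opnormZ_le (a : K) T : opnorm (a *: T) <= rnorm a * opnorm T.
Proof.
apply: opnorm_le => [|x]; first by rewrite mulr_ge0 ?opnorm_ge0 ?rnorm_ge0.
have -> : (a *: T) x = a *: T x by [].
by rewrite rnormZ -mulrA ler_wpM2l ?rnorm_ge0// opnormP.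
Qed.

Lemma opnormZ (a : K) T : opnorm (a *: T) = rnorm a * opnorm T.
Proof.
have [->|a0] := eqVneq a 0.
  rewrite rnorm0 mul0r scale0r; apply/le_anti; rewrite opnorm_ge0 andbT.
  by apply: opnorm_le => // x; rewrite mul0r rnorm0.
apply/le_anti; rewrite opnormZ_le/=.
rewrite -[X in _ * opnorm X]scale1r -(mulVf a0) -scalerA.
apply: (le_trans (ler_wpM2l (rnorm_ge0 a) (opnormZ_le _ _))).
rewrite mulrA [X in X * _](_ : _ = 1) ?mul1r//.
apply: (@kofR_inj _ k); rewrite kofRM !rnormE -normrM mulfV// normr1.
by rewrite /kofR; case: (k).
Qed.

Lemma opnorm_eq0 T : opnorm T = 0 -> T = 0.
Proof.
move=> T0; apply/val_inj/funext => x /=; apply: rnorm_eq0.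
by apply/le_anti; rewrite rnorm_ge0 andbT (le_trans (opnormP _ _))// T0 mul0r.
Qed.

Lemma kopnormD T S :
  kofR (opnorm (T + S)) <= kofR (opnorm T) + kofR (opnorm S) :> K.
Proof. by rewrite -kofRD kofR_le opnormD. Qed.

Lemma kopnormZ (a : K) T :
  kofR (opnorm (a *: T)) = `|a| * kofR (opnorm T) :> K.
Proof. by rewrite opnormZ kofRM rnormE. Qed.

Lemma kopnorm_eq0 T : kofR (opnorm T) = 0 :> K -> T = 0.
Proof. by rewrite -(kofR0 (k := k)) => /kofR_inj/opnorm_eq0. Qed.

HB.instance Definition _ := Lmodule_isNormed.Build K (bop X Y)
  kopnormD kopnormZ kopnorm_eq0.

End OperatorNorm.

Section Norm2.
Context {R : realType}.

Definition norm2 (p : \bar R) (a b : R) : R :=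
  match p with
  | r%:E => (`|a| `^ r + `|b| `^ r) `^ r^-1
  | _ => Num.max `|a| `|b|
  end.

Variable p : \bar R.
Hypothesis p1 : (1 <= p)%E.

Lemma norm2_ge0 a b : 0 <= norm2 p a b.
Proof. by rewrite /norm2; case: p => [r||]; rewrite ?powR_ge0// le_max normr_ge0. Qed.

Lemma norm2_eq0 a b : norm2 p a b = 0 -> a = 0 /\ b = 0.
Proof.
rewrite /norm2; case: p p1 => [r||]//; last first.
  move=> _ m0; split; apply/normr0_eq0/le_anti; rewrite normr_ge0 andbT -m0.
    by rewrite le_max lexx.
  by rewrite le_max lexx orbT.
rewrite lee_fin => r1 /eqP; have r0 : 0 < r by rewrite (lt_le_trans ltr01).
rewrite powR_eq0 invr_eq0 (gt_eqF r0)/= andbT paddr_eq0 ?powR_ge0//.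
by rewrite !powR_eq0 !normr_eq0 (gt_eqF r0)/= !andbT => /andP[/eqP-> /eqP->].
Qed.

Lemma norm2Z c a b : norm2 p (c * a) (c * b) = `|c| * norm2 p a b.
Proof.
rewrite /norm2 !normrM; case: p p1 => [r||]//; last first.
  by rewrite maxr_pMr.
rewrite lee_fin => r1; have r0 : 0 < r by rewrite (lt_le_trans ltr01).
rewrite !powRM// -mulrDr powRM ?addr_ge0 ?powR_ge0// -powRrM mulfV ?gt_eqF//.
by rewrite powRr1.
Qed.

Lemma norm2_le a b c d : `|a| <= `|c| -> `|b| <= `|d| ->
  norm2 p a b <= norm2 p c d.
Proof.
rewrite /norm2; case: p p1 => [r r1 ac bd|_ ac bd|//]; last first.
  rewrite ge_max; apply/andP; split; rewrite le_max; apply/orP; first by left.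
  by right.
move: r1; rewrite lee_fin => r1; have r0 : 0 < r by rewrite (lt_le_trans ltr01).
have pr := ge0_ler_powR (ltW r0).
apply: ge0_ler_powR; rewrite ?nnegrE ?invr_ge0 ?addr_ge0 ?powR_ge0 ?(ltW r0)//.
by apply: lerD; apply: pr; rewrite ?nnegrE.
Qed.

Lemma norm2_unit a b (r : R) : p = r%:E ->
  (norm2 p a b <= 1) = (`|a| `^ r + `|b| `^ r <= 1).
Proof.
rewrite /norm2 => pr; move: p1; rewrite pr lee_fin => r1.
have r0 : 0 < r by rewrite (lt_le_trans ltr01).
set s := _ + _; have s0 : 0 <= s by rewrite addr_ge0 ?powR_ge0.
apply/idP/idP => h.
  have := ge0_ler_powR (ltW r0) (powR_ge0 s r^-1) _ h.
  by rewrite nnegrE ler01 powR1 -powRrM mulVf ?gt_eqF// powRr1//; apply.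
have := ge0_ler_powR (_ : 0 <= r^-1) s0 _ h.
by rewrite invr_ge0 ltW// nnegrE ler01 powR1; apply.
Qed.

Lemma norm2D a b c d :
  norm2 p (a + c) (b + d) <= norm2 p a b + norm2 p c d.
Proof.
apply: (@le_trans _ _ (norm2 p (`|a| + `|c|) (`|b| + `|d|))).
  by apply: norm2_le; rewrite [leRHS]ger0_norm ?addr_ge0// ler_normD.
have nn x y : norm2 p x y = norm2 p `|x| `|y| by rewrite /norm2 !normr_id.
rewrite [norm2 p a b]nn [norm2 p c d]nn.
move: (normr_ge0 a) (normr_ge0 b) (normr_ge0 c) (normr_ge0 d).
move: `|a| `|b| `|c| `|d| => {}a {}b {}c {}d a0 b0 c0 d0.
case: (eqVneq p +oo%E) => [pE|pNy].
  rewrite pE /norm2 !ger0_norm ?addr_ge0//.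
  by rewrite ge_max !lerD// le_max lexx ?orbT.
have [r pE] : exists r, p = r%:E by move: p1 pNy; case: p => // r _ _; exists r.
have r1 : 1 <= r by move: p1; rewrite pE.
set A := norm2 p a b; set B := norm2 p c d.
have A0 : 0 <= A := norm2_ge0 _ _.
have B0 : 0 <= B := norm2_ge0 _ _.
have [AE|An0] := eqVneq A 0.
  by have [-> ->] := norm2_eq0 AE; rewrite !add0r -/B lerDr.
have [BE|Bn0] := eqVneq B 0.
  by have [-> ->] := norm2_eq0 BE; rewrite !addr0 -/A lerDl.
have Ap : 0 < A by rewrite lt_neqAle eq_sym An0.
have Bp : 0 < B by rewrite lt_neqAle eq_sym Bn0.
have ABp : 0 < A + B by rewrite addr_gt0.
have key u v (n0 : norm2 p u v != 0) : 0 <= u -> 0 <= v ->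
    (u / norm2 p u v) `^ r + (v / norm2 p u v) `^ r <= 1.
  move=> u0 v0; have N0 := norm2_ge0 u v.
  have := norm2_unit (u / norm2 p u v) (v / norm2 p u v) pE.
  rewrite !ger0_norm ?divr_ge0// => <-.
  by rewrite ![_ / _]mulrC norm2Z ger0_norm ?invr_ge0// mulVf.
have tP : 0 <= A / (A + B) <= 1.
  by rewrite divr_ge0 ?(ltW ABp)//= ler_pdivrMr// mul1r lerDl.
pose t : {i01 R} := Itv01 (andP tP).1 (andP tP).2.
have cvx x y : 0 <= x -> 0 <= y ->
    ((x + y) / (A + B)) `^ r <=
    A / (A + B) * (x / A) `^ r + (1 - A / (A + B)) * (y / B) `^ r.
  move=> x0 y0.
  have xA : x / A \in (`[0, +oo[%classic : set R).
    by rewrite inE/= in_itv/= andbT divr_ge0.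
  have yB : y / B \in (`[0, +oo[%classic : set R).
    by rewrite inE/= in_itv/= andbT divr_ge0.
  have := convex_powR r1 t xA yB.
  rewrite convRE [X in X `^ _ <= _ -> _]convRE /= /unstable.onem => cv.
  have tE : 1 - A / (A + B) = B / (A + B).
    by apply/eqP; rewrite subr_eq -mulrDl addrC mulfV// gt_eqF.
  suff -> : (x + y) / (A + B) =
      A / (A + B) * (x / A) + (1 - A / (A + B)) * (y / B) by exact: cv.
  rewrite tE; field.
  by rewrite An0 Bn0 gt_eqF.
suff : norm2 p ((a + c) / (A + B)) ((b + d) / (A + B)) <= 1.
  by rewrite ![_ / _]mulrC norm2Z gtr0_norm ?invr_gt0// ler_pdivrMl// mulr1.
rewrite (norm2_unit _ _ pE) !ger0_norm ?divr_ge0 ?addr_ge0//.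
apply: (le_trans (lerD (cvx _ _ a0 c0) (cvx _ _ b0 d0))).
rewrite addrACA -!mulrDr.
have t1 : 0 <= 1 - A / (A + B) by rewrite subr_ge0 (andP tP).2.
apply: (@le_trans _ _ (A / (A + B) * 1 + (1 - A / (A + B)) * 1)).
  by rewrite lerD// ler_wpM2l ?(andP tP).1// key.
by rewrite !mulr1 subrKC.
Qed.

End Norm2.

Section DirectSum.
Context {R : realType} {k : scalar_kind}.
Notation K := (kfield R k).

Definition psum (p : \bar R) (p1 : (1 <= p)%E) (X Y : normedModType K) : Type :=
  (X * Y)%type.

Variables (p : \bar R) (p1 : (1 <= p)%E) (X Y : normedModType K).

HB.instance Definition _ := Choice.on (psum p1 X Y).
HB.instance Definition _ := GRing.Lmodule.copy (psum p1 X Y) (X * Y)%type.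

Definition psum_norm (z : psum p1 X Y) : R := norm2 p (rnorm z.1) (rnorm z.2).

Lemma psum_normD z w :
  kofR (psum_norm (z + w)) <= kofR (psum_norm z) + kofR (psum_norm w) :> K.
Proof.
rewrite -kofRD kofR_le /psum_norm (le_trans _ (norm2D p1 _ _ _ _))//.
by apply: norm2_le => //; rewrite !ger0_norm ?addr_ge0 ?rnorm_ge0 ?rnormD.
Qed.

Lemma psum_normZ (a : K) z :
  kofR (psum_norm (a *: z)) = `|a| * kofR (psum_norm z) :> K.
Proof.
rewrite /psum_norm !rnormZ norm2Z// ger0_norm ?rnorm_ge0// kofRM.
by rewrite rnormE.
Qed.

Lemma psum_norm_eq0 z : kofR (psum_norm z) = 0 :> K -> z = 0.
Proof.
rewrite -(kofR0 (k := k)) => /kofR_inj/(norm2_eq0 p1)[/rnorm_eq0 z1 /rnorm_eq0 z2].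
by rewrite [z]surjective_pairing z1 z2.
Qed.

HB.instance Definition _ := Lmodule_isNormed.Build K (psum p1 X Y)
  psum_normD psum_normZ psum_norm_eq0.

End DirectSum.

Section EllNorm.
Context {R : realType}.
Local Open Scope ereal_scope.
Implicit Types (a b : nat -> R) (r : R).

Definition ell_norm r a : \bar R := 'N[counting]_(r%:E)[EFin \o a].

Lemma ell_norm_ge0 r a : 0 <= ell_norm r a.
Proof. exact: Lnorm_ge0. Qed.

Lemma ell_norm0 r : (1 <= r)%R -> ell_norm r (cst 0%R) = 0.
Proof.
move=> r1; apply: Lnorm0.
by rewrite eqe gt_eqF// (lt_le_trans ltr01).
Qed.

Lemma ell_norm_le r a b : (1 <= r)%R -> (forall n, `|a n| <= `|b n|)%R ->
  ell_norm r a <= ell_norm r b.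
Proof.
move=> r1 ab; have r0 : (0 < r)%R by rewrite (lt_le_trans ltr01).
have s0 (c : nat -> R) : 0 <= \sum_(n <oo) `|(EFin \o c) n| `^ r.
  by apply: nneseries_ge0 => *; exact: poweR_ge0.
rewrite /ell_norm !Lnorm_counting//; apply: gt0_ler_poweR.
- by rewrite invr_ge0 ltW.
- by rewrite in_itv/= s0 leey.
- by rewrite in_itv/= s0 leey.
apply: lee_nneseries => [n _ _|n _]; first exact: poweR_ge0.
apply: gt0_ler_poweR; rewrite ?(ltW r0)// ?in_itv/= ?leey ?andbT ?abse_ge0//.
by rewrite lee_fin ab.
Qed.

Lemma measurable_fun_seq a : measurable_fun [set: nat] a.
Proof. by []. Qed.

Lemma ell_normD r a b : (1 <= r)%R ->
  ell_norm r (a \+ b)%R <= ell_norm r a + ell_norm r b.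
Proof. by move=> r1; exact: minkowski_EFin. Qed.

Lemma ell_normZ r (c : R) a : (1 <= r)%R -> ell_norm r a < +oo ->
  ell_norm r (fun n => c * a n)%R = `|c|%:E * ell_norm r a.
Proof.
move=> r1 afin.
have aL : a \in Lfun counting r%:E by rewrite inE/=; apply/andP; rewrite !inE.
have r1' : 1 <= r%:E by rewrite lee_fin.
exact: (LnormZ (Lfun_Sub r1' aL) c).
Qed.

Lemma ell_norm_ge_term r a n : (1 <= r)%R -> `|a n|%:E <= ell_norm r a.
Proof.
move=> r1; have r0 : (0 < r)%R by rewrite (lt_le_trans ltr01).
rewrite /ell_norm Lnorm_counting//.
have -> : `|a n|%:E = (`|a n|%:E `^ r) `^ r^-1.
  by rewrite -poweRrM mulfV ?gt_eqF// poweRe1// lee_fin.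
have s0 : 0 <= \sum_(n <oo) `|(EFin \o a) n| `^ r.
  by apply: nneseries_ge0 => *; exact: poweR_ge0.
apply: gt0_ler_poweR.
- by rewrite invr_ge0 ltW.
- by rewrite in_itv; apply/andP; split; [exact: poweR_ge0|exact: leey].
- by rewrite in_itv/= s0 leey.
apply: (le_trans _ (nneseries_lim_ge n.+1 _)).
  rewrite big_nat_recr//; apply: leeDr; apply: sume_ge0 => *.
  exact: poweR_ge0.
by move=> *; exact: poweR_ge0.
Qed.

End EllNorm.

Section SeqProd.
Context {K : numFieldType} (F : nat -> normedModType K).

Definition seqprod : Type := forall n, F n.

HB.instance Definition _ := gen_eqMixin seqprod.
HB.instance Definition _ := gen_choiceMixin seqprod.

Implicit Types x y z : seqprod.

Definition seqprod_add x y : seqprod := fun n => x n + y n.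
Definition seqprod_opp x : seqprod := fun n => - x n.
Definition seqprod_zero : seqprod := fun=> 0.
Definition seqprod_scale (a : K) x : seqprod := fun n => a *: x n.

Lemma seqprod_addA : associative seqprod_add.
Proof. by move=> x y z; apply: functional_extensionality_dep => n; exact: addrA. Qed.

Lemma seqprod_addC : commutative seqprod_add.
Proof. by move=> x y; apply: functional_extensionality_dep => n; exact: addrC. Qed.

Lemma seqprod_add0 : left_id seqprod_zero seqprod_add.
Proof. by move=> x; apply: functional_extensionality_dep => n; exact: add0r. Qed.

Lemma seqprod_addN : left_inverse seqprod_zero seqprod_opp seqprod_add.
Proof. by move=> x; apply: functional_extensionality_dep => n; exact: addNr. Qed.

HB.instance Definition _ := GRing.isZmodule.Build seqprod
  seqprod_addA seqprod_addC seqprod_add0 seqprod_addN.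

Lemma seqprod_scaleA a b x :
  seqprod_scale a (seqprod_scale b x) = seqprod_scale (a * b) x.
Proof. by apply: functional_extensionality_dep => n; exact: scalerA. Qed.

Lemma seqprod_scale1 : left_id 1 seqprod_scale.
Proof. by move=> x; apply: functional_extensionality_dep => n; exact: scale1r. Qed.

Lemma seqprod_scaleDr : right_distributive seqprod_scale +%R.
Proof. by move=> a x y; apply: functional_extensionality_dep => n; exact: scalerDr. Qed.

Lemma seqprod_scaleDl x : {morph seqprod_scale^~ x : a b / a + b}.
Proof. by move=> a b; apply: functional_extensionality_dep => n; exact: scalerDl. Qed.

HB.instance Definition _ := GRing.Zmodule_isLmodule.Build K seqprod
  seqprod_scaleA seqprod_scale1 seqprod_scaleDr seqprod_scaleDl.

End SeqProd.

Definition lpsum_pred {R : realType} {k : scalar_kind} (r : R)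
    (F : nat -> normedModType (kfield R k)) : {pred seqprod F} :=
  mem [set x : seqprod F | (ell_norm r (fun n => rnorm (x n)) < +oo)%E].

Arguments lpsum_pred {R k} r F _.

Record lpsum {R : realType} {k : scalar_kind} (r : R) (r1 : 1 <= r)
    (F : nat -> normedModType (kfield R k)) := LpSum {
  lpsum_seq : seqprod F ;
  lpsum_proof : lpsum_seq \in lpsum_pred r F }.

Section LpSum.
Context {R : realType} {k : scalar_kind}.
Notation K := (kfield R k).
Variables (r : R) (r1 : 1 <= r) (F : nat -> normedModType K).
Notation T := (lpsum r1 F).

HB.instance Definition _ := [isSub of T for @lpsum_seq R k r r1 F].
HB.instance Definition _ := [Choice of T by <:].

Lemma lpsum_addle (x y : seqprod F) :
  (ell_norm r (fun n => rnorm ((x + y) n)) <=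
   ell_norm r (fun n => rnorm (x n)) + ell_norm r (fun n => rnorm (y n)))%E.
Proof.
apply: le_trans (ell_normD _ _ r1); apply: ell_norm_le => // n.
by rewrite !ger0_norm ?addr_ge0 ?rnorm_ge0// rnormD.
Qed.

Lemma lpsum_scale (a : K) (x : seqprod F) :
  (ell_norm r (fun n => rnorm (x n)) < +oo)%E ->
  (ell_norm r (fun n => rnorm ((a *: x) n)) =
   (rnorm a)%:E * ell_norm r (fun n => rnorm (x n)))%E.
Proof.
move=> xfin; rewrite -[in RHS](ger0_norm (rnorm_ge0 a)) -ell_normZ//.
by congr ell_norm; apply/funext => n; exact: rnormZ.
Qed.

Lemma lpsum_submod_closed : submod_closed (lpsum_pred r F).
Proof.
split.
  rewrite inE/=; have -> : (fun n => rnorm ((0 : seqprod F) n)) = cst 0.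
    by apply/funext => n; exact: rnorm0.
  by rewrite ell_norm0// ltry.
move=> a x y; rewrite !inE/= => xfin yfin.
apply: (le_lt_trans (lpsum_addle _ _)); rewrite lpsum_scale//.
by rewrite lte_add_pinfty// lte_mul_pinfty// ?lee_fin ?rnorm_ge0.
Qed.

HB.instance Definition _ :=
  GRing.isSubmodClosed.Build K (seqprod F) (lpsum_pred r F) lpsum_submod_closed.
HB.instance Definition _ := [SubChoice_isSubLmodule of T by <:].

Definition lpsum_norm (x : T) : R :=
  fine (ell_norm r (fun n => rnorm (lpsum_seq x n))).

Lemma lpsum_normE x :
  (lpsum_norm x)%:E = ell_norm r (fun n => rnorm (lpsum_seq x n)).
Proof.
by rewrite fineK// ge0_fin_numE ?ell_norm_ge0//; have := lpsum_proof x; rewrite inE.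
Qed.

Lemma lpsum_normD x y :
  kofR (lpsum_norm (x + y)) <= kofR (lpsum_norm x) + kofR (lpsum_norm y) :> K.
Proof.
by rewrite -kofRD kofR_le -lee_fin EFinD !lpsum_normE; exact: lpsum_addle.
Qed.

Lemma lpsum_normZ (a : K) x :
  kofR (lpsum_norm (a *: x)) = `|a| * kofR (lpsum_norm x) :> K.
Proof.
rewrite -(rnormE a) -kofRM; congr kofR; apply: EFin_inj.
rewrite EFinM !lpsum_normE; apply: lpsum_scale.
by have := lpsum_proof x; rewrite inE.
Qed.

Lemma lpsum_norm_eq0 x : kofR (lpsum_norm x) = 0 :> K -> x = 0.
Proof.
rewrite -(kofR0 (k := k)) => /kofR_inj x0.
apply/val_inj/functional_extensionality_dep => n; apply: rnorm_eq0.
apply/le_anti; rewrite rnorm_ge0 andbT -lee_fin.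
have := ell_norm_ge_term (fun n => rnorm (lpsum_seq x n)) n r1.
by rewrite -lpsum_normE x0 ger0_norm// rnorm_ge0.
Qed.

HB.instance Definition _ := Lmodule_isNormed.Build K T
  lpsum_normD lpsum_normZ lpsum_norm_eq0.

End LpSum.

Section CZero.
Variables (R : realType) (k : scalar_kind).
Notation K := (kfield R k).

Definition czero_pred : {pred nat -> K^o} :=
  mem [set x : nat -> K^o | x @ \oo --> (0 : K^o)].

Record czero :=
  CZero { czero_seq : nat -> K^o ; czero_proof : czero_seq \in czero_pred }.

HB.instance Definition _ := [isSub for czero_seq].
HB.instance Definition _ := [Choice of czero by <:].

Lemma czero_submod_closed : submod_closed czero_pred.
Proof.
split=> [|a x y]; first by rewrite inE; exact: cvg_cst.
rewrite !inE => x0 y0 /=.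
rewrite -[X in _ --> X]addr0 -[X in _ --> X + _](scaler0 _ a).
apply: cvgD; last exact: y0.
by apply: cvgZr; exact: x0.
Qed.

HB.instance Definition _ := GRing.isSubmodClosed.Build K (nat -> K^o)
  czero_pred czero_submod_closed.
HB.instance Definition _ := [SubChoice_isSubLmodule of czero by <:].

Definition czero_norm (x : czero) : R :=
  sup (range (fun n => rnorm (czero_seq x n))).

Lemma czero_has_ubound x : has_ubound (range (fun n => rnorm (czero_seq x n))).
Proof.
have : bounded_fun (czero_seq x).
  apply: cvg_seq_bounded; apply/cvg_ex; exists 0.
  by have := czero_proof x; rewrite inE.
move=> /pinfty_ex_gt0[M M0 xM]; exists (kRe M) => _ [n _ <-].
by rewrite -(kofR_le (k := k)) rnormE kReK ?(ltW M0)//; exact: xM.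
Qed.

Lemma czero_norm_ge x n : rnorm (czero_seq x n) <= czero_norm x.
Proof. by apply: ub_le_sup; [exact: czero_has_ubound|exists n]. Qed.

Lemma czero_norm_ge0 x : 0 <= czero_norm x.
Proof. exact: le_trans (rnorm_ge0 _) (czero_norm_ge x 0). Qed.

Lemma czero_norm_le x M : (forall n, rnorm (czero_seq x n) <= M) ->
  czero_norm x <= M.
Proof.
move=> xM; apply: ge_sup; first by exists (rnorm (czero_seq x 0)), 0%N.
by move=> _ [n _ <-].
Qed.

Lemma czero_normZ_le (a : K) x : czero_norm (a *: x) <= rnorm a * czero_norm x.
Proof.
apply: czero_norm_le => n.
have -> : czero_seq (a *: x) n = a *: czero_seq x n by [].
by rewrite rnormZ ler_wpM2l ?rnorm_ge0 ?czero_norm_ge.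
Qed.

Lemma czero_normD x y :
  kofR (czero_norm (x + y)) <= kofR (czero_norm x) + kofR (czero_norm y) :> K.
Proof.
rewrite -kofRD kofR_le; apply: czero_norm_le => n.
by rewrite (le_trans (rnormD _ _))// lerD ?czero_norm_ge.
Qed.

Lemma czero_normZ (a : K) x :
  kofR (czero_norm (a *: x)) = `|a| * kofR (czero_norm x) :> K.
Proof.
rewrite -(rnormE a) -kofRM; congr kofR; apply/le_anti; rewrite czero_normZ_le/=.
have [->|a0] := eqVneq a 0.
  by rewrite rnorm0 mul0r scale0r czero_norm_ge0.
rewrite -[X in _ * czero_norm X]scale1r -(mulVf a0) -scalerA.
apply: (le_trans (ler_wpM2l (rnorm_ge0 a) (czero_normZ_le _ _))).
rewrite mulrA [X in X * _](_ : _ = 1) ?mul1r//.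
apply: (@kofR_inj _ k); rewrite kofRM !rnormE -normrM mulfV// normr1.
by rewrite /kofR; case: (k).
Qed.

Lemma czero_norm_eq0 x : kofR (czero_norm x) = 0 :> K -> x = 0.
Proof.
rewrite -(kofR0 (k := k)) => /kofR_inj x0.
apply/val_inj/funext => n; apply: rnorm_eq0.
by apply/le_anti; rewrite rnorm_ge0 andbT -x0 czero_norm_ge.
Qed.

HB.instance Definition _ := Lmodule_isNormed.Build K czero
  czero_normD czero_normZ czero_norm_eq0.

End CZero.

Record closed_subspace (K : numFieldType) (E : normedModType K) :=
  ClosedSubspace {
    cs_pred :> {pred E} ;
    cs_submod : submod_closed cs_pred ;
    cs_closed : closed [set` cs_pred] }.

Section Subspace.
Context {K : numFieldType} {E : normedModType K}.
Variable U : closed_subspace E.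

Record cssub := CSSub { cssub_val : E ; cssub_proof : cssub_val \in cs_pred U }.

HB.instance Definition _ := [isSub for cssub_val].
HB.instance Definition _ := [Choice of cssub by <:].
HB.instance Definition _ :=
  GRing.isSubmodClosed.Build K E (cs_pred U) (cs_submod U).
HB.instance Definition _ := [SubChoice_isSubLmodule of cssub by <:].

Definition cssub_norm (x : cssub) : K := `|cssub_val x|.

Lemma cssub_normD x y : cssub_norm (x + y) <= cssub_norm x + cssub_norm y.
Proof. exact: ler_normD. Qed.

Lemma cssub_normZ a x : cssub_norm (a *: x) = `|a| * cssub_norm x.
Proof. exact: normrZ. Qed.

Lemma cssub_norm_eq0 x : cssub_norm x = 0 -> x = 0.
Proof. by move=> /normr0_eq0 x0; exact: val_inj. Qed.

HB.instance Definition _ := Lmodule_isNormed.Build K cssub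
  cssub_normD cssub_normZ cssub_norm_eq0.

End Subspace.

Section BanachNotions.
Context {R : realType} {k : scalar_kind}.
Notation K := (kfield R k).
Notation dual E := (bop E K^o).
Implicit Types (E X Y : normedModType K).

Definition separable E : Prop := exists2 D : set E, countable D & dense D.

Definition finite_dimensional E : Prop :=
  exists (n : nat) (e : 'I_n -> E),
    forall x, exists c : 'I_n -> K, x = \sum_(i < n) c i *: e i.

Definition compact_op {X Y} : set (bop X Y) :=
  [set T | precompact (T @` [set x | `|x| <= 1])].

Definition annihilator E (J : set E) : set (dual E) :=
  [set f | forall x, J x -> f x = 0].

Definition M_ideal E (J : set E) : Prop :=
  [/\ submod_closed (mem J : {pred E}), closed J &
      exists V : set (dual E),
        [/\ submod_closed (mem V : {pred dual E}),
            (forall f : dual E, exists! jv : dual E * dual E,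
               [/\ annihilator J jv.1, V jv.2 & f = jv.1 + jv.2]) &
            (forall j v : dual E, annihilator J j -> V v ->
               `|j + v| = `|j| + `|v|)]].

Definition weakly_null E (u : nat -> E) : Prop :=
  forall f : dual E, f \o u @ \oo --> (0 : K^o).

(** Weakly null sequences are bounded, so that the real-valued [limn_sup] is
    the usual limit superior here. *)
Definition property_mp (p : \bar R) E : Prop :=
  forall (x : E) (u : nat -> E), weakly_null u ->
    limn_sup (fun n => rnorm (x + u n)) =
    norm2 p (rnorm x) (limn_sup (fun n => rnorm (u n))).

Definition directed (I : Type) (le : I -> I -> Prop) : Prop :=
  [/\ inhabited I,
      (forall i, le i i),
      (forall i j l, le i j -> le j l -> le i l) &
      (forall i j, exists l, le i l /\ le j l)].

Definition metric_compact_approximation E : Prop :=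
  exists (I : Type) (le : I -> I -> Prop) (S : I -> bop E E),
    [/\ directed le,
        (forall i, compact_op (S i)),
        (forall i, opnorm (S i) <= 1) &
        (forall (x : E) (e : R), 0 < e ->
           exists i0, forall i, le i0 i -> rnorm (S i x - x) < e)].

Definition isomorphic X Y : Prop :=
  exists (T : bop X Y) (S : bop Y X), cancel T S /\ cancel S T.

Definition ell1 : normedModType K :=
  lpsum (lexx (1 : R)) (fun=> (K^o : normedModType K)).

Definition contains_ell1 E : Prop :=
  exists U : closed_subspace E, isomorphic (cssub U) ell1.

(** The infimum is [+oo] when [X] and [Y] are not isomorphic. *)
Definition banach_mazur X Y : \bar R :=
  ereal_inf [set (opnorm TS.1 * opnorm TS.2)%:E | TS in
    [set TS : bop X Y * bop Y X | cancel TS.1 TS.2 /\ cancel TS.2 TS.1]].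

Definition almost_isometric_to_member (YY : normedModType K -> Prop) X : Prop :=
  forall e : R, 0 < e ->
    exists2 Y, YY Y & (banach_mazur X Y < (1 + e)%:E)%E.

Definition subspace_of_lpsum_fd (r : R) (r1 : 1 <= r) Y : Prop :=
  exists (F : nat -> normedModType K) (U : closed_subspace (lpsum r1 F)),
    (forall n, finite_dimensional (F n)) /\ Y = cssub U.

Definition subspace_of_c0 Y : Prop :=
  exists U : closed_subspace (czero R k), Y = cssub U.

(** Used for [1 < p] only, where the side condition [r1] always holds. *)
Definition lp_models (p : \bar R) Y : Prop :=
  match p with
  | r%:E => exists r1 : 1 <= r, subspace_of_lpsum_fd r1 Y
  | +oo%E => subspace_of_c0 Y
  | -oo%E => False
  end.

End BanachNotions.

(* Main.v *)
Require Import Defs.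
From HB Require Import structures.
From mathcomp Require Import all_boot all_order all_algebra.
From mathcomp Require Import complex.
From mathcomp Require Import all_classical all_reals all_analysis.
From mathcomp Require Import ring lra zify.

Set Implicit Arguments.
Unset Strict Implicit.
Unset Printing Implicit Defensive.

Import Order.TTheory GRing.Theory Num.Theory.
Import numFieldNormedType.Exports.

Local Open Scope classical_set_scope.
Local Open Scope ring_scope.

(** (i) => (ii). For a compact [S] with [|S| <= 1], the M-ideal property yields
    compact [A] with [|S + I - A| <= 1 + e] and [A] close to the identity at given
    points, or at a given functional. With [S] of rank one this is Kalton's property
    (M) in [Z] and its dual; the swap of the two summands of [Z] turns (M) into
    (m_p). The dual version forces [f \o S_n -> f] weakly in the dual for compact
    contractions [S_n -> I], so bounded sequences have weakly Cauchy subsequences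
    and [ell_1] does not embed.

    (ii) => (iii) and (iii) => (i). If (m_p) holds and bounded sequences have weakly
    Cauchy subsequences (Rosenthal's theorem under (ii), a direct argument under
    (iii)), the approximating sequence is shrinking, and convex combinations of it
    give compact cuts [Q << Q'] with [|I - Q' + Q| <= 1 + e]. Along a fast sequence
    of such cuts, blocks between consecutive gaps add up like an [ell_p]-sum; since
    the gaps are shared between [2^K] interlaced block decompositions, averaging
    these makes the gaps negligible and embeds [X] almost isometrically into the
    model. On [Z] the cuts give [|S Q + T (I - Q')| <= 1 + e] for compact [S] and
    contractions [S], [T], which is what the M-ideal decomposition needs. *)

(** The cuts are not projections and need not commute; all that can be arranged is that a late cut
    almost fixes what earlier cuts produce. The trivial constant for [I - Q' + Q] is 3. It is
    lowered because [N 1 s] is [1 + o(s)]: a small multiple of the omitted middle can be added to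
    the rest at almost no cost in norm, so a functional norming the rest hardly sees the middle. The
    same flatness of the unit ball gives the shrinking property.

    Blocks along a single residue class satisfy only an upper bound, since [x] may live in the gaps
    of that class. The lower bound holds on average over the classes: their sum misses all the gap
    pieces once, a vector of norm at most 3, against [2 ^ K] copies of [x]. Both bounds for the
    whole family carry the factor [N 1 1 ^+ K], the norm of [2 ^ K] entries equal to 1. A power of
    two lets this factor arise by repeated halving, with no mention of the exponent, so that finite
    and infinite [p] are treated alike. *)

Lemma subrBB (V : zmodType) (x y z t : V) : (x - y) - (z - t) = (x - z) - (y - t).
Proof. by rewrite !opprB addrACA [RHS]addrACA [- y - z]addrC. Qed.

(** * Subsequences, diagonal arguments and real limits *)

Definition incr (s : nat -> nat) := forall n, (s n < s n.+1)%N.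

Lemma incr_lt s : incr s -> {homo s : m n / (m < n)%N}.
Proof. by move=> si; apply: homo_ltn; [exact: ltn_trans|exact: si]. Qed.

Lemma incr_ge s : incr s -> forall n, (n <= s n)%N.
Proof. by move=> si; elim=> // n IH; exact: leq_ltn_trans IH (si n). Qed.

Lemma incr_comp s t : incr s -> incr t -> incr (s \o t).
Proof. by move=> si ti n; apply: (incr_lt si); exact: ti. Qed.

(** Dependent choice in which the next term sees the whole list of earlier ones, as is needed for
    cuts that must be late with respect to all their predecessors. *)
Lemma prefix_choice (T : Type) (P : seq T -> T -> Prop) :
  (forall l, exists x, P l x) ->
  exists G : nat -> T, forall n, P (mkseq G n) (G n).
Proof.
move=> /choice[f Pf].
pose L := fix L n := if n is m.+1 then rcons (L m) (f (L m)) else [::].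
exists (fun n => f (L n)) => n.
suff -> : mkseq (fun n => f (L n)) n = L n; first exact: Pf.
by elim: n => // n IH; rewrite mkseqS IH.
Qed.

Lemma subseq_of_frequently (P : nat -> Prop) :
  (forall N, exists2 n, (N <= n)%N & P n) ->
  exists2 s, incr s & forall n, P (s n).
Proof.
move=> Pn; have /choice[f Pf] : forall N, exists n, (N <= n)%N /\ P n.
  by move=> N; have [n Nn Pn'] := Pn N; exists n.
pose s := fix s n := if n is m.+1 then f (s m).+1 else f 0.
exists s => [n|n]; first by rewrite -/(s _) [s n.+1]/=; case: (Pf (s n).+1).
by case: n => [|n]; [case: (Pf 0%N)|case: (Pf (s n).+1)].
Qed.

(** Each stage [S j.+1] is a subsequence of [S j], and from index [j] on the diagonal [S n n] is a
    subsequence of [S j]. This is why [Q j] has to pass to subsequences and to be insensitive to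
    initial terms. *)
Lemma diagonal_subseq (Q : nat -> (nat -> nat) -> Prop) :
  (forall j s t, incr t -> Q j s -> Q j (s \o t)) ->
  (forall j s N, Q j (fun n => s (n + N)%N) -> Q j s) ->
  (forall j s, incr s -> exists2 t, incr t & Q j (s \o t)) ->
  exists2 s, incr s & forall j, Q j s.
Proof.
move=> Qsub Qtail Qex.
have /choice[T HT] : forall js : nat * (nat -> nat), exists t, incr js.2 ->
    incr t /\ Q js.1 (js.2 \o t).
  move=> [j s]; have [si|ns] := pselect (incr s); last by exists id.
  by have [t ti Qt] := Qex j s si; exists t.
pose S := fix S j := if j is i.+1 then S i \o T (j, S i) else T (0%N, id).
have S0 : incr (S 0) /\ Q 0%N (S 0) by exact: (HT (0%N, id) (fun=> leqnn _)).
have Si j : incr (S j).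
  elim: j => [|j IH]; first exact: S0.1.
  by apply: incr_comp => //; case: (HT (j.+1, S j) IH).
have QS j : Q j (S j).
  by case: j => [|j]; [exact: S0.2|case: (HT (j.+1, S j) (Si j))].
pose t j := T (j.+1, S j).
have ti j : incr (t j) by case: (HT (j.+1, S j) (Si j)).
(* [r j m] records how stage [m + j] sits inside stage [j]. *)
pose r j := fix r m := if m is n.+1 then r n \o t (n + j)%N else id.
have rS j m : S (m + j)%N = S j \o r j m.
  by elim: m => // m IH; rewrite addSn /= -/(t _) IH.
have ri j m : incr (r j m).
  by elim: m => [n|m IH]; [exact: leqnn|apply: incr_comp].
have tauE j n : S (n + j)%N (n + j)%N = S j (r j n (n + j)%N) by rewrite rS.
have taui j : incr (fun n => r j n (n + j)%N).
  by move=> n /=; apply: (incr_lt (ri _ _)); rewrite -addSn; exact: incr_ge.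
exists (fun n => S n n) => [n|j].
  by have := incr_lt (Si n) (taui n 0%N); rewrite -!tauE.
apply: (Qtail j _ j); rewrite (_ : (fun n => _) = S j \o (fun n => r j n (n + j)%N)).
  exact: Qsub.
by apply/funext => n; rewrite tauE.
Qed.

Definition rcv {R : realType} (a : nat -> R) (l : R) :=
  forall e, 0 < e -> exists N, forall n, (N <= n)%N -> `|a n - l| < e.

Lemma rcvP {R : realType} (a : nat -> R) l : rcv a l <-> a @ \oo --> l.
Proof.
split=> [al|/cvgrPdist_lt al].
  apply/cvgrPdist_lt => e /al[N HN]; exists N => // n /= Nn.
  by rewrite distrC; exact: HN.
by move=> e /al[N _ HN]; exists N => n Nn; rewrite distrC; exact: HN.
Qed.

Lemma real_subseq {R : realType} (a : nat -> R) M :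
  (forall n, `|a n| <= M) -> exists s l, incr s /\ rcv (a \o s) l.
Proof.
move=> aM.
have [|s si /cvg_ex[l /rcvP sl]] := @bolzano_weierstrass R a.
  by exists M; split; [exact: num_real|move=> x Mx n _; exact: le_trans (ltW Mx)].
exists s, l; split => // n.
by rewrite ltnNge -leEnat si -ltnNge.
Qed.

Section ScalarsMore.
Context {R : realType} {k : scalar_kind}.
Notation K := (kfield R k).

Lemma kofRN a : kofR (- a) = - kofR a :> K.
Proof. by apply/eqP; rewrite -addr_eq0 -kofRD addNr kofR0. Qed.

Lemma kofR1 : kofR 1 = 1 :> K.
Proof. by rewrite /kofR; case: (k). Qed.

Lemma rnorm_kofR (a : R) : rnorm (kofR a : K) = `|a|.
Proof.
have pos (b : R) : 0 <= b -> rnorm (kofR b : K) = b.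
  by move=> b0; rewrite /rnorm ger0_norm ?kofRK// -(kofR0 (k:=k)) kofR_le.
have [a0|a0] := leP 0 a; first by rewrite pos// ger0_norm.
rewrite ltr0_norm// -[RHS]pos ?oppr_ge0 1?ltW//.
rewrite /rnorm -normrN; congr (kRe `| _ |).
by rewrite kofRN.
Qed.

Lemma kReD (x y : K) : kRe (x + y) = kRe x + kRe y.
Proof. by rewrite /kRe; case: (k) x y => // -[a b] [c d]. Qed.

Lemma kReZ (a : R) (x : K^o) : kRe (kofR a *: x) = a * kRe x.
Proof.
rewrite /kRe /kofR; case: (k) x => // -[c d] /=.
by rewrite -[in LHS]/(_ * _) /= mul0r subr0.
Qed.

Lemma kRe_le (x : K^o) : kRe x <= rnorm x.
Proof.
rewrite /rnorm /kRe; case: (k) x => [x|]; first exact: ler_norm.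
move=> x; apply: le_trans (ler_norm _) _.
by have := normc_ge_Re x; rewrite lecE => /andP[].
Qed.

Lemma kRe_eq (x y : K^o) : (forall a : K, kRe (a *: x) = kRe (a *: y)) -> x = y.
Proof.
rewrite /kRe; case: (k) x y => /= [x y /(_ 1)|]; first by rewrite !scale1r.
move=> [a b] [c d] h; have := h 1; have := h 'i%C; rewrite -![_ *: _]/(_ * _) /=.
by rewrite !(mul0r, mul1r, sub0r, addr0, subr0) => /oppr_inj-> ->.
Qed.
End ScalarsMore.

(** * Linear functionals and the Hahn-Banach theorem *)

Section LinearFun.
Context {K : nzRingType} {U W : lmodType K} (f : U -> W).
Hypothesis lf : linear f.

Lemma lin0 : f 0 = 0.
Proof.
have := lf 1 0 0; rewrite !scale1r add0r => /eqP.
by rewrite -subr_eq0 opprD addrA addrN sub0r oppr_eq0 => /eqP.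
Qed.

Lemma linD x y : f (x + y) = f x + f y.
Proof. by have := lf 1 x y; rewrite !scale1r. Qed.

Lemma linZ a x : f (a *: x) = a *: f x.
Proof. by have := lf a x 0; rewrite !addr0 lin0 addr0. Qed.

Lemma linN x : f (- x) = - f x.
Proof. by rewrite -scaleN1r linZ scaleN1r. Qed.

Lemma linB x y : f (x - y) = f x - f y.
Proof. by rewrite linD linN. Qed.

Lemma lin_sum I (r : seq I) (P : pred I) (g : I -> U) :
  f (\sum_(i <- r | P i) g i) = \sum_(i <- r | P i) f (g i).
Proof. by apply: (big_morph f linD lin0). Qed.

End LinearFun.

Lemma complex_of_real_part (R : realType) (k : scalar_kind)
    (V : lmodType (kfield R k)) (h : V -> R) :
  (forall x y, h (x + y) = h x + h y) ->
  (forall (a : R) x, h (kofR a *: x) = a * h x) ->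
  exists F : V -> (kfield R k)^o, linear F /\ forall x, kRe (F x) = h x.
Proof.
case: k V h => V h hD hZ.
  by exists h; split=> // a x y; rewrite hD hZ.
have hN x : h (- x) = - h x.
  by rewrite -scaleN1r -[X in X *: _](_ : kofR (-1) = _) ?hZ ?mulN1r// kofRN kofR1.
pose F (x : V) : R[i] := (h x +i* - h ('i%C *: x))%C.
exists F; split=> [|x]; last by [].
have FD x y : F (x + y) = F x + F y.
  by rewrite /F scalerDr !hD opprD.
have aE (u v : R) (x : V) :
    (u +i* v)%C *: x = (u%:C)%C *: x + (v%:C)%C *: ('i%C *: x).
  by rewrite scalerA -scalerDl; congr (_ *: _); rewrite [LHS]complexE mulrC.
have hZ' a x : h ((a%:C)%C *: x) = a * h x := hZ a x.
move=> [u v] x y; rewrite FD; congr (_ + _).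
have iE : 'i%C *: ((u +i* v)%C *: x) = (u%:C)%C *: ('i%C *: x) - (v%:C)%C *: x.
  rewrite (aE u v) scalerDr !scalerA ![('i * _)%C]mulrC; congr (_ + _).
  by rewrite -mulrA -expr2 sqr_i mulrN1 scaleNr.
rewrite /F iE (aE u v) !hD hN !hZ'.
apply/eqP; rewrite eq_complex /=; apply/andP; split; apply/eqP; ring.
Qed.

Section HahnBanach.
Context {R : realType} {k : scalar_kind}.
Notation K := (kfield R k).
Variable V : lmodType K.
Variable q : V -> R.
Hypothesis qD : forall x y, q (x + y) <= q x + q y.
Hypothesis qZ : forall (a : K) x, q (a *: x) = rnorm a * q x.

(** Graphs of partial real-linear functionals dominated by [q]. Single-valuedness is a consequence:
    if [(0, r)] is in [G], so is [(0, - r)], and both are bounded by [q 0 = 0]. *)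
Definition sublin_graph (G : set (V * R)) := 
  [/\ forall u v, G u -> G v -> G (u.1 + v.1, u.2 + v.2),
      forall (a : R) u, G u -> G (kofR a *: u.1, a * u.2) &
      forall u, G u -> u.2 <= q u.1].

(** The value at [x0] has to lie above all [u.2 - q (u.1 - x0)] and below all [q (v.1 + x0) - v.2].
    Subadditivity puts these in the right order, and [c] is the least admissible value. *)
Lemma sublin_graph_extend (G : set (V * R)) (x0 : V) : sublin_graph G -> G !=set0 ->
  exists G', [/\ sublin_graph G', G `<=` G' & exists r, G' (x0, r)].
Proof.
move=> [GD GZ Gq] [u0 Gu0].
have G0 : G (0, 0) by have := GZ 0 _ Gu0; rewrite kofR0 scale0r mul0r.
pose c := sup [set u.2 - q (u.1 - x0) | u in G].
have Gle u v : G u -> G v -> u.2 - q (u.1 - x0) <= q (v.1 + x0) - v.2.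
  move=> Gu Gv; have /= h := Gq _ (GD _ _ Gu Gv).
  have := qD (u.1 - x0) (v.1 + x0).
  by rewrite addrACA addNr addr0 => h'; lra.
have cub u : G u -> u.2 - q (u.1 - x0) <= c.
  move=> Gu; apply: ub_le_sup; last by exists u.
  exists (q (0 + x0) - 0) => _ [v Gv <-]; exact: (Gle _ (0, 0)).
have clb v : G v -> c <= q (v.1 + x0) - v.2.
  move=> Gv; apply: ge_sup; first by exists (u0.2 - q (u0.1 - x0)), u0.
  by move=> _ [u Gu <-]; exact: Gle.
exists [set w | exists u (t : R), G u /\ w = (u.1 + kofR t *: x0, u.2 + t * c)].
split.
- split=> [_ _ [u [s [Gu ->]]] [v [t [Gv ->]]]|a _ [u [s [Gu ->]]]|_ [u [s [Gu ->]]]] /=.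
  + exists (u.1 + v.1, u.2 + v.2), (s + t); split; first exact: GD.
    by rewrite /= kofRD scalerDl mulrDl; congr (_, _); rewrite addrACA.
  + exists (kofR a *: u.1, a * u.2), (a * s); split; first exact: GZ.
    by rewrite /= kofRM scalerDr scalerA mulrDr mulrA.
  + have [s0|s0|->] := ltgtP s 0; last first.
    * by rewrite kofR0 scale0r mul0r !addr0; exact: Gq.
    * have e : q (u.1 + kofR s *: x0) = s * q (kofR s^-1 *: u.1 + x0).
        rewrite -[X in X * q _](gtr0_norm s0) -(rnorm_kofR (k := k)) -qZ.
        by rewrite scalerDr scalerA -kofRM mulfV ?gt_eqF// kofR1 scale1r.
      have := ler_wpM2l (ltW s0) (clb _ (GZ s^-1 _ Gu)).
      by rewrite e mulrBr mulVKf ?gt_eqF//= => ?; lra.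
    * have s0' : 0 < - s by rewrite oppr_gt0.
      have e : q (u.1 + kofR s *: x0) = - s * q (kofR (- s)^-1 *: u.1 - x0).
        rewrite -[X in X * q _](gtr0_norm s0') -(rnorm_kofR (k := k)) -qZ.
        rewrite scalerBr scalerA -kofRM mulfV ?gt_eqF// kofR1 scale1r.
        by rewrite kofRN scaleNr opprK.
      have := ler_wpM2l (ltW s0') (cub _ (GZ (- s)^-1 _ Gu)).
      by rewrite e mulrBr mulVKf ?gt_eqF//= => ?; lra.
- move=> u Gu; exists u, 0; split=> //.
  by rewrite kofR0 scale0r mul0r !addr0; case: u Gu.
- exists (0 + 1 * c), (0, 0), 1; split; first exact: G0.
  by rewrite /= kofR1 scale1r [X in _ = (X, _)]add0r.
Qed.

Lemma sublin_graph_total (G : set (V * R)) : sublin_graph G -> G !=set0 ->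
  exists h : V -> R, [/\ forall x y, h (x + y) = h x + h y,
    forall (a : R) x, h (kofR a *: x) = a * h x, forall x, h x <= q x &
    forall u, G u -> h u.1 = u.2].
Proof.
move=> sG G0.
(* The chain to be bounded may be empty, so the property is imposed on [H] joined with [G]; it then
   holds for the empty [H]. *)
have [F FP Ftot|M [sM Mmax]] := @Zorn_bigcup (V * R)%type
    (fun H => sublin_graph (G `|` H)).
  case: sG => GD GZ Gq; split=> [u v|a u|u].
  - have key w H : F H -> (G `|` H) w -> (G `|` \bigcup_(X in F) X) w.
      by move=> FH [Gw|Hw]; [left|right; exists H].
    move=> [Gu|[H1 FH1 H1u]] [Gv|[H2 FH2 H2v]].
    + by left; exact: GD.
    + by apply: (key _ H2) => //; have [+ _ _] := FP _ FH2; apply; [left|right].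
    + by apply: (key _ H1) => //; have [+ _ _] := FP _ FH1; apply; [right|left].
    + have [H12|H21] := Ftot _ _ FH1 FH2.
        apply: (key _ H2) => //; have [+ _ _] := FP _ FH2; apply; right => //.
        exact: H12.
      apply: (key _ H1) => //; have [+ _ _] := FP _ FH1; apply; right => //.
      exact: H21.
  - move=> [Gu|[H FH Hu]]; first by left; exact: GZ.
    have [_ + _] := FP _ FH; move=> /(_ a u (or_intror Hu))[?|?]; first by left.
    by right; exists H.
  - move=> [Gu|[H FH Hu]]; first exact: Gq.
    by have [_ _] := FP _ FH; apply; right.
have Mtot x : exists r, M (x, r).
  have [|G' [sG' MG' [r G'r]]] := sublin_graph_extend x sM.
    by case: G0 => u Gu; exists u; left.
  have [<-|MneG'] := pselect (G' = M); first by exists r.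
  exfalso; apply: (Mmax G').
    split=> [u Mu|G'M]; first by apply: MG'; right.
    by apply: MneG'; apply/seteqP; split=> // u Mu; apply: MG'; right.
  rewrite (_ : G `|` G' = G')//; apply/setUidPr => u Gu.
  by apply: MG'; left.
have [MD MZ Mq] := sM.
have Muniq x r s : (G `|` M) (x, r) -> (G `|` M) (x, s) -> r <= s.
  move=> Mr Ms; have /= := MD _ _ Mr (MZ (-1) _ Ms).
  rewrite mulN1r (_ : kofR (-1) = -1 :> K) ?scaleN1r ?addrN; last first.
    by rewrite /kofR; case: (k) => //=; rewrite rmorphN rmorph1.
  have q0 : q 0 = 0 by rewrite -(scale0r 0) qZ rnorm0 mul0r.
  by move=> /Mq /=; rewrite q0 subr_le0.
have Meq x r s : (G `|` M) (x, r) -> (G `|` M) (x, s) -> r = s.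
  by move=> Mr Ms; apply/le_anti/andP; split; [exact: Muniq Mr Ms|exact: Muniq Ms Mr].
have /choice[h Mh] := Mtot.
have Gh x : (G `|` M) (x, h x) by right.
exists h; split=> [x y|a x|x|u Gu].
- exact: Meq (Gh _) (MD _ _ (Gh x) (Gh y)).
- exact: Meq (Gh _) (MZ a _ (Gh x)).
- exact: (Mq _ (Gh x)).
- by apply: Meq (Gh _) _; left; case: u Gu.
Qed.

(** For the bound, [x] is multiplied by the phase that makes [F x] real; there [F] coincides with
    its real part [h]. *)
Lemma complexify (h : V -> R) : (forall x y, h (x + y) = h x + h y) ->
  (forall (a : R) x, h (kofR a *: x) = a * h x) -> (forall x, h x <= q x) ->
  exists F : V -> K^o, [/\ linear F, forall x, rnorm (F x) <= q x &
    forall x, kRe (F x) = h x].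
Proof.
move=> hD hZ hq.
have [F [lF FE]] := complex_of_real_part hD hZ.
exists F; split=> // x.
  have [F0|F0] := eqVneq (F x) 0.
    rewrite F0 rnorm0; have := hq 0; have := hD 0 0; rewrite addr0.
    by have := qD x ((-1) *: x); have := qZ 0 0; have := qZ (-1) x; rewrite scale0r rnorm0
      mul0r scaleN1r addrN /rnorm normrN1 -(kofR1) kofRK mul1r; lra.
  have n0 : `|F x| != 0 by rewrite normr_eq0.
  pose t := `|F x| / F x.
  have tE : F (t *: x) = `|F x|.
    by rewrite (linZ lF) /t -[LHS]/(_ * _) divfK.
  have t1 : rnorm (t : K^o) = 1.
    by rewrite /rnorm /t normrM normfV normr_id mulfV// -kofR1 kofRK.
  by have := hq (t *: x); rewrite qZ t1 mul1r -FE tE.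
Qed.
End HahnBanach.

(** Only the real part of [g] is extended. The complexified extension agrees with [g] on [A] because
    their real parts agree on all scalar multiples of a point of [A]. *)
Lemma hahn_banach (R : realType) (k : scalar_kind) (V : lmodType (kfield R k))
    (q : V -> R) (A : set V) (g : V -> (kfield R k)^o) :
  (forall x y, q (x + y) <= q x + q y) ->
  (forall (a : kfield R k) x, q (a *: x) = rnorm a * q x) ->
  A !=set0 -> (forall a x y, A x -> A y -> A (a *: x + y)) ->
  (forall a x y, A x -> A y -> g (a *: x + y) = a *: g x + g y) ->
  (forall x, A x -> rnorm (g x) <= q x) ->
  exists F : V -> (kfield R k)^o,
    [/\ linear F, forall x, rnorm (F x) <= q x & forall x, A x -> F x = g x].
Proof.
move=> qD qZ [x0 Ax0] Alin glin gq.
have A0 : A 0.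
  have := Alin (-1) x0 x0 Ax0 Ax0; by rewrite scaleN1r addNr.
have g0 : g 0 = 0.
  by have := glin (-1) 0 0 A0 A0; rewrite !scaleN1r !addNr.
have AD x y : A x -> A y -> A (x + y) by move=> Ax Ay; rewrite -(scale1r x); exact: Alin.
have AZ a x : A x -> A (a *: x) by move=> Ax; rewrite -(addr0 (_ *: _)); exact: Alin.
have gD x y : A x -> A y -> g (x + y) = g x + g y.
  by move=> Ax Ay; rewrite -(scale1r x) glin// !scale1r.
have gZ a x : A x -> g (a *: x) = a *: g x.
  by move=> Ax; have := glin a x 0 Ax A0; rewrite g0 !addr0.
pose G : set (V * R) := [set (x, kRe (g x)) | x in A].
have sG : sublin_graph q G.
  split=> [_ _ [x Ax <-] [y Ay <-]|a _ [x Ax <-]|_ [x Ax <-]] /=.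
  - by exists (x + y); [exact: AD|rewrite gD// kReD].
  - by exists (kofR a *: x); [exact: AZ|rewrite gZ// kReZ].
  - by apply: le_trans (gq _ Ax); exact: kRe_le.
have [|h [hD hZ hq hG]] := sublin_graph_total qD qZ sG; first by exists (0, kRe (g 0)), 0.
have [F [lF Fq FE]] := complexify qD qZ hD hZ hq.
exists F; split=> // x Ax; apply: kRe_eq => a.
rewrite -(linZ lF) FE -gZ//; apply: (hG (a *: x, kRe (g (a *: x)))).
by exists (a *: x) => //; exact: AZ.
Qed.

(** * Sequences and operators *)

Section Convergence.
Context {R : realType} {k : scalar_kind}.
Notation K := (kfield R k).
Implicit Types E : normedModType K.

Definition cv {E : normedModType K} (u : nat -> E) (l : E) :=
  forall e : R, 0 < e -> exists N, forall n, (N <= n)%N -> rnorm (u n - l) < e.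

Lemma kpos_real (e : K) : 0 < e -> exists2 r : R, 0 < r & e = kofR r.
Proof.
move=> e0; exists (kRe e); last by rewrite (kReK (ltW e0)).
rewrite lt_neqAle -(kofR_le (k := k)) (kReK (ltW e0)) kofR0 (ltW e0) andbT.
apply/eqP => e0'; have := kReK (ltW e0); rewrite -e0' kofR0 => e0''.
by rewrite -e0'' ltxx in e0.
Qed.

Lemma kofR_lt x y : (kofR x < kofR y :> K) = (x < y).
Proof. by rewrite /kofR; case: (k) => //=; rewrite ltcR. Qed.

Lemma rnorm_lt E (x : E) (e : R) : (`|x| < kofR e) = (rnorm x < e).
Proof. by rewrite -(rnormE x) kofR_lt. Qed.

Lemma rnorm_le_kofR E (x : E) (e : R) : (`|x| <= kofR e) = (rnorm x <= e).
Proof. by rewrite -(rnormE x) kofR_le. Qed.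

Lemma cvP E (u : nat -> E) l : cv u l <-> u @ \oo --> l.
Proof.
split=> [ul|/cvgrPdist_lt ul].
  apply/cvgrPdist_lt => e /kpos_real[r r0 ->].
  have [N HN] := ul r r0; exists N => // n /= Nn.
  by rewrite distrC rnorm_lt HN.
move=> e e0; have : 0 < kofR e :> K by rewrite -(kofR0 (k := k)) kofR_lt.
by move=> /ul[N _ HN]; exists N => n Nn; rewrite -rnorm_lt distrC; exact: HN.
Qed.

Lemma rnormN E (x : E) : rnorm (- x) = rnorm x.
Proof. by rewrite /rnorm normrN. Qed.

Lemma rnormBC E (x y : E) : rnorm (x - y) = rnorm (y - x).
Proof. by rewrite -rnormN opprB. Qed.

Lemma rnormB E (x y : E) : rnorm (x - y) <= rnorm x + rnorm y.
Proof. by rewrite (le_trans (rnormD _ _))// rnormN. Qed.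

Lemma rnorm_sub_le E (x y : E) : rnorm x - rnorm y <= rnorm (x - y).
Proof. by rewrite lerBlDr; have := rnormD (x - y) y; rewrite subrK. Qed.

Lemma rnorm_dist E (x y : E) : `|rnorm x - rnorm y| <= rnorm (x - y).
Proof.
rewrite ler_norml rnorm_sub_le andbT lerNl opprB.
by rewrite [leRHS](rnormBC x y) rnorm_sub_le.
Qed.

Lemma rnorm_sum E I (r : seq I) (P : pred I) (F : I -> E) :
  rnorm (\sum_(i <- r | P i) F i) <= \sum_(i <- r | P i) rnorm (F i).
Proof.
elim/big_rec2: _ => [|i y x _ xy]; first by rewrite rnorm0.
by rewrite (le_trans (rnormD _ _))// lerD2l.
Qed.

Lemma rnorm_triangle E (x y z : E) : rnorm (x - z) <= rnorm (x - y) + rnorm (y - z).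
Proof. by apply: le_trans (rnormD _ _); rewrite addrA subrK. Qed.

Lemma cv_cst E (l : E) : cv (fun=> l) l.
Proof. by move=> e e0; exists 0%N => n _; rewrite subrr rnorm0. Qed.

Lemma cvD E (u v : nat -> E) l m : cv u l -> cv v m -> cv (fun n => u n + v n) (l + m).
Proof. by move=> /cvP ul /cvP vm; apply/cvP; exact: cvgD. Qed.

Lemma cvZ E (a : K) (u : nat -> E) l : cv u l -> cv (fun n => a *: u n) (a *: l).
Proof. by move=> /cvP ul; apply/cvP; apply: cvgZr. Qed.

Lemma cvN E (u : nat -> E) l : cv u l -> cv (fun n => - u n) (- l).
Proof. by move=> /cvP ul; apply/cvP; exact: cvgN. Qed.

Lemma cvB E (u v : nat -> E) l m : cv u l -> cv v m -> cv (fun n => u n - v n) (l - m).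
Proof. by move=> ul vm; apply: cvD => //; exact: cvN. Qed.

Lemma cv_sub E (u : nat -> E) l s : incr s -> cv u l -> cv (u \o s) l.
Proof.
move=> si ul e /ul[N HN]; exists N => n Nn; apply: HN.
by rewrite (leq_trans Nn)// incr_ge.
Qed.

Lemma cv_norm E (u : nat -> E) l : cv u l -> rcv (fun n => rnorm (u n)) (rnorm l).
Proof.
move=> ul e /ul[N HN]; exists N => n /HN; apply: le_lt_trans; exact: rnorm_dist.
Qed.

Lemma cv_squeeze E (u : nat -> E) l (a : nat -> R) :
  (forall n, rnorm (u n - l) <= a n) -> rcv a 0 -> cv u l.
Proof.
move=> ua a0 e /a0[N HN]; exists N => n /HN; rewrite subr0.
by apply: le_lt_trans; rewrite (le_trans (ua n))// ler_norm.
Qed.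

Lemma cv_unique E (u : nat -> E) l m : cv u l -> cv u m -> l = m.
Proof.
move=> ul um; apply/eqP; rewrite -subr_eq0; apply/eqP/rnorm_eq0/le_anti.
rewrite rnorm_ge0 andbT; apply/ler_addgt0Pr => e e0; rewrite add0r.
have e2 : 0 < e / 2 by rewrite divr_gt0.
have [N HN] := ul _ e2; have [M HM] := um _ e2.
have := rnorm_triangle l (u (maxn N M)) m; have := rnormBC l (u (maxn N M)).
have := HN _ (leq_maxl N M); have := HM _ (leq_maxr N M); lra.
Qed.

Lemma cv_tail E (u : nat -> E) l N : cv (fun n => u (n + N)%N) l -> cv u l.
Proof.
move=> ul e /ul[M HM]; exists (M + N)%N => n MNn.
by have := HM (n - N)%N; rewrite subnK; [apply; rewrite leq_subRL|]; rewrite ?(addnC N)//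
  (leq_trans _ MNn)// leq_addl.
Qed.

End Convergence.

Lemma rcv_unique (R : realType) (u : nat -> R) l m : rcv u l -> rcv u m -> l = m.
Proof. exact: (@cv_unique R real_scalars R). Qed.

Lemma rcv_sub (R : realType) (u : nat -> R) l s : incr s -> rcv u l -> rcv (u \o s) l.
Proof. exact: (@cv_sub R real_scalars R). Qed.

Lemma rcv_le (R : realType) (u v : nat -> R) l m :
  (forall n, u n <= v n) -> rcv u l -> rcv v m -> l <= m.
Proof.
move=> uv ul vm; apply/ler_addgt0Pr => e e0.
have e2 : 0 < e / 2 by rewrite divr_gt0.
have [N HN] := ul _ e2; have [M HM] := vm _ e2.
have := HN _ (leq_maxl N M); have := HM _ (leq_maxr N M).
by rewrite !ltr_norml; have := uv (maxn N M) => ? /andP[??] /andP[??]; lra.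
Qed.

Lemma rcv_inv (R : realType) : rcv (fun n => (n.+1%:R)^-1 : R) 0.
Proof. by apply/rcvP; exact: cvg_harmonic. Qed.

Lemma inv_lt (R : realType) (e : R) : 0 < e ->
  exists N, forall n, (N <= n)%N -> n.+1%:R^-1 < e.
Proof.
move=> /(rcv_inv (R := R))[N HN]; exists N => n /HN; rewrite subr0 ger0_norm//.
Qed.

Section Operators.
Context {R : realType} {k : scalar_kind}.
Notation K := (kfield R k).
Implicit Types E F G : normedModType K.

Lemma mk_bop E F (f : E -> F) (M : R) : linear f ->
  (forall x, rnorm (f x) <= M * rnorm x) ->
  exists T : bop E F, forall x, T x = f x.
Proof.
move=> lf fM.
pose L : {linear E -> F} := HB.pack f (GRing.isLinear.Build K E F *:%R f lf).
have cf : continuous f.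
  apply: (@bounded_linear_continuous K E F L); apply/linear_boundedP.
  exists (kofR `|M|); split.
    by rewrite ger0_real// -(kofR0 (k := k)) kofR_le.
  move=> r Mr x /=; apply: (@le_trans _ _ (kofR `|M| * `|x|)).
    rewrite -(rnormE x) -kofRM -(rnormE (f x)) kofR_le (le_trans (fM x))//.
    by rewrite ler_wpM2r ?rnorm_ge0// ler_norm.
  by rewrite ler_wpM2r// ltW.
have fp : f \in @bop_pred R k E F by rewrite inE.
by exists (Bop fp).
Qed.

Lemma bopD E F (T : bop E F) x y : T (x + y) = T x + T y.
Proof. exact: linD (bop_linear T) _ _. Qed.
Lemma bopB E F (T : bop E F) x y : T (x - y) = T x - T y.
Proof. exact: linB (bop_linear T) _ _. Qed.
Lemma bopN E F (T : bop E F) x : T (- x) = - T x.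
Proof. exact: linN (bop_linear T) _. Qed.
Lemma bopZ E F (T : bop E F) a x : T (a *: x) = a *: T x.
Proof. exact: linZ (bop_linear T) _ _. Qed.
Lemma bop0 E F (T : bop E F) : T 0 = 0.
Proof. exact: lin0 (bop_linear T). Qed.

Lemma bop_cv E F (T : bop E F) u l : cv u l -> cv (T \o u) (T l).
Proof.
move=> ul e e0.
have e1 : 0 < e / (opnorm T + 1) by rewrite divr_gt0// ltr_wpDl ?opnorm_ge0.
have [N HN] := ul _ e1; exists N => n /HN.
rewrite ltr_pdivlMr ?ltr_wpDl ?opnorm_ge0//= => h.
rewrite -bopB; apply: le_lt_trans (opnormP _ _) _; apply: le_lt_trans h.
by rewrite mulrC ler_wpM2l ?rnorm_ge0// lerDl.
Qed.

Lemma opnormP1 E F (T : bop E F) x M : opnorm T <= M -> rnorm (T x) <= M * rnorm x.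
Proof. by move=> TM; rewrite (le_trans (opnormP _ _))// ler_wpM2r// rnorm_ge0. Qed.

Lemma opnorm_approx E F (T : bop E F) e : 0 < e ->
  exists2 x, rnorm x <= 1 & opnorm T - e < rnorm (T x).
Proof.
move=> e0; have := sup_adherent e0 (conj (opnorm_nonempty T) (opnorm_has_ubound T)).
move=> [_ [x /= x1 <-] h]; exists x => //.
by rewrite -(rnorm_le_kofR x) (kofR1).
Qed.

Lemma bop_normE E F (T : bop E F) : rnorm T = opnorm T.
Proof. by rewrite /rnorm /Num.norm /= kofRK. Qed.

Lemma bcomp_ex E F G (A : bop F G) (B : bop E F) :
  exists T : bop E G, forall x, T x = A (B x).
Proof.
apply: (@mk_bop _ _ _ (opnorm A * opnorm B)) => [a x y|x].
  by rewrite (bop_linear B) (bop_linear A).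
by rewrite -mulrA (le_trans (opnormP _ _))// ler_wpM2l ?opnorm_ge0// opnormP.
Qed.

Definition bcomp E F G (A : bop F G) (B : bop E F) : bop E G :=
  projT1 (cid (bcomp_ex A B)).

Lemma bcompE E F G (A : bop F G) (B : bop E F) x : bcomp A B x = A (B x).
Proof. exact: (projT2 (cid (bcomp_ex A B))). Qed.

Lemma bid_ex E : exists T : bop E E, forall x, T x = x.
Proof. by apply: (@mk_bop _ _ _ 1) => // x; rewrite mul1r. Qed.

Definition bid E : bop E E := projT1 (cid (bid_ex E)).

Lemma bidE E x : bid E x = x.
Proof. exact: (projT2 (cid (bid_ex E))). Qed.

Lemma bop_ext E F (T S : bop E F) : (forall x, T x = S x) -> T = S.
Proof. by move=> TS; apply/val_inj/funext. Qed.

Lemma bop_addE E F (T S : bop E F) x : (T + S) x = T x + S x. Proof. by []. Qed.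
Lemma bop_oppE E F (T : bop E F) x : (- T) x = - T x. Proof. by []. Qed.
Lemma bop_subE E F (T S : bop E F) x : (T - S) x = T x - S x. Proof. by []. Qed.
Lemma bop_scaleE E F a (T : bop E F) x : (a *: T) x = a *: T x. Proof. by []. Qed.
Lemma bop_zeroE E F x : (0 : bop E F) x = 0. Proof. by []. Qed.

Lemma bop_sumE E F I (r : seq I) (P : pred I) (T : I -> bop E F) x :
  (\sum_(i <- r | P i) T i) x = \sum_(i <- r | P i) T i x.
Proof. by elim/big_rec2: _ => [|i y z _ <-]. Qed.

End Operators.

Lemma mem_mkseq (T : eqType) (G : nat -> T) n y :
  y \in mkseq G n -> exists2 i, (i < n)%N & y = G i.
Proof.
move=> yG; have [j] := mapP yG.
by rewrite mem_iota add0n /= => nj ->; exists j.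
Qed.

Lemma mkseq_mem (T : eqType) (G : nat -> T) n i : (i < n)%N -> G i \in mkseq G n.
Proof. by move=> ni; apply: map_f; rewrite mem_iota. Qed.

(** * Relatively compact sets and compact operators *)

Section Compactness.
Context {R : realType} {k : scalar_kind}.
Notation K := (kfield R k).
Implicit Types E F : normedModType K.

Lemma nbhs_rnorm E (p : E) (U : set E) :
  nbhs p U <-> exists2 e : R, 0 < e & forall x, rnorm (x - p) < e -> U x.
Proof.
split=> [/nbhs_ballP[e /= /kpos_real[r r0 ->] HU]|[e e0 HU]].
  exists r => // x xp; apply: HU; rewrite -ball_normE /ball_/=.
  by rewrite rnorm_lt rnormBC.
apply/nbhs_ballP; exists (kofR e) => /=; first by rewrite -(kofR0 (k := k)) kofR_lt.
by move=> x; rewrite -ball_normE /ball_/= rnorm_lt => xp; apply: HU; rewrite rnormBC.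
Qed.

Lemma closure_rnorm E (C : set E) x :
  closure C x <-> forall e : R, 0 < e -> exists2 y, C y & rnorm (y - x) < e.
Proof.
split=> [xC e e0|xC U /nbhs_rnorm[e e0 HU]].
  by have [|y [Cy yx]] := xC [set y | rnorm (y - x) < e];
    [apply/nbhs_rnorm; exists e|exists y].
by have [y Cy yx] := xC e e0; exists y; split => //; exact: HU.
Qed.

(** The limit is only asked to lie in [E]: this is relative sequential compactness. *)
Definition seqc {E : normedModType K} (C : set E) :=
  forall u : nat -> E, (forall n, C (u n)) -> exists s l, incr s /\ cv (u \o s) l.

Lemma seqc_closure E (C : set E) : seqc C -> seqc (closure C).
Proof.
move=> sC u uC.
have /choice[v vP] n : exists v, C v /\ rnorm (v - u n) < n.+1%:R^-1.
  have n0 : 0 < n.+1%:R^-1 :> R by rewrite invr_gt0.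
  by have [v Cv vu] := (closure_rnorm _ _).1 (uC n) _ n0; exists v.
have [s [l [si vl]]] := sC v (fun n => (vP n).1).
exists s, l; split=> //.
have uv : cv (fun n => u (s n) - v (s n)) 0.
  apply: (cv_squeeze (a := fun n => (s n).+1%:R^-1)) => [n|].
    by rewrite subr0 rnormBC ltW//; case: (vP (s n)).
  by apply: (rcv_sub (u := fun n => n.+1%:R^-1)) => //; exact: rcv_inv.
have := cvD uv vl; rewrite add0r; congr cv; apply/funext => n /=.
by rewrite subrK.
Qed.

(** Otherwise points at mutual distance at least [e] could be chosen one after the other, and no
    subsequence of them would converge. *)
Lemma seqc_totally_bounded E (C : set E) (e : R) : seqc C -> 0 < e ->
  exists l : seq E, (forall y, y \in l -> C y) /\ forall x, C x -> exists2 y, y \in l &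
    rnorm (x - y) < e.
Proof.
move=> sC e0; apply: contrapT => /forallNP Hl.
have [l|G GP] := @prefix_choice E (fun l x => (forall y, y \in l -> C y) ->
    C x /\ forall y, y \in l -> e <= rnorm (x - y)).
  have [lC|nlC] := pselect (forall y, y \in l -> C y); last by exists 0.
  have /not_andP[//|/existsNP[x /not_implyP[Cx nx]]] := Hl l.
  exists x => _; split=> // y yl; rewrite leNgt; apply/negP => xy; apply: nx.
  by exists y.
have GC n : forall m, (m < n)%N -> C (G m).
  elim: n => // n IH m; rewrite ltnS leq_eqVlt => /predU1P[->|]; last exact: IH.
  apply: (GP n _).1 => y /mem_mkseq[i ni ->].
  exact: IH.
have Gfar m n : (m < n)%N -> e <= rnorm (G n - G m).
  move=> mn; apply: (GP n _).2.
    by move=> y /mem_mkseq[i ni ->]; exact: GC ni.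
  exact: mkseq_mem.
have [s [l [si Gl]]] := sC G (fun n => GC n.+1 n (ltnSn n)).
have e2 : 0 < e / 2 by rewrite divr_gt0.
have [N HN] := Gl _ e2; have := HN _ (leqnn N); have := HN _ (leqnSn N).
have := Gfar _ _ (si N); have /= := rnorm_triangle (G (s N.+1)) l (G (s N)).
by have := rnormBC l (G (s N)); rewrite /=; lra.
Qed.

Lemma ultra_finite_cover E (F : set_system E) (B : E -> set E) (l : seq E) :
  UltraFilter F -> F [set x | exists2 y, y \in l & B y x] -> exists y, F (B y).
Proof.
move=> UF; elim: l => [|y l IH] Fl.
  by exfalso; apply: (@filter_not_empty _ F); apply: filterS Fl => x [].
have [Fy|Fny] := in_ultra_setVsetC (B y) UF; first by exists y.
apply: IH; apply: filterS (filterI Fny Fl) => x [nBy [z]].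
by rewrite in_cons => /predU1P[->//|zl Bz]; exists z.
Qed.

(** If the closure is compact, a cluster point of [u] is approached along indices picked one by one.
    Conversely, an ultrafilter on the closure contains, for every [n], a ball of radius
    [1 / (n + 1)] around some [y n]; points [a n] of the closure near [y n] have a convergent
    subsequence, and the ultrafilter converges to its limit. *)
Lemma precompactP E (C : set E) : precompact C <-> seqc C.
Proof.
rewrite precompactE; split=> [cC u uC|/seqc_closure sC].
  have uclC : (u @ \oo) (closure C) by exists 0%N => // n _; exact/subset_closure/uC.
  have [l [Cl ul]] := cC (u @ \oo) _ uclC.
  have freq e N : 0 < e -> exists2 n, (N <= n)%N & rnorm (u n - l) < e.
    move=> e0; have [||_ [[n /= Nn <-]]] := ul [set u n | n in [set n | (N <= n)%N]]
      [set y | rnorm (y - l) < e].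
    - by exists N => // n /= Nn; exists n.
    - by apply/nbhs_rnorm; exists e.
    by exists n.
  have [G|G GP] := @prefix_choice nat (fun l' n => (forall m, m \in l' -> m < n)%N /\
      rnorm (u n - l) < (size l').+1%:R^-1).
    have [|n Gn nl] := freq (size G).+1%:R^-1 (\max_(i <- G) i).+1.
      by rewrite invr_gt0.
    exists n; split=> // m mG; apply: leq_trans Gn; rewrite ltnS.
    exact: leq_bigmax_seq.
  exists G, l; split=> [n|].
    by apply: (GP n.+1).1; exact: mkseq_mem.
  apply: (cv_squeeze (a := fun n => n.+1%:R^-1)); last exact: rcv_inv.
  by move=> n; have := (GP n).2; rewrite size_mkseq => /ltW.
rewrite compact_ultra => F UF FC.
have /choice[y yP] n : exists y, F [set x | rnorm (x - y) < n.+1%:R^-1].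
  have n0 : 0 < n.+1%:R^-1 :> R by rewrite invr_gt0.
  have [l [_ Hl]] := seqc_totally_bounded sC n0.
  by apply: ultra_finite_cover; apply: filterS FC; exact: Hl.
have /choice[a aP] n : exists a, closure C a /\ rnorm (a - y n) < n.+1%:R^-1.
  by have [a [Ca ay]] := filter_ex (filterI FC (yP n)); exists a.
have [s [p [si ap]]] := sC a (fun n => (aP n).1).
exists p; split.
  apply: (closed_closure (A := C)) => U /nbhs_rnorm[e e0 HU].
  have [N HN] := ap e e0; exists (a (s N)); split; first by case: (aP (s N)).
  exact/HU/HN.
move=> U /nbhs_rnorm[e e0 HU].
have e4 : 0 < e / 4 by rewrite divr_gt0.
have [N HN] := ap _ e4; have [M HM] := inv_lt e4.
pose n := maxn N M.
apply: filterS (yP (s n)) => x /= xy; apply: HU.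
have := HN n (leq_maxl _ _); have hM := HM (s n) (leq_trans (leq_maxr N M) (incr_ge si n)).
have := lt_trans (aP (s n)).2 hM; have := lt_trans xy hM.
have := rnorm_triangle x (y (s n)) p; have := rnorm_triangle (y (s n)) (a (s n)) p; have :=
  rnormBC (a (s n)) (y (s n)).
by rewrite /=; lra.
Qed.

Definition kop {E F : normedModType K} (T : bop E F) :=
  forall u, (forall n, rnorm (u n) <= 1) -> exists s l, incr s /\ cv (T \o u \o s) l.

Lemma compact_opP E F (T : bop E F) : compact_op T <-> kop T.
Proof.
have unit (x : E) : (`|x| <= 1) = (rnorm x <= 1) by rewrite -(kofR1 (k := k)) rnorm_le_kofR.
rewrite /compact_op /=; split=> [/precompactP sT u u1|kT].
  by apply: (sT (T \o u)) => n; exists (u n) => //=; rewrite unit.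
apply/precompactP => v vT.
have /choice[u uP] n : exists u, rnorm u <= 1 /\ T u = v n.
  by have [x /= x1 <-] := vT n; exists x; rewrite -unit.
have [s [l [si Tl]]] := kT u (fun n => (uP n).1).
exists s, l; split=> //; move: Tl; congr cv; apply/funext => n /=.
by case: (uP (s n)).
Qed.

Lemma kop_bounded E F (T : bop E F) M u : kop T -> (forall n, rnorm (u n) <= M) ->
  exists s l, incr s /\ cv (T \o u \o s) l.
Proof.
move=> kT uM; pose c := `|M| + 1.
have c0 : 0 < c by rewrite ltr_wpDl.
have [n|s [l [si Tl]]] := kT (fun n => kofR c^-1 *: u n).
  rewrite rnormZ rnorm_kofR gtr0_norm ?invr_gt0// ler_pdivrMl// mulr1.
  by rewrite (le_trans (uM n))// (le_trans (ler_norm M))// lerDl.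
exists s, (kofR c *: l); split=> //; have := cvZ (kofR c) Tl; congr cv.
apply/funext => n /=; rewrite bopZ scalerA -kofRM mulfV ?gt_eqF//.
by rewrite kofR1 scale1r.
Qed.

Lemma kop_comp_l E F (G : normedModType K) (A : bop F G) (B : bop E F) :
  kop B -> kop (bcomp A B).
Proof.
move=> kB u u1; have [s [l [si Bl]]] := kB u u1; exists s, (A l); split=> //.
by have := bop_cv A Bl; congr cv; apply/funext => n /=; rewrite bcompE.
Qed.

Lemma kop_comp_r E F (G : normedModType K) (A : bop F G) (B : bop E F) :
  kop A -> kop (bcomp A B).
Proof.
move=> kA u u1; have [|s [l [si Al]]] := kop_bounded (M := opnorm B) (u := B \o u) kA.
  by move=> n /=; apply: le_trans (opnormP _ _) _; rewrite -[leRHS]mulr1 ler_wpM2l ?opnorm_ge0.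
exists s, l; split=> //; move: Al; congr cv; apply/funext => n /=.
by rewrite bcompE.
Qed.

Lemma kop_lin E F (a : K) (S T : bop E F) : kop S -> kop T -> kop (a *: S + T).
Proof.
move=> kS kT u u1; have [s [l [si Sl]]] := kS u u1.
have [|t [m [ti Tm]]] := kT (u \o s); first by move=> n; exact: u1.
exists (s \o t), (a *: l + m); split; first exact: incr_comp.
have := cvD (cvZ a (cv_sub ti Sl)) Tm; congr cv.
Qed.

Lemma kop0 E F : kop (0 : bop E F).
Proof.
by move=> u _; exists id, 0; split=> [n|]; [exact: leqnn|exact: (cv_cst 0)].
Qed.

Lemma kopD E F (S T : bop E F) : kop S -> kop T -> kop (S + T).
Proof. by move=> kS kT; rewrite -(scale1r S); exact: kop_lin. Qed.
Lemma kopZ E F a (T : bop E F) : kop T -> kop (a *: T).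
Proof. by move=> kT; rewrite -(addr0 (_ *: _)); apply: kop_lin => //; exact: kop0. Qed.
Lemma kopB E F (S T : bop E F) : kop S -> kop T -> kop (S - T).
Proof. by move=> kS kT; rewrite -scaleN1r; apply: kopD => //; exact: kopZ. Qed.
Lemma kop_sum E F I (r : seq I) (P : pred I) (T : I -> bop E F) :
  (forall i, P i -> kop (T i)) -> kop (\sum_(i <- r | P i) T i).
Proof. by move=> kT; apply: (big_ind (fun T => kop T)) => //; [exact: kop0|move=> *; exact:
  kopD]. Qed.

End Compactness.

Section ScalarTopology.
Context {R : realType}.

Lemma rnorm_complex_ge (z : (kfield R complex_scalars)^o) :
  `|complex.Re z| <= rnorm z /\ `|complex.Im z| <= rnorm z.
Proof.
split; first by have := normc_ge_Re (z : R[i]); rewrite lecE => /andP[].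
have := normc_ge_Re ((z : R[i]) * 'i%C); rewrite ReiNIm normrN normrM lecE => /andP[_].
rewrite /rnorm /kRe (_ : `|'i%C| = 1 :> R[i]) ?mulr1//.
by rewrite normc_def /= expr0n expr1n add0r sqrtr1.
Qed.

Lemma rnorm_complex_le (z : (kfield R complex_scalars)^o) :
  rnorm z <= `|complex.Re z| + `|complex.Im z|.
Proof.
rewrite -(rnorm_kofR (k := complex_scalars) (complex.Re z)).
rewrite -(rnorm_kofR (k := complex_scalars) (complex.Im z)).
rewrite {1}(complexE (z : R[i])); apply: le_trans (rnormD _ _) _; rewrite lerD2l.
rewrite /rnorm normrM (_ : `|'i%C| = 1 :> R[i]) ?mul1r//.
by rewrite normc_def /= expr0n expr1n add0r sqrtr1.
Qed.

Context {k : scalar_kind}.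
Notation K := (kfield R k).

Lemma scalar_subseq (u : nat -> K^o) M : (forall n, rnorm (u n) <= M) ->
  exists s l, incr s /\ cv (u \o s) l.
Proof.
case: (k) u => u uM; first exact: (@real_subseq _ u M).
have [n|s [a [si ra]]] := @real_subseq _ (fun n => complex.Re (u n)) M.
  exact: le_trans (rnorm_complex_ge _).1 (uM n).
have [n|t [b [ti rb]]] := @real_subseq _ (fun n => complex.Im (u (s n))) M.
  exact: le_trans (rnorm_complex_ge _).2 (uM _).
exists (s \o t), (a +i* b)%C; split; first exact: incr_comp.
move=> e e0; have e2 : 0 < e / 2 by rewrite divr_gt0.
have [N1 H1] := rcv_sub ti ra e2; have [N2 H2] := rb _ e2.
exists (maxn N1 N2) => n; rewrite geq_max => /andP[/H1 /= h1 /H2 /= h2].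
apply: le_lt_trans (rnorm_complex_le _) _.
move: h1 h2; case: (u (s (t n))) => x y /= h1 h2.
by rewrite [e]splitr; exact: ltrD.
Qed.

Definition cauchyseq {E : normedModType K} (u : nat -> E) :=
  forall e : R, 0 < e -> exists N, forall m n, (N <= m)%N -> (N <= n)%N ->
    rnorm (u m - u n) < e.

Definition seq_complete (E : normedModType K) :=
  forall u : nat -> E, cauchyseq u -> exists l, cv u l.

Lemma cv_cauchy (E : normedModType K) (u : nat -> E) l : cv u l -> cauchyseq u.
Proof.
move=> ul e e0; have e2 : 0 < e / 2 by rewrite divr_gt0.
have [N HN] := ul _ e2; exists N => m n /HN h1 /HN h2.
have := rnorm_triangle (u m) l (u n); rewrite (rnormBC l); lra.
Qed.

Lemma cauchy_bounded (E : normedModType K) (u : nat -> E) : cauchyseq u ->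
  exists M, forall n, rnorm (u n) <= M.
Proof.
move=> /(_ 1 ltr01)[N HN].
exists (rnorm (u N) + 1 + \sum_(i < N) rnorm (u i)) => n.
have S0 (P : pred 'I_N) : 0 <= \sum_(i < N | P i) rnorm (u i) by apply: sumr_ge0 => i _;
  exact: rnorm_ge0.
have [nN|Nn] := ltnP n N.
  rewrite (bigD1 (Ordinal nN))//=; have := S0 (fun i => i != Ordinal nN).
  by have := rnorm_ge0 (u N); lra.
have := HN n N Nn (leqnn N); have := rnorm_sub_le (u n) (u N).
by have := S0 xpredT; lra.
Qed.

Lemma cauchy_sub_cv (E : normedModType K) (u : nat -> E) s l : cauchyseq u ->
  incr s -> cv (u \o s) l -> cv u l.
Proof.
move=> cu si ul e e0; have e2 : 0 < e / 2 by rewrite divr_gt0.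
have [N HN] := cu _ e2; have [M HM] := ul _ e2.
exists N => n Nn; have := HM _ (leq_maxr N M).
have := HN _ _ Nn (leq_trans (leq_maxl N M) (incr_ge si _)).
by have := rnorm_triangle (u n) (u (s (maxn N M))) l; rewrite /=; lra.
Qed.

Lemma scalar_complete : seq_complete (K^o : normedModType K).
Proof.
move=> u cu; have [M uM] := cauchy_bounded cu.
have [s [l [si ul]]] := scalar_subseq uM.
by exists l; exact: cauchy_sub_cv ul.
Qed.

Lemma complete_seq (X : completeNormedModType K) : seq_complete X.
Proof.
move=> u cu.
have : cvg (u @ \oo).
  apply: cauchy_cvg; apply/cauchyP => e /kpos_real[r r0 ->].
  have [N HN] := cu _ r0; exists (u N), N => // n /= Nn.
  by rewrite -ball_normE /ball_ /= rnorm_lt HN.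
by move=> /cvg_ex[l /cvP ul]; exists l.
Qed.

Lemma phase (z : K^o) : exists2 t : K, rnorm t = 1 & t *: z = kofR (rnorm z).
Proof.
have [->|z0] := eqVneq z 0.
  by exists 1; rewrite ?scaler0 ?rnorm0 ?kofR0// -kofR1 rnorm_kofR normr1.
exists (`|z| / z); last by rewrite rnormE -[LHS]/(_ * _) divfK.
by rewrite /rnorm normrM normfV normr_id mulfV ?normr_eq0// -kofR1 kofRK.
Qed.

Lemma rnorm1 : rnorm (1 : K) = 1.
Proof. by rewrite -kofR1 rnorm_kofR normr1. Qed.

End ScalarTopology.

(** * The norm of the plane, and duality *)

Section Norm2More.
Context {R : realType} (p : \bar R) (p_gt1 : (1 < p)%E).
Notation N := (norm2 p).
Let p1 : (1 <= p)%E := ltW p_gt1.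

Lemma norm2_cases : p = +oo%E \/ exists2 r : R, p = r%:E & 1 < r.
Proof. by move: p_gt1; case: (p) => // [r r1|_]; [right; exists r|left]. Qed.

Lemma norm2C a b : N a b = N b a.
Proof. by rewrite /norm2; case: (p) => [r||]; rewrite 1?addrC 1?maxC. Qed.

Lemma norm2x0 a : N a 0 = `|a|.
Proof.
rewrite /norm2; have [->|[r -> r1]] := norm2_cases.
  by rewrite normr0; apply/max_idPl.
have r0 : r != 0 by rewrite gt_eqF// (lt_trans ltr01).
by rewrite normr0 powR0// addr0 -powRrM mulfV// powRr1.
Qed.

Lemma norm20x a : N 0 a = `|a|.
Proof. by rewrite norm2C norm2x0. Qed.

Lemma norm2A a b c : N (N a b) c = N a (N b c).
Proof.
rewrite /norm2; have [->|[r -> r1]] := norm2_cases.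
  have m0 x y : `|Num.max `|x| `|y| : R| = Num.max `|x| `|y|.
    by rewrite ger0_norm// le_max normr_ge0.
  by rewrite !m0 maxA.
have r0 : r != 0 by rewrite gt_eqF// (lt_trans ltr01).
have cancelr (u : R) : 0 <= u -> `|u `^ r^-1| `^ r = u.
  by move=> u0; rewrite ger0_norm ?powR_ge0// -powRrM mulVf// powRr1.
move: (powR_ge0 `|a| r) (powR_ge0 `|b| r) (powR_ge0 `|c| r).
move: (`|a| `^ r) (`|b| `^ r) (`|c| `^ r) => x y z x0 y0 z0.
by rewrite (cancelr (x + y)) ?addr_ge0// (cancelr (y + z)) ?addr_ge0// addrA.
Qed.

Lemma norm2ACA a b c d : N (N a b) (N c d) = N (N a c) (N b d).
Proof. by rewrite norm2A -(norm2A b) (norm2C b) (norm2A c) -norm2A. Qed.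

Lemma norm2_mono a b c d : 0 <= a -> 0 <= b -> a <= c -> b <= d -> N a b <= N c d.
Proof.
move=> a0 b0 ac bd; apply: norm2_le => //; rewrite !ger0_norm//.
  exact: le_trans ac.
exact: le_trans bd.
Qed.

Lemma norm2_add_le a b : N a b <= `|a| + `|b|.
Proof. by have := norm2D p1 a 0 0 b; rewrite addr0 add0r norm2x0 norm20x. Qed.

Lemma norm2_lip a b c d : N a b <= N c d + (`|a - c| + `|b - d|).
Proof.
have := norm2D p1 c d (a - c) (b - d); rewrite !subrKC => /le_trans; apply.
by rewrite lerD2l norm2_add_le.
Qed.

Lemma norm2_dist a b c d : `|N a b - N c d| <= `|a - c| + `|b - d|.
Proof.
rewrite ler_norml lerNl opprB !lerBlDl norm2_lip andbT.
by rewrite (distrC a) (distrC b) norm2_lip.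
Qed.

Lemma norm2_cv (a b : nat -> R) x y : rcv a x -> rcv b y ->
  rcv (fun n => N (a n) (b n)) (N x y).
Proof.
move=> ax by' e e0; have e2 : 0 < e / 2 by rewrite divr_gt0.
have [n Hn] := ax _ e2; have [m Hm] := by' _ e2.
exists (maxn n m) => i; rewrite geq_max => /andP[/Hn h1 /Hm h2].
by rewrite (le_lt_trans (norm2_dist _ _ _ _))// [e]splitr ltrD.
Qed.

Lemma norm2_gel a b : `|a| <= N a b.
Proof. by rewrite -norm2x0; apply: norm2_le => //; rewrite normr0. Qed.

Lemma norm2_ger a b : `|b| <= N a b.
Proof. by rewrite norm2C norm2_gel. Qed.

Lemma norm2_scale c a b : 0 <= c -> N (c * a) (c * b) = c * N a b.
Proof. by move=> c0; rewrite norm2Z// ger0_norm. Qed.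

(* The only place where [1 < p] is used: the unit ball of [N] is smooth at [(1, 0)]. *)
Lemma norm2_flat (c : R) : 0 < c ->
  exists2 s0, 0 < s0 <= 1 & forall s, 0 <= s <= s0 -> N 1 s <= 1 + c * s.
Proof.
move=> c0; have [pE|[r pE r1]] := norm2_cases.
  exists 1; rewrite ?ltr01 ?lexx// => s /andP[s0 s1].
  rewrite pE /norm2 normr1 ger0_norm// (max_idPl _)//.
  by rewrite lerDl mulr_ge0// ltW.
have r0 : 0 < r by rewrite (lt_trans ltr01).
have r10 : 0 < r - 1 by rewrite subr_gt0.
pose d := Num.min c 1; have d0 : 0 < d by rewrite lt_min c0 ltr01.
have d1 : d <= 1 by rewrite ge_min lexx orbT.
exists (d `^ (r - 1)^-1).
  have h : d `^ (r - 1)^-1 <= 1 `^ (r - 1)^-1.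
    apply: ge0_ler_powR => //.
    - by rewrite invr_ge0 ltW.
    - by rewrite nnegrE ltW.
    - by rewrite nnegrE.
  by rewrite powR_gt0//=; move: h; rewrite powR1.
move=> s /andP[s0 sd].
have [->|sn0] := eqVneq s 0; first by rewrite norm2x0 normr1 mulr0 addr0.
have sp : 0 < s by rewrite lt_neqAle eq_sym sn0.
rewrite pE /norm2 normr1 powR1 ger0_norm//.
have sr : s `^ r <= c * s.
  have -> : s `^ r = s `^ (r - 1) * s.
    rewrite -[X in _ * X](powRr1 s0) -powRD ?subrK//.
    by rewrite sn0 implybT.
  rewrite ler_wpM2r// (le_trans _ (_ : d <= c))//; last by rewrite ge_min lexx.
  have -> : d = (d `^ (r - 1)^-1) `^ (r - 1).
    by rewrite -powRrM mulVf ?gt_eqF// powRr1 ?(ltW d0).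
  apply: ge0_ler_powR => //; rewrite ?nnegrE ?powR_ge0//.
  exact: ltW.
apply: (@le_trans _ _ (1 + s `^ r)); last by rewrite lerD2l.
have h1 : 1 <= 1 + s `^ r by rewrite lerDl powR_ge0.
rewrite -[leRHS]powRr1 ?(le_trans ler01)//.
by apply: ler_powR => //; rewrite invf_le1// ltW.
Qed.

(** Beyond [A = 2 / s0] the flatness of the unit ball gives [N x 2 <= x + c]. So a norm that grows
    by adding vectors of norm at most 2, in the [N] sense, grows at an arbitrarily small linear rate
    after a fixed initial cost. *)
Lemma norm2_sublinear (c : R) : 0 < c ->
  exists2 A, 0 <= A & forall (a : nat -> R) (e : R), 0 <= e -> a 0 = 0 ->
    (forall n, 0 <= a n) -> (forall n, a n.+1 <= N (a n) 2 + e) ->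
    forall n, a n <= A + n%:R * (c + e).
Proof.
move=> c0; have c2 : 0 < c / 2 by rewrite divr_gt0.
have [s0 /andP[s00 _] Hs] := norm2_flat c2.
pose A := 2 / s0; have A0 : 0 < A by rewrite divr_gt0.
have big x : A <= x -> N x 2 <= x + c.
  move=> Ax; have x0 : 0 < x by exact: lt_le_trans Ax.
  have xn0 : x != 0 by rewrite gt_eqF.
  have -> : N x 2 = x * N 1 (2 / x).
    rewrite -(norm2_scale _ _ (ltW x0)) mulr1; congr (N x _); field.
    exact: xn0.
  have -> : x + c = x * (1 + c / 2 * (2 / x)) by field; exact: xn0.
  rewrite ler_wpM2l ?(ltW x0)// Hs// divr_ge0 ?(ltW x0)//=.
  by rewrite ler_pdivrMr// mulrC -ler_pdivrMr.
exists A; first exact: ltW.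
move=> a e e0 a0 age aS; elim=> [|n IH]; first by rewrite a0 mul0r addr0 ltW.
have e1 : n.+1%:R = 1 + n%:R :> R by rewrite nat1r.
rewrite (le_trans (aS n))// e1 mulrDl mul1r.
have ce : 0 <= n%:R * (c + e) by rewrite mulr_ge0// addr_ge0// ltW.
have [aA|Aa] := leP (a n) A.
  have := norm2_mono (age n) (ler0n R 2) aA (lexx 2); have := big _ (lexx A); lra.
have := big _ (ltW Aa); lra.
Qed.

End Norm2More.

Section DualFacts.
Context {R : realType} {k : scalar_kind}.
Notation K := (kfield R k).
Notation dual E := (bop E (K^o : normedModType K)).
Implicit Types E F : normedModType K.

Lemma bop_extension E (A : set E) (g : E -> K^o) (M : R) : 0 <= M ->
  A !=set0 -> (forall a x y, A x -> A y -> A (a *: x + y)) ->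
  (forall a x y, A x -> A y -> g (a *: x + y) = a *: g x + g y) ->
  (forall x, A x -> rnorm (g x) <= M * rnorm x) ->
  exists f : dual E, [/\ forall x, rnorm (f x) <= M * rnorm x, opnorm f <= M &
    forall x, A x -> f x = g x].
Proof.
move=> M0 A0 Al gl gM.
have [|a x|F [lF FM Fg]] := @hahn_banach R k E (fun x => M * rnorm x) A g _ _ A0 Al gl gM.
- by move=> x y; rewrite -mulrDr ler_wpM2l// rnormD.
- by rewrite rnormZ mulrCA.
have [f fE] := mk_bop lF FM.
exists f; split=> [x||x Ax]; [by rewrite fE| |by rewrite fE Fg].
by apply: opnorm_le => // x; rewrite fE.
Qed.

(** Hahn-Banach for [x + c *: z |-> c] on the span of [A] and [z]. That [z] keeps [q]-distance 1
    from [A] makes this map well defined and dominated by [q]. *)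
Lemma seminorm_separation (V : lmodType K) (q : V -> R) (A : set V) (z : V) :
  (forall x y, q (x + y) <= q x + q y) ->
  (forall (a : K) x, q (a *: x) = rnorm a * q x) ->
  A !=set0 -> (forall a x y, A x -> A y -> A (a *: x + y)) ->
  (forall x, A x -> 1 <= q (z - x)) ->
  exists F : V -> K^o, [/\ linear F, forall x, rnorm (F x) <= q x,
    forall x, A x -> F x = 0 & F z = 1].
Proof.
move=> qD qZ [a0 Aa0] Al qz.
have A0 : A 0 by have := Al (-1) a0 a0 Aa0 Aa0; rewrite scaleN1r addNr.
have AZ a x : A x -> A (a *: x) by move=> Ax; rewrite -(addr0 (_ *: _)); exact: Al.
have q0 : q 0 = 0 by rewrite -(scale0r 0) qZ rnorm0 mul0r.
have qN v : q (- v) = q v.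
  by rewrite -scaleN1r qZ /rnorm normrN1 -(kofR1 (k := k)) kofRK mul1r.
pose B := [set x + c *: z | x in A & c in [set: K]].
have uniq x c y d : A x -> A y -> x + c *: z = y + d *: z -> c = d.
  move=> Ax Ay xy; apply/eqP; rewrite -subr_eq0; apply/negP => /negP cd.
  have zE : z = (c - d)^-1 *: (y - x).
    rewrite (_ : y - x = (c - d) *: z) ?scalerA ?mulVf ?scale1r//.
    have -> : y = x + (c *: z - d *: z) by rewrite addrA xy addrK.
    by rewrite addrC addKr scalerBl.
  have Az : A z by rewrite zE; apply: AZ; rewrite addrC -scaleN1r; exact: Al.
  by have := qz _ Az; rewrite subrr q0 leNgt ltr01.
have /choice[g gP] v : exists c : K, B v -> exists2 x, A x & v = x + c *: z.
  have [[x Ax [c _ <-]]|nBv] := pselect (B v); last by exists 0.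
  by exists c => _; exists x.
have gE x c : A x -> g (x + c *: z) = c.
  move=> Ax; have [|y Ay e] := gP (x + c *: z); first by exists x => //; exists c.
  exact: uniq Ay Ax (esym e).
have [||||F [lF Fq Fg]] := @hahn_banach R k V q B g qD qZ.
- by exists (0 + 0 *: z); exists 0 => //; exists 0.
- move=> a _ _ [x Ax [c _ <-]] [y Ay [d _ <-]].
  exists (a *: x + y); first exact: Al.
  by exists (a * c + d) => //; rewrite scalerDr scalerDl scalerA addrACA.
- move=> a _ _ [x Ax [c _ <-]] [y Ay [d _ <-]].
  rewrite scalerDr scalerA addrACA -scalerDl !gE//; exact: Al.
- move=> _ [x Ax [c _ <-]]; rewrite gE//.
  have [->|c0] := eqVneq c 0.
    rewrite rnorm0; have := qD (x + 0 *: z) (- (x + 0 *: z)).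
    by rewrite addrN q0 qN; lra.
  have -> : x + c *: z = c *: (z - (- c^-1) *: x).
    by rewrite scalerBr scalerA mulrN mulfV// scaleN1r opprK addrC.
  by rewrite qZ ler_peMr ?rnorm_ge0//; apply: qz; exact: AZ.
exists F; split=> // [x Ax|].
  by rewrite -(addr0 x) -(scale0r z) Fg ?gE//; exists x => //; exists 0.
by rewrite -(add0r z) -[in F _](scale1r z) Fg ?gE//; exists 0 => //; exists 1.
Qed.

Lemma norming E (x : E) : exists f : dual E,
  [/\ opnorm f <= 1, forall y, rnorm (f y) <= rnorm y & f x = kofR (rnorm x)].
Proof.
have [->|x0] := eqVneq x 0.
  exists 0; split; [|by move=> y; rewrite bop_zeroE rnorm0 rnorm_ge0|by rewrite rnorm0 kofR0].
  by apply: opnorm_le => // y; rewrite bop_zeroE rnorm0 mul1r rnorm_ge0.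
have nx0 : rnorm x != 0 by apply: contra_neq x0; exact: rnorm_eq0.
have nx : 0 < rnorm x by rewrite lt_neqAle eq_sym nx0 rnorm_ge0.
have [|||||F [lF Fq _ Fx]] := @seminorm_separation E (fun y => rnorm y / rnorm x) [set 0] x.
- by move=> y z; rewrite -mulrDl ler_wpM2r ?rnormD ?invr_ge0 ?ltW.
- by move=> a y; rewrite rnormZ mulrA.
- by exists 0.
- by move=> a y z -> ->; rewrite scaler0 addr0.
- by move=> y ->; rewrite subr0 mulfV.
have Fb y : rnorm (kofR (rnorm x) *: F y) <= 1 * rnorm y.
  rewrite rnormZ rnorm_kofR ger0_norm ?rnorm_ge0// mul1r.
  by rewrite -ler_pdivlMl// mulrC Fq.
have lF' : linear (fun y => kofR (rnorm x) *: F y).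
  by move=> a y z; rewrite lF scalerDr !scalerA mulrC.
have [f fE] := mk_bop lF' Fb; exists f; split.
- by apply: opnorm_le => // y; rewrite fE.
- by move=> y; rewrite fE -[leRHS]mul1r.
- by rewrite fE Fx -[LHS]/(_ * _) mulr1.
Qed.

Lemma weakly_nullP E (u : nat -> E) :
  weakly_null u <-> forall f : dual E, cv (f \o u) 0.
Proof. by split=> h f; apply/cvP; exact: h. Qed.

Definition wcauchy {E : normedModType K} (u : nat -> E) :=
  forall f : dual E, cauchyseq (f \o u).

(** The conclusion of Rosenthal's theorem, isolated because the routes leading to the construction
    of cuts obtain it in different ways. *)
Definition wcauchy_property E := forall (u : nat -> E) M, (forall n, rnorm (u n) <= M) ->
  exists2 s, incr s & wcauchy (u \o s).

Lemma rcvB0 (a b : nat -> R) l m : rcv a l -> rcv b m -> rcv (fun n => a n + b n) (l + m).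
Proof. by move=> /rcvP al /rcvP bm; apply/rcvP; exact: cvgD. Qed.

Lemma dual_bound E (f : dual E) x : rnorm x <= 1 -> rnorm (f x) <= opnorm f.
Proof.
by move=> x1; rewrite (le_trans (opnormP _ _))// -[leRHS]mulr1 ler_wpM2l ?opnorm_ge0.
Qed.

(** Otherwise some subsequence of [T (u n)] converges to a nonzero [l], while a functional norming
    [l], composed with [T], tends to 0 along it. *)
Lemma kop_weak_norm E F (T : bop E F) (u : nat -> E) M : kop T ->
  (forall n, rnorm (u n) <= M) -> (forall f : dual E, cv (f \o u) 0) ->
  cv (T \o u) 0.
Proof.
move=> kT uM u0 e e0; apply: contrapT => /forallNP Hn.
have [N|s si Hs] := @subseq_of_frequently (fun n => e <= rnorm (T (u n) - 0)).
  have /existsNP[n /not_implyP[Nn h]] := Hn N; exists n => //.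
  by rewrite leNgt; exact/negP.
have [n|t [l [ti Tl]]] := kop_bounded (M := M) (u := u \o s) kT; first exact: uM.
have [f [_ fb fl]] := norming l.
have /cv_unique := bop_cv f Tl; move=> /(_ 0) fl0.
have : f l = 0.
  apply: fl0; have := cv_sub (incr_comp si ti) (u0 (bcomp f T)); congr cv.
  by apply/funext => n /=; rewrite bcompE.
rewrite fl -(kofR0 (k := k)) => /kofR_inj/rnorm_eq0 l0.
have [N HN] := Tl e e0; have := HN N (leqnn N); rewrite l0.
by have := Hs (t N); rewrite leNgt => /negP.
Qed.

End DualFacts.

(** * Property (m_p) and compact cuts *)

Section CoreDefs.
Context {R : realType} {k : scalar_kind}.
Notation K := (kfield R k).
Notation dual E := (bop E (K^o : normedModType K)).

(* Property (m_p) along subsequences on which all the norms converge. *)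
Definition mp_limit (p : \bar R) (E : normedModType K) :=
  forall (x : E) (u : nat -> E) (M b c : R), (forall n, rnorm (u n) <= M) ->
    (forall f : dual E, cv (f \o u) 0) -> rcv (fun n => rnorm (u n)) b ->
    rcv (fun n => rnorm (x + u n)) c -> c = norm2 p (rnorm x) b.

(** Used whenever one functional has to detect two contributions at once: after a rotation they
    cannot cancel. *)
Lemma phase2 (z w : K^o) :
  exists2 t : K, rnorm t = 1 & rnorm (z + t *: w) = rnorm z + rnorm w.
Proof.
have [a a1 az] := phase z; have [b b1 bw] := phase w.
have a0 : a != 0 by apply: contra_eq_neq a1 => ->; rewrite rnorm0 eq_sym oner_neq0.
exists (a^-1 * b).
  rewrite /rnorm normrM normfV; move: a1 b1; rewrite /rnorm => a1 b1.
  have -> : `|a| = 1 by rewrite -(kReK (normr_ge0 a)) a1 kofR1.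
  by rewrite invr1 mul1r.
have -> : z + (a^-1 * b) *: w = a^-1 *: (kofR (rnorm z + rnorm w) : K^o).
  by rewrite kofRD -az -bw scalerDr !scalerA mulVf// scale1r.
rewrite rnormZ rnorm_kofR ger0_norm ?addr_ge0 ?rnorm_ge0//.
suff -> : rnorm (a^-1) = 1 by rewrite mul1r.
rewrite /rnorm normfV -(kReK (normr_ge0 a)) -/(rnorm a) a1 kofR1 invr1.
by rewrite -kofR1 kofRK.
Qed.

Lemma opnorm_unit (E F : normedModType K) (T : bop E F) e :
  (forall x, rnorm x <= 1 -> rnorm (T x) <= e) -> forall x, rnorm (T x) <= e * rnorm x.
Proof.
move=> Te x; apply: opnormP1; apply: ge_sup; first exact: opnorm_nonempty.
by move=> _ [y /= y1 <-]; apply: Te; rewrite -rnorm_le_kofR kofR1.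
Qed.

Lemma bounded_norm_subseq (E : normedModType K) (u : nat -> E) M :
  (forall n, rnorm (u n) <= M) -> exists s b, incr s /\ rcv (fun n => rnorm (u (s n))) b.
Proof.
move=> uM; have [n|s [b [si ub]]] := @real_subseq _ (fun n => rnorm (u n)) M.
  by rewrite ger0_norm ?rnorm_ge0.
by exists s, b.
Qed.

End CoreDefs.

Section Core.
Context {R : realType} {k : scalar_kind}.
Notation K := (kfield R k).
Notation dual E := (bop E (K^o : normedModType K)).
Variables (p : \bar R) (p_gt1 : (1 < p)%E) (E : normedModType K).
Notation N := (norm2 p).
Let p1 : (1 <= p)%E := ltW p_gt1.

Hypothesis mpE : mp_limit p E.

Lemma mp_limit_le (x : E) (v : nat -> E) b e n0 : (forall n, rnorm (v n) <= b) ->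
  (forall f : dual E, cv (f \o v) 0) -> 0 < e ->
  exists2 n, (n0 <= n)%N & rnorm (x + v n) <= N (rnorm x) b + e.
Proof.
move=> vb v0 e0.
have [s [b' [si vb']]] := bounded_norm_subseq vb.
have [n|t [c [ti xc]]] := @bounded_norm_subseq _ _ _ (fun n => x + v (s n)) (rnorm x + b).
  by rewrite (le_trans (rnormD _ _))// lerD2l.
have cE : c = N (rnorm x) b'.
  apply: (mpE (M := b) (u := v \o s \o t)) => [n|f||//]; first exact: vb.
    by have := cv_sub (incr_comp si ti) (v0 f).
  exact: rcv_sub vb'.
have b'b : b' <= b.
  apply: (rcv_le (u := fun n => rnorm (v (s n))) (v := fun=> b)) => // e1 e10.
  by exists 0%N => n _; rewrite subrr normr0.
have b'0 : 0 <= b'.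
  apply: (rcv_le (u := fun=> 0) (v := fun n => rnorm (v (s n)))) => [n||//].
    exact: rnorm_ge0.
  by move=> e1 e10; exists 0%N => n _; rewrite subrr normr0.
have [M HM] := xc e e0; exists (s (t (maxn n0 M))).
  by rewrite (leq_trans (leq_maxl n0 M))// (incr_ge (incr_comp si ti)).
have := HM _ (leq_maxr n0 M); rewrite cE ltr_norml => /andP[_].
have := norm2_mono p_gt1 (rnorm_ge0 x) b'0 (lexx _) b'b; lra.
Qed.

Hypothesis wcE : wcauchy_property E.
Variable S : nat -> bop E E.
Hypothesis kS : forall n, kop (S n).
Hypothesis S1 : forall n x, rnorm (S n x) <= rnorm x.
Hypothesis Scv : forall x, cv (fun n => S n x) x.

(* [f] being fixed, a weakly null sequence on which [f \o S n] stays large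
   could be added to a point where [f] almost attains its norm. *)
Lemma shrinking (f : dual E) (e : R) : 0 < e ->
  exists n0, forall n, (n0 <= n)%N -> forall x, rnorm (f x - f (S n x)) <= e * rnorm x.
Proof.
move=> e0; apply: contrapT => /forallNP Hn.
have [n0|s si Hs] := @subseq_of_frequently (fun n =>
    exists2 x, rnorm x <= 1 & e < rnorm (f x - f (S n x))).
  have /existsNP[n /not_implyP[Nn h]] := Hn n0; exists n => //.
  apply: contrapT => /forall2NP h'; apply: h => x.
  have h2 y : rnorm y <= 1 -> rnorm ((f - bcomp f (S n)) y) <= e.
    by move=> y1; rewrite leNgt; apply/negP; have [//|] := h' y; rewrite bop_subE bcompE.
  by have := opnorm_unit h2 x; rewrite bop_subE bcompE.
have /choice[x xP] n : exists x, rnorm x <= 1 /\ e < rnorm (f x - f (S (s n) x)).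
  by have [x] := Hs n; exists x.
have [t ti xw] := wcE (fun n => (xP n).1).
pose y := x \o t; pose sg := s \o t; have sgi : incr sg := incr_comp si ti.
have e2 : 0 < e / 2 by rewrite divr_gt0.
(* [l j] is so large that [f] no longer distinguishes [y j] from its image under [S (sg (l j))].
   Subtracting [y j] makes the sequence weakly null and still leaves a discrepancy [e / 2]. *)
have /choice[l lP] j : exists l, (j < l)%N /\ rnorm (f (y j) - f (S (sg l) (y j))) <= e / 2.
  have [n Hn'] := bop_cv f (Scv (y j)) e2.
  exists (maxn j.+1 n); split; first exact: leq_maxl.
  rewrite rnormBC ltW//; apply: Hn'.
  by rewrite (leq_trans (leq_maxr j.+1 n))// incr_ge.
pose u j := y (l j) - y j; pose ta j := sg (l j).
have u2 j : rnorm (u j) <= 2.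
  by rewrite (le_trans (rnormB _ _))// -[2]/(1 + 1) lerD//; exact: (xP _).1.
have taj j : (j <= ta j)%N.
  by rewrite (leq_trans (ltnW (lP j).1))// incr_ge.
have u0 (g : dual E) : cv (g \o u) 0.
  move=> d d0; have [n Hn'] := xw g d d0; exists n => j nj.
  by rewrite subr0 /= bopB; apply: Hn' => //; rewrite (leq_trans nj)// ltnW// (lP j).1.
have fu j : e / 2 <= rnorm (f (u j) - f (S (ta j) (u j))).
  have := (xP (t (l j))).2; have := (lP j).2.
  have := rnorm_sub_le (f (y (l j)) - f (S (ta j) (y (l j)))) (f (y j) - f (S (ta j) (y j))).
  rewrite subrBB -!bopB -/(u j).
  rewrite /ta /sg /y /=; lra.
pose F := opnorm f; have F0 : 0 <= F := opnorm_ge0 f.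
have F1 : 0 < F + 1 by rewrite ltr_wpDl.
(* The constants are set up with [2 * a = s0], at the edge of the flat range, and in units of
   [a * e / 16]: the perturbation gains 6, whereas the near attainment of the norm and the excess of
   [x0 + v j] over norm 1 cost 5. *)
have c0 : 0 < e / (16 * (F + 1)) by rewrite divr_gt0// mulr_gt0.
have [s0 /andP[s00 _] flat] := norm2_flat p_gt1 c0.
pose a := s0 / 2; have a0 : 0 < a by rewrite divr_gt0.
have d0 : 0 < a * e / 16 by rewrite divr_gt0// mulr_gt0.
have [x0 x01 fx0] := opnorm_approx f d0.
have [n1 Hn1] := bop_cv f (Scv x0) d0.
have e8 : 0 < e / 8 by rewrite divr_gt0.
have [n2 Hn2] := u0 f _ e8.
have /choice[th thP] j : exists th : K, rnorm th = 1 /\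
    rnorm (f (S (ta j) x0) + th *: (kofR a *: f (S (ta j) (u j)))) =
    rnorm (f (S (ta j) x0)) + a * rnorm (f (S (ta j) (u j))).
  have [th th1 thE] := phase2 (f (S (ta j) x0)) (kofR a *: f (S (ta j) (u j))).
  by exists th; split=> //; rewrite thE rnormZ rnorm_kofR gtr0_norm.
pose v j := th j *: (kofR a *: u j).
have vnorm j : rnorm (v j) = a * rnorm (u j).
  by rewrite rnormZ (thP j).1 mul1r rnormZ rnorm_kofR gtr0_norm.
have v2 j : rnorm (v j) <= 2 * a by rewrite vnorm mulrC ler_wpM2r// ltW.
have v0 (g : dual E) : cv (g \o v) 0.
  apply: (cv_squeeze (a := fun j => a * rnorm (g (u j)))) => [j|].
    by rewrite subr0 /= !bopZ rnormZ (thP j).1 mul1r rnormZ rnorm_kofR gtr0_norm.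
  apply/rcvP; rewrite -(mulr0 a); apply: cvgMr; apply/rcvP.
  by have := cv_norm (u0 g); rewrite rnorm0.
have eta0 : 0 < a * e / (16 * (F + 1)) by rewrite divr_gt0// ?mulr_gt0.
have [j] := mp_limit_le x0 (maxn n1 n2) v2 v0 eta0.
rewrite geq_max => /andP[n1j n2j] xv.
have h1 := Hn1 _ (leq_trans n1j (taj j)); have h2 := Hn2 _ n2j.
have h3 : rnorm (f (S (ta j) (x0 + v j))) =
    rnorm (f (S (ta j) x0)) + a * rnorm (f (S (ta j) (u j))).
  by rewrite -(thP j).2 (bopD (S (ta j)) x0) (bopD f (S (ta j) x0)) /v !bopZ.
have h4 : rnorm (f (S (ta j) (x0 + v j))) <= F * rnorm (x0 + v j).
  by rewrite (le_trans (opnormP _ _))// ler_wpM2l.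
have h5 : N (rnorm x0) (2 * a) <= 1 + e / (16 * (F + 1)) * (2 * a).
  apply: (@le_trans _ _ (N 1 (2 * a))).
    by apply: norm2_mono => //; rewrite ?rnorm_ge0// mulr_ge0// ltW.
  by apply: flat; rewrite mulr_ge0 ?(ltW a0)//= /a mulrC divfK.
have h6 : F * rnorm (x0 + v j) <= F + 3 * (a * e / 16).
  have -> : 3 * (a * e / 16) = (F + 1) * (3 * (a * e / (16 * (F + 1)))).
    by field; rewrite gt_eqF.
  apply: (@le_trans _ _ (F * (1 + 3 * (a * e / (16 * (F + 1)))))).
    apply: ler_wpM2l => //; apply: (le_trans xv).
    have e5 : e / (16 * (F + 1)) * (2 * a) = 2 * (a * e / (16 * (F + 1))).
      by field; rewrite gt_eqF.
    by rewrite e5 in h5; lra.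
  by rewrite mulrDr mulr1 lerD2l ler_wpM2r ?lerDl// mulr_ge0// ltW.
have h7 : rnorm (f (S (ta j) (u j))) >= 3 * (e / 8).
  have := fu j; have := rnormB (f (u j)) (f (S (ta j) (u j))).
  by move: h2; rewrite /= subr0; lra.
have h8 : rnorm (f (S (ta j) x0)) > F - 2 * (a * e / 16).
  have := rnorm_sub_le (f x0) (f (S (ta j) x0)); rewrite rnormBC.
  by move: h1 fx0; rewrite /= -/F; lra.
have h9 : a * rnorm (f (S (ta j) (u j))) >= a * (3 * (e / 8)) by rewrite ler_wpM2l// ltW.
have h10 : 0 < a * e by rewrite mulr_gt0.
have : a * (3 * (e / 8)) = 6 * (a * e / 16) by field.
lra.
Qed.

(** By [shrinking], [f] is close to [f \o S n] uniformly on bounded sets, and [S n (w n)] tends to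
    0. *)
Lemma tail_weakly_null (w : nat -> E) M :
  (forall n, rnorm (w n) <= M) ->
  (forall n, rnorm (S n (w n)) <= n.+1%:R^-1) -> forall f : dual E, cv (f \o w) 0.
Proof.
move=> wM Sw f e e0.
have M1 : 0 < `|M| + 1 by rewrite ltr_wpDl.
have [n1 H1] : exists n0, forall n, (n0 <= n)%N -> forall x, rnorm (f x - f (S n x)) <= e /
  2 / (`|M| + 1) * rnorm x.
  by apply: shrinking; rewrite !divr_gt0.
have F1 : 0 < opnorm f + 1 by rewrite ltr_wpDl ?opnorm_ge0.
have [|n2 H2] := @inv_lt R (e / 2 / (opnorm f + 1)); first by rewrite !divr_gt0.
exists (maxn n1 n2) => n; rewrite geq_max => /andP[n1n n2n]; rewrite subr0 /=.
have h1 := H1 n n1n (w n); have h2 := H2 n n2n.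
have h3 : rnorm (f (S n (w n))) < e / 2.
  apply: le_lt_trans (opnormP _ _) _.
  apply: (@le_lt_trans _ _ ((opnorm f + 1) * n.+1%:R^-1)).
    by apply: ler_pM; rewrite ?opnorm_ge0 ?rnorm_ge0// lerDl.
  by rewrite mulrC -ltr_pdivlMr.
have h4 : e / 2 / (`|M| + 1) * rnorm (w n) <= e / 2.
  rewrite -[leRHS]mulr1 -mulrA ler_wpM2l ?divr_ge0 ?(ltW e0)//.
  rewrite mulrC ler_pdivrMr// mul1r (le_trans (wM n))// (le_trans (ler_norm M))//.
  by rewrite lerDl.
have := rnormD (f (w n) - f (S n (w n))) (f (S n (w n))); rewrite subrK; lra.
Qed.

(** Failure for every [m] yields a sequence [w] that is weakly null by [tail_weakly_null], and heads
    [u] that converge along a subsequence; in the limit this contradicts (m_p). Smallness of [S m w]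
    is thus a quantitative substitute for weak convergence. *)
Lemma uniform_mp (C : set E) (M e : R) : seqc C -> 0 < e ->
  exists m, forall u w, C u -> rnorm w <= M -> rnorm (S m w) <= m.+1%:R^-1 ->
    `|rnorm (u + w) - N (rnorm u) (rnorm w)| <= e.
Proof.
move=> sC e0; apply: contrapT => /forallNP Hm.
have /choice[uw uwP] m : exists uw : E * E, [/\ C uw.1, rnorm uw.2 <= M,
    rnorm (S m uw.2) <= m.+1%:R^-1 &
    e < `|rnorm (uw.1 + uw.2) - N (rnorm uw.1) (rnorm uw.2)|].
  have /existsNP[u /existsNP[w /not_implyP[Cu /not_implyP[wM /not_implyP[Sw h]]]]] := Hm m.
  by exists (u, w); split=> //; rewrite ltNge; exact/negP.
pose u n := (uw n).1; pose w n := (uw n).2.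
have wM n : rnorm (w n) <= M by case: (uwP n).
have w0 (f : dual E) : cv (f \o w) 0.
  apply: (tail_weakly_null wM) => n; by case: (uwP n).
have [s1 [l [s1i ul]]] := sC u (fun n => let: And4 h _ _ _ := uwP n in h).
have [s2 [b [s2i wb]]] := bounded_norm_subseq (fun n => wM (s1 n)).
have [n|s3 [c [s3i wc]]] := @bounded_norm_subseq _ _ _ (fun n => l + w (s1 (s2 n))) (rnorm l + M).
  by rewrite (le_trans (rnormD _ _))// lerD2l.
pose s := s1 \o s2 \o s3; have si : incr s by exact: incr_comp (incr_comp _ _) _.
have ws : rcv (fun n => rnorm (w (s n))) b by have := rcv_sub s3i wb.
have us : cv (u \o s) l by have := cv_sub (incr_comp s2i s3i) ul.
have cE : c = N (rnorm l) b.
  apply: (mpE (u := w \o s) (M := M)) => [n|f||//]; [exact: wM| |exact: ws].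
  exact: cv_sub si (w0 f).
have lim1 : rcv (fun n => rnorm (u (s n) + w (s n))) c.
  move=> d d0; have d2 : 0 < d / 2 by rewrite divr_gt0.
  have [n1 H1] := us _ d2; have [n2 H2] := wc _ d2; exists (maxn n1 n2) => n.
  rewrite geq_max => /andP[/H1 h1 /H2 h2].
  have := rnorm_dist (u (s n) + w (s n)) (l + w (s n)).
  rewrite opprD addrACA addrN addr0; move: h1 h2 => /=.
  have := ler_normD (rnorm (u (s n) + w (s n)) - rnorm (l + w (s n))) (rnorm (l + w (s n)) - c).
  by rewrite addrA subrK /s/=; lra.
have lim2 := norm2_cv p_gt1 (cv_norm us) ws.
have e2 : 0 < e / 2 by rewrite divr_gt0.
have [n1 H1] := lim1 _ e2; have [n2 H2] := lim2 _ e2.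
have := H1 _ (leq_maxl n1 n2); have := H2 _ (leq_maxr n1 n2).
have [_ _ _] := uwP (s (maxn n1 n2)); rewrite -/(u _) -/(w _) -cE /=.
set a := rnorm (_ + _); set a' := N _ _.
have := ler_normD (a - c) (c - a'); rewrite addrA subrK (distrC c); lra.
Qed.

(** For bounded [x n] the vectors [x n - S n (x n)] are weakly null, by [shrinking], and a compact
    operator turns this into norm convergence. *)
Lemma kop_tail (F : normedModType K) (G : bop E F) (e : R) : kop G -> 0 < e ->
  exists n0, forall n, (n0 <= n)%N -> forall x, rnorm (G (x - S n x)) <= e * rnorm x.
Proof.
move=> kG e0; apply: contrapT => /forallNP Hn.
have [n0|s si Hs] := @subseq_of_frequently (fun n =>
    exists2 x, rnorm x <= 1 & e < rnorm (G (x - S n x))).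
  have /existsNP[n /not_implyP[Nn h]] := Hn n0; exists n => //.
  apply: contrapT => /forall2NP h'; apply: h => x.
  have h2 y : rnorm y <= 1 -> rnorm ((bcomp G (bid E - S n)) y) <= e.
    move=> y1; rewrite leNgt; apply/negP; have [//|] := h' y.
    by rewrite bcompE bop_subE bidE.
  by have := opnorm_unit h2 x; rewrite bcompE bop_subE bidE.
have /choice[x xP] n : exists x, rnorm x <= 1 /\ e < rnorm (G (x - S (s n) x)).
  by have [x] := Hs n; exists x.
pose w n := x n - S (s n) (x n).
have w2 n : rnorm (w n) <= 2.
  rewrite (le_trans (rnormB _ _))// -[2]/(1 + 1) lerD//; first exact: (xP n).1.
  exact: le_trans (S1 _ _) (xP n).1.
have w0 (f : dual E) : cv (f \o w) 0.
  move=> d d0; have d2 : 0 < d / 2 by rewrite divr_gt0.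
  have [n0 H] := shrinking f d2; exists n0 => n nn.
  rewrite subr0 /= bopB; apply: le_lt_trans (H _ (leq_trans nn (incr_ge si n)) _) _.
  have := ler_wpM2l (ltW d2) (xP n).1; lra.
have [n Hn'] := kop_weak_norm kG w2 w0 e0.
by have := Hn' n (leqnn n); rewrite subr0 ltNge ltW//; exact: (xP n).2.
Qed.

(** The [S n] are contractions, so their strong convergence is uniform on the relatively compact
    image of the ball under [G]. *)
Lemma kop_head (F : normedModType K) (G : bop F E) (e : R) : kop G -> 0 < e ->
  exists n0, forall n, (n0 <= n)%N -> forall x, rnorm (G x - S n (G x)) <= e * rnorm x.
Proof.
move=> kG e0; apply: contrapT => /forallNP Hn.
have [n0|s si Hs] := @subseq_of_frequently (fun n =>
    exists2 x, rnorm x <= 1 & e < rnorm (G x - S n (G x))).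
  have /existsNP[n /not_implyP[Nn h]] := Hn n0; exists n => //.
  apply: contrapT => /forall2NP h'; apply: h => x.
  have h2 y : rnorm y <= 1 -> rnorm ((G - bcomp (S n) G) y) <= e.
    move=> y1; rewrite leNgt; apply/negP; have [//|] := h' y.
    by rewrite bop_subE bcompE.
  by have := opnorm_unit h2 x; rewrite bop_subE bcompE.
have /choice[x xP] n : exists x, rnorm x <= 1 /\ e < rnorm (G x - S (s n) (G x)).
  by have [x] := Hs n; exists x.
have [t [l [ti Gl]]] := kG x (fun n => (xP n).1).
have e3 : 0 < e / 3 by rewrite divr_gt0.
have [n1 H1] := Gl _ e3; have [n2 H2] := cv_sub (incr_comp si ti) (Scv l) e3.
pose n := maxn n1 n2; have h1 := H1 _ (leq_maxl n1 n2); have h2 := H2 _ (leq_maxr n1 n2).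
have := (xP (t n)).2; move: h1 h2; rewrite -/n /=.
set y := G (x (t n)); set T := S (s (t n)) => h1 h2.
have := rnorm_triangle y l (T y); have := rnorm_triangle l (T l) (T y).
have := S1 (s (t n)) (l - y); rewrite -/T bopB (rnormBC l y) (rnormBC l (T l)); lra.
Qed.

(* [Q] is close to the identity on what the first [S j] see, and conversely. *)
Definition late (m : nat) (Q : bop E E) :=
  [/\ kop Q, forall x, rnorm (Q x) <= rnorm x,
      forall j x, (j <= m)%N -> rnorm (S j (x - Q x)) <= m.+1%:R^-1 * rnorm x &
      forall j x, (j <= m)%N -> rnorm (S j x - Q (S j x)) <= m.+1%:R^-1 * rnorm x].

Lemma late_mono m m' Q : (m <= m')%N -> late m' Q -> late m Q.
Proof.
move=> mm [kQ Q1 QS SQ].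
have le1 (x : E) : m'.+1%:R^-1 * rnorm x <= m.+1%:R^-1 * rnorm x :> R.
  by rewrite ler_wpM2r ?rnorm_ge0// lef_pV2 ?posrE// ler_nat.
split=> [//|//|j x jm|j x jm].
  exact: le_trans (QS j x (leq_trans jm mm)) (le1 x).
exact: le_trans (SQ j x (leq_trans jm mm)) (le1 x).
Qed.

Lemma late_S m : exists n0, forall n, (n0 <= n)%N -> late m (S n).
Proof.
have m0 : 0 < m.+1%:R^-1 :> R by rewrite invr_gt0.
have /choice[n1 H1] j := kop_tail (kS j) m0.
have /choice[n2 H2] j := kop_head (kS j) m0.
exists (\sum_(j < m.+1) (n1 j + n2 j))%N => n nn.
have le (j : nat) : (j <= m)%N -> (n1 j <= n)%N /\ (n2 j <= n)%N.
  move=> jm; have jm' : (j < m.+1)%N by [].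
  move: nn; rewrite (bigD1 (Ordinal jm'))//= => nn.
  by split; apply: leq_trans nn; rewrite -addnA ?leq_addr// addnCA leq_addr.
split=> // j x jm; have [h1 h2] := le j jm; [exact: H1|exact: H2].
Qed.

(** Lateness is a convex condition; this is what allows cuts to be averaged when the gap constant is
    improved. *)
Lemma late_mean M m (Q : nat -> bop E E) : (0 < M)%N ->
  (forall i, (i < M)%N -> late m (Q i)) ->
  late m (kofR M%:R^-1 *: \sum_(i < M) Q i).
Proof.
move=> M0 QL.
have Mn0 : M%:R != 0 :> R by rewrite pnatr_eq0 -lt0n.
have avg (y : nat -> E) c : (forall i, (i < M)%N -> rnorm (y i) <= c) ->
    rnorm (kofR M%:R^-1 *: \sum_(i < M) y i) <= c.
  move=> yc; rewrite rnormZ rnorm_kofR ger0_norm ?invr_ge0//.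
  rewrite ler_pdivrMl ?ltr0n// (le_trans (rnorm_sum _ _ _))//.
  apply: (@le_trans _ _ (\sum_(i < M) c)); first by apply: ler_sum => i _; exact: yc.
  by rewrite sumr_const card_ord mulr_natl.
have QE x : (kofR M%:R^-1 *: \sum_(i < M) Q i) x = kofR M%:R^-1 *: \sum_(i < M) Q i x.
  by rewrite bop_scaleE bop_sumE.
have IE x : x = kofR M%:R^-1 *: \sum_(i < M) x :> E.
  rewrite sumr_const card_ord -(scaler_nat M x) scalerA.
  rewrite (_ : kofR _ * _ = 1) ?scale1r//.
  by rewrite -(_ : kofR M%:R = M%:R) -?kofRM ?mulVf ?kofR1// /kofR; case: (k) => //=;
    rewrite rmorph_nat.
split=> [|x|j x jm|j x jm].
- by apply: kopZ; apply: kop_sum => i _; case: (QL i (ltn_ord i)).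
- by rewrite QE; apply: (avg (fun i => Q i x)) => i iM; case: (QL i iM) => _ + _ _; apply.
- rewrite QE {1}[x]IE -scalerBr -sumrB bopZ (lin_sum (bop_linear (S j))).
  by apply: (avg (fun i => S j (x - Q i x))) => i iM; case: (QL i iM) => _ _ + _; apply.
- rewrite QE {1}[S j x]IE -scalerBr -sumrB.
  by apply: (avg (fun i => S j x - Q i (S j x))) => i iM; case: (QL i iM) => _ _ _; apply.
Qed.

(** [G] is replaced by [G \o S j] at a cost of [e / 4] on vectors of norm at most [2 * rnorm x], and
    lateness makes [S j (x - Q x)] small. *)
Lemma late_tail (F : normedModType K) (G : bop E F) (e : R) : kop G -> 0 < e ->
  exists m, forall Q, late m Q -> forall x, rnorm (G (x - Q x)) <= e * rnorm x.
Proof.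
move=> kG e0; have e4 : 0 < e / 4 by rewrite divr_gt0.
have [j Hj] := kop_tail kG e4; have /(_ j (leqnn j)) {}Hj := Hj.
have G1 : 0 < opnorm G + 1 by rewrite ltr_wpDl ?opnorm_ge0.
have [|n Hn] := @inv_lt R (e / 2 / (opnorm G + 1)); first by rewrite !divr_gt0.
exists (maxn j n) => Q [kQ Q1 QS _] x.
have h1 := Hj (x - Q x); have h2 := QS j x (leq_maxl j n).
have h3 := Hn _ (leq_maxr j n); have x0 := rnorm_ge0 x.
have h4 : rnorm (x - Q x) <= 2 * rnorm x.
  by have := rnormB x (Q x); have := Q1 x; lra.
have h5 : rnorm (G (S j (x - Q x))) <= e / 2 * rnorm x.
  apply: le_trans (opnormP _ _) _.
  apply: (@le_trans _ _ ((opnorm G + 1) * ((maxn j n).+1%:R^-1 * rnorm x))).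
    by apply: ler_pM; rewrite ?opnorm_ge0 ?rnorm_ge0// lerDl.
  rewrite mulrA ler_wpM2r// mulrC -ler_pdivlMr// ltW//.
have := rnormD (G (x - Q x - S j (x - Q x))) (G (S j (x - Q x))).
rewrite -bopD subrK; have := ler_wpM2l (ltW e4) h4; lra.
Qed.

Lemma late_head (F : normedModType K) (G : bop F E) (e : R) : kop G -> 0 < e ->
  exists m, forall Q, late m Q -> forall x, rnorm (G x - Q (G x)) <= e * rnorm x.
Proof.
move=> kG e0; have e4 : 0 < e / 4 by rewrite divr_gt0.
have [j Hj] := kop_head kG e4; have /(_ j (leqnn j)) {}Hj := Hj.
have G1 : 0 < opnorm G + 1 by rewrite ltr_wpDl ?opnorm_ge0.
have [|n Hn] := @inv_lt R (e / 2 / (opnorm G + 1)); first by rewrite !divr_gt0.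
exists (maxn j n) => Q [kQ Q1 _ SQ] x.
have h1 := Hj x; have h2 := SQ j (G x) (leq_maxl j n).
have h3 := Hn _ (leq_maxr j n); have x0 := rnorm_ge0 x.
have h4 : rnorm (S j (G x) - Q (S j (G x))) <= e / 2 * rnorm x.
  apply: (le_trans h2).
  apply: (@le_trans _ _ ((maxn j n).+1%:R^-1 * ((opnorm G + 1) * rnorm x))).
    by rewrite ler_wpM2l// (le_trans (opnormP _ _))// ler_wpM2r// lerDl.
  by rewrite mulrA ler_wpM2r// -ler_pdivlMr// ltW.
have h5 := Q1 (G x - S j (G x)).
have h6 := rnormB (G x - S j (G x)) (Q (G x - S j (G x))).
have -> : G x - Q (G x) = (G x - S j (G x) - Q (G x - S j (G x))) + (S j (G x) - Q (S j (G x))).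
  by rewrite bopB subrBB subrK.
have := rnormD (G x - S j (G x) - Q (G x - S j (G x))) (S j (G x) - Q (S j (G x))).
lra.
Qed.

End Core.

Lemma kofR_nat {R : realType} {k : scalar_kind} n : kofR n%:R = n%:R :> kfield R k.
Proof. by elim: n => [|n IH]; rewrite ?kofR0// -!natr1 kofRD IH kofR1. Qed.

(** * Chains of cuts and the gap constant *)

Section NestedIndices.
Variables (M i : nat) (iM : (i < M)%N).
(** In a chain of [4 * M] cuts, the inner cut of the [i]-th nested pair stands at position [2 * i]
    and the outer one at the mirror position [J]. The lemmas below locate the thin layers next to
    both. *)
Let J := (M + M + (M + M) - i.*2.+1)%N.

Lemma nested_ge : (M + M <= J)%N. Proof. by rewrite /J; lia. Qed.
Lemma nested_gt : (i.*2.+1 < J)%N. Proof. by rewrite /J; lia. Qed.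
Lemma nested_sym : (M + M + (M + M) - J.+1)%N = i.*2. Proof. by rewrite /J; lia. Qed.
Lemma nested_odd : (M + M - i.+1).*2.+1 = J. Proof. by rewrite /J; lia. Qed.
Lemma nested_even : (M + M - i.+1).*2 = J.-1. Proof. by rewrite /J; lia. Qed.
Lemma nested_pred : (i.*2.+1 <= J.-1)%N. Proof. by rewrite /J; lia. Qed.
Lemma nested_pred_gt : (i.*2.+1 < J.-1)%N. Proof. by rewrite /J; lia. Qed.
Lemma nested_half : (i.*2 < M + M)%N. Proof. lia. Qed.

End NestedIndices.

Section Heads.
Context {R : realType} {k : scalar_kind}.
Notation K := (kfield R k).
Variable E : normedModType K.
Implicit Types (G : nat -> bop E E) (y : nat -> E).

Definition hsum G n y := \sum_(i < n) G i (y i).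

Lemma hsumD G n y z : hsum G n (fun i => y i + z i) = hsum G n y + hsum G n z.
Proof. by rewrite /hsum -big_split /=; apply: eq_bigr => i _; rewrite bopD. Qed.

Lemma hsum_delta G n c v : (c < n)%N ->
  hsum G n (fun i => if i == c then v else 0) = G c v.
Proof.
move=> cn; rewrite /hsum (bigD1 (Ordinal cn))//= eqxx big1 ?addr0// => i /eqP ic.
by case: eqP => [e|_]; [exfalso; apply: ic; exact: val_inj|rewrite bop0].
Qed.

Lemma hsum_widen G n m y : (n <= m)%N ->
  hsum G m (fun i => if (i < n)%N then y i else 0) = hsum G n y.
Proof.
move=> nm; rewrite /hsum (big_ord_widen m (fun i => G i (y i)) nm) [RHS]big_mkcond.
by apply: eq_bigr => i _; case: ifP => // _; rewrite bop0.
Qed.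

(** Every one of the first [n] operators is applied once, to its own vector of the unit ball. The
    resulting set is relatively compact, by [seqc_heads], and contains the partial sums to which
    later pieces will be added. *)
Definition heads G n : set E :=
  [set u | exists2 y, (forall i, rnorm (y i) <= 1) & u = hsum G n y].

Lemma heads_eq G G' n : (forall i, (i < n)%N -> G i = G' i) -> heads G n = heads G' n.
Proof.
move=> GG; apply/seteqP; split=> _ [y y1 ->]; exists y => //; apply: eq_bigr => i _;
  by rewrite GG.
Qed.

Lemma heads0 G n : heads G n 0.
Proof.
exists (fun=> 0) => [i|]; first by rewrite rnorm0.
by rewrite /hsum big1// => i _; rewrite bop0.
Qed.

(** The indices [c] and [d] are distinct and at least [n], so no operator receives two vectors and
    the bound 1 is kept. *)
Lemma heads_ext G n u c d x (t : K) : heads G n u -> (n <= c < d)%N ->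
  rnorm x <= 1 -> rnorm t <= 1 -> heads G d.+1 (u + t *: (G d x - G c x)).
Proof.
move=> [y y1 ->] /andP[nc cd] x1 t1.
have tx : rnorm (t *: x) <= 1.
  by rewrite rnormZ -[leRHS]mulr1; apply: ler_pM; rewrite ?rnorm_ge0.
exists (fun i => (if (i < n)%N then y i else 0) +
    ((if i == d then t *: x else 0) + (if i == c then - (t *: x) else 0))).
  move=> i; case: ltnP => [iltn|ni].
    rewrite (ltn_eqF (leq_trans iltn (leq_trans nc (ltnW cd)))) (ltn_eqF (leq_trans iltn nc)).
    by rewrite !addr0.
  rewrite add0r; case: eqP => [->|_]; first by rewrite (gtn_eqF cd) addr0.
  by rewrite add0r; case: eqP => _; rewrite ?rnormN// rnorm0.
rewrite !hsumD hsum_widen ?(leq_trans nc)// ?hsum_delta// ?(ltn_trans cd)//; last first.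
  by rewrite (leq_trans (ltnW cd)).
by rewrite bopN !bopZ scalerBr.
Qed.

Lemma heads_single G n c x : (c < n)%N -> rnorm x <= 1 -> heads G n (G c x).
Proof.
move=> cn x1; exists (fun i => if i == c then x else 0); last by rewrite hsum_delta.
by move=> i; case: eqP => _; rewrite ?rnorm0.
Qed.

Lemma seqc_heads G n : (forall i, (i < n)%N -> kop (G i)) -> seqc (heads G n).
Proof.
move=> kG; have key (y : nat -> nat -> E) : (forall m i, rnorm (y m i) <= 1) ->
    exists s l, incr s /\ cv (fun m => hsum G n (y (s m))) l.
  elim: n kG => [|n IH] kG y1.
    exists id, 0; split=> [m|]; first exact: leqnn.
    by move=> e e0; exists 0%N => m _; rewrite /hsum big_ord0 subr0 rnorm0.
  have [|s [l [si sl]]] := IH _ y1; first by move=> i ni; apply: kG; exact: ltnW.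
  have [|t [l' [ti tl]]] := kG n (ltnSn n) (fun m => y (s m) n); first by move=> m; exact: y1.
  exists (s \o t), (l + l'); split; first exact: incr_comp.
  have := cvD (cv_sub ti sl) tl; congr cv; apply/funext => m /=.
  by rewrite /hsum big_ord_recr.
move=> u uH.
have /choice[y yP] m : exists y, (forall i, rnorm (y i) <= 1) /\ u m = hsum G n y.
  by have [y y1 e] := uH m; exists y.
have [s [l [si sl]]] := key y (fun m => (yP m).1).
by exists s, l; split=> //; move: sl; congr cv; apply/funext => m /=; rewrite (yP _).2.
Qed.

End Heads.

Section Chains.
Context {R : realType} {k : scalar_kind}.
Notation K := (kfield R k).
Notation dual E := (bop E (K^o : normedModType K)).
Variables (p : \bar R) (p_gt1 : (1 < p)%E) (E : normedModType K).
Notation N := (norm2 p).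
Let p1 : (1 <= p)%E := ltW p_gt1.
Hypothesis mpE : mp_limit p E.
Hypothesis wcE : wcauchy_property E.
Variable S : nat -> bop E E.
Hypothesis kS : forall n, kop (S n).
Hypothesis S1 : forall n x, rnorm (S n x) <= rnorm x.
Hypothesis Scv : forall x, cv (fun n => S n x) x.
Notation late := (late S).

(* [far e l m]: operators late after [m] act e-independently of the list [l]. *)
Definition far (e : R) (l : seq (bop E E)) (m : nat) :=
  [/\ forall u w, heads (nth 0 l) (size l) u -> rnorm w <= 2 ->
        (exists Q Q' x (t : K), [/\ late m Q, late m Q', rnorm x <= 1, rnorm t <= 1 &
           w = t *: (Q' x - Q x) \/ w = t *: (x - Q x)]) ->
        `|rnorm (u + w) - N (rnorm u) (rnorm w)| <= e,
      forall i Q x, (i < size l)%N -> late m Q ->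
        rnorm (nth 0 l i x - Q (nth 0 l i x)) <= e * rnorm x &
      (size l <= m)%N].

(** [uniform_mp] on the compact set of heads provides [m0], and [late_tail] for [S m0] says how late
    [Q] and [Q'] must be for [S m0] to be small on [w]. *)
Lemma far_ex (e : R) l : 0 < e -> (forall i, (i < size l)%N -> kop (nth 0 l i)) ->
  exists m, far e l m.
Proof.
move=> e0 kl.
have [m0 H0] := @uniform_mp _ _ _ p_gt1 _ mpE wcE _ S1 Scv _ 2 _ (seqc_heads kl) e0.
have [iv ivE] : exists iv : R, iv = m0.+1%:R^-1 by exists m0.+1%:R^-1.
have d0 : 0 < iv / 2 by rewrite ivE divr_gt0.
have [m1 H1] := @late_tail _ _ _ p_gt1 _ mpE wcE _ S1 Scv _ _ _ (kS m0) d0.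
have /choice[m2 H2] i : exists m, (i < size l)%N -> forall Q, late m Q ->
    forall x, rnorm (nth 0 l i x - Q (nth 0 l i x)) <= e * rnorm x.
  have [il|_] := boolP (i < size l)%N; last by exists 0%N.
  have [m H] := @late_head _ _ _ _ S1 Scv _ _ _ (kl i il) e0.
  by exists m.
pose m := (maxn m1 (\max_(i < size l) m2 i) + size l)%N; exists m.
have m1m : (m1 <= m)%N by exact: leq_trans (leq_maxl _ _) (leq_addr _ _).
split=> [u w uH w2 [Q [Q' [x [t [lQ lQ' x1 t1 wE]]]]]|i Q x il lQ|]; last exact: leq_addl.
  apply: H0 => //; rewrite -ivE.
  have h1 := H1 _ (late_mono m1m lQ) x; have h2 := H1 _ (late_mono m1m lQ') x.
  have h3 : iv / 2 * rnorm x <= iv / 2.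
    by rewrite -[leRHS]mulr1 ler_wpM2l// ltW.
  have tle y : rnorm y <= iv -> rnorm (t *: y) <= iv.
    by move=> yb; rewrite rnormZ -[leRHS]mul1r; apply: ler_pM; rewrite ?rnorm_ge0.
  case: wE => ->; rewrite bopZ; apply: tle; last by lra.
  rewrite (_ : Q' x - Q x = (x - Q x) - (x - Q' x)).
    by rewrite bopB; have := rnormB (S m0 (x - Q x)) (S m0 (x - Q' x)); lra.
  by rewrite subrBB subrr sub0r opprB.
apply: (H2 i il) => //; apply: late_mono lQ.
have := @leq_bigmax _ (fun i : 'I_(size l) => m2 i) (Ordinal il) => /= h.
exact: leq_trans h (leq_trans (leq_maxr _ _) (leq_addr _ _)).
Qed.

(** A fast sequence of cuts: each prefix has a threshold that is met by all the later terms, since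
    what is added to a head is the difference of two of them or the whole remainder after one. *)
Definition chain (eta : nat -> R) (G : nat -> bop E E) :=
  forall i, exists m, far (eta i) (mkseq G i) m /\ forall n, (i <= n)%N -> late m (G n).

(** [X] is an extra requirement that can be met by arbitrarily late operators; it will carry the gap
    bounds. *)
Lemma chain_build (eta : nat -> R) (X : seq (bop E E) -> bop E E -> Prop) :
  (forall i, 0 < eta i) -> (forall l m, exists2 Q, late m Q & X l Q) ->
  exists2 G, chain eta G & forall n, X (mkseq G n) (G n).
Proof.
move=> eta0 Xex.
have /choice[mu muP] l : exists m, (forall i, (i < size l)%N -> kop (nth 0 l i)) ->
    far (eta (size l)) l m.
  have [kl|nkl] := pselect (forall i, (i < size l)%N -> kop (nth 0 l i)); last by exists 0%N.
  by have [m H] := far_ex (eta0 (size l)) kl; exists m.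
(* The next cut respects the thresholds of all the prefixes, hence the maximum over them. *)
pose nu l := \max_(i < (size l).+1) mu (take i l).
have [l|G GP] := @prefix_choice _ (fun l Q => late (nu l) Q /\ X l Q).
  by have [Q ? ?] := Xex l (nu l); exists Q.
have kG n : kop (G n) by have [[]] := GP n.
exists G => [i|n]; last by case: (GP n).
exists (mu (mkseq G i)); split=> [|n ni].
  rewrite -{1}(size_mkseq G i); apply: muP => j; rewrite size_mkseq => ji.
  by rewrite nth_mkseq.
apply: late_mono (GP n).1; rewrite /nu size_mkseq.
have ni' : (i < n.+1)%N by [].
have := @leq_bigmax _ (fun j : 'I_n.+1 => mu (take j (mkseq G n))) (Ordinal ni') => /=.
suff -> : take i (mkseq G n) = mkseq G i by [].
by rewrite /mkseq -map_take take_iota (minn_idPl ni).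
Qed.

Section ChainFacts.
Variables (eta : nat -> R) (G : nat -> bop E E).
Hypothesis cG : chain eta G.

Lemma chain_kop n : kop (G n).
Proof. by have [m [_ /(_ n (leqnn n))[]]] := cG n. Qed.

Lemma chain_contr n x : rnorm (G n x) <= rnorm x.
Proof. by have [m [_ /(_ n (leqnn n))[_ + _ _]]] := cG n. Qed.

Lemma chain_heads n : heads (nth 0 (mkseq G n)) (size (mkseq G n)) = heads G n.
Proof. by rewrite size_mkseq; apply: heads_eq => i ni; rewrite nth_mkseq. Qed.

Lemma chain_gap n u c d x (t : K) : heads G n u -> (n <= c)%N -> (n <= d)%N ->
  rnorm x <= 1 -> rnorm t <= 1 ->
  `|rnorm (u + t *: (G d x - G c x)) - N (rnorm u) (rnorm (t *: (G d x - G c x)))| <= eta n.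
Proof.
move=> uH nc nd x1 t1; have [m [[H _ _] lG]] := cG n.
apply: H; first by rewrite chain_heads.
  rewrite rnormZ; apply: (@le_trans _ _ (1 * rnorm (G d x - G c x))).
    by rewrite ler_wpM2r ?rnorm_ge0.
  rewrite mul1r; have := rnormB (G d x) (G c x).
  by have := chain_contr d x; have := chain_contr c x; lra.
by exists (G c), (G d), x, t; split=> //; [exact: lG|exact: lG|left].
Qed.

Lemma chain_gap_id n u c x : heads G n u -> (n <= c)%N -> rnorm x <= 1 ->
  `|rnorm (u + (x - G c x)) - N (rnorm u) (rnorm (x - G c x))| <= eta n.
Proof.
move=> uH nc x1; have [m [[H _ _] lG]] := cG n.
apply: H; first by rewrite chain_heads.
  by have := rnormB x (G c x); have := chain_contr c x; lra.
exists (G c), (G c), x, 1; split; rewrite ?rnorm1//; [exact: lG|exact: lG|].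
by right; rewrite scale1r.
Qed.

Lemma chain_absorb i n c x : (i < n)%N -> (n <= c)%N ->
  rnorm (G i x - G c (G i x)) <= eta n * rnorm x.
Proof.
move=> ni nc; have [m [[_ H _] lG]] := cG n.
have := H i (G c) x; rewrite size_mkseq nth_mkseq//; apply => //.
exact: lG.
Qed.

(** Comes from the clause [size l <= m] of [far]; through it the chain converges strongly to the
    identity. *)
Lemma chain_late n : late n (G n).
Proof.
have [m [[_ _]]] := cG n; rewrite size_mkseq => nm /(_ n (leqnn n)).
exact: late_mono.
Qed.

Lemma chain_cv x : cv (fun n => G n x) x.
Proof.
move=> e e0; have e4 : 0 < e / 4 by rewrite divr_gt0.
have [j Hj] := Scv x e4; have /(_ j (leqnn j)) {}Hj := Hj.
have X1 : 0 < rnorm x + 1 by rewrite ltr_wpDl ?rnorm_ge0.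
have [|n0 Hn] := @inv_lt R (e / 4 / (rnorm x + 1)); first by rewrite !divr_gt0.
exists (maxn j n0) => n; rewrite geq_max => /andP[jn n0n].
have [_ c1 _ /(_ j x jn) h0] := chain_late n.
have h1 := Hn n n0n.
have h2 : n.+1%:R^-1 * rnorm x <= e / 4.
  apply: (@le_trans _ _ (n.+1%:R^-1 * (rnorm x + 1))).
    by rewrite ler_wpM2l// lerDl.
  by rewrite -ler_pdivlMr// ltW.
have {h0 h2} := le_trans h0 h2.
have := c1 (S j x - x); rewrite bopB.
have := rnorm_triangle (G n x) (G n (S j x)) x.
have := rnorm_triangle (G n (S j x)) (S j x) x.
have := rnormBC (G n x) (G n (S j x)); have := rnormBC (G n (S j x)) (S j x); lra.
Qed.

(** Each layer has norm at most 2 and is added to a head, so the norms of the partial sums obey the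
    recursion of [norm2_sublinear], whose conclusion for the pair [A], [c] is the first hypothesis.
    A sum of [n] layers thus has norm far below [n], whatever the phases [t]. *)
Lemma chain_blocks A c x (t : nat -> K) n :
  (forall a e, 0 <= e -> a 0%N = 0 -> (forall n, 0 <= a n) ->
    (forall n, a n.+1 <= N (a n) 2 + e) -> forall n, a n <= A + n%:R * (c + e)) ->
  forall e, 0 <= e -> (forall i, eta i <= e) -> rnorm x <= 1 -> (forall i, rnorm (t i) <= 1) ->
  rnorm (\sum_(i < n) t i *: (G i.*2.+1 x - G i.*2 x)) <= A + n%:R * (c + e).
Proof.
move=> Asub e e0 etae x1 t1; pose a n := rnorm (\sum_(i < n) t i *: (G i.*2.+1 x - G i.*2 x)).
have H m : heads G m.*2 (\sum_(i < m) t i *: (G i.*2.+1 x - G i.*2 x)).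
  elim: m => [|m IH]; first by rewrite big_ord0; exact: heads0.
  rewrite big_ord_recr /= doubleS; apply: (heads_ext IH) => //.
  by rewrite leqnn ltnSn.
apply: (Asub a) => // [|m|m]; first by rewrite /a big_ord0 rnorm0.
  exact: rnorm_ge0.
rewrite /a big_ord_recr /=.
have := chain_gap (H m) (leqnn _) (leqnSn _) x1 (t1 m); rewrite ler_distl => /andP[_ h].
apply: le_trans h _; apply: lerD; last exact: etae.
apply: norm2_mono; rewrite ?rnorm_ge0// rnormZ.
apply: (@le_trans _ _ (1 * rnorm (G m.*2.+1 x - G m.*2 x))).
  by rewrite ler_wpM2r ?rnorm_ge0.
rewrite mul1r; have := rnormB (G m.*2.+1 x) (G m.*2 x).
by have := chain_contr m.*2.+1 x; have := chain_contr m.*2 x; lra.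
Qed.

End ChainFacts.

(* [x - Q' x + Q x] keeps the head and the tail of [x] and drops what lies between. *)
Definition gap_bound (B : R) (Q : bop E E) := forall m',
  exists2 Q', late m' Q' & forall x, rnorm (x - Q' x + Q x) <= B * rnorm x.

Definition gap_property (B : R) := forall m, exists2 Q, late m Q & gap_bound B Q.

Lemma gap_property_mono B B' : B <= B' -> gap_property B -> gap_property B'.
Proof.
move=> BB gB m; have [Q lQ bQ] := gB m; exists Q => // m'.
have [Q' lQ' QQ'] := bQ m'; exists Q' => // x.
by rewrite (le_trans (QQ' x))// ler_wpM2r ?rnorm_ge0.
Qed.

Lemma late_ex m : exists Q, late m Q.
Proof.
have [n Hn] := @late_S _ _ _ p_gt1 _ mpE wcE _ kS S1 Scv m.
by exists (S n); exact: Hn.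
Qed.

Lemma gap_property3 : gap_property 3.
Proof.
move=> m; have [Q lQ] := late_ex m; exists Q => // m'.
have [Q' lQ'] := late_ex m'; exists Q' => // x.
have := rnormD (x - Q' x) (Q x); have := rnormB x (Q' x).
by have [_ /(_ x) + _ _] := lQ; have [_ /(_ x) + _ _] := lQ'; lra.
Qed.

(* The improved cuts are the averages of the [Q_i] and of the [Q'_i] over nested
   pairs [Q_0 << Q_1 << ... << Q'_1 << Q'_0], each with constant [B]. Let [f] norm
   the average of the [D_i = x - Q'_i x + Q_i x] and let [R_i] be the part of [x]
   strictly between [Q_i] and [Q'_i], up to two thin layers [b_j]. If
   [|f R_i| < tau], then [|f D_i|] is at most [1 + tau], up to the layers; otherwise
   [|f D_i| + s |f R_i| <= N B (2 s)], which is [B] to first order. By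
   [norm2_sublinear] the layers contribute little on average. *)
Lemma gap_property_step (eta : R) : 0 < eta ->
  exists2 c, 0 < c & forall B, 1 + eta <= B <= 3 -> gap_property B -> gap_property (B - c).
Proof.
move=> eta0; pose tau := eta / 2; have tau0 : 0 < tau by rewrite divr_gt0.
have k10 : 0 < tau / 8 by rewrite divr_gt0.
have [s0 /andP[s00 s01] flat] := norm2_flat p_gt1 k10.
pose s := s0 / 2; have sp : 0 < s by rewrite divr_gt0.
have s2 : 2 * s = s0 by rewrite /s mulrC divfK.
have st0 : 0 < s * tau by rewrite mulr_gt0.
pose e := s * tau / 128; have e0 : 0 < e by rewrite divr_gt0.
have [A A0 Asub] := norm2_sublinear p_gt1 e0.
have A1 : 0 < A + 1 by rewrite ltr_wpDl.
(* The number [M] of nested pairs makes the fixed cost [A] of the layers small on average. *)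
have [|M' HM] := @inv_lt R (s * tau / 16 / (A + 1)); first by rewrite !divr_gt0.
pose M := M'.+1; have MR : 0 < M%:R :> R by rewrite ltr0n.
have AM : A <= s * tau / 16 * M%:R.
  have := HM M' (leqnn M'); rewrite -/M ltr_pdivlMr// mulrC ltr_pdivrMr// => /ltW.
  by apply: le_trans; rewrite lerDl.
exists (s * tau / 2); first by rewrite divr_gt0.
move=> B /andP[B1 B3] gB; apply: contrapT => /existsNP[m /forall2NP Hm].
(* The argument is by contradiction: for [Q] late after [m], [phi Q] is a degree of lateness at
   which every outer cut violates the improved bound. *)
have /choice[phi phiP] Q : exists m', late m Q -> forall Q', late m' Q' ->
    ~ forall x, rnorm (x - Q' x + Q x) <= (B - s * tau / 2) * rnorm x.
  have [nlQ|/existsNP[m' /forall2NP H]] := Hm Q; first by exists 0%N.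
  by exists m' => _ Q' lQ'; have [|] := H Q'.
pose M2 := (M + M)%N; pose M4 := (M2 + M2)%N.
pose mean (l : seq (bop E E)) := kofR M%:R^-1 *: \sum_(i < M) nth 0 l i.*2.
(* Inner cuts come first; the term at position [n >= M2] is an outer cut for the term at the mirror
   position [M4 - n.+1]. The averaged inner cut involves only positions below [M2], so the lateness
   that [phi] prescribes for it is known before any outer cut is chosen. *)
have [l m1|G cG XG] := @chain_build (fun=> e) (fun l Q => if (size l < M2)%N
   then late m Q /\ gap_bound B Q else late (phi (mean l)) Q /\
     (gap_bound B (nth 0 l (M4 - (size l).+1)) -> forall x,
       rnorm (x - Q x + nth 0 l (M4 - (size l).+1) x) <= B * rnorm x)) (fun=> e0).
  case: (size l < M2)%N.
    have [Q lQ bQ] := gB (maxn m m1); exists Q.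
      exact: late_mono (leq_maxr _ _) lQ.
    by split=> //; exact: late_mono (leq_maxl _ _) lQ.
  have [bQ|nbQ] := pselect (gap_bound B (nth 0 l (M4 - (size l).+1))).
    have [Q' lQ' Hx] := bQ (maxn m1 (phi (mean l))).
    exists Q'; first exact: late_mono (leq_maxl _ _) lQ'.
    by split=> //; exact: late_mono (leq_maxr _ _) lQ'.
  have [Q' lQ'] := late_ex (maxn m1 (phi (mean l))).
  exists Q'; first exact: late_mono (leq_maxl _ _) lQ'.
  by split=> //; exact: late_mono (leq_maxr _ _) lQ'.
pose Q := kofR M%:R^-1 *: \sum_(i < M) G i.*2.
pose J i := (M4 - i.*2.+1)%N.
pose Q' := kofR M%:R^-1 *: \sum_(i < M) G (J i).
have lt2 i : (i < M)%N -> (i.*2 < M2)%N by exact: nested_half.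
have JM2 i : (i < M)%N -> (M2 <= J i)%N by exact: nested_ge.
have jJ i : (i < M)%N -> (i.*2.+1 < J i)%N by exact: nested_gt.
have JJ i : (i < M)%N -> (M4 - (J i).+1)%N = i.*2 by exact: nested_sym.
have early i : (i < M)%N -> late m (G i.*2) /\ gap_bound B (G i.*2).
  by move=> /lt2 iM; have := XG i.*2; rewrite size_mkseq iM.
have meanE n : (M2 <= n)%N -> mean (mkseq G n) = Q.
  move=> Mn; congr (_ *: _); apply: eq_bigr => i _; rewrite nth_mkseq//.
  exact: leq_trans (lt2 i (ltn_ord i)) Mn.
have lateJ i : (i < M)%N -> late (phi Q) (G (J i)) /\
    forall x, rnorm (x - G (J i) x + G i.*2 x) <= B * rnorm x.
  move=> iM; have := XG (J i); rewrite size_mkseq ltnNge (JM2 i iM)/= meanE ?JM2//.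
  rewrite JJ// nth_mkseq; last exact: ltn_trans (jJ i iM).
  by move=> [lJ H]; split=> //; apply: H; case: (early i iM).
have lQ : late m Q by apply: (late_mean (Q := fun i => G i.*2)) => // i iM; case: (early i iM).
have lQ' : late (phi Q) Q' by apply: (late_mean (Q := G \o J)) => // i iM; case: (lateJ i iM).
apply: (phiP Q lQ Q' lQ') => x.
suff H z : rnorm z <= 1 -> rnorm ((bid E - Q' + Q) z) <= B - s * tau / 2.
  by have := opnorm_unit H x; rewrite bop_addE bop_subE bidE.
move=> {x} => z1; move: z z1 => x x1.
rewrite bop_addE bop_subE bidE.
pose D i := x - G (J i) x + G i.*2 x.
have DE : x - Q' x + Q x = kofR M%:R^-1 *: \sum_(i < M) D i.
  rewrite /Q' /Q !bop_scaleE !bop_sumE big_split sumrB /= scalerDr scalerBr.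
  congr (_ - _ + _); rewrite sumr_const card_ord -(scaler_nat M x) scalerA.
  rewrite (_ : kofR _ * _ = 1) ?scale1r//.
  by rewrite -(kofR_nat M) -kofRM mulVf ?kofR1// gt_eqF.
have [f [_ f1 fE]] := norming (x - Q' x + Q x).
have fkE : rnorm (x - Q' x + Q x) = rnorm (f (x - Q' x + Q x)).
  by rewrite fE rnorm_kofR ger0_norm ?rnorm_ge0.
rewrite fkE DE bopZ rnormZ rnorm_kofR ger0_norm ?invr_ge0 ?(ltW MR)//.
rewrite ler_pdivrMl// (lin_sum (bop_linear f)) (le_trans (rnorm_sum _ _ _))//.
pose b n := G n.*2.+1 x - G n.*2 x.
have fb : \sum_(n < M2) rnorm (f (b n)) <= A + M2%:R * (e + e).
  have /choice[t tP] n : exists t : K, rnorm t = 1 /\ t *: f (b n) = kofR (rnorm (f (b n))).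
    by have [t] := phase (f (b n)); exists t.
  have t1 n : rnorm (t n) <= 1 by rewrite (tP n).1.
  have := @chain_blocks (fun=> e) G cG A e x t M2 Asub e (ltW e0) (fun=> lexx e) x1 t1.
  apply: le_trans; apply: le_trans (f1 _); rewrite (lin_sum (bop_linear f)).
  rewrite (eq_bigr (fun n : 'I_M2 => kofR (rnorm (f (b n))))) => [|n _]; last first.
    by rewrite bopZ (tP n).2.
  rewrite -(big_morph kofR kofRD kofR0) rnorm_kofR ger0_norm//.
  by apply: sumr_ge0 => n _; exact: rnorm_ge0.
have fb1 : \sum_(i < M) rnorm (f (b i)) <= \sum_(n < M2) rnorm (f (b n)).
  by rewrite /M2 big_split_ord /= lerDl sumr_ge0// => i _; exact: rnorm_ge0.
have fb2 : \sum_(i < M) rnorm (f (b (M2 - i.+1)%N)) <= \sum_(n < M2) rnorm (f (b n)).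
  rewrite [leRHS](reindex_inj rev_ord_inj) /= {2}/M2 big_split_ord /= lerDl.
  by apply: sumr_ge0 => i _; exact: rnorm_ge0.
have key i : (i < M)%N -> rnorm (f (D i)) <=
    B - 3 * (s * tau / 4) + 3 * e + (rnorm (f (b i)) + rnorm (f (b (M2 - i.+1)%N))).
  move=> iM; pose Ri := G (J i).-1 x - G i.*2.+1 x.
  have Jb : b (M2 - i.+1)%N = G (J i) x - G (J i).-1 x.
    by rewrite /b (nested_odd iM) (nested_even iM).
  have xDR : x = D i + Ri + b i + b (M2 - i.+1)%N.
    rewrite Jb /D /Ri /b; move: (G (J i) x) (G (J i).-1 x) (G i.*2.+1 x) (G i.*2 x).
    move=> g1 g2 g3 g4.
    rewrite -[_ + (g3 - g4)]addrA subrKA -[_ + (g1 - g2)]addrA [(g2 - g4) + _]addrC.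
    by rewrite subrKA -addrA subrKC subrK.
  have fx : rnorm (f (D i)) <= 1 + (rnorm (f Ri) + (rnorm (f (b i)) + rnorm (f (b (M2 - i.+1)%N)))).
    have -> : f (D i) = f x - (f Ri + (f (b i) + f (b (M2 - i.+1)%N))).
      have xE : x = D i + (Ri + (b i + b (M2 - i.+1)%N)).
        by rewrite (addrA Ri) (addrA (D i)) (addrA (D i) Ri).
      by rewrite -!bopD -bopB [X in _ = f (X - _)]xE addrK.
    apply: le_trans (rnormB _ _) _; apply: lerD; first exact: le_trans (f1 x) x1.
    by rewrite (le_trans (rnormD _ _))// lerD2l rnormD.
  have [t t1 tE] := phase2 (f (D i)) (kofR s *: f Ri).
  have fs : rnorm (f (D i)) + s * rnorm (f Ri) <= N B (2 * s) + 3 * e.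
    rewrite -[s in s * _]ger0_norm ?(ltW sp)// -(rnorm_kofR (k := k)) -rnormZ -tE.
    rewrite -!bopZ -bopD; apply: le_trans (f1 _) _.
    pose u1 := G i.*2 x; pose w1 := (t * kofR s) *: Ri; pose w2 := x - G (J i) x.
    have ts1 : rnorm (t * kofR s) <= 1.
      rewrite /rnorm normrM -(rnormE t) t1 kofR1 mul1r -/(rnorm (kofR s : K)) rnorm_kofR.
      by rewrite gtr0_norm// /s; lra.
    have tsE : rnorm (t * kofR s) = s.
      rewrite /rnorm normrM -(rnormE t) t1 kofR1 mul1r -/(rnorm (kofR s : K)) rnorm_kofR.
      by rewrite gtr0_norm.
    (* The norm of [u1 + w1 + w2] is nearly [N (N u1 w1) w2], with norms understood, and this equals
       [N (N u1 w2) w1]: the middle piece is taken from its place between head and tail and set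
       beside their sum [D i]. Each of the three comparisons costs [e]. *)
    have -> : D i + t *: (kofR s *: Ri) = u1 + w1 + w2.
      by rewrite scalerA -/w1 [RHS]addrC addrA.
    have Hu1 : heads G i.*2.+1 u1 by exact: heads_single.
    have jJ1 : (i.*2.+1 <= (J i).-1)%N by exact: nested_pred.
    have Hu2 : heads G (J i) (u1 + w1).
      rewrite -(prednK (ltn_trans (ltn0Sn _) (jJ i iM))).
      apply: heads_ext Hu1 _ x1 ts1; rewrite leqnn /=; exact: nested_pred_gt.
    have g1 := chain_gap cG Hu1 (leqnn _) jJ1 x1 ts1.
    have g2 := chain_gap_id cG Hu1 (ltnW (jJ i iM)) x1.
    have g3 := chain_gap_id cG Hu2 (leqnn _) x1.
    have D1 : rnorm (u1 + w2) <= B.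
      rewrite addrC; apply: le_trans ((lateJ i iM).2 x) _.
      by rewrite -[leRHS]mulr1 ler_wpM2l//; lra.
    have w1s : rnorm w1 <= 2 * s.
      rewrite rnormZ tsE mulrC ler_wpM2r ?(ltW sp)//.
      have := rnormB (G (J i).-1 x) (G i.*2.+1 x).
      by have := chain_contr cG (J i).-1 x; have := chain_contr cG i.*2.+1 x; lra.
    have l1 := norm2_lip p_gt1 (rnorm (u1 + w1)) (rnorm w2) (N (rnorm u1) (rnorm w1)) (rnorm w2).
    have l2 := norm2_lip p_gt1 (N (rnorm u1) (rnorm w2)) (rnorm w1) (rnorm (u1 + w2)) (rnorm w1).
    have l3 : N (N (rnorm u1) (rnorm w1)) (rnorm w2) = N (N (rnorm u1) (rnorm w2)) (rnorm w1).
      by rewrite !norm2A// (norm2C _ (rnorm w1)).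
    have l4 := norm2_mono p_gt1 (rnorm_ge0 (u1 + w2)) (rnorm_ge0 w1) D1 w1s.
    move: g3 l1 l2 g1 g2; rewrite !subrr !normr0 !addr0.
    rewrite [in X in _ -> _ -> _ -> _ -> X -> _]distrC => g3 l1 l2 g1 g2.
    have g3' := le_trans (ler_norm _) g3.
    lra.
  have NB : N B (2 * s) <= B + s * tau / 4.
    have B0 : 0 < B by lra.
    have Bn0 : B != 0 by rewrite gt_eqF.
    have -> : N B (2 * s) = B * N 1 (2 * s / B).
      by rewrite -(norm2_scale _ _ _ (ltW B0))// mulr1; congr (N B _); field.
    have -> : B + s * tau / 4 = B * (1 + tau / 8 * (2 * s / B)) by field.
    rewrite ler_wpM2l ?(ltW B0)// flat// divr_ge0 ?(ltW B0) ?s2 ?(ltW s00)//=.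
    by rewrite ler_pdivrMr// ler_peMr ?(ltW s00)//; lra.
  have stau : s * tau <= tau by rewrite ler_piMl ?(ltW tau0)// /s; lra.
  have n1 := rnorm_ge0 (f (b i)); have n2 := rnorm_ge0 (f (b (M2 - i.+1)%N)).
  have e2 : eta = 2 * tau by rewrite /tau; lra.
  (* Either [f] sees at least [tau] of the middle and loses [s * tau] on [D i], or [f (D i)] is at
     most [1 + tau] up to layers, which is at most [B - tau] because [B >= 1 + 2 * tau]. *)
  have [taule|taugt] := leP tau (rnorm (f Ri)).
    have := ler_wpM2l (ltW sp) taule; lra.
  lra.
apply: (@le_trans _ _ (\sum_(i < M) (B - 3 * (s * tau / 4) + 3 * e +
    (rnorm (f (b i)) + rnorm (f (b (M2 - i.+1)%N)))))).
  by apply: ler_sum => i _; exact: key.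
rewrite big_split /= sumr_const card_ord -mulr_natl big_split /=.
have M2R : M2%:R = 2 * M%:R :> R by rewrite /M2 natrD mulr_natl mulr2n.
move: fb fb1 fb2; rewrite M2R; set S1' := \sum_(i < M) _; set S2' := \sum_(i < M) _.
set S3' := \sum_(n < M2) _ => fb fb1 fb2.
have sM : 0 < s * tau * M%:R by rewrite mulr_gt0.
(* In units of [s * tau * M], the gain [3 / 4 - 3 / 128] minus the cost [2 * (1 / 16 + 1 / 32)] of
   the two families of layers is still above [1 / 2]. *)
have : M%:R * (B - 3 * (s * tau / 4) + 3 * e) = M%:R * B - (3 / 4 - 3 / 128) * (s * tau * M%:R).
  by rewrite /e; field.
have : M%:R * (B - s * tau / 2) = M%:R * B - (1 / 2) * (s * tau * M%:R) by field.
have : 2 * M%:R * (e + e) = (1 / 32) * (s * tau * M%:R) by rewrite /e; field.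
have : s * tau / 16 * M%:R = (1 / 16) * (s * tau * M%:R) by field.
lra.
Qed.

(** The decrement [c] is the same for every constant between [1 + eta] and 3, so finitely many
    improvements lead from 3 to [1 + eta]. *)
Lemma gap_property1 (eta : R) : 0 < eta -> gap_property (1 + eta).
Proof.
move=> eta0; have [c c0 step] := gap_property_step eta0.
have H n : gap_property (1 + eta) \/ gap_property (3 - n%:R * c).
  elim: n => [|n [|IH]]; [by right; rewrite mul0r subr0; exact: gap_property3|by left|].
  have [le|gt] := leP (3 - n%:R * c) (1 + eta); first by left; exact: gap_property_mono IH.
  have e1 : n.+1%:R = n%:R + 1 :> R by rewrite natr1.
  right; rewrite e1 mulrDl mul1r opprD addrA; apply: step => //.
  by rewrite ltW//= lerBlDr lerDl mulr_ge0// ltW.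
have [n Hn] := inv_lt (divr_gt0 c0 (ltr0n R 3)).
have h := Hn n (leqnn n).
have h2 : 3 < n.+1%:R * c.
  by move: h; rewrite ltr_pdivlMr// mulrC ltr_pdivrMr// mulrC.
have [//|] := H n.+1; apply: gap_property_mono; lra.
Qed.

End Chains.

(** * The compact operators form an M-ideal *)

Section CompactIdeal.
Context {R : realType} {k : scalar_kind}.
Notation K := (kfield R k).
Notation dual E := (bop E (K^o : normedModType K)).
Variables (p : \bar R) (p_gt1 : (1 < p)%E) (E : normedModType K).
Notation N := (norm2 p).
Hypothesis mpE : mp_limit p E.
Hypothesis wcE : wcauchy_property E.
Hypothesis cE : seq_complete E.
Variable S : nat -> bop E E.
Hypothesis kS : forall n, kop (S n).
Hypothesis S1 : forall n x, rnorm (S n x) <= rnorm x.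
Hypothesis Scv : forall x, cv (fun n => S n x) x.
Notation late := (late S).
Notation L := (bop E E : normedModType K).

Lemma compact_op_submod : submod_closed (mem (compact_op : set L) : {pred L}).
Proof.
split=> [|a T T']; first by rewrite inE; apply/compact_opP; exact: kop0.
rewrite !inE => /compact_opP kT /compact_opP kT'; apply/compact_opP; exact: kop_lin.
Qed.

Lemma compact_op_closed : closed (compact_op : set L).
Proof.
move=> T /closure_rnorm clT; apply/compact_opP => u u1.
have /choice[A AP] n : exists A : L, kop A /\ rnorm (A - T) < n.+1%:R^-1.
  have n0 : 0 < n.+1%:R^-1 :> R by rewrite invr_gt0.
  by have [A /compact_opP kA AT] := clT _ n0; exists A.
have [||j s si|s si Hs] := @diagonal_subseq (fun j s => exists l, cv (A j \o u \o s) l).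
- by move=> j s t ti [l Hl]; exists l; exact: cv_sub ti Hl.
- by move=> j s n [l Hl]; exists l; exact: cv_tail Hl.
- have [t [l [ti Hl]]] := (AP j).1 (u \o s) (fun n => u1 (s n)).
  by exists t => //; exists l.
have [l Hl] : exists l, cv (T \o u \o s) l.
  apply: cE => e e0; have e3 : 0 < e / 3 by rewrite divr_gt0.
  have [j Hj] := inv_lt e3; have {Hj} := Hj j (leqnn j) => Hj.
  have [l /cv_cauchy/(_ _ e3)[n Hn]] := Hs j.
  exists n => a b na nb; have := Hn a b na nb.
  have bnd x : rnorm x <= 1 -> rnorm (A j x - T x) <= e / 3.
    move=> x1; rewrite -bop_subE; apply: le_trans (opnormP _ _) _.
    rewrite -[leRHS]mulr1; apply: ler_pM; rewrite ?opnorm_ge0 ?rnorm_ge0//.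
    by rewrite -bop_normE ltW// (lt_trans (AP j).2).
  have := bnd _ (u1 (s a)); have := bnd _ (u1 (s b)) => /=.
  move: (u (s a)) (u (s b)) => x y.
  have := rnorm_triangle (T x) (A j x) (T y); have := rnorm_triangle (A j x) (A j y) (T y).
  have := rnormBC (T x) (A j x); lra.
by exists s, l.
Qed.

(** The norm of [Q x + (x - Q' x)] is bounded by the gap property, and it is nearly [N] of the two
    norms because [Q'] is chosen far from [Q]. *)
Lemma gap_operators : exists Q Q' : nat -> bop E E,
  [/\ forall n, late n (Q n), forall n, late n (Q' n) &
      forall n x, rnorm x <= 1 ->
        N (rnorm (Q n x)) (rnorm (x - Q' n x)) <= 1 + 2 * n.+1%:R^-1].
Proof.
have /choice[QQ' H] n : exists QQ' : bop E E * bop E E, [/\ late n QQ'.1, late n QQ'.2 &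
      forall x, rnorm x <= 1 ->
        N (rnorm (QQ'.1 x)) (rnorm (x - QQ'.2 x)) <= 1 + 2 * n.+1%:R^-1].
  have n0 : 0 < n.+1%:R^-1 :> R by rewrite invr_gt0.
  have [Q lQ bQ] := gap_property1 p_gt1 mpE wcE kS S1 Scv n0 n.
  have [i|m [Hm _ _]] := @far_ex _ _ _ p_gt1 _ mpE wcE _ kS S1 Scv _ [:: Q] n0.
    by case: i => // _; case: lQ.
  have [Q' lQ' QQ'] := bQ (maxn n m).
  exists (Q, Q'); split=> //=; first exact: late_mono (leq_maxl _ _) lQ'.
  move=> x x1.
  have : `|rnorm (Q x + (x - Q' x)) - N (rnorm (Q x)) (rnorm (x - Q' x))| <= n.+1%:R^-1.
    apply: Hm; first exact: (@heads_single _ _ _ (nth 0 [:: Q]) 1 0).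
      have [_ /(_ x) c1 _ _] := lQ'; have := rnormB x (Q' x); lra.
    have lm := late_mono (leq_maxr n m) lQ'.
    by exists Q', Q', x, 1; split; rewrite ?rnorm1//; right; rewrite scale1r.
  rewrite [Q x + _]addrC; have := ler_wpM2l (addr_ge0 ler01 (ltW n0)) x1; have := QQ' x.
  move: n0; move: (n.+1%:R^-1) => iv iv0 h1 h2; rewrite ler_distlC => /andP[h3 h4].
  by lra.
by exists (fun n => (QQ' n).1), (fun n => (QQ' n).2); split=> n; case: (H n).
Qed.

Lemma opnorm_bcomp (A B : L) : opnorm (bcomp A B) <= opnorm A * opnorm B.
Proof.
apply: opnorm_le => [|x]; first by rewrite mulr_ge0 ?opnorm_ge0.
rewrite bcompE (le_trans (opnormP _ _))// -mulrA ler_wpM2l ?opnorm_ge0//.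
exact: opnormP.
Qed.

(** The complement [V] consists of the functionals determined in the limit by the compact operators
    [bcomp T (Q' n)]. By [VP] and [VA] these are the functionals normed by compact contractions; a
    norm-preserving extension of [f] from the compact operators is one of them, and it is the
    [V]-part of [f]. *)
Lemma compact_M_ideal : M_ideal (compact_op : set L).
Proof.
have [Q [Q' [lQ lQ' NQ]]] := gap_operators.
split; [exact: compact_op_submod|exact: compact_op_closed|].
have Q1 n : opnorm (Q n) <= 1.
  by apply: opnorm_le => // x; rewrite mul1r; case: (lQ n).
have kQ n : kop (Q n) by case: (lQ n).
have kQ' n : kop (Q' n) by case: (lQ' n).
have tailQ (A : L) e : kop A -> 0 < e -> exists n0, forall n, (n0 <= n)%N ->
    opnorm (A - bcomp A (Q n)) <= e.
  move=> kA e0; have [m Hm] := @late_tail _ _ _ p_gt1 _ mpE wcE _ S1 Scv _ _ _ kA e0.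
  exists m => n mn; apply: opnorm_le => [|x]; first exact: ltW.
  by rewrite bop_subE bcompE -bopB; apply: Hm; exact: late_mono (lQ n).
have tailQ' (A : L) e : kop A -> 0 < e -> exists n0, forall n, (n0 <= n)%N ->
    opnorm (A - bcomp A (Q' n)) <= e.
  move=> kA e0; have [m Hm] := @late_tail _ _ _ p_gt1 _ mpE wcE _ S1 Scv _ _ _ kA e0.
  exists m => n mn; apply: opnorm_le => [|x]; first exact: ltW.
  by rewrite bop_subE bcompE -bopB; apply: Hm; exact: late_mono (lQ' n).
(* The image of the ball under [A] is relatively compact, and [S m] is small on [t *: T (x - Q' x)],
   so [uniform_mp] applies. The resulting [N] is dominated by the one in [gap_operators], as [A] and
   [T] are contractions. *)
have mix (A T : L) e : kop A -> opnorm A <= 1 -> opnorm T <= 1 -> 0 < e ->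
    exists n0, forall n, (n0 <= n)%N -> forall t : K, rnorm t <= 1 ->
      opnorm (bcomp A (Q n) + t *: (T - bcomp T (Q' n))) <= 1 + e.
  move=> kA A1 T1 e0; have e2 : 0 < e / 2 by rewrite divr_gt0.
  have sA : seqc [set A y | y in [set y | rnorm y <= 1]].
    move=> u uA; have /choice[y yP] n : exists y, rnorm y <= 1 /\ A y = u n.
      by have [y ? ?] := uA n; exists y.
    have [s [l [si sl]]] := kA y (fun n => (yP n).1).
    by exists s, l; split=> //; move: sl; congr cv; apply/funext => n /=; rewrite (yP _).2.
  have [m Hm] := @uniform_mp _ _ _ p_gt1 _ mpE wcE _ S1 Scv _ 2 _ sA e2.
  have m0 : 0 < m.+1%:R^-1 :> R by rewrite invr_gt0.
  have kST := kop_comp_r T (kS m).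
  have [n1 H1] := @late_tail _ _ _ p_gt1 _ mpE wcE _ S1 Scv _ _ _ kST m0.
  have [n2 H2] := inv_lt (divr_gt0 e2 (ltr0n R 2)).
  exists (maxn n1 n2) => n; rewrite geq_max => /andP[n1n n2n] t t1.
  have e1 : 0 <= 1 + e by rewrite addr_ge0// ltW.
  apply: opnorm_le => // x; apply: opnorm_unit => {}x x1.
  rewrite bop_addE bop_scaleE bop_subE !bcompE -bopB.
  have [_ c1 _ _] := lQ n; have [_ c1' _ _] := lQ' n.
  have x2 : rnorm (x - Q' n x) <= 2 by have := rnormB x (Q' n x); have := c1' x; lra.
  have w1 : rnorm (t *: T (x - Q' n x)) <= rnorm (x - Q' n x).
    rewrite rnormZ -[leRHS]mul1r; apply: ler_pM; rewrite ?rnorm_ge0//.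
    by rewrite (le_trans (opnormP _ _))// ler_piMl ?rnorm_ge0.
  have h1 := Hm (A (Q n x)) (t *: T (x - Q' n x)).
  have {}h1 : `|rnorm (A (Q n x) + t *: T (x - Q' n x)) -
      N (rnorm (A (Q n x))) (rnorm (t *: T (x - Q' n x)))| <= e / 2.
    apply: h1; [|exact: le_trans w1 x2|].
      by exists (Q n x) => //=; rewrite (le_trans (c1 x)).
    rewrite bopZ rnormZ -[leRHS]mul1r; apply: ler_pM; rewrite ?rnorm_ge0//.
    have := H1 _ (late_mono n1n (lQ' n)) x; rewrite bcompE => /le_trans; apply.
    by rewrite -[leRHS]mulr1 ler_wpM2l// ltW.
  have h2 : N (rnorm (A (Q n x))) (rnorm (t *: T (x - Q' n x))) <=
      N (rnorm (Q n x)) (rnorm (x - Q' n x)).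
    apply: norm2_mono; rewrite ?rnorm_ge0//.
    by rewrite (le_trans (opnormP _ _))// ler_piMl ?rnorm_ge0.
  have h3 := NQ n x x1; have h4 := H2 n n2n.
  move: h1; rewrite ler_distl => /andP[_ h1].
  move: h3 h4; move: (n.+1%:R^-1) => iv h3 h4; lra.
pose V : set (dual L) := [set v | forall T, cv (fun n => v (bcomp T (Q' n))) (v T)].
have VP (v : dual L) : (forall e, 0 < e -> exists A : L, [/\ kop A, opnorm A <= 1 &
    opnorm v - e <= rnorm (v A)]) -> V v.
  move=> vA.
  have unitT (T : L) : opnorm T <= 1 -> cv (fun n => v (bcomp T (Q' n))) (v T).
    move=> T1 e e0.
    have e8 : 0 < e / 8 by rewrite divr_gt0.
    have v1 : 0 < opnorm v + 1 by rewrite ltr_wpDl ?opnorm_ge0.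
    have ev : 0 < e / 8 / (opnorm v + 1) by rewrite divr_gt0.
    have [A [kA A1 vAe]] := vA _ e8.
    have [n1 H1] := mix A T _ kA A1 T1 ev; have [n2 H2] := tailQ A _ kA ev.
    exists (maxn n1 n2) => n; rewrite geq_max => /andP[n1n n2n].
    (* With aligned phases, [v] is tested on the operator of [mix]: its value on [bcomp A (Q n)]
       already exhausts its norm, so hardly anything is left for [T - bcomp T (Q' n)]. *)
    have [t t1 tE] := phase2 (v (bcomp A (Q n))) (v (T - bcomp T (Q' n))).
    have h1 : rnorm (v (bcomp A (Q n))) + rnorm (v (T - bcomp T (Q' n))) <=
        opnorm v * (1 + e / 8 / (opnorm v + 1)).
      rewrite -tE -bopZ -bopD; apply: le_trans (opnormP _ _) _.
      rewrite ler_wpM2l ?opnorm_ge0// bop_normE; apply: H1 => //.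
      by rewrite t1.
    have h2 : rnorm (v (A - bcomp A (Q n))) <= opnorm v * (e / 8 / (opnorm v + 1)).
      apply: le_trans (opnormP _ _) _; rewrite ler_wpM2l ?opnorm_ge0// bop_normE.
      exact: H2.
    have h3 : opnorm v * (e / 8 / (opnorm v + 1)) <= e / 8.
      by rewrite mulrCA ler_piMr ?(ltW e8)// ler_pdivrMr// mul1r lerDl.
    rewrite mulrDr mulr1 in h1; rewrite bopB in h2.
    rewrite rnormBC -bopB; have := rnorm_sub_le (v A) (v (bcomp A (Q n))); lra.
  move=> T e e0.
  have T1 : 0 < opnorm T + 1 by rewrite ltr_wpDl ?opnorm_ge0.
  have eT : 0 < e / (opnorm T + 1) by rewrite divr_gt0.
  have [|n Hn] := unitT (kofR (opnorm T + 1)^-1 *: T) _ _ eT.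
    rewrite opnormZ rnorm_kofR ger0_norm ?invr_ge0 ?(ltW T1)//.
    by rewrite ler_pdivrMl// mulr1 lerDl.
  exists n => m nm; have := Hn m nm.
  rewrite (_ : bcomp _ _ = kofR (opnorm T + 1)^-1 *: bcomp T (Q' m)); last first.
    by apply: bop_ext => x; rewrite bop_scaleE !bcompE bop_scaleE.
  rewrite -!bopB -scalerBr bopZ rnormZ rnorm_kofR ger0_norm ?invr_ge0 ?(ltW T1)//.
  by rewrite mulrC ltr_pM2r ?invr_gt0.
have VA (v : dual L) e : V v -> 0 < e -> exists A : L, [/\ kop A, opnorm A <= 1 &
    opnorm v - e <= rnorm (v A)].
  move=> Vv e0; have e2 : 0 < e / 2 by rewrite divr_gt0.
  have [T T1 vT] := opnorm_approx v e2; rewrite bop_normE in T1.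
  have [n Hn] := Vv T _ e2; exists (bcomp T (Q' n)); split; first exact: kop_comp_l.
    rewrite (le_trans (opnorm_bcomp _ _))//; apply: mulr_ile1; rewrite ?opnorm_ge0//.
    by apply: opnorm_le => // x; rewrite mul1r; case: (lQ' n).
  have := rnormBC (v T) (v (bcomp T (Q' n))).
  have := Hn n (leqnn n); have := rnorm_sub_le (v T) (v (bcomp T (Q' n))); lra.
exists V; split.
- split=> [|a v w]; first by rewrite inE => T; exact: cv_cst.
  rewrite !inE => Vv Vw T; rewrite bop_addE bop_scaleE.
  by have := cvD (cvZ a (Vv T)) (Vw T).
- move=> f.
  pose M := sup [set rnorm (f A) | A in [set A : L | kop A /\ opnorm A <= 1]].
  have Mub A : kop A -> opnorm A <= 1 -> rnorm (f A) <= M.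
    move=> kA A1; apply: ub_le_sup; last by exists A.
    exists (opnorm f) => _ [B [_ B1] <-]; apply: dual_bound.
    by rewrite bop_normE.
  have M0 : 0 <= M.
    have h : opnorm (0 : L) <= 1.
      by apply: opnorm_le => // x; rewrite bop_zeroE rnorm0 mul1r rnorm_ge0.
    exact: le_trans (rnorm_ge0 (f 0)) (Mub 0 (@kop0 R k E E) h).
  have [||||v [_ vM vf]] := @bop_extension R k L compact_op f M M0.
  + by exists 0; apply/compact_opP; exact: kop0.
  + move=> a A B /compact_opP kA /compact_opP kB; apply/compact_opP; exact: kop_lin.
  + by move=> a A B _ _; rewrite bopD bopZ.
  + move=> B /compact_opP kB; rewrite bop_normE.
    have [B0|B0] := eqVneq (opnorm B) 0.
      by rewrite (opnorm_eq0 B0) bop0 rnorm0 mulr_ge0// opnorm_ge0.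
    have Bp : 0 < opnorm B by rewrite lt_neqAle eq_sym B0 opnorm_ge0.
    have := Mub (kofR (opnorm B)^-1 *: B) (kopZ _ kB).
    rewrite opnormZ bopZ rnormZ rnorm_kofR ger0_norm ?invr_ge0 ?(ltW Bp)// mulVf//.
    by move=> /(_ (lexx _)); rewrite ler_pdivrMl// mulrC.
  have Vv : V v.
    apply: VP => e e0.
    have [|_ [A [kA A1] <-] h] := @sup_adherent R [set rnorm (f A) | A in [set A : L | kop
      A /\ opnorm A <= 1]] e e0.
      split; last first.
        exists (opnorm f) => _ [B [_ B1] <-]; apply: dual_bound.
        by rewrite bop_normE.
      exists (rnorm (f 0)), 0 => //; split; first exact: kop0.
      by apply: opnorm_le => // x; rewrite bop_zeroE rnorm0 mul1r rnorm_ge0.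
    exists A; split=> //; rewrite vf; last exact/compact_opP.
    by move: h; rewrite -/M; lra.
  exists (f - v, v); split=> /=.
    split=> //=; first by move=> A cA; rewrite bop_subE vf// subrr.
    by rewrite subrK.
  move=> [j w] [/= jJ Vw fE].
  (* The operators [bcomp T (Q' n)] are compact, so on them every candidate for the [V]-part agrees
     with [f]; membership in [V] then fixes its value at [T]. *)
  suff -> : v = w by rewrite fE addrK.
  apply: bop_ext => T; apply: (cv_unique (Vv T)); have := Vw T; congr cv.
  apply/funext => n; have kTQ : compact_op (bcomp T (Q' n)) by apply/compact_opP; exact: kop_comp_l.
  by rewrite vf// fE bop_addE (jJ _ kTQ) add0r.
- move=> j v jJ Vv; rewrite -!rnormE -kofRD; congr kofR; apply/le_anti/andP.
  split; first exact: rnormD.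
  rewrite !bop_normE; apply/ler_addgt0Pr => e e0.
  have e8 : 0 < e / 8 by rewrite divr_gt0.
  have jv1 : 0 < opnorm (j + v) + 1 by rewrite ltr_wpDl ?opnorm_ge0.
  have ejv : 0 < e / 8 / (opnorm (j + v) + 1) by rewrite divr_gt0.
  have v1 : 0 < opnorm v + 1 by rewrite ltr_wpDl ?opnorm_ge0.
  have ev : 0 < e / 8 / (opnorm v + 1) by rewrite divr_gt0.
  have [A [kA A1 vAe]] := VA v _ Vv e8.
  have [T T1 jT] := opnorm_approx j e8; rewrite bop_normE in T1.
  have [n1 H1] := mix A T _ kA A1 T1 ejv; have [n2 H2] := tailQ A _ kA ev.
  have [n3 H3] := Vv T _ e8.
  pose n := (n1 + n2 + n3)%N.
  have {}H1 := H1 n (leq_trans (leq_addr _ _) (leq_addr _ _)).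
  have {}H2 := H2 n (leq_trans (leq_addl _ _) (leq_addr _ _)).
  have {}H3 := H3 n (leq_addl _ _).
  (* On the operator of [mix], [j] ignores both compact terms and sees only [T], while [v] sees
     almost only [bcomp A (Q n)]. With aligned phases both norms are nearly attained at the same
     operator. *)
  have [t t1 tE] := phase2 (v (bcomp A (Q n))) (j T).
  have h1 : rnorm ((j + v) (bcomp A (Q n) + t *: (T - bcomp T (Q' n)))) <=
      opnorm (j + v) * (1 + e / 8 / (opnorm (j + v) + 1)).
    apply: le_trans (opnormP _ _) _; rewrite ler_wpM2l ?opnorm_ge0// bop_normE.
    by apply: H1; rewrite t1.
  have h2 : rnorm (v (A - bcomp A (Q n))) <= opnorm v * (e / 8 / (opnorm v + 1)).
    apply: le_trans (opnormP _ _) _; rewrite ler_wpM2l ?opnorm_ge0// bop_normE.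
    exact: H2.
  have small (c : R) : 0 <= c -> c * (e / 8 / (c + 1)) <= e / 8.
    move=> c0; rewrite mulrCA ler_piMr ?(ltW e8)// ler_pdivrMr ?mul1r ?lerDl//.
    by rewrite ltr_wpDl.
  have h3 := small _ (opnorm_ge0 v); have h4 := small _ (opnorm_ge0 (j + v)).
  have cAQ : compact_op (bcomp A (Q n)) by apply/compact_opP; exact: kop_comp_l.
  have cTQ : compact_op (bcomp T (Q' n)) by apply/compact_opP; exact: kop_comp_l.
  have h5 : (j + v) (bcomp A (Q n) + t *: (T - bcomp T (Q' n))) =
      (v (bcomp A (Q n)) + t *: j T) + t *: v (T - bcomp T (Q' n)).
    rewrite bop_addE (bopD j (bcomp A _)) (bopD v (bcomp A _)) !bopZ (bopB j).
    by rewrite (jJ _ cAQ) (jJ _ cTQ) subr0 add0r addrCA addrA.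
  have h6 : rnorm (t *: v (T - bcomp T (Q' n))) < e / 8.
    by rewrite rnormZ t1 mul1r bopB rnormBC.
  rewrite h5 mulrDr mulr1 in h1.
  have := rnorm_sub_le (v (bcomp A (Q n)) + t *: j T) (- (t *: v (T - bcomp T (Q' n)))).
  rewrite opprK rnormN tE.
  have := rnorm_sub_le (v A) (v (bcomp A (Q n))); rewrite -bopB; lra.
Qed.

End CompactIdeal.

(** * The [p]-sum of two copies of a space *)

Section SumSpace.
Context {R : realType} {k : scalar_kind}.
Notation K := (kfield R k).
Notation dual E := (bop E (K^o : normedModType K)).
Variables (p : \bar R) (p_gt1 : (1 < p)%E) (X : normedModType K).
Notation N := (norm2 p).
Notation Z := (psum (ltW p_gt1) X X : normedModType K).

Lemma rnorm_psum (z : Z) : rnorm z = N (rnorm z.1) (rnorm z.2).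
Proof. by rewrite /rnorm /Num.norm /= kofRK. Qed.

Lemma proj1_ex : exists T : bop Z X, forall z, T z = z.1.
Proof.
apply: (@mk_bop _ _ _ _ _ 1) => // z; rewrite mul1r rnorm_psum.
by have := norm2_gel p_gt1 (rnorm z.1) (rnorm z.2); rewrite ger0_norm// rnorm_ge0.
Qed.

Lemma proj2_ex : exists T : bop Z X, forall z, T z = z.2.
Proof.
apply: (@mk_bop _ _ _ _ _ 1) => // z; rewrite mul1r rnorm_psum.
by have := norm2_ger p_gt1 (rnorm z.1) (rnorm z.2); rewrite ger0_norm// rnorm_ge0.
Qed.

Lemma inj1_ex : exists T : bop X Z, forall x, T x = ((x, 0) : X * X).
Proof.
apply: (@mk_bop _ _ _ _ (fun x => (x, 0) : Z) 1) => [a x y|x].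
  by apply: injective_projections; rewrite /= ?scaler0 ?addr0.
by rewrite mul1r rnorm_psum /= rnorm0 norm2x0// ger0_norm ?rnorm_ge0.
Qed.

Lemma inj2_ex : exists T : bop X Z, forall x, T x = ((0, x) : X * X).
Proof.
apply: (@mk_bop _ _ _ _ (fun x => (0, x) : Z) 1) => [a x y|x].
  by apply: injective_projections; rewrite /= ?scaler0 ?addr0.
by rewrite mul1r rnorm_psum /= rnorm0 norm20x// ger0_norm ?rnorm_ge0.
Qed.

Lemma psum_cv (u : nat -> Z) (l : Z) :
  cv (fun n => (u n).1) l.1 -> cv (fun n => (u n).2) l.2 -> cv u l.
Proof.
move=> u1 u2; apply: (cv_squeeze (a := fun n => rnorm ((u n).1 - l.1) + rnorm ((u n).2 - l.2))).
  move=> n; rewrite rnorm_psum (le_trans (norm2_add_le p_gt1 _ _))//.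
  by rewrite !ger0_norm ?rnorm_ge0.
rewrite -(addr0 0); apply: rcvB0.
  move=> e /u1[n Hn]; exists n => m /Hn; rewrite subr0 ger0_norm ?rnorm_ge0//.
move=> e /u2[n Hn]; exists n => m /Hn; rewrite subr0 ger0_norm ?rnorm_ge0//.
Qed.

Lemma psum_complete : seq_complete X -> seq_complete Z.
Proof.
move=> cX u cu.
have [pr1 pr1E] := proj1_ex; have [pr2 pr2E] := proj2_ex.
have [|l1 Hl1] := cX (fun n => (u n).1).
  move=> e /cu[n Hn]; exists n => a b na nb; apply: le_lt_trans (Hn a b na nb).
  rewrite rnorm_psum.
  by have := norm2_gel p_gt1 (rnorm (u a - u b).1) (rnorm (u a - u b).2); rewrite
    ger0_norm// rnorm_ge0.
have [|l2 Hl2] := cX (fun n => (u n).2).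
  move=> e /cu[n Hn]; exists n => a b na nb; apply: le_lt_trans (Hn a b na nb).
  rewrite rnorm_psum.
  by have := norm2_ger p_gt1 (rnorm (u a - u b).1) (rnorm (u a - u b).2); rewrite
    ger0_norm// rnorm_ge0.
by exists (l1, l2); exact: psum_cv.
Qed.

Lemma psum_wcauchy : wcauchy_property X -> wcauchy_property Z.
Proof.
move=> wX u M uM.
have le1 (z : Z) : rnorm z.1 <= rnorm z.
  rewrite rnorm_psum; have := norm2_gel p_gt1 (rnorm z.1) (rnorm z.2).
  by rewrite ger0_norm// rnorm_ge0.
have le2 (z : Z) : rnorm z.2 <= rnorm z.
  rewrite rnorm_psum; have := norm2_ger p_gt1 (rnorm z.1) (rnorm z.2).
  by rewrite ger0_norm// rnorm_ge0.
have [s si w1] := wX (fun n => (u n).1) M (fun n => le_trans (le1 _) (uM n)).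
have [t ti w2] := wX (fun n => (u (s n)).2) M (fun n => le_trans (le2 _) (uM (s n))).
exists (s \o t); first exact: incr_comp.
move=> f e e0; have e2 : 0 < e / 2 by rewrite divr_gt0.
have [i1 i1E] := inj1_ex; have [i2 i2E] := inj2_ex.
have [n1 H1] := w1 (bcomp f i1) _ e2; have [n2 H2] := w2 (bcomp f i2) _ e2.
exists (maxn n1 n2) => a b; rewrite !geq_max => /andP[n1a n2a] /andP[n1b n2b].
have fE z : f z = bcomp f i1 z.1 + bcomp f i2 z.2.
  rewrite !bcompE -bopD; congr (f _); rewrite i1E i2E.
  by apply: injective_projections; rewrite /= ?addr0 ?add0r.
have h1 := H1 (t a) (t b) (leq_trans n1a (incr_ge ti a)) (leq_trans n1b (incr_ge ti b)).
have h2 := H2 a b n2a n2b.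
rewrite /= !fE opprD addrACA; apply: le_lt_trans (rnormD _ _) _.
by rewrite [e]splitr; exact: ltrD.
Qed.

(** Along a subsequence the norms of both coordinates converge, and (m_p) in each coordinate reduces
    the claim to the exchange rule [norm2ACA]. *)
Lemma psum_mp_limit : mp_limit p X -> mp_limit p Z.
Proof.
move=> mX z u M b c uM u0 ub uc.
have [pr1 pr1E] := proj1_ex; have [pr2 pr2E] := proj2_ex.
have le1 (w : Z) : rnorm w.1 <= rnorm w.
  rewrite rnorm_psum; have := norm2_gel p_gt1 (rnorm w.1) (rnorm w.2).
  by rewrite ger0_norm// rnorm_ge0.
have le2 (w : Z) : rnorm w.2 <= rnorm w.
  rewrite rnorm_psum; have := norm2_ger p_gt1 (rnorm w.1) (rnorm w.2).
  by rewrite ger0_norm// rnorm_ge0.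
have u1M n : rnorm (u n).1 <= M by exact: le_trans (le1 _) (uM n).
have u2M n : rnorm (u n).2 <= M by exact: le_trans (le2 _) (uM n).
have [s1 [b1 [s1i ub1]]] := bounded_norm_subseq u1M.
have [s2 [b2 [s2i ub2]]] := bounded_norm_subseq (fun n => u2M (s1 n)).
have zM (x : X) (y : X) : rnorm y <= M -> rnorm (x + y) <= rnorm x + M.
  by move=> yM; rewrite (le_trans (rnormD _ _))// lerD2l.
have [s3 [c1 [s3i uc1]]] := bounded_norm_subseq (fun n => zM z.1 _ (u1M (s1 (s2 n)))).
have [s4 [c2 [s4i uc2]]] := bounded_norm_subseq (fun n => zM z.2 _ (u2M (s1 (s2 (s3 n))))).
pose t := s2 \o s3 \o s4; have ti : incr t by exact: incr_comp (incr_comp _ _) _.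
pose s := s1 \o t; have si : incr s by exact: incr_comp.
have {}ub1 : rcv (fun n => rnorm (u (s n)).1) b1 by exact: (rcv_sub ti ub1).
have {}ub2 : rcv (fun n => rnorm (u (s n)).2) b2.
  exact: (rcv_sub (incr_comp s3i s4i) ub2).
have {}uc1 : rcv (fun n => rnorm (z.1 + (u (s n)).1)) c1 by exact: (rcv_sub s4i uc1).
have c1E : c1 = N (rnorm z.1) b1.
  apply: (mX _ (fun n => (u (s n)).1) M) => // f.
  have := cv_sub si (u0 (bcomp f pr1)); congr cv; apply/funext => n /=.
  by rewrite bcompE pr1E.
have c2E : c2 = N (rnorm z.2) b2.
  apply: (mX _ (fun n => (u (s n)).2) M) => // f.
  have := cv_sub si (u0 (bcomp f pr2)); congr cv; apply/funext => n /=.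
  by rewrite bcompE pr2E.
have bE : b = N b1 b2.
  apply: rcv_unique (rcv_sub si ub) _; have := norm2_cv p_gt1 ub1 ub2.
  by congr rcv; apply/funext => n /=; rewrite rnorm_psum.
have cE : c = N c1 c2.
  apply: rcv_unique (rcv_sub si uc) _; have := norm2_cv p_gt1 uc1 uc2.
  by congr rcv; apply/funext => n /=; rewrite rnorm_psum.
by rewrite cE c1E c2E norm2ACA// -rnorm_psum -bE.
Qed.

Lemma psum_compact_M_ideal (S : nat -> bop X X) :
  mp_limit p X -> wcauchy_property X -> seq_complete X ->
  (forall n, kop (S n)) -> (forall n x, rnorm (S n x) <= rnorm x) ->
  (forall x, cv (fun n => S n x) x) ->
  M_ideal (compact_op : set (bop Z Z)).
Proof.
move=> mX wX cX kS S1 Scv.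
have [pr1 pr1E] := proj1_ex; have [pr2 pr2E] := proj2_ex.
have [i1 i1E] := inj1_ex; have [i2 i2E] := inj2_ex.
pose T n := bcomp i1 (bcomp (S n) pr1) + bcomp i2 (bcomp (S n) pr2).
have TE n z : T n z = ((S n z.1, S n z.2) : X * X).
  rewrite /T bop_addE !bcompE i1E i2E pr1E pr2E.
  by apply: injective_projections; rewrite /= ?addr0 ?add0r.
apply: (@compact_M_ideal R k p p_gt1 Z (psum_mp_limit mX) (psum_wcauchy wX) (psum_complete cX) T).
- by move=> n; apply: kopD; apply: kop_comp_l; exact: kop_comp_r.
- move=> n z; rewrite !rnorm_psum TE /=; apply: norm2_mono => //; exact: rnorm_ge0.
- move=> z; apply: psum_cv.
    by have := Scv z.1; congr cv; apply/funext => n; rewrite TE.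
  by have := Scv z.2; congr cv; apply/funext => n; rewrite TE.
Qed.

End SumSpace.

(** * Sums of finite-dimensional spaces *)

Section Separability.
Context {R : realType} {k : scalar_kind}.
Notation K := (kfield R k).
Notation dual E := (bop E (K^o : normedModType K)).
Implicit Types X E : normedModType K.

Lemma separable_seq X : separable X ->
  exists d : nat -> X, forall x e, 0 < e -> exists n, rnorm (d n - x) < e.
Proof.
move=> [D /pcard_leP[f] dD].
have /choice[d dP] n : exists x, (exists2 y, D y & f y = n) -> D x /\ f x = n.
  have [[y Dy fy]|h] := pselect (exists2 y, D y & f y = n); last by exists 0.
  by exists y.
exists d => x e e0.
have [||y [yx Dy]] := dD [set y | rnorm (y - x) < e].
- by exists x => /=; rewrite subrr rnorm0.
- rewrite openE => y /= yx; apply/nbhs_rnorm; exists (e - rnorm (y - x)).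
    by rewrite subr_gt0.
  by move=> z zy /=; have := rnorm_triangle z y x; lra.
exists (f y); have [|Dd fd] := dP (f y); first by exists y.
suff -> : d (f y) = y by [].
by apply: (@inj _ _ D f); rewrite ?inE.
Qed.

(** The [n]-th operator is taken from the net so as to be close to the identity on the first [n]
    points of a dense sequence; contractivity extends the convergence to all points. *)
Lemma approximating_sequence X : separable X -> metric_compact_approximation X ->
  exists S : nat -> bop X X, [/\ forall n, kop (S n),
    forall n x, rnorm (S n x) <= rnorm x & forall x, cv (fun n => S n x) x].
Proof.
move=> /separable_seq[d dd] [I [le [S [[[i0] lexx' letr ledir] kS S1 Scv]]]].
have /choice[a aP] n : exists i, forall j, (j < n)%N -> rnorm (S i (d j) - d j) < n.+1%:R^-1.
  have n0 : 0 < n.+1%:R^-1 :> R by rewrite invr_gt0.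
  suff H m : exists i, forall i', le i i' -> forall j, (j < m)%N -> rnorm (S i' (d j) - d
    j) < n.+1%:R^-1.
    by have [i Hi] := H n; exists i; exact: Hi.
  elim: m => [|m [i Hi]]; first by exists i0.
  have [i1 Hi1] := Scv (d m) _ n0; have [l [il i1l]] := ledir i i1.
  exists l => i' li' j; rewrite ltnS leq_eqVlt => /predU1P[->|jm].
    by apply: Hi1; exact: letr li'.
  by apply: Hi => //; exact: letr li'.
have S1' n x : rnorm (S (a n) x) <= rnorm x.
  by rewrite -[leRHS]mul1r; apply: opnormP1; exact: S1.
exists (fun n => S (a n)); split=> [n||x e e0]; [|exact: S1'|].
  by apply/compact_opP; exact: kS.
have e3 : 0 < e / 3 by rewrite divr_gt0.
have [j Hj] := dd x _ e3; have [n Hn] := inv_lt e3.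
exists (maxn j.+1 n) => m; rewrite geq_max => /andP[jm nm].
have h1 := lt_trans (aP m j jm) (Hn m nm); have h2 := S1' m (d j - x).
have := rnorm_triangle (S (a m) x) (S (a m) (d j)) x.
have := rnorm_triangle (S (a m) (d j)) (d j) x.
have := rnormBC (S (a m) x) (S (a m) (d j)); rewrite -!bopB; lra.
Qed.

(** Induction on the number of spanning vectors. If the last one is outside the span of the others,
    it has positive distance [d] to it, since by induction that span is closed; this bounds the last
    coefficients by [M / d]. *)
Lemma span_subseq E (e : nat -> E) n (u : nat -> E) M :
  (forall j, rnorm (u j) <= M) ->
  (forall j, exists c : nat -> K, u j = \sum_(i < n) c i *: e i) ->
  exists s l, [/\ incr s, cv (u \o s) l & exists c : nat -> K, l = \sum_(i < n) c i *: e i].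
Proof.
elim: n u M => [|n IH] u M uM uc.
  exists id, 0; split; [by move=> m; exact: leqnn| |by exists (fun=> 0); rewrite big_ord0].
  move=> d d0; exists 0%N => j _ /=; have [c ->] := uc j.
  by rewrite big_ord0 subr0 rnorm0.
have /choice[c cP] j : exists c : nat -> K, u j = \sum_(i < n.+1) c i *: e i by exact: uc.
pose v j := \sum_(i < n) c j i *: e i.
have uv j : u j = v j + c j n *: e n by rewrite cP big_ord_recr.
have [[b bP]|nb] := pselect (exists b : nat -> K, e n = \sum_(i < n) b i *: e i).
  have [||s [l [si ul [a aP]]]] := IH u M => //.
    move=> j; exists (fun i => c j i + c j n * b i).
    rewrite uv bP scaler_sumr -big_split /=; apply: eq_bigr => i _.
    by rewrite scalerDl scalerA.
  exists s, l; split=> //; exists (fun i => if (i < n)%N then a i else 0).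
  rewrite big_ord_recr /= ltnn scale0r addr0 aP; apply: eq_bigr => i _.
  by rewrite ltn_ord.
have [d d0 dP] : exists2 d : R, 0 < d & forall a : nat -> K,
    d <= rnorm (e n - \sum_(i < n) a i *: e i).
  apply: contrapT => /forall2NP Hd.
  have /choice[a aP] j : exists a : nat -> K,
      rnorm (e n - \sum_(i < n) a i *: e i) < j.+1%:R^-1.
    have [h|/existsNP[a /negP]] := Hd j.+1%:R^-1; first by rewrite invr_gt0 in h.
    by rewrite -ltNge => h; exists a.
  have [j|j|s [l [si al [b bP]]]] := IH (fun j => \sum_(i < n) a j i *: e i) (rnorm (e n) + 1).
  - have := rnorm_sub_le (\sum_(i < n) a j i *: e i) (e n); rewrite rnormBC.
    have h1 : j.+1%:R^-1 <= 1 :> R by rewrite invf_le1// ler1n.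
    by have := lt_le_trans (aP j) h1; lra.
  - by exists (a j).
  apply: nb; exists b; rewrite -bP; apply: (cv_unique _ al).
  apply: (cv_squeeze (a := fun j => (s j).+1%:R^-1)) => [j /=|].
    by rewrite rnormBC ltW.
  by apply: (rcv_sub (u := fun j => j.+1%:R^-1)) => //; exact: rcv_inv.
have cb j : rnorm (c j n : K^o) <= M / d.
  rewrite ler_pdivlMr//; have [c0|c0] := eqVneq (c j n) 0.
    by rewrite c0 rnorm0 mul0r (le_trans (rnorm_ge0 _) (uM j)).
  apply: le_trans (uM j); rewrite uv.
  have -> : v j + c j n *: e n = c j n *: (e n - \sum_(i < n) (- (c j n)^-1 * c j i) *: e i).
    rewrite scalerBr addrC; congr (_ + _); rewrite -scalerN -sumrN scaler_sumr.
    by apply: eq_bigr => i _; rewrite -scaleNr scalerA mulNr opprK mulVKf.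
  by rewrite rnormZ; apply: ler_wpM2l; [exact: rnorm_ge0|exact: (dP (fun i => - (c j n)^-1
    * c j i))].
have [s [a [si ca]]] := scalar_subseq cb.
have vb j : rnorm (v (s j)) <= M + M / d * rnorm (e n).
  have -> : v (s j) = u (s j) - c (s j) n *: e n by rewrite uv addrK.
  rewrite (le_trans (rnormB _ _))// lerD// rnormZ ler_wpM2r ?rnorm_ge0//.
have [j|t [l [ti vl [b bP]]]] := IH (v \o s) _ vb; first by exists (c (s j)).
exists (s \o t), (l + a *: e n); split; first exact: incr_comp.
  have ca' : cv (fun j => c (s (t j)) n *: e n) (a *: e n).
    move=> x x0; have en1 : 0 < rnorm (e n) + 1 by rewrite ltr_wpDl ?rnorm_ge0.
    have [m Hm] := cv_sub ti ca (divr_gt0 x0 en1); exists m => j /Hm /= h.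
    rewrite -scalerBl rnormZ; rewrite ltr_pdivlMr// in h; apply: le_lt_trans h.
    by rewrite ler_wpM2l ?rnorm_ge0// lerDl.
  by have := cvD vl ca'; congr cv; apply/funext => j /=; rewrite uv.
exists (fun i => if (i < n)%N then b i else a).
rewrite big_ord_recr /= ltnn bP; congr (_ + _); apply: eq_bigr => i _.
by rewrite ltn_ord.
Qed.

Lemma finite_dimensional_subseq E (u : nat -> E) M : finite_dimensional E ->
  (forall j, rnorm (u j) <= M) -> exists s l, incr s /\ cv (u \o s) l.
Proof.
move=> [n [e eP]] uM.
pose e' i := if insub i is Some j then e j else 0.
have [j|s [l [si ul _]]] := @span_subseq E e' n u M uM; last by exists s, l.
have [c cE] := eP (u j).
exists (fun i => if insub i is Some j then c j else 0); rewrite cE.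
by apply: eq_bigr => i _; rewrite /e' valK.
Qed.

End Separability.

(** * The models, and what their almost isometric subspaces inherit *)

Section Models.
Context {R : realType} {k : scalar_kind}.
Notation K := (kfield R k).
Notation dual E := (bop E (K^o : normedModType K)).
Variables (p : \bar R) (p_gt1 : (1 < p)%E).
Notation N := (norm2 p).

(* What is used of an l_p-sum of finite-dimensional spaces, or of c_0. *)
Definition ell_model (W : normedModType K) := exists P : nat -> bop W W,
  [/\ forall m w, rnorm (P m w) <= rnorm w, forall w, cv (fun m => P m w) w,
      forall m v w, rnorm (P m v + (w - P m w)) = N (rnorm (P m v)) (rnorm (w - P m w)) &
      forall m, kop (P m)].

Definition almost_embeds (X : normedModType K) := forall e, 0 < e ->
  exists W (T : bop X W), ell_model W /\
    forall x, rnorm x <= rnorm (T x) <= (1 + e) * rnorm x.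

(** In the model some [P m] nearly fixes [T x], while [P m (T (u n))] tends to 0 because [P m] is
    compact. So [T x] and [T (u n)] nearly split, and the distortion of [T] disappears as [e] tends
    to 0. *)
Lemma almost_embeds_mp X : almost_embeds X -> mp_limit p X.
Proof.
move=> aX x u M b c uM u0 ub uc.
have c0 : 0 <= c.
  apply: (rcv_le (u := fun=> 0) (v := fun n => rnorm (x + u n))) => [n||//].
    exact: rnorm_ge0.
  by move=> e1 e10; exists 0%N => n _; rewrite subrr normr0.
have Nlim := norm2_cv p_gt1 (a := fun=> rnorm x) (cv_norm (cv_cst x)) ub.
set B := N (rnorm x) b in Nlim *.
have B0 : 0 <= B by rewrite /B norm2_ge0.
(* The 5 absorbs the additive errors; [lim] only needs the excess to be of order [e]. *)
have main e : 0 < e <= 1 -> c <= B + (B + 5) * e /\ B <= c + (c + 5) * e.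
  move=> /andP[e0 e1]; have [W [T [[P [P1 Pcv Psplit kP]] TP]]] := aX e e0.
  have e2 : 0 < e / 2 by rewrite divr_gt0.
  have [m Hm] := Pcv (T x) _ e2; have {}Hm := Hm m (leqnn m).
  have Pu : cv (bcomp (P m) T \o u) 0.
    by apply: (kop_weak_norm (M := M)) => //; exact: kop_comp_r.
  have [n1 H1] := Pu _ e2; have [n2 H2] := uc _ e0; have [n3 H3] := Nlim _ e0.
  pose n := (n1 + n2 + n3)%N.
  have {}H1 := H1 n (leq_trans (leq_addr _ _) (leq_addr _ _)).
  have {}H2 := H2 n (leq_trans (leq_addl _ _) (leq_addr _ _)).
  have {}H3 := H3 n (leq_addl _ _).
  rewrite subr0 /= bcompE in H1.
  have h1 := rnorm_dist (T x + T (u n)) (P m (T x) + (T (u n) - P m (T (u n)))).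
  have h2 : rnorm (T x + T (u n) - (P m (T x) + (T (u n) - P m (T (u n))))) <= e.
    rewrite (_ : _ - _ = (T x - P m (T x)) + P m (T (u n))); last first.
      by rewrite opprD addrACA opprB subrKC.
    apply: le_trans (rnormD _ _) _; rewrite rnormBC; lra.
  have h3 := norm2_dist p_gt1 (rnorm (P m (T x))) (rnorm (T (u n) - P m (T (u n))))
     (rnorm (T x)) (rnorm (T (u n))).
  have h4 := rnorm_dist (P m (T x)) (T x).
  have h5 := rnorm_dist (T (u n) - P m (T (u n))) (T (u n)).
  have h6 : rnorm (T (u n) - P m (T (u n)) - T (u n)) = rnorm (P m (T (u n))).
    by rewrite addrAC subrr sub0r rnormN.
  rewrite Psplit in h1.
  have /andP[T1 T2] := TP (x + u n); rewrite bopD in T1 T2.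
  have /andP[Tx1 Tx2] := TP x; have /andP[Tu1 Tu2] := TP (u n).
  have h7 := norm2_mono p_gt1 (rnorm_ge0 x) (rnorm_ge0 (u n)) Tx1 Tu1.
  have h8 := norm2_mono p_gt1 (rnorm_ge0 (T x)) (rnorm_ge0 (T (u n))) Tx2 Tu2.
  have e10 : 0 <= 1 + e by lra.
  rewrite norm2_scale// in h8.
  move: H2 H3 => /=.
  move: (N (rnorm x) (rnorm (u n))) h7 h8 => n4 h7 h8.
  move: (N (rnorm (T x)) (rnorm (T (u n)))) h3 h7 h8 => n5 h3 h7 h8.
  move: h1 h3 h4 h5; rewrite !ler_norml => /andP[h11 h12] /andP[h31 h32] /andP[h41 h42]
    /andP[h51 h52].
  rewrite !ltr_norml => /andP[H21 H22] /andP[H31 H32].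
  move: h11 h12 h31 h32.
  move: (N (rnorm (P m (T x))) (rnorm (T (u n) - P m (T (u n))))) => n6 h11 h12 h31 h32.
  have a1 : `|rnorm (P m (T x)) - rnorm (T x)| <= e / 2.
    by apply: le_trans (rnorm_dist _ _) (ltW Hm).
  have a2 : `|rnorm (T (u n) - P m (T (u n))) - rnorm (T (u n))| <= e / 2.
    by apply: le_trans (rnorm_dist _ _) _; rewrite h6 ltW.
  have en4 : e * n4 <= e * (B + 1) by rewrite ler_wpM2l ?(ltW e0)//; lra.
  have ec : e * rnorm (x + u n) <= e * (c + 1) by rewrite ler_wpM2l ?(ltW e0)//; lra.
  by split; lra.
have lim (a b' : R) : 0 <= b' -> (forall e, 0 < e <= 1 -> a <= b' + (b' + 5) * e) -> a <= b'.
  move=> b'0 H; apply/ler_addgt0Pr => e e0.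
  have b5 : 0 < b' + 5 by rewrite ltr_wpDl.
  have := H (Num.min 1 (e / (b' + 5))); rewrite lt_min ltr01 divr_gt0//= ge_min lexx.
  move=> /(_ isT) /le_trans; apply; rewrite lerD2l -ler_pdivlMl// mulrC.
  by rewrite ge_min lexx orbT.
by apply/le_anti/andP; split; apply: lim => // e e01; have [] := main e e01.
Qed.

(** [h] nearly attains its norm at some [P m w0]. Adding a small tail there costs almost no norm, by
    flatness, so [h] has to be small on tails. *)
Lemma ell_model_shrinking W (P : nat -> bop W W) (h : dual W) (e : R) :
  (forall m w, rnorm (P m w) <= rnorm w) -> (forall w, cv (fun m => P m w) w) ->
  (forall m v w, rnorm (P m v + (w - P m w)) = N (rnorm (P m v)) (rnorm (w - P m w))) ->
  0 < e -> exists m, forall w, rnorm (h (w - P m w)) <= e * rnorm w.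
Proof.
move=> P1 Pcv Psplit e0; pose H := opnorm h; have H0 : 0 <= H := opnorm_ge0 h.
have H1 : 0 < H + 1 by rewrite ltr_wpDl.
have c0 : 0 < e / (8 * (H + 1)) by rewrite divr_gt0// mulr_gt0.
have [s0 /andP[s00 _] flat] := norm2_flat p_gt1 c0.
pose s := s0 / 2; have sp : 0 < s by rewrite divr_gt0.
have d0 : 0 < s * e / 4 by rewrite divr_gt0// mulr_gt0.
have [w0 w01 hw0] := opnorm_approx h d0.
have [m Hm] := bop_cv h (Pcv w0) d0; have {}Hm := Hm m (leqnn m).
exists m => w.
suff G z : rnorm z <= 1 -> rnorm (bcomp h (bid W - P m) z) <= e.
  by have := opnorm_unit G w; rewrite bcompE bop_subE bidE.
move=> {w} z1; rewrite bcompE bop_subE bidE.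
have [t t1 tE] := phase2 (h (P m w0)) (kofR s *: h (z - P m z)).
have g1 : rnorm (h (P m w0)) + s * rnorm (h (z - P m z)) <= H * N 1 s0.
  rewrite -[s in s * _]ger0_norm ?(ltW sp)// -(rnorm_kofR (k := k)) -rnormZ -tE.
  rewrite -!bopZ -bopD; apply: le_trans (opnormP _ _) _; rewrite ler_wpM2l//.
  rewrite scalerA scalerBr -bopZ Psplit; apply: norm2_mono; rewrite ?rnorm_ge0//.
    exact: le_trans (P1 _ _) w01.
  apply: le_trans (rnormB _ _) _; have := P1 m ((t * kofR s) *: z).
  have tsE : rnorm (t * kofR s) = s.
    rewrite /rnorm normrM -(rnormE t) t1 kofR1 mul1r -/(rnorm (kofR s : K)) rnorm_kofR.
    by rewrite gtr0_norm.
  rewrite rnormZ tsE; have := ler_wpM2l (ltW sp) z1; rewrite /s; lra.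
have g2 : N 1 s0 <= 1 + e / (8 * (H + 1)) * s0 by rewrite flat// (ltW s00) lexx.
have g3 := ler_wpM2l H0 g2.
have g4 : H * (e / (8 * (H + 1)) * s0) <= s * e / 4.
  have -> : s * e / 4 = (H + 1) * (e / (8 * (H + 1)) * s0).
    by rewrite /s; field; rewrite gt_eqF.
  by rewrite ler_wpM2r ?lerDl// mulr_ge0 ?(ltW c0) ?(ltW s00).
have g5 := rnorm_sub_le (h w0) (h (P m w0)).
rewrite /= rnormBC in Hm; rewrite -/H in hw0; rewrite mulrDr mulr1 in g3.
have g6 : s * rnorm (h (z - P m z)) <= s * e by lra.
by rewrite ler_pM2l in g6.
Qed.

(** On a diagonal subsequence all the [P j (T (u n))] converge. The functional [f] extends from the
    range of [T] to a functional [h] on the model, and [h] is uniformly small on the tails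
    [w - P m w]. *)
Lemma almost_embeds_wcauchy X : almost_embeds X -> wcauchy_property X.
Proof.
move=> aX u M uM; have [W [T [[P [P1 Pcv Psplit kP]] TP]]] := aX 1 ltr01.
have M0 : 0 <= M by exact: le_trans (rnorm_ge0 _) (uM 0).
have [||j s si|s si Hs] := @diagonal_subseq
    (fun j s => exists l, cv (bcomp (P j) T \o u \o s) l).
- by move=> j s t ti [l Hl]; exists l; exact: cv_sub ti Hl.
- by move=> j s n [l Hl]; exists l; exact: cv_tail Hl.
- have [t [l [ti Hl]]] := kop_bounded (kop_comp_r T (kP j)) (fun n => uM (s n)).
  by exists t => //; exists l.
exists s => // f e e0.
have Tinj x y : T x = T y -> x = y.
  move=> Txy; apply/eqP; rewrite -subr_eq0; apply/eqP/rnorm_eq0/le_anti.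
  rewrite rnorm_ge0 andbT; have /andP[+ _] := TP (x - y).
  by rewrite bopB Txy subrr rnorm0.
have /choice[g gP] w : exists c, forall x, w = T x -> c = f x.
  have [[x wx]|h] := pselect (exists x, w = T x); last first.
    by exists 0 => x wx; exfalso; apply: h; exists x.
  by exists (f x) => y wy; congr (f _); apply: Tinj; rewrite -wx.
have gE x : g (T x) = f x by exact: gP.
have [||||h [_ _ hg]] := @bop_extension R k W [set w | exists x, w = T x] g _ (opnorm_ge0 f).
- by exists (T 0), 0.
- by move=> a _ _ [x ->] [y ->]; exists (a *: x + y); rewrite (bop_linear T).
- move=> a _ _ [x ->] [y ->].
  by rewrite -bopZ -bopD !gE bopD bopZ.
- move=> _ [x ->]; rewrite gE (le_trans (opnormP _ _))// ler_wpM2l ?opnorm_ge0//.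
  by case/andP: (TP x).
have hE x : h (T x) = f x by rewrite hg ?gE//; exists x.
have M8 : 0 < 8 * (M + 1) by rewrite mulr_gt0// ltr_wpDl.
have [m Hm] := ell_model_shrinking h P1 Pcv Psplit (divr_gt0 e0 M8).
have [l /cv_cauchy Hl] := Hs m.
have h1 : 0 < 2 * (opnorm h + 1) by rewrite mulr_gt0// ltr_wpDl ?opnorm_ge0.
have [n Hn] := Hl _ (divr_gt0 e0 h1); exists n => a b na nb.
have := Hn a b na nb; rewrite /= !bcompE -!hE -!bopB.
move: (uM (s a)) (uM (s b)); move: (u (s a)) (u (s b)) => x y xM yM g1.
have xy : rnorm (x - y) <= 2 * M by have := rnormB x y; lra.
have g2 := Hm (T (x - y)).
have /andP[_ g3] := TP (x - y).
have g4 : e / (8 * (M + 1)) * rnorm (T (x - y)) <= e / 2.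
  have -> : e / 2 = e / (8 * (M + 1)) * (4 * (M + 1)).
    by field; rewrite gt_eqF// ltr_wpDl.
  rewrite ler_wpM2l ?divr_ge0 ?(ltW e0) ?(ltW M8)//; lra.
have g5 : rnorm (h (P m (T (x - y)))) < e / 2.
  apply: le_lt_trans (opnormP _ _) _.
  have -> : e / 2 = (opnorm h + 1) * (e / (2 * (opnorm h + 1))).
    by field; rewrite gt_eqF// ltr_wpDl ?opnorm_ge0.
  apply: (@le_lt_trans _ _ ((opnorm h + 1) * rnorm (P m (T (x - y))))).
    by rewrite ler_wpM2r ?rnorm_ge0// lerDl.
  by rewrite ltr_pM2l// ltr_wpDl ?opnorm_ge0.
have := rnormD (h (T (x - y) - P m (T (x - y)))) (h (P m (T (x - y)))).
rewrite -bopD subrK; lra.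
Qed.

End Models.

Section EllPartialSums.
Context {R : realType}.
Variables (r : R) (r1 : 1 <= r).
Implicit Types a b : nat -> R.

Let r0 : 0 < r. Proof. exact: lt_le_trans ltr01 r1. Qed.

Definition ell_sum a L := \sum_(i < L) `|a i| `^ r.

Lemma ell_sum_ge0 a L : 0 <= ell_sum a L.
Proof. by apply: sumr_ge0 => i _; rewrite powR_ge0. Qed.

Lemma powRK (x : R) : 0 <= x -> (x `^ r^-1) `^ r = x.
Proof. by move=> x0; rewrite -powRrM mulVf ?gt_eqF// powRr1. Qed.

Lemma powRVK (x : R) : 0 <= x -> (x `^ r) `^ r^-1 = x.
Proof. by move=> x0; rewrite -powRrM mulfV ?gt_eqF// powRr1. Qed.

Lemma ler_powRr (x y : R) : 0 <= x -> 0 <= y -> (x `^ r <= y `^ r) = (x <= y).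
Proof.
move=> x0 y0; apply/idP/idP => h; last first.
  by apply: ge0_ler_powR; rewrite ?nnegrE ?(ltW r0).
rewrite -[x]powRVK// -[y]powRVK//.
by apply: ge0_ler_powR; rewrite ?nnegrE ?powR_ge0 ?invr_ge0 ?(ltW r0).
Qed.

Lemma ell_norm_sum_ub a D : 0 <= D -> (forall L, ell_sum a L <= D) ->
  (ell_norm r a <= (D `^ r^-1)%:E)%E.
Proof.
move=> D0 aD; rewrite /ell_norm Lnorm_counting// -poweR_EFin.
have t0 n : (0 <= `|(EFin \o a) n| `^ r)%E by exact: poweR_ge0.
apply: gt0_ler_poweR.
- by rewrite invr_ge0 ltW.
- by rewrite in_itv/= leey andbT; exact: nneseries_ge0.
- by rewrite in_itv/= leey andbT lee_fin.
apply: lime_le; first exact: is_cvg_nneseries.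
apply: nearW => L; rewrite big_mkord.
rewrite (eq_bigr (fun i : 'I_L => (`|a i| `^ r)%:E))//.
by rewrite sumEFin lee_fin aD.
Qed.

Lemma ell_sum_le a C L : 0 <= C -> (ell_norm r a <= C%:E)%E -> ell_sum a L <= C `^ r.
Proof.
move=> C0; rewrite /ell_norm Lnorm_counting//.
set T := (\sum_(k <oo) _)%E => h.
have t0 n : (0 <= `|(EFin \o a) n| `^ r)%E by exact: poweR_ge0.
have T0 : (0 <= T)%E by exact: nneseries_ge0.
have TC : (T <= (C `^ r)%:E)%E.
  rewrite -poweR_EFin -[T]poweRe1// -(mulVf (_ : r != 0)) ?gt_eqF// poweRrM.
  apply: gt0_ler_poweR => //; first exact: ltW.
    by rewrite in_itv/= leey andbT poweR_ge0.
  by rewrite in_itv/= leey andbT lee_fin.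
rewrite -lee_fin; apply: le_trans TC; rewrite /ell_sum -sumEFin.
have := @nneseries_lim_ge R (fun n => `|(EFin \o a) n| `^ r)%E xpredT 0 L (fun n _ _ => t0 n).
by rewrite big_mkord.
Qed.

End EllPartialSums.

Section LpSumModel.
Context {R : realType} {k : scalar_kind}.
Notation K := (kfield R k).
Variables (r : R) (r1 : 1 <= r) (F : nat -> normedModType K).
Notation W := (lpsum r1 F : normedModType K).
Notation ell_sum := (ell_sum r).

Let r0 : 0 < r. Proof. exact: lt_le_trans ltr01 r1. Qed.

Definition lpcoord (x : W) n : F n := lpsum_seq x n.

Lemma rnorm_lpsum (x : W) : rnorm x = lpsum_norm x.
Proof. by rewrite /rnorm /Num.norm /= kofRK. Qed.

Lemma lpsum_sum_le (x : W) L : ell_sum (fun n => rnorm (lpcoord x n)) L <= rnorm x `^ r.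
Proof.
apply: ell_sum_le => //; first exact: rnorm_ge0.
by rewrite rnorm_lpsum lpsum_normE.
Qed.

Lemma lpsum_sum_ub (x : W) D : 0 <= D ->
  (forall L, ell_sum (fun n => rnorm (lpcoord x n)) L <= D) -> rnorm x `^ r <= D.
Proof.
move=> D0 /(ell_norm_sum_ub r1 D0); rewrite -lpsum_normE lee_fin -rnorm_lpsum => h.
by rewrite -(powRK r1 D0) ler_powRr ?rnorm_ge0 ?powR_ge0.
Qed.

Lemma mk_lpsum (x : Defs.seqprod F) D : 0 <= D ->
  (forall L, ell_sum (fun n => rnorm (x n)) L <= D) ->
  exists w : W, forall n, lpcoord w n = x n.
Proof.
move=> D0 xD; have xp : x \in lpsum_pred r F.
  by rewrite inE /=; apply: le_lt_trans (ell_norm_sum_ub r1 D0 xD) _; rewrite ltry.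
by exists (LpSum r1 xp).
Qed.

Lemma lpsum_ext (x y : W) : (forall n, lpcoord x n = lpcoord y n) -> x = y.
Proof. by move=> xy; apply/val_inj/functional_extensionality_dep. Qed.

Lemma lpcoordD x y n : lpcoord (x + y) n = lpcoord x n + lpcoord y n. Proof. by []. Qed.
Lemma lpcoordZ a x n : lpcoord (a *: x) n = a *: lpcoord x n. Proof. by []. Qed.
Lemma lpcoordB x y n : lpcoord (x - y) n = lpcoord x n - lpcoord y n. Proof. by []. Qed.
Lemma lpcoord_sum I (s : seq I) (P : pred I) (x : I -> W) n :
  lpcoord (\sum_(i <- s | P i) x i) n = \sum_(i <- s | P i) lpcoord (x i) n.
Proof. by elim/big_rec2: _ => [|i y z _ <-]. Qed.

Lemma rnorm_lpcoord (x : W) n : rnorm (lpcoord x n) <= rnorm x.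
Proof.
have := ell_norm_ge_term (fun n => rnorm (lpsum_seq x n)) n r1.
by rewrite -lpsum_normE lee_fin ger0_norm ?rnorm_ge0// -rnorm_lpsum.
Qed.

Lemma lpproj_ex n : exists T : bop W (F n), forall x, T x = lpcoord x n.
Proof. by apply: (@mk_bop _ _ _ _ _ 1) => // x; rewrite mul1r rnorm_lpcoord. Qed.

Lemma ell_sum_single n (v : F n) L :
  ell_sum (fun m => rnorm (eqtype.dfwith (fun m => 0 : F m) v m)) L <= rnorm v `^ r.
Proof.
have z0 (m : nat) : (n != m)%N -> `|rnorm (eqtype.dfwith (fun m => 0 : F m) v m)| `^ r = 0.
  by move=> nm; rewrite dfwith_out// rnorm0 normr0 powR0// gt_eqF.
rewrite /ell_sum; have [nL|Ln] := ltnP n L.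
  rewrite (bigD1 (Ordinal nL))//= dfwith_in ger0_norm ?rnorm_ge0//.
  rewrite big1 ?addr0// => i /eqP ni; apply: z0.
  by apply/eqP => nE; apply: ni; exact: val_inj.
rewrite big1 ?powR_ge0// => i _; apply: z0.
by rewrite neq_ltn (leq_trans (ltn_ord i) Ln) orbT.
Qed.

Lemma lpinj_ex n : exists T : bop (F n) W,
  forall v m, lpcoord (T v) m = eqtype.dfwith (fun m => 0 : F m) v m.
Proof.
have /choice[T TE] (v : F n) : exists w : W, forall m, lpcoord w m = eqtype.dfwith (fun m
  => 0 : F m) v m.
  exact: (mk_lpsum (powR_ge0 (rnorm v) r) (ell_sum_single v)).
have lT : linear T.
  move=> a x y; apply: lpsum_ext => m; rewrite lpcoordD lpcoordZ !TE.
  have [<-|nm] := eqVneq n m; first by rewrite !dfwith_in.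
  by rewrite !dfwith_out// scaler0 addr0.
have [|S SE] := @mk_bop _ _ _ _ T 1 lT; last by exists S => v m; rewrite SE TE.
move=> v; rewrite mul1r -(ler_powRr r1) ?rnorm_ge0//.
apply: lpsum_sum_ub; first exact: powR_ge0.
move=> L; apply: le_trans (ell_sum_single v L); rewrite le_eqVlt; apply/orP; left.
by apply/eqP; apply: eq_bigr => i _; rewrite TE.
Qed.

Lemma lpcut_ex : exists P : nat -> bop W W,
  (forall m x n, lpcoord (P m x) n = if (n < m)%N then lpcoord x n else 0) /\
  ((forall n, finite_dimensional (F n)) -> forall m, kop (P m)).
Proof.
have /choice[pr prE] n : exists T : bop W W,
    (forall x m, lpcoord (T x) m = if m == n then lpcoord x m else 0) /\
    (finite_dimensional (F n) -> kop T).
  have [q qE] := lpproj_ex n; have [i iE] := lpinj_ex n.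
  exists (bcomp i q); split=> [x m|fdF].
    rewrite bcompE iE qE eq_sym; case: eqVneq => [<-|nm]; first by rewrite dfwith_in.
    by rewrite dfwith_out.
  apply: kop_comp_l => u u1; apply: (finite_dimensional_subseq (M := 1)) => // j.
  by rewrite /= qE (le_trans (rnorm_lpcoord _ _)).
exists (fun m => \sum_(n < m) pr n); split=> [m x n|fdF m]; last first.
  by apply: kop_sum => n _; exact: (prE n).2.
rewrite bop_sumE lpcoord_sum; have [nm|mn] := ltnP n m.
  rewrite (bigD1 (Ordinal nm))//= (prE n).1 eqxx big1 ?addr0// => i /eqP ni.
  by rewrite (prE i).1; case: eqP => // e; exfalso; apply: ni; exact: val_inj.
rewrite big1// => i _; rewrite (prE i).1; case: eqP => // e.
by move: mn; rewrite e leqNgt ltn_ord.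
Qed.

(** The [r]-th powers are compared on partial sums of different lengths for [x] and [y], so that the
    two suprema can be taken one after the other. *)
Lemma lpsum_split (x y z : W) :
  (forall n, rnorm (lpcoord z n) `^ r = rnorm (lpcoord x n) `^ r + rnorm (lpcoord y n) `^ r) ->
  rnorm z = norm2 r%:E (rnorm x) (rnorm y).
Proof.
move=> zE.
have sE L : ell_sum (fun n => rnorm (lpcoord z n)) L =
    ell_sum (fun n => rnorm (lpcoord x n)) L + ell_sum (fun n => rnorm (lpcoord y n)) L.
  rewrite /ell_sum -big_split /=; apply: eq_bigr => i _.
  by rewrite !ger0_norm ?rnorm_ge0.
have mono (w : W) L L' : (L <= L')%N ->
    ell_sum (fun n => rnorm (lpcoord w n)) L <= ell_sum (fun n => rnorm (lpcoord w n)) L'.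
  move=> LL; rewrite /ell_sum (big_ord_widen L' (fun n => `|rnorm (lpcoord w n)| `^ r) LL).
  by rewrite big_mkcond /=; apply: ler_sum => i _; case: ifP => // _; rewrite powR_ge0.
have h1 : rnorm z `^ r <= rnorm x `^ r + rnorm y `^ r.
  apply: lpsum_sum_ub; first by rewrite addr_ge0 ?powR_ge0.
  by move=> L; rewrite sE lerD ?lpsum_sum_le.
have h2 L L' : ell_sum (fun n => rnorm (lpcoord x n)) L +
    ell_sum (fun n => rnorm (lpcoord y n)) L' <= rnorm z `^ r.
  apply: le_trans (lpsum_sum_le z (maxn L L')); rewrite sE.
  by apply: lerD; apply: mono; rewrite ?leq_maxl ?leq_maxr.
have ge0 (w : W) L := ell_sum_ge0 r (fun n => rnorm (lpcoord w n)) L.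
have h3 L' : rnorm x `^ r <= rnorm z `^ r - ell_sum (fun n => rnorm (lpcoord y n)) L'.
  apply: lpsum_sum_ub => [|L]; first by have := h2 0%N L'; have := ge0 x 0%N; lra.
  by have := h2 L L'; lra.
have h4 : rnorm y `^ r <= rnorm z `^ r - rnorm x `^ r.
  apply: lpsum_sum_ub => [|L]; first by have := h3 0%N; have := ge0 y 0%N; lra.
  by have := h3 L; lra.
rewrite /norm2 !ger0_norm ?rnorm_ge0//.
rewrite (_ : _ + _ = rnorm z `^ r); last by apply/le_anti; apply/andP; split; lra.
by rewrite powRVK ?rnorm_ge0.
Qed.

Lemma lpsum_model : (forall n, finite_dimensional (F n)) -> ell_model r%:E W.
Proof.
move=> fdF; have [P [PE kP]] := lpcut_ex; exists P.
have r00 : (0 : R) `^ r = 0 by rewrite powR0// gt_eqF.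
have split1 m v w : rnorm (P m v + (w - P m w)) =
    norm2 r%:E (rnorm (P m v)) (rnorm (w - P m w)).
  apply: lpsum_split => n; rewrite lpcoordD lpcoordB !PE.
  by case: ifP => _; rewrite ?subrr ?subr0 ?addr0 ?add0r rnorm0 r00 ?addr0 ?add0r.
have wE m w : rnorm w = norm2 r%:E (rnorm (P m w)) (rnorm (w - P m w)).
  by rewrite -split1 subrKC.
split=> [m w|w|//|]; last exact: kP.
  rewrite [leRHS](wE m) -[X in X <= _]ger0_norm ?rnorm_ge0//.
  rewrite /norm2 -[leLHS](powRVK r1)//; apply: ge0_ler_powR.
  - by rewrite invr_ge0 ltW.
  - by rewrite nnegrE powR_ge0.
  - by rewrite nnegrE addr_ge0 ?powR_ge0.
  - by rewrite lerDl powR_ge0.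
move=> e e0; have er : 0 < e / 2 by rewrite divr_gt0.
have err : 0 < (e / 2) `^ r by rewrite powR_gt0.
have [L HL] : exists L, rnorm w `^ r - (e / 2) `^ r < ell_sum (fun n => rnorm (lpcoord w n)) L.
  apply: contrapT => /forallNP H.
  have := @lpsum_sum_ub w (rnorm w `^ r - (e / 2) `^ r).
  have H' L : ell_sum (fun n => rnorm (lpcoord w n)) L <= rnorm w `^ r - (e / 2) `^ r.
    by rewrite leNgt; exact/negP.
  move=> /(_ (le_trans (ell_sum_ge0 _ _ 0) (H' 0%N)) H'); lra.
exists L => m Lm; rewrite rnormBC.
apply: (@le_lt_trans _ _ (e / 2)); last by lra.
rewrite -(ler_powRr r1) ?rnorm_ge0 ?(ltW er)//.
have h : rnorm w `^ r = rnorm (P m w) `^ r + rnorm (w - P m w) `^ r.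
  have := wE m w; rewrite /norm2 !ger0_norm ?rnorm_ge0// => ->.
  by rewrite powRK// addr_ge0 ?powR_ge0.
have h2 : ell_sum (fun n => rnorm (lpcoord w n)) L <= rnorm (P m w) `^ r.
  apply: le_trans (lpsum_sum_le (P m w) L); rewrite le_eqVlt; apply/orP; left; apply/eqP.
  by apply: eq_bigr => i _; rewrite PE (leq_trans (ltn_ord i) Lm).
lra.
Qed.

End LpSumModel.

Section CZeroModel.
Context {R : realType} {k : scalar_kind}.
Notation K := (kfield R k).
Notation W := (Defs.czero R k : normedModType K).

Definition c0coord (x : W) n : K^o := czero_seq x n.

Lemma rnorm_czero (x : W) : rnorm x = czero_norm x.
Proof. by rewrite /rnorm /Num.norm /= kofRK. Qed.

Lemma rnorm_c0coord (x : W) n : rnorm (c0coord x n) <= rnorm x.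
Proof. by rewrite rnorm_czero; exact: czero_norm_ge. Qed.

Lemma c0_norm_le (x : W) M : (forall n, rnorm (c0coord x n) <= M) -> rnorm x <= M.
Proof. by rewrite rnorm_czero; exact: czero_norm_le. Qed.

Lemma c0coord_cv (x : W) : cv (c0coord x) 0.
Proof. by apply/cvP; have := czero_proof x; rewrite inE. Qed.

Lemma mk_czero (x : nat -> K^o) : cv x 0 -> exists w : W, forall n, c0coord w n = x n.
Proof.
move=> /cvP x0; have xp : x \in @czero_pred R k by rewrite inE.
by exists (CZero xp).
Qed.

Lemma czero_ext (x y : W) : (forall n, c0coord x n = c0coord y n) -> x = y.
Proof. by move=> xy; apply/val_inj/funext. Qed.

Lemma c0coordD x y n : c0coord (x + y) n = c0coord x n + c0coord y n. Proof. by []. Qed.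
Lemma c0coordZ a x n : c0coord (a *: x) n = a *: c0coord x n. Proof. by []. Qed.
Lemma c0coordB x y n : c0coord (x - y) n = c0coord x n - c0coord y n. Proof. by []. Qed.

Lemma c0cut_ex m : exists P : bop W W,
  forall x n, c0coord (P x) n = if (n < m)%N then c0coord x n else 0.
Proof.
have /choice[T TE] (x : W) : exists w : W, forall n, c0coord w n = if (n < m)%N then
  c0coord x n else 0.
  apply: mk_czero => e e0; exists m => n mn.
  by rewrite ltnNge mn /= subr0 rnorm0.
have lT : linear T.
  move=> a x y; apply: czero_ext => n; rewrite c0coordD c0coordZ !TE.
  by case: ifP => _; rewrite ?scaler0 ?addr0.
have [|P PE] := @mk_bop _ _ _ _ T 1 lT; last by exists P => x n; rewrite PE TE.
move=> x; rewrite mul1r; apply: c0_norm_le => n; rewrite TE.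
by case: ifP => _; rewrite ?rnorm_c0coord// rnorm0 rnorm_ge0.
Qed.

Lemma czero_model : ell_model +oo%E W.
Proof.
have /choice[P PE] m := c0cut_ex m; exists P.
split=> [m w|w e e0|m v w|m].
- by apply: c0_norm_le => n; rewrite PE; case: ifP => _; rewrite ?rnorm_c0coord// rnorm0 rnorm_ge0.
- have e2 : 0 < e / 2 by rewrite divr_gt0.
  have [m Hm] := c0coord_cv w e2; exists m => m' mm'.
  apply: (@le_lt_trans _ _ (e / 2)); last by lra.
  apply: c0_norm_le => n; rewrite c0coordB PE; case: ltnP => mn.
    by rewrite subrr rnorm0 ltW.
  rewrite sub0r rnormN -[c0coord w n]subr0 ltW// Hm//.
  exact: leq_trans mn.
- rewrite /norm2 !ger0_norm ?rnorm_ge0//; apply/le_anti/andP; split.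
    apply: c0_norm_le => n; rewrite c0coordD c0coordB le_max.
    have := rnorm_c0coord (P m v) n; have := rnorm_c0coord (w - P m w) n.
    rewrite c0coordB !PE; case: ifP => _.
      by rewrite subrr addr0 => _ ->.
    by rewrite subr0 add0r => ->; rewrite orbT.
  rewrite ge_max; apply/andP; split; apply: c0_norm_le => n.
    apply: le_trans (rnorm_c0coord (P m v + (w - P m w)) n).
    rewrite c0coordD c0coordB !PE; case: ifP => _; first by rewrite subrr addr0.
    by rewrite rnorm0 rnorm_ge0.
  apply: le_trans (rnorm_c0coord (P m v + (w - P m w)) n).
  rewrite [in leRHS]c0coordD c0coordB !PE; case: ifP => _; last by rewrite add0r.
  by rewrite subrr rnorm0 rnorm_ge0.
- move=> u u1.
  have [||j s si|s si Hs] := @diagonal_subseq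
      (fun j s => exists l, cv (fun n => c0coord (u (s n)) j) l).
  + by move=> j s t ti [l Hl]; exists l; exact: (cv_sub ti Hl).
  + by move=> j s n [l Hl]; exists l; exact: (@cv_tail _ _ _ (fun n => c0coord (u (s n)) j) _ _ Hl).
  + have [n|t [l [ti Hl]]] := @scalar_subseq R k (fun n => c0coord (u (s n)) j) 1.
      exact: le_trans (rnorm_c0coord _ _) (u1 _).
    by exists t => //; exists l.
  have /choice[l Hl] := Hs.
  have [|w wE] := @mk_czero (fun n => if (n < m)%N then l n else 0).
    by move=> e e0; exists m => n mn; rewrite ltnNge mn /= subr0 rnorm0.
  exists s, w; split=> // e e0; have e2 : 0 < e / 2 by rewrite divr_gt0.
  have /choice[n0 Hn0] j := Hl j _ e2.
  exists (\sum_(j < m) n0 j)%N => n nn.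
  apply: (@le_lt_trans _ _ (e / 2)); last by lra.
  apply: c0_norm_le => j; rewrite c0coordB /= PE wE; case: ltnP => jm; last first.
    by rewrite subrr rnorm0 ltW.
  apply/ltW/Hn0; apply: leq_trans nn; rewrite (bigD1 (Ordinal jm))//=.
  exact: leq_addr.
Qed.

End CZeroModel.

Section AlmostIsometric.
Context {R : realType} {k : scalar_kind}.
Notation K := (kfield R k).
Implicit Types X Y : normedModType K.

Lemma banach_mazur_lt X Y (e : R) : (banach_mazur X Y < e%:E)%E ->
  exists (T : bop X Y) (S : bop Y X), [/\ cancel T S, cancel S T & opnorm T * opnorm S < e].
Proof.
move=> /ereal_inf_lt[_ [[T S] /= [TS ST] <-]]; rewrite lte_fin => lte.
by exists T, S.
Qed.

Lemma banach_mazur_le X Y (T : bop X Y) (S : bop Y X) : cancel T S -> cancel S T ->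
  (banach_mazur X Y <= (opnorm T * opnorm S)%:E)%E.
Proof. by move=> TS ST; apply: ereal_inf_lbound; exists (T, S). Qed.

(** The isomorphism is multiplied by the norm of its inverse, which turns the lower constant into 1
    and the upper one into the product of the two norms. *)
Lemma cssub_embeds (W : normedModType K) (U : closed_subspace W) X (e : R) :
  0 < e -> (banach_mazur X (cssub U) < (1 + e)%:E)%E ->
  exists T : bop X W, forall x, rnorm x <= rnorm (T x) <= (1 + e) * rnorm x.
Proof.
move=> e0 /banach_mazur_lt[T [S [TS _ TSe]]].
pose a := opnorm S; have a0 : 0 <= a := opnorm_ge0 _.
have eq x : rnorm (kofR a *: cssub_val (T x)) = a * rnorm (T x).
  by rewrite rnormZ rnorm_kofR ger0_norm.
have ub x : a * rnorm (T x) <= (1 + e) * rnorm x.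
  apply: (@le_trans _ _ ((opnorm T * a) * rnorm x)).
    by rewrite [opnorm T * a]mulrC -mulrA ler_wpM2l// opnormP.
  by rewrite ler_wpM2r ?rnorm_ge0// ltW.
have [|x|T2 T2E] := @mk_bop R k X W (fun x => kofR a *: cssub_val (T x)) (1 + e).
- move=> b x y; rewrite (bop_linear T).
  by rewrite [cssub_val _]/= -[LHS]/(kofR a *: (b *: cssub_val (T x) + cssub_val (T y)))
    scalerDr !scalerA mulrC.
- by rewrite eq.
exists T2 => x; rewrite T2E eq ub andbT -{1}(TS x); exact: opnormP.
Qed.

Lemma lp_models_embed (p : \bar R) X : (1 < p)%E ->
  almost_isometric_to_member (lp_models p) X -> almost_embeds p X.
Proof.
move=> p_gt1 aX e e0; have [Y mY XY] := aX e e0.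
case: p p_gt1 mY {aX} => [r|_|//] /= => [_ [r1 [F [U [fF YU]]]]|[U YU]].
- rewrite {}YU in XY; have [T TP] := cssub_embeds e0 XY.
  by exists (lpsum r1 F : normedModType K), T; split=> //; exact: lpsum_model.
- rewrite {}YU in XY; have [T TP] := cssub_embeds e0 XY.
  by exists (Defs.czero R k : normedModType K), T; split=> //; exact: czero_model.
Qed.

Lemma compact_M_ideal_of_models (p : \bar R) (p_gt1 : (1 < p)%E)
    (X : completeNormedModType K) : separable X ->
  metric_compact_approximation X -> almost_isometric_to_member (lp_models p) X ->
  let Z : normedModType K := psum (ltW p_gt1) X X in
  M_ideal (compact_op : set (bop Z Z)).
Proof.
move=> sX mX /(lp_models_embed p_gt1) aX Z.
have [S [kS S1 Scv]] := approximating_sequence sX mX.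
apply: (@psum_compact_M_ideal _ _ _ p_gt1 X S) => //.
- exact: (almost_embeds_mp p_gt1).
- exact: (almost_embeds_wcauchy p_gt1).
- exact: complete_seq.
Qed.

End AlmostIsometric.

(** * Rosenthal's theorem *)

Lemma frequent_value (F : finType) (g : nat -> F) :
  exists2 t, incr t & exists v, forall n, g (t n) = v.
Proof.
have [v Hv] : exists v, forall N, exists2 n, (N <= n)%N & g n = v.
  apply: contrapT => /forallNP h.
  have /choice[N HN] (v : F) : exists N, forall n, (N <= n)%N -> g n <> v.
    have /existsNP[N HN] := h v; exists N => n Nn gv.
    by apply: HN; exists n.
  by apply: (HN (g (\max_v N v)) (\max_v N v)) => //; exact: leq_bigmax.
have [t ti gt] := subseq_of_frequently Hv.
by exists t => //; exists v.
Qed.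

Section Independence.
Variables (T : Type) (A B : nat -> set T).

(* No point of [S] lies in infinitely many [A (m n)] and in infinitely many [B (m n)]. *)
Definition separates_not (S : set T) (m : nat -> nat) := forall t, S t ->
  (exists N, forall n, (N <= n)%N -> ~ A (m n) t) \/
  (exists N, forall n, (N <= n)%N -> ~ B (m n) t).

Lemma separates_not_sub S m s : incr s -> separates_not S m -> separates_not S (m \o s).
Proof.
move=> si Sm t /Sm[[N HN]|[N HN]]; [left|right]; exists N => n Nn; apply: HN;
  by rewrite (leq_trans Nn)//; exact: incr_ge.
Qed.

Lemma separates_not_tail S m N :
  separates_not S (fun n => m (n + N)%N) -> separates_not S m.
Proof.
move=> Sm t /Sm[[M HM]|[M HM]]; [left|right]; exists (M + N)%N => n Nn;
  have := HM (n - N)%N; rewrite subnK; first [apply; lia|lia].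
Qed.

Definition cell (l : seq nat) (b : nat -> bool) : set T :=
  [set t | forall i, (i < size l)%N -> (if b i then A else B) (nth 0%N l i) t].

(** One sequence [m] serves all the cells: along each of its subsequences every cell still has a
    point lying in infinitely many of the [A] and in infinitely many of the [B]. In particular no
    cell is empty, and this is how independence is read off. *)
Definition splits (l : seq nat) := exists2 m, incr m &
  forall b s, incr s -> ~ separates_not (cell l b) (m \o s).

Lemma cell_rcons l n b t : cell (rcons l n) b t <->
  cell l b t /\ (if b (size l) then A else B) n t.
Proof.
split=> [h|[h1 h2] i]; last first.
  rewrite size_rcons ltnS leq_eqVlt nth_rcons => /orP[/eqP->|il].
    by rewrite ltnn eqxx.
  by rewrite il; exact: h1.
split=> [i il|].
  by have := h i; rewrite size_rcons nth_rcons il; apply; rewrite ltnS ltnW.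
by have := h (size l); rewrite size_rcons nth_rcons ltnn eqxx; apply.
Qed.

(* If no index splits all the cells, a diagonal subsequence and the pigeonhole
   principle produce one cell on which a subsequence no longer separates. *)
Lemma splits_rcons l : splits l -> exists n, splits (rcons l n).
Proof.
move=> [m mi bad]; apply: contrapT => /forallNP nosplit.
pose bits (f : {ffun 'I_(size l).+1 -> bool}) i := f (inord i).
pose Q j s := exists f, separates_not (cell (rcons l (m j)) (bits f)) (m \o s).
have [|j s N|j s si|s si Qs] := @diagonal_subseq Q.
- by move=> j s t ti [f Hf]; exists f; exact: separates_not_sub Hf.
- by move=> [f Hf]; exists f; apply: (separates_not_tail (N := N)).
- apply: contrapT => h; apply: (nosplit (m j)); exists (m \o s); first exact: incr_comp.
  move=> b t ti bt; apply: h; exists t => //.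
  exists [ffun i : 'I_(size l).+1 => b i] => x.
  rewrite cell_rcons => -[xl xm]; apply: bt; rewrite cell_rcons; split.
    by move=> i il; have := xl i il; rewrite /bits ffunE inordK// ltnS ltnW.
  by move: xm; rewrite /bits ffunE inordK.
- have /choice[g gP] := Qs; have [t ti [f gf]] := frequent_value (g \o s).
  apply: (bad (bits f) (s \o t)); first exact: incr_comp.
  move=> x xl.
  have [[j xj]|noj] := pselect (exists j, (if bits f (size l) then A else B) (m (s (t j))) x).
    have := gP (s (t j)); rewrite -[g _]/((g \o s) (t j)) gf.
    move=> /(separates_not_sub ti); apply; rewrite cell_rcons; split=> //.
  move: noj; case: (bits f _) => /forallNP noj; [left|right]; exists 0%N => n _;
    exact: noj.
Qed.

(** Rosenthal's dichotomy. If every subsequence fails to separate on the whole set, the empty list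
    splits, and [splits_rcons] extends it index by index; an empty cell would be separated
    vacuously. *)
Lemma independent_or_separates_not :
  (exists2 s, incr s & separates_not setT s) \/
  (exists G : nat -> nat, forall n (b : nat -> bool), exists t, forall i, (i < n)%N ->
     (if b i then A else B) (G i) t).
Proof.
have [h|nos] := pselect (exists2 s, incr s & separates_not setT s); [by left|right].
have spl0 : splits [::].
  exists id => // b s si h; apply: nos; exists s => // t _; apply: h.
  by move=> i; rewrite ltn0.
have [|G GP] := @prefix_choice nat (fun l n => splits l -> splits (rcons l n)).
  move=> l; have [/splits_rcons[n ln]|h] := pselect (splits l); first by exists n.
  by exists 0%N => /h.
exists G => n b.
have [m mi bad] : splits (mkseq G n).
  by elim: n => // n IH; rewrite mkseqS; exact: GP.
apply: contrapT => /forallNP h; apply: (bad b id) => // t Ct; exfalso; apply: (h t) => i il.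
by have := Ct i; rewrite size_mkseq nth_mkseq//; apply.
Qed.

End Independence.

(** * Weakly Cauchy subsequences and independent sequences *)

Section WeaklyCauchy.
Context {R : realType} {k : scalar_kind}.
Notation K := (kfield R k).
Notation dual E := (bop E (K^o : normedModType K)).
Implicit Types E : normedModType K.

Lemma scalar_dense : exists d : nat -> K^o,
  forall x (e : R), 0 < e -> exists n, rnorm (d n - x) < e.
Proof.
have rat_near (x e : R) : 0 < e -> exists q : rat, `|ratr q - x| < e.
  move=> e0; have [|q] := @rat_in_itvoo R (x - e) (x + e); first lra.
  by rewrite in_itv /= => /andP[h1 h2]; exists q; rewrite ltr_norml; apply/andP; split; lra.
case: (k).
  exists (fun n => ratr (odflt 0 (unpickle n : option rat))) => x e /(rat_near x)[q hq].
  by exists (pickle q); rewrite pickleK.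
exists (fun n => let q := odflt (0, 0) (unpickle n : option (rat * rat)) in
  Complex (ratr q.1) (ratr q.2) : R[i]) => -[x y] e e0.
have e2 : 0 < e / 2 by rewrite divr_gt0.
have [q hq] := rat_near x _ e2; have [r hr] := rat_near y _ e2.
exists (pickle (q, r)); rewrite pickleK; apply: (le_lt_trans (rnorm_complex_le _)).
rewrite /=; lra.
Qed.

Lemma two_clusters (u : nat -> K^o) M : (forall n, rnorm (u n) <= M) -> ~ cauchyseq u ->
  exists l l' s s', [/\ l != l', incr s, incr s', cv (u \o s) l & cv (u \o s') l'].
Proof.
move=> uM ncu; have [s [l [si sl]]] := scalar_subseq uM.
have [e e0 he] : exists2 e : R, 0 < e & forall N, exists2 n, (N <= n)%N & e <= rnorm (u n - l).
  apply: contrapT => h; apply: ncu; apply: (@cv_cauchy _ _ _ _ l) => e e0.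
  apply: contrapT => /forallNP h'; apply: h; exists e => // N.
  have /existsNP[n /not_implyP[Nn hn]] := h' N; exists n => //.
  by rewrite leNgt; exact/negP.
have [t ti he'] := subseq_of_frequently he.
have [t' [l' [ti' sl']]] := @scalar_subseq _ _ (u \o t) M (fun n => uM _).
exists l, l', s, (t \o t'); split=> //; last exact: incr_comp.
apply/eqP => ll; subst l'; have [N HN] := sl' _ e0.
by have := HN N (leqnn _); have := he' (t' N); rewrite /=; lra.
Qed.

Lemma cauchyZ (u : nat -> K^o) a : cauchyseq u -> cauchyseq (fun n => a *: u n).
Proof. by move=> /scalar_complete[l ul]; apply: cv_cauchy; exact: cvZ ul. Qed.

Definition independent_seq E (y : nat -> E) (d1 d2 : K) :=
  forall n (b : nat -> bool), exists2 f : dual E, opnorm f <= 1 &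
    forall i, (i < n)%N -> rnorm (f (y i) - (if b i then d1 else d2)) < rnorm (d1 - d2) / 20.

(** Only countably many pairs of centres are needed, so a single diagonal subsequence rules out, for
    all pairs at once, functionals visiting both discs infinitely often. A functional with two
    cluster values would visit the discs around centres close to them. *)
Lemma wcauchy_or_independent E (x : nat -> E) M : (forall n, rnorm (x n) <= M) ->
  (exists2 s, incr s & wcauchy (x \o s)) \/
  (exists (y : nat -> E) d1 d2,
     [/\ d1 != d2, forall n, rnorm (y n) <= M & independent_seq y d1 d2]).
Proof.
move=> xM; have [h|noind] := pselect (exists (y : nat -> E) d1 d2,
  [/\ d1 != d2, forall n, rnorm (y n) <= M & independent_seq y d1 d2]); [by right|left].
have [d dP] := scalar_dense.
pose pr j := odflt (0, 0)%N (unpickle j : option (nat * nat)).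
pose near j c n : set (dual E) := [set f | opnorm f <= 1 /\
  rnorm (f (x n) - d c) < rnorm (d (pr j).1 - d (pr j).2) / 20].
pose A j := near j (pr j).1; pose B j := near j (pr j).2.
pose Q j s := d (pr j).1 = d (pr j).2 \/ separates_not (A j) (B j) setT s.
have [|j s N|j s si|s si Qs] := @diagonal_subseq Q.
- by move=> j s t ti [|h]; [left|right; exact: separates_not_sub h].
- by move=> [|h]; [left|right; apply: (separates_not_tail (N := N))].
- have [dd|/eqP dd] := pselect (d (pr j).1 = d (pr j).2); first by exists id => //; left.
  have [[t ti ht]|[G GP]] := independent_or_separates_not (A j \o s) (B j \o s).
    by exists t => //; right.
  exfalso; apply: noind; exists (x \o s \o G), (d (pr j).1), (d (pr j).2); split=> [|n|n
    b]; [exact: dd|exact: xM|].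
  (* For [n = 0] the dichotomy says nothing about [f], not even about its norm, hence the zero
     functional. *)
  have [f fP] := GP n b; exists (if (0 < n)%N then f else 0).
    case: ifP => [n0|_]; last by apply: opnorm_le => // y; rewrite bop_zeroE rnorm0 mul1r rnorm_ge0.
    by have := fP _ n0; case: (b 0%N) => -[].
  by move=> i il; rewrite (leq_ltn_trans _ il)//; have := fP i il; case: (b i) => -[].
exists s => // f; pose c := opnorm f + 1; have c0 : 0 < c by rewrite ltr_wpDl ?opnorm_ge0.
pose g := kofR c^-1 *: f.
have fg n : f (x (s n)) = kofR c *: g (x (s n)).
  by rewrite bop_scaleE scalerA -kofRM mulfV ?gt_eqF// kofR1 scale1r.
have g1 : opnorm g <= 1.
  rewrite opnormZ rnorm_kofR ger0_norm ?invr_ge0 ?(ltW c0)// mulrC ler_pdivrMr// mul1r.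
  by rewrite /c lerDl.
suff cg : cauchyseq (g \o (x \o s)).
  by have := cauchyZ (kofR c) cg; congr cauchyseq; apply/funext => n /=; rewrite -fg.
apply: contrapT => ncg.
have gM n : rnorm ((g \o (x \o s)) n) <= M.
  by rewrite (le_trans _ (xM (s n)))// -[leRHS]mul1r; exact: opnormP1.
have [l [l' [s1 [s2 [ll si1 si2 gl gl']]]]] := two_clusters gM ncg.
(* The centres are found within a hundredth of [l] and [l']. Then the values eventually lie within
   [2 / 100] of the centres, relative to the distance of the clusters, and the radius is at least
   [98 / 2000]. *)
have dl : 0 < rnorm (l - l') / 100.
  rewrite divr_gt0// lt_neqAle rnorm_ge0 andbT; apply/eqP => /esym/rnorm_eq0/eqP.
  by rewrite subr_eq0 => /eqP le; rewrite le eqxx in ll.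
have [i1 h1] := dP l _ dl; have [i2 h2] := dP l' _ dl.
have prE : pr (pickle (i1, i2)) = (i1, i2) by rewrite /pr pickleK.
have dd : 98 / 100 * rnorm (l - l') <= rnorm (d i1 - d i2).
  have := rnorm_triangle l (d i1) l'; have := rnorm_triangle (d i1) (d i2) l'.
  by rewrite (rnormBC l (d i1)); lra.
have big c0' t tl i : incr t -> cv (g \o (x \o s) \o t) tl -> rnorm (d i - tl) < rnorm (l -
  l') / 100 ->
    c0' = i -> forall N, exists2 n, (N <= n)%N & near (pickle (i1, i2)) c0' (s n) g.
  move=> ti ct di -> N; have [N1 HN] := ct _ dl; exists (t (maxn N N1)).
    by rewrite (leq_trans (leq_maxl N N1))//; exact: incr_ge.
  split=> //; rewrite prE /=; have := HN (maxn N N1) (leq_maxr _ _).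
  have := rnorm_triangle (g (x (s (t (maxn N N1))))) tl (d i).
  by rewrite (rnormBC tl (d i)) /=; lra.
have [|] := Qs (pickle (i1, i2)).
  rewrite prE /= => dE; move: dd; rewrite dE subrr rnorm0; lra.
have EA : A (pickle (i1, i2)) = near (pickle (i1, i2)) i1 by rewrite /A prE.
have EB : B (pickle (i1, i2)) = near (pickle (i1, i2)) i2 by rewrite /B prE.
rewrite EA EB => /(_ g I)[[N HN]|[N HN]].
  by have [n Nn] := big _ _ _ i1 si1 gl h1 erefl N; exact: HN.
by have [n Nn] := big _ _ _ i2 si2 gl' h2 erefl N; exact: HN.
Qed.

End WeaklyCauchy.

Section LowerEstimate.
Context {R : realType} {k : scalar_kind}.
Notation K := (kfield R k).
Notation dual E := (bop E (K^o : normedModType K)).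
Implicit Types E : normedModType K.

(** The rotation is ['i] for complex scalars and 1 for real ones: estimates of real parts, made once
    for 1 and once for [w], then control absolute values in both cases. *)
Lemma imaginary_rotation : exists2 w : K, rnorm w = 1 &
  forall c : K^o, rnorm c <= `|kRe c| + `|kRe (w *: c)|.
Proof.
case: (k); first by exists 1; [exact: rnorm1|move=> c; rewrite scale1r /kRe /rnorm /= lerDl].
exists ('i%C : R[i]).
  by rewrite /rnorm /= expr0n /= add0r expr1n sqrtr1.
move=> c; apply: le_trans (rnorm_complex_le _) _; rewrite lerD2l.
by case: c => a b; rewrite -[_ *: _]/(_ * _) /kRe /= mul0r mul1r sub0r normrN.
Qed.

Lemma kRe0 : kRe (0 : K) = 0.
Proof. by rewrite -(kofR0 (k := k)) kofRK. Qed.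

Lemma kRe_ge (x : K^o) : - rnorm x <= kRe x.
Proof.
have := kRe_le (- x); rewrite rnormN.
by have := kReD x (- x); rewrite subrr kRe0; lra.
Qed.

(* Discs around [d1] and [d2] rather than real half-planes, and a rotation [w],
   make the estimate work for complex scalars. *)
Lemma independent_lower_at E (y : nat -> E) d1 d2 (w : K) n (a : nat -> K^o) :
  independent_seq y d1 d2 -> rnorm w = 1 ->
  \sum_(i < n) (`|kRe (w *: a i)| * rnorm (d1 - d2) - rnorm (a i) * (rnorm (d1 - d2) / 10))
    <= 2 * rnorm (\sum_(i < n) a i *: y i).
Proof.
move=> ind w1; set del := rnorm (d1 - d2).
pose b i := 0 <= kRe (w *: a i).
have [f f1 fP] := ind n b; have [g g1 gP] := ind n (fun i => ~~ b i).
have [t t1 tE] := phase (d1 - d2).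
pose h := f - g.
apply: (@le_trans _ _ (kRe ((w * t) *: h (\sum_(i < n) a i *: y i)))); last first.
  apply: le_trans (kRe_le _) _; rewrite rnormZ.
  have -> : rnorm (w * t) = 1 by have := rnormZ w (t : K^o); rewrite w1 t1 mul1r.
  rewrite mul1r /h bop_subE (le_trans (rnormB _ _))// (_ : 2 = 1 + 1)// mulrDl.
  by rewrite lerD// opnormP1.
rewrite (lin_sum (bop_linear h)) scaler_sumr.
rewrite (big_morph kRe kReD kRe0); apply: ler_sum => i _.
rewrite bopZ scalerA.
have -> : w * t * a i = w * a i * t by rewrite mulrAC.
rewrite -scalerA.
pose s : R := if b i then 1 else -1.
pose err : K^o := t *: h (y i) - kofR s *: (kofR del : K^o).
have err_le : rnorm err <= del / 10.
  have -> : err = t *: (h (y i) - kofR s *: ((d1 - d2) : K^o)).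
    by rewrite /err [RHS]scalerBr; congr (_ - _); rewrite /del -tE !scalerA mulrC.
  rewrite rnormZ t1 mul1r.
  have -> : h (y i) - kofR s *: ((d1 - d2) : K^o) =
      (f (y i) - (if b i then d1 else d2)) - (g (y i) - (if ~~ b i then d1 else d2)).
    rewrite /h bop_subE [RHS]subrBB; congr (_ - _); rewrite /s.
    by case: (b i) => /=; rewrite ?kofRN kofR1 ?scaleN1r ?scale1r ?opprB.
  by have := rnormB (f (y i) - (if b i then d1 else d2))
    (g (y i) - (if ~~ b i then d1 else d2)); have := fP i (ltn_ord i);
    have := gP i (ltn_ord i); rewrite -/del; lra.
have -> : t *: h (y i) = kofR s *: (kofR del : K^o) + err by rewrite /err addrC subrK.
rewrite scalerDr kReD.
have -> : kRe ((w * a i) *: (kofR s *: (kofR del : K^o))) = `|kRe (w *: a i)| * del.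
  have -> : (w * a i) *: (kofR s *: (kofR del : K^o)) = kofR (del * s) *: (w *: a i).
    by rewrite kofRM -![_ *: _]/(_ * _) [LHS]mulrC [kofR s * _]mulrC.
  rewrite kReZ /s /b; case: ifP => [h0|/negbT]; first by rewrite mulr1 ger0_norm// mulrC.
  by rewrite -ltNge => h0; rewrite mulrN1 ltr0_norm// mulrC mulNr mulrN.
rewrite lerD2l; apply: le_trans (kRe_ge _); rewrite rnormZ lerN2.
rewrite -[(w * a i)]/(w *: a i) rnormZ w1 mul1r.
by rewrite ler_wpM2l// rnorm_ge0.
Qed.

Lemma independent_lower E (y : nat -> E) d1 d2 : d1 != d2 -> independent_seq y d1 d2 ->
  exists2 c : R, 0 < c & forall n (a : nat -> K^o),
    c * \sum_(i < n) rnorm (a i) <= rnorm (\sum_(i < n) a i *: y i).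
Proof.
move=> dd ind; set del := rnorm (d1 - d2).
have del0 : 0 < del.
  rewrite lt_neqAle rnorm_ge0 andbT; apply/eqP => /esym/rnorm_eq0/eqP.
  by rewrite subr_eq0 (negbTE dd).
have [w w1 wP] := imaginary_rotation.
(* The estimates for 1 and for [w] are added: [(1 - 2 / 10) * del] times the sum is at most 4 times
   the norm. *)
exists (del / 5); first by rewrite divr_gt0.
move=> n a.
have h1 := independent_lower_at n a ind rnorm1.
have h2 := independent_lower_at n a ind w1.
have h3 : del * \sum_(i < n) rnorm (a i) <=
    \sum_(i < n) (`|kRe (1 *: a i)| * del) + \sum_(i < n) (`|kRe (w *: a i)| * del).
  rewrite -big_split mulr_sumr; apply: ler_sum => i _ /=.
  by rewrite -mulrDl mulrC ler_wpM2r ?(ltW del0)// scale1r wP.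
move: h1 h2; rewrite !sumrB -!mulr_suml -/del.
move: h3; rewrite -!mulr_suml.
by lra.
Qed.

End LowerEstimate.

(** * Copies of [ell1] as ranges of operators bounded below *)

Section BoundedBelow.
Context {R : realType} {k : scalar_kind}.
Notation K := (kfield R k).
Implicit Types X W : normedModType K.

Lemma bounded_below_inj X W (T : bop X W) (c : R) : 0 < c ->
  (forall x, c * rnorm x <= rnorm (T x)) -> injective T.
Proof.
move=> c0 cT x y Txy; apply/eqP; rewrite -subr_eq0; apply/eqP/rnorm_eq0/le_anti.
rewrite rnorm_ge0 andbT -(ler_pM2l c0) mulr0.
by apply: le_trans (cT _) _; rewrite bopB Txy subrr rnorm0.
Qed.

Lemma range_closed X W (T : bop X W) (c : R) : seq_complete X -> 0 < c ->
  (forall x, c * rnorm x <= rnorm (T x)) -> closed [set` mem (range T) : {pred W}].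
Proof.
move=> cX c0 cT y /closure_rnorm cly.
have /choice[x xP] (n : nat) : exists x, rnorm (T x - y) < n.+1%:R^-1.
  have n0 : 0 < n.+1%:R^-1 :> R by rewrite invr_gt0.
  have [z] := cly _ n0; rewrite /= inE => -[x _ <-] h; by exists x.
have Ty : cv (T \o x) y.
  move=> e /(inv_lt (R := R))[N HN]; exists N => n /HN; by apply: lt_trans; exact: xP.
have [|l xl] := cX x.
  move=> e e0; have [N HN] := cv_cauchy Ty (mulr_gt0 c0 e0).
  exists N => m n Nm Nn; rewrite -(ltr_pM2l c0); apply: le_lt_trans (cT _) _.
  by rewrite bopB; exact: HN.
by rewrite /= inE; exists l => //; exact: cv_unique (bop_cv T xl) Ty.
Qed.

Lemma range_submod X W (T : bop X W) : submod_closed (mem (range T) : {pred W}).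
Proof.
split; first by rewrite inE; exists 0; rewrite ?bop0.
move=> a _ _ /set_mem[x _ <-] /set_mem[y _ <-]; rewrite inE.
by exists (a *: x + y); rewrite // (bop_linear T).
Qed.

Lemma bounded_below_iso X W (T : bop X W) (c : R) : seq_complete X -> 0 < c ->
  (forall x, c * rnorm x <= rnorm (T x)) ->
  exists (U : closed_subspace W) (T' : bop X (cssub U)) (S : bop (cssub U) X),
    [/\ cancel T' S, cancel S T', forall x, rnorm (T' x) = rnorm (T x) &
        forall y, c * rnorm (S y) <= rnorm y].
Proof.
move=> cX c0 cT.
pose U := ClosedSubspace (range_submod T) (range_closed cX c0 cT).
have inU x : T x \in cs_pred U by rewrite inE; exists x.
have [|x|T' TE] := @mk_bop R k X (cssub U) (fun x => CSSub (inU x)) (opnorm T).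
- by move=> a x y; apply: val_inj; rewrite /= (bop_linear T).
- exact: opnormP.
have nT x : rnorm (T' x) = rnorm (T x) by rewrite TE.
have /choice[f fP] (y : cssub U) : exists x, T x = cssub_val y.
  by case: y => y yU /=; move: (yU); rewrite inE => -[x _ <-]; exists x.
have inj := bounded_below_inj c0 cT.
have nf y : c * rnorm (f y) <= rnorm y by apply: le_trans (cT _) _; rewrite fP.
have [|y|S SE] := @mk_bop R k (cssub U) X f c^-1.
- by move=> a x y; apply: inj; rewrite fP (bop_linear T) !fP.
- by rewrite ler_pdivlMl.
exists U, T', S; split=> [x|y||y]; [| |exact: nT|by rewrite SE].
- by apply: inj; rewrite SE fP TE.
- by apply: val_inj; rewrite TE /= SE fP.
Qed.

End BoundedBelow.

Section EllOne.
Context {R : realType} {k : scalar_kind}.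
Notation K := (kfield R k).
Notation W := (ell1 (R := R) (k := k)).
Implicit Types E : normedModType K.

Definition l1coord (x : W) (n : nat) : K^o := lpcoord x n.

Lemma ell_sum1 (a : nat -> K^o) L :
  ell_sum 1 (fun n => rnorm (a n)) L = \sum_(i < L) rnorm (a i).
Proof.
by apply: eq_bigr => i _; rewrite powRr1// ger0_norm// rnorm_ge0.
Qed.

Lemma l1_sum_le (x : W) L : \sum_(i < L) rnorm (l1coord x i) <= rnorm x.
Proof. by rewrite -ell_sum1 (le_trans (lpsum_sum_le _ _))// powRr1// rnorm_ge0. Qed.

Lemma l1_norm_le (x : W) D : 0 <= D ->
  (forall L, \sum_(i < L) rnorm (l1coord x i) <= D) -> rnorm x <= D.
Proof.
move=> D0 xD; rewrite -[leLHS]powRr1 ?rnorm_ge0//; apply: lpsum_sum_ub => // L.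
by have := xD L; rewrite -ell_sum1.
Qed.

Lemma mk_l1 (a : nat -> K^o) D : 0 <= D -> (forall L, \sum_(i < L) rnorm (a i) <= D) ->
  exists w : W, forall n, l1coord w n = a n.
Proof.
move=> D0 aD; apply: (@mk_lpsum R k 1 (lexx 1) (fun=> K^o) a D D0) => L.
by rewrite ell_sum1.
Qed.

Lemma l1coordB (x y : W) n : l1coord (x - y) n = l1coord x n - l1coord y n.
Proof. by []. Qed.

Lemma rcv_sum (f : nat -> nat -> R) (l : nat -> R) L : (forall i, rcv (f i) (l i)) ->
  rcv (fun n => \sum_(i < L) f i n) (\sum_(i < L) l i).
Proof.
move=> fl; elim: L => [|L IH].
  by move=> e e0; exists 0%N => n _; rewrite !big_ord0 subrr normr0.
rewrite big_ord_recr /=; under [fun n => _]funext => n do rewrite big_ord_recr /=.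
exact: rcvB0.
Qed.

Lemma rcv_cst (l : R) : rcv (fun=> l) l.
Proof. by move=> e e0; exists 0%N => n _; rewrite subrr normr0. Qed.

Lemma l1_complete : seq_complete W.
Proof.
move=> u cu; have [M uM] := cauchy_bounded cu.
have /choice[a aP] (i : nat) : exists l, cv (fun n => l1coord (u n) i) l.
  apply: scalar_complete => e /cu[N HN]; exists N => m n Nm Nn.
  by rewrite -l1coordB; apply: le_lt_trans (HN m n Nm Nn); exact: rnorm_lpcoord.
have M0 : 0 <= M := le_trans (rnorm_ge0 _) (uM 0%N).
have [|x xa] := mk_l1 (a := a) M0.
  move=> L; apply: (@rcv_le _ (fun n => \sum_(i < L) rnorm (l1coord (u n) i)) (fun=> M)).
  - by move=> n; apply: le_trans (l1_sum_le _ _) (uM n).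
  - by apply: (@rcv_sum (fun i n => rnorm (l1coord (u n) i)) (fun i => rnorm (a i))) => i;
    exact: cv_norm (aP i).
  - exact: rcv_cst.
exists x => e e0; have e2 : 0 < e / 2 by rewrite divr_gt0.
have [N HN] := cu _ e2; exists N => n Nn.
suff : rnorm (u n - x) <= e / 2 by lra.
apply: l1_norm_le => [|L]; first exact: ltW.
apply: (@rcv_le _ (fun m => \sum_(i < L) rnorm (l1coord (u n) i - l1coord (u (m + N)%N) i))
  (fun=> e / 2)).
- move=> m; apply: le_trans (l1_sum_le (u n - u (m + N)%N) _) _.
  by apply/ltW/HN => //; exact: leq_addl.
- apply: (@rcv_sum (fun i m => rnorm (l1coord (u n) i - l1coord (u (m + N)%N) i)) (fun i =>
  rnorm (l1coord (u n - x) i))) => i.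
  rewrite l1coordB xa.
  apply: (cv_norm (u := fun m => l1coord (u n) i - l1coord (u (m + N)%N) i)).
  apply: cvB; first exact: cv_cst.
  have si : incr (fun m => (m + N)%N) by move=> m; rewrite addSn.
  exact: cv_sub si (aP i).
- exact: rcv_cst.
Qed.

Lemma l1_operator E (y : nat -> E) M : seq_complete E -> (forall n, rnorm (y n) <= M) ->
  exists T : bop W E, forall x, cv (fun n => \sum_(i < n) l1coord x i *: y i) (T x).
Proof.
move=> cE yM; have M0 : 0 <= M := le_trans (rnorm_ge0 _) (yM 0%N).
have bnd (x : W) n : rnorm (\sum_(i < n) l1coord x i *: y i) <= M * rnorm x.
  apply: le_trans (rnorm_sum _ _ _) _.
  apply: (@le_trans _ _ (M * \sum_(i < n) rnorm (l1coord x i))); last first.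
    by rewrite ler_wpM2l// l1_sum_le.
  rewrite mulr_sumr; apply: ler_sum => i _.
  by rewrite rnormZ mulrC ler_wpM2r// rnorm_ge0.
have /choice[f fP] (x : W) : exists l, cv (fun n => \sum_(i < n) l1coord x i *: y i) l.
  pose P n := \sum_(i < n) rnorm (l1coord x i).
  have step n d : rnorm (\sum_(i < n + d) l1coord x i *: y i - \sum_(i < n) l1coord x i *: y i)
      <= M * (P (n + d)%N - P n).
    elim: d => [|d IH]; first by rewrite addn0 !subrr rnorm0 mulr0.
    rewrite addnS big_ord_recr /= addrAC [P _.+1]/P big_ord_recr /= -/(P _).
    apply: le_trans (rnormD _ _) _; rewrite rnormZ.
    have := ler_wpM2l (rnorm_ge0 (l1coord x (n + d))) (yM (n + d)%N).
    move: IH; rewrite !mulrBr mulrDr [M * rnorm _]mulrC; lra.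
  have [l Pl] : exists l, rcv P l.
    have : cvgn P.
      apply: nondecreasing_is_cvgn.
        apply/nondecreasing_seqP => n.
        by rewrite /P big_ord_recr /= lerDl rnorm_ge0.
      by exists (rnorm x) => _ [n _ <-]; exact: l1_sum_le.
    by move=> /cvg_ex[l /= /rcvP]; exists l.
  apply: cE => e e0; have e2 : 0 < e / (2 * (M + 1)) by rewrite divr_gt0// mulr_gt0// ltr_wpDl.
  have [N HN] := Pl _ e2; exists N.
  have half m n : (N <= m)%N -> (m <= n)%N ->
     rnorm (\sum_(i < n) l1coord x i *: y i - \sum_(i < m) l1coord x i *: y i) < e.
    move=> Nm mn; have := step m (n - m)%N; rewrite subnKC// => h.
    apply: le_lt_trans h _.
    have := HN _ Nm; have := HN _ (leq_trans Nm mn); rewrite !ltr_norml => /andP[h1 h2]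
      /andP[h3 h4].
    have : P n - P m <= 2 * (e / (2 * (M + 1))) by lra.
    move=> /(ler_wpM2l M0) h; apply: le_lt_trans h _.
    rewrite (_ : M * _ = e * (M / (M + 1))); last by field; rewrite gt_eqF// ltr_wpDl.
    rewrite -[ltRHS]mulr1 ltr_pM2l// ltr_pdivrMr ?ltr_wpDl//; lra.
  move=> m n Nm Nn; have [mn|/ltnW nm] := leqP m n; last exact: half.
  by rewrite rnormBC; exact: half.
have fM x : rnorm (f x) <= M * rnorm x.
  apply: rcv_le (bnd x) (cv_norm (fP x)) (rcv_cst _).
have [|//|T TE] := @mk_bop R k W E f M; last by exists T => x; rewrite TE.
move=> a x x'; apply: cv_unique (fP _) _.
have := cvD (cvZ a (fP x)) (fP x'); congr cv; apply/funext => n.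
rewrite scaler_sumr -big_split; apply: eq_bigr => i _ /=.
by rewrite scalerA -scalerDl.
Qed.

(** The lower estimate passes from finite sums to the operator mapping the unit vectors to the
    [y n]; its range is closed and isomorphic to [ell1]. *)
Lemma contains_ell1_of_lower E (y : nat -> E) M (c : R) : seq_complete E ->
  (forall n, rnorm (y n) <= M) -> 0 < c ->
  (forall n (a : nat -> K^o), c * \sum_(i < n) rnorm (a i) <= rnorm (\sum_(i < n) a i *: y i)) ->
  contains_ell1 E.
Proof.
move=> cE yM c0 yc; have [T TP] := l1_operator cE yM.
have [|U [T' [S [T'S ST' _ _]]]] := bounded_below_iso (T := T) l1_complete c0.
  move=> x; rewrite mulrC -ler_pdivlMr//; apply: l1_norm_le.
    by rewrite divr_ge0 ?rnorm_ge0// ltW.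
  move=> L; rewrite ler_pdivlMr// mulrC.
  apply: (@rcv_le _ (fun=> c * \sum_(i < L) rnorm (l1coord x i))
    (fun n => rnorm (\sum_(i < n + L) l1coord x i *: y i))) => [n||].
  - apply: le_trans (yc _ (l1coord x)); rewrite ler_pM2l//.
    elim: n => // n IH; rewrite addSn big_ord_recr /=; apply: le_trans IH _.
    by rewrite lerDl rnorm_ge0.
  - exact: rcv_cst.
  - have si : incr (fun m => (m + L)%N) by move=> m; rewrite addSn.
    exact: cv_norm (cv_sub si (TP x)).
by exists U, S, T'.
Qed.

Lemma rosenthal E : seq_complete E -> ~ contains_ell1 E -> wcauchy_property E.
Proof.
move=> cE nE x M xM; have [//|[y [d1 [d2 [dd yM ind]]]]] := wcauchy_or_independent xM.
have [c c0 cP] := independent_lower dd ind.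
by exfalso; apply: nE; exact: contains_ell1_of_lower yM c0 cP.
Qed.

End EllOne.

(** * Limits superior and property (m_p) *)

Section LimSup.
Context {R : realType}.
Implicit Types u : nat -> R.

Lemma limn_sup_cluster u M : (forall n, `|u n| <= M) ->
  exists2 s, incr s & rcv (u \o s) (limn_sup u).
Proof.
move=> uM.
have ub : has_ubound (range u) by exists M => _ [n _ <-]; exact: le_trans (ler_norm _) (uM n).
have lb : has_lbound (range u).
  by exists (- M) => _ [n _ <-]; have := uM n; rewrite ler_norml => /andP[].
have sc : rcv (sups u) (limn_sup u).
  by apply/rcvP; rewrite /limn_sup; have := cvg_sups_inf ub lb => h; rewrite (cvg_lim _ h).
have uble N : has_ubound (sdrop u N) by exact: has_ubound_sdrop.
have /choice[t tP] (j : nat) : exists n, (j <= n)%N /\ `|u n - limn_sup u| < j.+1%:R^-1.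
  have j0 : 0 < j.+1%:R^-1 :> R by rewrite invr_gt0.
  have [N HN] := sc _ j0; pose N' := maxn N j.
  have hi := HN N' (leq_maxl _ _).
  (* Part of the tolerance is already used by the distance of [sups u N'] to the limit; only the
     rest is allowed below the supremum. *)
  have [_ [n /= Nn <-] h2] : exists2 v, sdrop u N' v & sups u N' - (j.+1%:R^-1 - `|sups u
    N' - limn_sup u|) < v.
    by apply: sup_adherent; [rewrite subr_gt0|split; [exists (u N'), N' => /=|exact: uble]].
  exists n; split; first exact: leq_trans (leq_maxr N j) Nn.
  have h3 : u n <= sups u N' by apply: ub_le_sup; [exact: uble|exists n].
  move: hi h2 h3; move: (j.+1%:R^-1) (sups u N') (limn_sup u) => iv S L.
  move=> h1 h2 h3; move: (h1); rewrite !ltr_norml => /andP[h4 h5].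
  have [SL|SL] := leP 0 (S - L); first by move: h2; rewrite ger0_norm// => h2; apply/andP;
    split; lra.
  by move: h2; rewrite ltr0_norm// => h2; apply/andP; split; lra.
pose s := fix s n := if n is m.+1 then t (s m).+1 else t 0%N.
have sE n : s n.+1 = t (s n).+1 by [].
have si : incr s by move=> n; rewrite sE; case: (tP (s n).+1).
exists s => // e /inv_lt[N HN]; exists N => n Nn /=.
have [n' [nn ->]] : exists n', (n <= n')%N /\ s n = t n'.
  by case: n Nn => [|n] Nn; [exists 0%N|exists (s n).+1; split=> //; rewrite ltnS incr_ge].
by apply: lt_trans (tP n').2 _; exact: HN (leq_trans Nn nn).
Qed.

Lemma limn_sup_ge u M s l : (forall n, `|u n| <= M) -> incr s -> rcv (u \o s) l ->
  l <= limn_sup u.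
Proof.
move=> uM si ul.
have ub : has_ubound (range u) by exists M => _ [n _ <-]; exact: le_trans (ler_norm _) (uM n).
have lb : has_lbound (range u).
  by exists (- M) => _ [n _ <-]; have := uM n; rewrite ler_norml => /andP[].
have sc : rcv (sups u) (limn_sup u).
  by apply/rcvP; rewrite /limn_sup; have := cvg_sups_inf ub lb => h; rewrite (cvg_lim _ h).
apply: rcv_le ul sc => n; apply: ub_le_sup; first exact: has_ubound_sdrop.
by exists (s n) => //=; exact: incr_ge.
Qed.

Lemma rcv_limn_sup u l : rcv u l -> limn_sup u = l.
Proof. by move=> /rcvP ul; rewrite (cvg_limn_inf_sup ul). Qed.

End LimSup.

Section PropertyMp.
Context {R : realType} {k : scalar_kind}.
Notation K := (kfield R k).
Notation dual E := (bop E (K^o : normedModType K)).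
Variables (p : \bar R) (p_gt1 : (1 < p)%E) (E : normedModType K).

Lemma mp_limit_of_property : property_mp p E -> mp_limit p E.
Proof.
move=> mpE x u M b c uM u0 ub uc.
have wu : weakly_null u by apply/weakly_nullP.
by have := mpE x u wu; rewrite (rcv_limn_sup ub) (rcv_limn_sup uc).
Qed.

(** For each inequality, one of the two limits superior is attained along a subsequence, which is
    then refined until all the norms converge. Boundedness of weakly null sequences makes these
    limits superior genuine cluster values. *)
Lemma property_of_mp_limit :
  (forall u : nat -> E, weakly_null u -> exists M, forall n, rnorm (u n) <= M) ->
  mp_limit p E -> property_mp p E.
Proof.
move=> wb mpE x u wu; have [M uM] := wb u wu; move/weakly_nullP: wu => wu.
have M0 : 0 <= M := le_trans (rnorm_ge0 _) (uM 0%N).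
have uM' n : `|rnorm (u n)| <= M by rewrite ger0_norm ?rnorm_ge0.
have xM n : `|rnorm (x + u n)| <= rnorm x + M.
  by rewrite ger0_norm ?rnorm_ge0// (le_trans (rnormD _ _))// lerD2l.
have sub s : incr s -> exists t b c, [/\ incr t, rcv (fun n => rnorm (u (s (t n)))) b,
    rcv (fun n => rnorm (x + u (s (t n)))) c & c = norm2 p (rnorm x) b].
  move=> si; have [t [b [ti tb]]] := bounded_norm_subseq (u := u \o s) (fun n => uM _).
  have [|t' [c [ti' tc]]] := @bounded_norm_subseq _ _ E (fun n => x + u (s (t n))) (rnorm x + M).
    by move=> n; have := xM (s (t n)); rewrite ger0_norm ?rnorm_ge0.
  have tb' := rcv_sub ti' tb.
  exists (t \o t'), b, c; split=> //; first exact: incr_comp.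
  apply: (mpE x (fun n => u (s (t (t' n)))) M) => // f.
  exact: (cv_sub (incr_comp si (incr_comp ti ti')) (wu f)).
have b0 s b : rcv (fun n => rnorm (u (s n))) b -> 0 <= b.
  by move=> sb; apply: (rcv_le (u := fun=> 0)) sb => [n|]; [exact: rnorm_ge0|exact: rcv_cst].
apply/le_anti/andP; split.
- have [s si sc] := limn_sup_cluster xM; have [t [b [c [ti tb tc cE]]]] := sub s si.
  rewrite (rcv_unique (rcv_sub ti sc) tc) cE; apply: norm2_mono => //; rewrite ?rnorm_ge0//.
    exact: (b0 (s \o t)).
  exact: limn_sup_ge uM' (incr_comp si ti) tb.
- have [s si sb] := limn_sup_cluster uM'; have [t [b [c [ti tb tc cE]]]] := sub s si.
  rewrite (rcv_unique (rcv_sub ti sb) tb) -cE.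
  exact: limn_sup_ge xM (incr_comp si ti) tc.
Qed.

End PropertyMp.

(** * Embedding into the models *)

Section NormSequence.
Context {R : realType} (p : \bar R) (p_gt1 : (1 < p)%E).
Notation N := (norm2 p).
Let p1 : (1 <= p)%E := ltW p_gt1.
Implicit Types a b : nat -> R.

(** The ell_p norm of the first [L] terms, as an iterated norm of the plane, so that one recursion
    covers finite and infinite [p]. *)
Fixpoint lp_norm a L := if L is l.+1 then N (lp_norm a l) (a l) else 0.

Lemma lp_norm_ge0 a L : 0 <= lp_norm a L.
Proof. by case: L => //= L; exact: norm2_ge0. Qed.

Lemma lp_norm_ext a b L : (forall i, (i < L)%N -> a i = b i) -> lp_norm a L = lp_norm b L.
Proof.
elim: L => //= L IH ab; rewrite IH ?ab//.
by move=> i iL; rewrite ab// ltnS ltnW.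
Qed.

Lemma lp_normS a L : lp_norm a L <= lp_norm a L.+1.
Proof. by rewrite -[leLHS]ger0_norm ?lp_norm_ge0//; exact: norm2_gel. Qed.

Lemma lp_norm_le_len a L L' : (L <= L')%N -> lp_norm a L <= lp_norm a L'.
Proof.
move=> /subnK <-; elim: (L' - L)%N => // d IH.
exact: le_trans IH (lp_normS _ _).
Qed.

Lemma lp_norm_scale c a L : 0 <= c -> lp_norm (fun n => c * a n) L = c * lp_norm a L.
Proof. by move=> c0; elim: L => /= [|L ->]; rewrite ?mulr0// norm2_scale. Qed.

Lemma lp_norm_lip a b L : lp_norm a L <= lp_norm b L + \sum_(i < L) `|a i - b i|.
Proof.
suff : `|lp_norm a L - lp_norm b L| <= \sum_(i < L) `|a i - b i|.
  by rewrite ler_norml => /andP[]; lra.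
elim: L => [|L IH]; first by rewrite subrr normr0 big_ord0.
rewrite big_ord_recr /=; apply: le_trans (norm2_dist p_gt1 _ _ _ _) _.
by rewrite lerD2r.
Qed.

Lemma lp_norm_double a L :
  lp_norm a L.*2 = N (lp_norm (fun n => a n.*2) L) (lp_norm (fun n => a n.*2.+1) L).
Proof.
elim: L => [|L IH]; first by rewrite /= norm20x// normr0.
by rewrite doubleS /= IH norm2A// norm2ACA.
Qed.

Lemma sum_double (v : nat -> R) M :
  \sum_(s < M.*2) v s = \sum_(s < M) (v s.*2 + v s.*2.+1).
Proof.
elim: M => [|M IH]; first by rewrite !big_ord0.
by rewrite doubleS !big_ord_recr /= IH addrA.
Qed.

Lemma norm2_11_gt0 : 0 < N 1 1.
Proof. by have := norm2_gel p_gt1 1 1; rewrite normr1; lra. Qed.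

(** The triangle inequality for the sum of [(x, y)] and [(y, x)]. *)
Lemma norm2_mean (x y : R) : 0 <= x -> 0 <= y -> N 1 1 * (x + y) <= 2 * N x y.
Proof.
move=> x0 y0; have := norm2D p1 x y y x; rewrite (addrC y x) (norm2C _ y x).
by have := norm2_scale p_gt1 1 1 (addr_ge0 x0 y0); rewrite !mulr1 [_ * N 1 1]mulrC; lra.
Qed.

Lemma norm2_max (x y c : R) : 0 <= x <= c -> 0 <= y <= c -> N x y <= N 1 1 * c.
Proof.
move=> /andP[x0 xc] /andP[y0 yc]; have c0 := le_trans x0 xc.
have := norm2_scale p_gt1 1 1 c0; rewrite !mulr1 [_ * N 1 1]mulrC => <-.
exact: norm2_mono.
Qed.

(** Splitting the indices by parity gives [N] of the norms of two halves, which [norm2_mean]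
    compares with their sum; after [K] rounds the halves have become the residue classes mod
    [2 ^ K]. Equality occurs when all the classes have the same norm, so the factor matches the one
    in [lp_norm_dyadic_max]. *)
Lemma lp_norm_dyadic_mean K : forall a L,
  N 1 1 ^+ K * \sum_(s < 2 ^ K) lp_norm (fun n => a (n * 2 ^ K + s)%N) L
    <= 2 ^+ K * lp_norm a (L * 2 ^ K).
Proof.
elim: K => [|K IH] a L.
  rewrite !expr0 !mul1r expn0 muln1 big_ord_recl big_ord0 addr0 /=.
  by under [X in lp_norm X _]funext => n do rewrite muln1 addn0.
have eL : (L * 2 ^ K.+1)%N = (L * 2 ^ K).*2 by rewrite expnS -muln2; lia.
rewrite eL lp_norm_double expnS mul2n.
rewrite (sum_double (fun s => lp_norm (fun n => a (n * (2 ^ K).*2 + s)%N) L)).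
have e1 s n : (n * (2 ^ K).*2 + s.*2)%N = (n * 2 ^ K + s).*2 by rewrite doubleD doubleMr.
have e2 s n : (n * (2 ^ K).*2 + s.*2.+1)%N = (n * 2 ^ K + s).*2.+1 by rewrite addnS e1.
rewrite big_split /=.
under eq_bigr => s _ do under [X in lp_norm X _]funext => n do rewrite e1.
under [X in _ * (_ + X)]eq_bigr => s _ do under [X in lp_norm X _]funext => n do rewrite e2.
have h1 := IH (fun n => a n.*2) L; have h2 := IH (fun n => a n.*2.+1) L.
have := norm2_mean (lp_norm_ge0 (fun n => a n.*2) (L * 2 ^ K)) (lp_norm_ge0 (fun n => a
  n.*2.+1) (L * 2 ^ K)).
move: h1 h2; move: (\sum_(_ < _) _) (\sum_(_ < _) _) (lp_norm _ _) (lp_norm _ _) => A B u v h1 h2.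
rewrite [v + u]addrC [N v u]norm2C => h3.
rewrite exprS [2 ^+ K.+1]exprS -mulrA mulrDr mulrDr.
have g0 := norm2_11_gt0.
have h4 : N 1 1 * (N 1 1 ^+ K * A + N 1 1 ^+ K * B) <= N 1 1 * (2 ^+ K * (u + v)).
  by rewrite ler_pM2l//; move: h1 h2; rewrite mulrDr; lra.
have h5 : 2 ^+ K * (N 1 1 * (u + v)) <= 2 ^+ K * (2 * N u v).
  by rewrite ler_wpM2l// exprn_ge0.
move: h4 h5; rewrite mulrDr; set c2 := 2 ^+ K; set cn := N 1 1 ^+ K.
have -> : N 1 1 * (c2 * (u + v)) = c2 * (N 1 1 * (u + v)) by rewrite mulrCA.
have -> : 2 * c2 * N u v = c2 * (2 * N u v) by rewrite mulrCA mulrA.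
by lra.
Qed.

Lemma lp_norm_dyadic_max K C : forall a L,
  (forall s, (s < 2 ^ K)%N -> lp_norm (fun n => a (n * 2 ^ K + s)%N) L <= C) ->
  lp_norm a (L * 2 ^ K) <= N 1 1 ^+ K * C.
Proof.
elim: K => [|K IH] a L aC.
  rewrite expr0 mul1r expn0 muln1; apply: le_trans (aC 0%N isT).
  by rewrite le_eqVlt; apply/orP; left; apply/eqP/lp_norm_ext => n _; rewrite expn0 muln1 addn0.
have eL : (L * 2 ^ K.+1)%N = (L * 2 ^ K).*2 by rewrite expnS -muln2; lia.
have e1 s n : (n * (2 ^ K).*2 + s.*2)%N = (n * 2 ^ K + s).*2.
  by rewrite doubleD doubleMr.
rewrite eL lp_norm_double exprS -mulrA; apply: norm2_max; rewrite lp_norm_ge0 /=; apply: IH => s sK.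
  have := aC s.*2; rewrite expnS mul2n ltn_double => /(_ sK); apply: le_trans.
  by rewrite le_eqVlt; apply/orP; left; apply/eqP/lp_norm_ext => n _; rewrite e1.
have := aC s.*2.+1; rewrite expnS mul2n ltn_Sdouble => /(_ sK); apply: le_trans.
by rewrite le_eqVlt; apply/orP; left; apply/eqP/lp_norm_ext => n _; rewrite addnS e1.
Qed.

End NormSequence.

Section GapChain.
Context {R : realType} {k : scalar_kind}.
Notation K := (kfield R k).
Variables (p : \bar R) (p_gt1 : (1 < p)%E) (E : normedModType K).
Hypothesis mpE : mp_limit p E.
Hypothesis wcE : wcauchy_property E.
Variable S : nat -> bop E E.
Hypothesis kS : forall n, kop (S n).
Hypothesis S1 : forall n x, rnorm (S n x) <= rnorm x.
Hypothesis Scv : forall x, cv (fun n => S n x) x.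

(** Even positions receive a cut that admits a gap bound, odd positions the outer cut realising it.
    Both exist arbitrarily late, as [chain_build] demands. *)
Lemma gap_chain (eta : nat -> R) : (forall i, 0 < eta i) ->
  exists2 G, chain p S eta G & forall j x,
    rnorm (x - G j.*2.+1 x + G j.*2 x) <= (1 + eta j.*2) * rnorm x.
Proof.
move=> eta0.
pose X (l : seq (bop E E)) (Q : bop E E) := if odd (size l) then
    gap_bound S (1 + eta (size l).-1) (last 0 l) ->
    forall x, rnorm (x - Q x + last 0 l x) <= (1 + eta (size l).-1) * rnorm x
  else gap_bound S (1 + eta (size l)) Q.
have [//|l m|G cG GX] := @chain_build _ _ _ p_gt1 _ mpE wcE _ kS S1 Scv eta X.
  rewrite /X; case: (odd (size l)); last exact: (gap_property1 p_gt1 mpE wcE kS S1 Scv (eta0 _)).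
  have [g|ng] := pselect (gap_bound S (1 + eta (size l).-1) (last 0 l)).
    by have [Q lQ QP] := g m; exists Q.
  by have [Q lQ] := late_ex p_gt1 mpE wcE kS S1 Scv m; exists Q.
exists G => // j x.
have := GX j.*2; rewrite /X size_mkseq odd_double => gj.
have := GX j.*2.+1; rewrite /X mkseqS size_rcons last_rcons size_mkseq /= odd_double; exact.
Qed.

End GapChain.

(** * Interlaced block decompositions *)

Section Blocks.
Context {R : realType} {k : scalar_kind}.
Notation K := (kfield R k).
Variables (p : \bar R) (p_gt1 : (1 < p)%E) (E : normedModType K).
Variables (S : nat -> bop E E) (eta : nat -> R) (G : nat -> bop E E) (eps : R).
Notation h := (2^-1 : R).
Hypothesis Scv : forall x, cv (fun n => S n x) x.
Hypothesis cG : chain p S eta G.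
Hypothesis gapG : forall j x, rnorm (x - G j.*2.+1 x + G j.*2 x) <= (1 + eta j.*2) * rnorm x.
Hypothesis eps01 : 0 < eps <= 1.
Hypothesis eta_ge0 : forall i, 0 <= eta i.
(** The factor [i.+1] pays for the errors on all the gap pieces before position [i], and the power
    of [h] makes the errors of successive positions summable. *)
Hypothesis eta_le : forall i, 2 * i.+1%:R * eta i <= eps / 2 * h ^+ i.

Let gap_piece j x := G j.*2.+1 x - G j.*2 x.

Let hge0 n : 0 <= h ^+ n.
Proof. by rewrite exprn_ge0. Qed.

Let hle m n : (m <= n)%N -> h ^+ n <= h ^+ m.
Proof. by move=> mn; apply: ler_wiXn2l; rewrite // invf_le1// ler1n. Qed.

Lemma gap_piece_absorb i j M x : (j < i)%N -> (i.*2 <= M)%N ->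
  rnorm (gap_piece j x - G M (gap_piece j x)) <= 2 * eta i.*2 * rnorm x.
Proof.
move=> ji iM; rewrite /gap_piece bopB subrBB.
apply: le_trans (rnormB _ _) _; rewrite -mulrA mulr_natl mulr2n.
by apply: lerD; apply: (chain_absorb cG) => //; lia.
Qed.

Lemma gap_piece_gap_piece i j x : (j < i)%N ->
  rnorm (gap_piece i (gap_piece j x)) <= 4 * eta i.*2 * rnorm x.
Proof.
move=> ji; rewrite [gap_piece i _]/(G i.*2.+1 _ - G i.*2 _).
have h1 := gap_piece_absorb x ji (leqnn i.*2).
have h2 := gap_piece_absorb x ji (leqnSn i.*2).
have := rnorm_triangle (G i.*2.+1 (gap_piece j x)) (gap_piece j x) (G i.*2 (gap_piece j x)).
by rewrite (rnormBC (G i.*2.+1 (gap_piece j x)) (gap_piece j x)); move: h1 h2; lra.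
Qed.

Lemma gap_pieceB i x y : gap_piece i (x - y) = gap_piece i x - gap_piece i y.
Proof. by rewrite /gap_piece !bopB subrBB. Qed.

Lemma gap_piece_sum i n (F : 'I_n -> E) :
  gap_piece i (\sum_(l < n) F l) = \sum_(l < n) gap_piece i (F l).
Proof.
by rewrite /gap_piece (lin_sum (bop_linear _)) (lin_sum (bop_linear (G i.*2))) -sumrB.
Qed.

(** Gaps are removed one at a time. The gap bound is applied to the vector already freed of the
    earlier pieces, and the new gap piece of those earlier pieces is tiny, because both of its cuts
    almost fix them. *)
Lemma sub_gap_pieces c L x : incr c ->
  rnorm (x - \sum_(l < L) gap_piece (c l) x) <= (1 + eps * (1 - h ^+ L)) * rnorm x.
Proof.
move=> ci; have x0 := rnorm_ge0 x; elim: L => [|L IH].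
  by rewrite big_ord0 subr0 expr0 subrr mulr0 addr0 mul1r.
rewrite big_ord_recr /= opprD addrA; set sL := \sum_(l < L) _.
set y := x - sL; rewrite -/y in IH.
pose i := c L; have Li : (L <= i)%N := incr_ge ci L.
have -> : y - gap_piece i x = (y - G i.*2.+1 y + G i.*2 y) - gap_piece i sL.
  have -> : y - G i.*2.+1 y + G i.*2 y = y - gap_piece i y.
    by rewrite /gap_piece opprB addrA [RHS]addrAC.
  by rewrite {3}/y gap_pieceB -[RHS]addrA -opprD subrK.
have h1 := gapG i y.
have h2 : rnorm (gap_piece i sL) <= L%:R * (4 * eta i.*2 * rnorm x).
  rewrite /sL gap_piece_sum; apply: le_trans (rnorm_sum _ _ _) _.
  apply: (@le_trans _ _ (\sum_(l < L) (4 * eta i.*2 * rnorm x))).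
    by apply: ler_sum => l _; apply: gap_piece_gap_piece; apply: incr_lt.
  by rewrite sumr_const card_ord [leRHS]mulr_natl.
have h3 := eta_le i.*2.
have h4 : (2 * L%:R + 1) * eta i.*2 <= i.*2.+1%:R * eta i.*2.
  apply: ler_wpM2r; first exact: eta_ge0.
  by rewrite -natrM natr1 ler_nat; lia.
have h5 : h ^+ i.*2 <= h ^+ L by apply: hle; lia.
apply: le_trans (rnormB _ _) _.
have h6 : rnorm y <= 2 * rnorm x.
  apply: le_trans IH _; apply: ler_wpM2r => //.
  have /andP[e0 e1] := eps01.
  have := mulr_ge0 (ltW e0) (hge0 L); lra.
have /andP[e0 e1] := eps01.
have h7 : eta i.*2 * rnorm y <= eta i.*2 * (2 * rnorm x) by rewrite ler_wpM2l.
have h8 : (2 * (2 * L%:R + 1) * eta i.*2) * rnorm x <= (eps / 2 * h ^+ L) * rnorm x.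
  apply: ler_wpM2r => //; apply: (@le_trans _ _ (eps / 2 * h ^+ i.*2)).
    by move: h3 h4; lra.
  by rewrite ler_wpM2l// divr_ge0// ltW.
move: IH h1 h2 h7 h8; rewrite exprS; move: (h ^+ L) (rnorm y) (rnorm x) (eta i.*2) (L%:R).
move=> a ny nx et l; lra.
Qed.

Lemma sub_gap_pieces_le c L x : incr c ->
  rnorm (x - \sum_(l < L) gap_piece (c l) x) <= (1 + eps) * rnorm x.
Proof.
move=> ci; apply: le_trans (sub_gap_pieces L x ci) _.
have /andP[e0 e1] := eps01; apply: ler_wpM2r; first exact: rnorm_ge0.
have := mulr_ge0 (ltW e0) (hge0 L); lra.
Qed.

(** The contraction [G (c L).*2] is applied to the vector freed of its gap pieces; it almost fixes
    these pieces, as they come from earlier cuts. *)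
Lemma head_sub_gap_pieces c L x : incr c ->
  rnorm (G (c L).*2 x - \sum_(l < L) gap_piece (c l) x) <= (1 + 2 * eps) * rnorm x.
Proof.
move=> ci; pose i := c L; have Li : (L <= i)%N := incr_ge ci L.
have x0 := rnorm_ge0 x; have /andP[e0 e1] := eps01.
set sL := \sum_(l < L) _.
have h1 : rnorm (sL - G i.*2 sL) <= L%:R * (2 * eta i.*2 * rnorm x).
  rewrite /sL (lin_sum (bop_linear (G i.*2))) -sumrB; apply: le_trans (rnorm_sum _ _ _) _.
  apply: (@le_trans _ _ (\sum_(l < L) (2 * eta i.*2 * rnorm x))).
    by apply: ler_sum => l _; apply: gap_piece_absorb => //; apply: incr_lt.
  by rewrite sumr_const card_ord [leRHS]mulr_natl.
have h2 := chain_contr cG i.*2 (x - sL); rewrite bopB in h2.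
have h3 := sub_gap_pieces_le L x ci; rewrite -/sL in h3.
have h5 : rnorm (G i.*2 x - sL - (G i.*2 x - G i.*2 sL)) = rnorm (sL - G i.*2 sL).
  by rewrite subrBB subrr sub0r rnormN.
have h6 : (2 * L%:R * eta i.*2) * rnorm x <= eps * rnorm x.
  apply: ler_wpM2r => //; apply: le_trans (_ : 2 * i.*2.+1%:R * eta i.*2 <= _).
    by rewrite -!mulrA ler_wpM2l// ler_wpM2r// ler_nat; lia.
  apply: le_trans (eta_le _) _.
  have hh : h ^+ i.*2 <= 1 by rewrite exprn_ile1// invf_le1// ler1n.
  have : eps / 2 * h ^+ i.*2 <= eps / 2 * 1 by rewrite ler_wpM2l// divr_ge0// ltW.
  lra.
have h7 := rnormD (G i.*2 x - sL - (G i.*2 x - G i.*2 sL)) (G i.*2 x - G i.*2 sL).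
rewrite subrK h5 in h7.
move: h1 h2 h3 h6 h7; rewrite -/i; lra.
Qed.

Variables (M : nat) (M_gt0 : (0 < M)%N).

(* Along a residue class mod [M] the blocks telescope up to the gap pieces, which
   are common to all the classes and hence negligible after averaging. *)
Definition block j : bop E E :=
  if (j < M)%N then G j.*2 else G j.*2 - G (j - M).*2.+1.

Let row s l := (l * M + s)%N.

Let row_incr s : incr (row s).
Proof. by move=> l; rewrite /row mulSn; lia. Qed.

Lemma block_row0 s : (s < M)%N -> block (row s 0) = G s.*2.
Proof. by move=> sM; rewrite /block /row mul0n add0n sM. Qed.

Lemma block_rowS s l : block (row s l.+1) = G (row s l.+1).*2 - G (row s l).*2.+1.
Proof.
by rewrite /block /row mulSn -addnA ltnNge leq_addr /= addKn.
Qed.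

Let prow s L x := \sum_(l < L.+1) block (row s l) x.

Lemma block_row_sum s L x : (s < M)%N ->
  prow s L x = G (row s L).*2 x - \sum_(l < L) gap_piece (row s l) x.
Proof.
move=> sM; elim: L => [|L IH].
  by rewrite /prow big_ord_recl !big_ord0 addr0 subr0 block_row0// /row mul0n add0n.
have -> : prow s L.+1 x = prow s L x + (G (row s L.+1).*2 x - G (row s L).*2.+1 x).
  by rewrite {1}/prow big_ord_recr; congr (_ + _); rewrite block_rowS.
rewrite IH [in RHS]big_ord_recr /= /gap_piece opprD opprB addrACA.
by rewrite [- _ + (_ - _)]addrCA [RHS]addrA [G (row s L.+1).*2 x + _]addrC.
Qed.

Lemma block_row_le s L x : (s < M)%N -> rnorm (prow s L x) <= (1 + 2 * eps) * rnorm x.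
Proof. by move=> sM; rewrite block_row_sum//; exact: head_sub_gap_pieces. Qed.

(** A partial sum of a row is a head, and the next block is a difference of two later cuts, so
    [chain_gap] applies at every step. The factor [1 - h ^+ L] bookkeeps the accumulated errors. *)
Lemma block_row_lp_norm s L x : (s < M)%N -> rnorm x <= 1 ->
  heads G (row s L).*2.+1 (prow s L x) /\
  `|rnorm (prow s L x) - lp_norm p (fun l => rnorm (block (row s l) x)) L.+1| <= eps * (1 - h ^+ L).
Proof.
move=> sM x1; have /andP[e0 e1] := eps01; elim: L => [|L [IH1 IH2]].
  rewrite /prow big_ord_recl big_ord0 addr0 /= norm20x// [`|rnorm _|]ger0_norm ?rnorm_ge0//.
  rewrite subrr normr0 expr0 subrr mulr0; split=> //.
  by rewrite block_row0// /row mul0n add0n; exact: heads_single.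
have lt : ((row s L).*2.+1 < (row s L.+1).*2)%N.
  by have := row_incr s L; lia.
have pE : prow s L.+1 x = prow s L x + 1 *: (G (row s L.+1).*2 x - G (row s L).*2.+1 x).
  by rewrite scale1r {1}/prow big_ord_recr; congr (_ + _); rewrite block_rowS.
split.
  by rewrite pE; apply: (heads_ext IH1) => //; rewrite ?leqnn ?rnorm1//.
have := chain_gap cG IH1 (leqnn _) (ltnW lt) x1 (t := 1); rewrite rnorm1 => /(_ (lexx _)).
rewrite -pE scale1r -bop_subE -block_rowS => h1.
have h2 := norm2_dist p_gt1 (rnorm (prow s L x)) (rnorm (block (row s L.+1) x))
  (lp_norm p (fun l => rnorm (block (row s l) x)) L.+1) (rnorm (block (row s L.+1) x)).
rewrite subrr normr0 addr0 in h2.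
have h3 : eta (row s L).*2.+1 <= eps / 2 * h ^+ L.
  have h4 := eta_le (row s L).*2.+1; have h5 : h ^+ (row s L).*2.+1 <= h ^+ L.
    by apply: hle; have := incr_ge (row_incr s) L; lia.
  have h6 : eps / 2 * h ^+ (row s L).*2.+1 <= eps / 2 * h ^+ L.
    by rewrite ler_wpM2l// divr_ge0// ltW.
  have h7 : 1 * eta (row s L).*2.+1 <= 2 * (row s L).*2.+2%:R * eta (row s L).*2.+1.
    by apply: ler_wpM2r; [exact: eta_ge0|rewrite -natrM ler1n].
  lra.
rewrite -[lp_norm _ _ L.+2]/(norm2 p (lp_norm p (fun l => rnorm (block (row s l) x)) L.+1)
  (rnorm (block (row s L.+1) x))).
rewrite exprS; move: h1 h2 h3 IH2.
move: (norm2 p _ _) (norm2 p _ _) (h ^+ L) (eta _) => n2 n1 hL et h1 h2 h3 IH2.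
apply: le_trans (ler_distD n1 _ _) _; lra.
Qed.

Lemma sum_rows (F : nat -> E) L :
  \sum_(j < L * M) F j = \sum_(s < M) \sum_(l < L) F (row s l).
Proof.
elim: L => [|L IH].
  by rewrite big_ord0 big1// => s _; rewrite big_ord0.
rewrite mulSn addnC big_split_ord /= IH -big_split /=; apply: eq_bigr => s _.
by rewrite big_ord_recr.
Qed.

Lemma block_kop j : kop (block j).
Proof.
by rewrite /block; case: ifP => _; [|apply: kopB]; exact: chain_kop cG _.
Qed.

Lemma block_cv0 x : cv (fun j => block j x) 0.
Proof.
have Gx := chain_cv Scv cG x.
have i1 : incr (fun j => (j + M).*2) by move=> j; rewrite ltn_double.
have i2 : incr (fun j => j.*2.+1) by move=> j; rewrite ltnS ltn_double.
have := cvB (cv_sub i1 Gx) (cv_sub i2 Gx); rewrite subrr => c0.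
apply: (cv_tail (N := M)); move: c0; congr cv; apply/funext => j /=.
by rewrite /block ltnNge leq_addl /= addnK.
Qed.

Lemma lp_norm_block_le x J d : M = (2 ^ d)%N -> rnorm x <= 1 ->
  lp_norm p (fun j => rnorm (block j x)) J <= norm2 p 1 1 ^+ d * (1 + 3 * eps).
Proof.
move=> MK x1; have /andP[e0 e1] := eps01.
apply: (@le_trans _ _ (lp_norm p (fun j => rnorm (block j x)) (J * 2 ^ d))).
  by apply: lp_norm_le_len => //; rewrite leq_pmulr// expn_gt0.
apply: lp_norm_dyadic_max => // s sK; rewrite -MK in sK *.
case: J => [|L]; first by rewrite /= ; lra.
have [_ h1] := block_row_lp_norm L sK x1; have := block_row_le L x sK.
move: h1; rewrite ler_norml => /andP[h1 _].
have h2 : (1 + 2 * eps) * rnorm x <= (1 + 2 * eps) * 1 by rewrite ler_wpM2l//; lra.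
have := mulr_ge0 (ltW e0) (hge0 L); move: h1; rewrite /row; lra.
Qed.

(** A single row may lose most of [x] in its gaps. All the rows together give nearly [M *: x] minus
    every gap piece once; these pieces add up to norm at most 3, which is at most [M%:R * eps]. *)
Lemma lp_norm_block_ge x d : M = (2 ^ d)%N -> 3 <= 2 ^+ d * eps -> rnorm x = 1 ->
  exists J, norm2 p 1 1 ^+ d * (1 - 3 * eps) <= lp_norm p (fun j => rnorm (block j x)) J.
Proof.
move=> MK Keps x1; have /andP[e0 e1] := eps01.
have [n0 Hn] := chain_cv Scv cG x e0; exists (n0.+1 * 2 ^ d)%N.
have MR : 2 ^+ d = M%:R :> R by rewrite MK natrX.
have M0 : 0 < M%:R :> R by rewrite ltr0n.
have g0 : 0 < norm2 p 1 1 ^+ d by rewrite exprn_gt0// norm2_11_gt0.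
have := lp_norm_dyadic_mean p_gt1 d (fun j => rnorm (block j x)) n0.+1; rewrite MR -MK => h1.
rewrite -(ler_pM2l M0); apply: le_trans h1; rewrite mulrCA ler_pM2l//.
have h2 : rnorm (\sum_(s < M) prow s n0 x) - M%:R * eps <=
    \sum_(s < M) lp_norm p (fun n => rnorm (block (n * M + s) x)) n0.+1.
  rewrite lerBlDr; apply: le_trans (rnorm_sum _ _ _) _.
  have -> : M%:R * eps = \sum_(s < M) eps by rewrite sumr_const card_ord mulr_natl.
  rewrite -big_split; apply: ler_sum => s _ /=.
  have x1' : rnorm x <= 1 by rewrite x1.
  have [_] := block_row_lp_norm n0 (ltn_ord s) x1'; rewrite ler_norml => /andP[_]; have :=
    mulr_ge0 (ltW e0) (hge0 n0); rewrite /row /=; lra.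
apply: le_trans h2.
have pE : \sum_(s < M) prow s n0 x =
   \sum_(s < M) G (row s n0).*2 x - \sum_(j < n0 * M) gap_piece j x.
  rewrite (sum_rows (fun j => gap_piece j x)) -sumrB; apply: eq_bigr => s _.
  exact: block_row_sum.
have h3 : rnorm (\sum_(j < n0 * M) gap_piece j x) <= 3.
  have idi : incr id by move=> n.
  have := sub_gap_pieces_le (n0 * M) x idi; rewrite x1 /= => h3.
  have := rnorm_sub_le (\sum_(j < n0 * M) gap_piece j x) x; rewrite x1 rnormBC; lra.
have h4 : rnorm (M%:R *: x - \sum_(s < M) G (row s n0).*2 x) <= M%:R * eps.
  have -> : (M%:R : K) *: x = \sum_(s < M) x by rewrite sumr_const card_ord scaler_nat.
  rewrite -sumrB; apply: le_trans (rnorm_sum _ _ _) _.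
  have -> : M%:R * eps = \sum_(s < M) eps by rewrite sumr_const card_ord mulr_natl.
  apply: ler_sum => s _; rewrite rnormBC; apply/ltW/Hn.
  by have := incr_ge (row_incr s) n0; lia.
have h5 : rnorm ((M%:R : K) *: x) = M%:R.
  by rewrite rnormZ x1 mulr1 -kofR_nat rnorm_kofR ger0_norm// ltW.
have h6 := rnorm_sub_le ((M%:R : K) *: x) ((M%:R : K) *: x - \sum_(s < M) G (row s n0).*2 x).
rewrite subKr h5 in h6.
have h7 := rnorm_sub_le (\sum_(s < M) G (row s n0).*2 x) (\sum_(j < n0 * M) gap_piece j x).
rewrite pE; move: Keps h3 h4 h6 h7; rewrite MR; lra.
Qed.

End Blocks.

(** * Discretization of the blocks and the embeddings *)

Section RowVectors.
Context {R : realType} {k : scalar_kind}.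
Notation K := (kfield R k).
Variable m : nat.
Notation V := ('rV[K]_m : normedModType K).

Lemma rnorm_row_ge (v : V) i : rnorm (v 0 i : K^o) <= rnorm v.
Proof.
rewrite -rnorm_le [X in _ <= X]/Num.norm /= mx_normE.
have -> : `|v 0 i : K^o| = (`|v 0 i|%:nng)%:num by [].
by rewrite num_le; apply/bigmax_geP; right; exists (0, i).
Qed.

Lemma rnorm_row_le (v : V) (M : R) : 0 <= M -> (forall i, rnorm (v 0 i : K^o) <= M) ->
  rnorm v <= M.
Proof.
move=> M0 vM; have [v0|/mx_norm_neq0[[a i] /= e]] := eqVneq (mx_norm v) 0.
  by rewrite (mx_norm_eq0 v0) rnorm0.
rewrite -rnorm_le_kofR [leLHS]/Num.norm /= e; rewrite (ord1 a) rnorm_le_kofR; exact: vM.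
Qed.

Lemma row_finite_dimensional : finite_dimensional V.
Proof.
exists m, (fun i => delta_mx 0 i) => v; exists (fun i => v 0 i); exact: row_sum_delta.
Qed.

End RowVectors.

Section Discretization.
Context {R : realType} {k : scalar_kind}.
Notation K := (kfield R k).
Notation dual E := (bop E (K^o : normedModType K)).
Implicit Types E F : normedModType K.

Lemma normalized E (x : E) : exists2 x', x = kofR (rnorm x) *: x' & x = 0 \/ rnorm x' = 1.
Proof.
have [->|x0] := eqVneq x 0; first by exists 0; [rewrite scaler0|left].
have r0 : 0 < rnorm x.
  by rewrite lt_neqAle rnorm_ge0 andbT; apply: contraNneq x0 => /esym/rnorm_eq0 ->.
exists (kofR (rnorm x)^-1 *: x).
  by rewrite scalerA -kofRM mulfV ?gt_eqF// kofR1 scale1r.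
by right; rewrite rnormZ rnorm_kofR ger0_norm ?invr_ge0 ?(ltW r0)// mulVf// gt_eqF.
Qed.

(** The functionals norm the points of a finite [d / 2]-net of the image of the unit ball, and are
    composed with [B]. *)
Lemma discretize E F (B : bop E F) (d : R) : kop B -> 0 < d ->
  exists m (f : nat -> dual E), (forall i x, rnorm (f i x) <= rnorm (B x)) /\
    forall x, exists2 i, (i < m)%N & rnorm (B x) <= rnorm (f i x) + d * rnorm x.
Proof.
move=> kB d0; have d2 : 0 < d / 2 by rewrite divr_gt0.
pose C := [set B x | x in [set x | rnorm x <= 1]].
have sC : seqc C.
  move=> u uC; have /choice[v vP] (n : nat) : exists v, rnorm v <= 1 /\ B v = u n.
    by have [v v1 <-] := uC n; exists v.
  have [s [l [si sl]]] := kB v (fun n => (vP n).1); exists s, l; split=> //.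
  by move: sl; congr cv; apply/funext => n /=; rewrite (vP _).2.
have [l [lC lP]] := seqc_totally_bounded sC d2.
have /choice[g gP] (i : nat) := norming (nth 0 l i).
exists (size l), (fun i => bcomp (g i) B); split=> [i x|x].
  by rewrite bcompE; case: (gP i).
have C0 : C (B 0) by exists 0 => //=; rewrite rnorm0.
have [x' xE [->|x'1]] := normalized x.
  have [y /(nthP 0)[i il _] _] := lP _ C0.
  by exists i => //; rewrite bcompE !bop0 !rnorm0 mulr0 addr0.
have Cx' : C (B x') by exists x' => //=; rewrite x'1.
have [y yl h] := lP _ Cx'; have [i il iE] := nthP 0 yl.
exists i => //; rewrite bcompE {}xE; have r0 := rnorm_ge0 x; move: (rnorm x) r0 => r r0.
rewrite !bopZ !rnormZ !rnorm_kofR ger0_norm// x'1 mulr1 mulrC [r * rnorm _]mulrC -mulrDl.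
apply: ler_wpM2r => //.
have [_ g1 gy] := gP i; rewrite iE in gy.
have h1 := rnorm_sub_le y (B x'); have h2 := g1 (y - B x'); rewrite bopB gy in h2.
have h3 := rnorm_sub_le (kofR (rnorm y) : K^o) (g i (B x')).
rewrite rnorm_kofR ger0_norm ?rnorm_ge0// in h3.
have h4 := rnorm_sub_le (B x') y; rewrite (rnormBC y (B x')) in h2.
lra.
Qed.

End Discretization.

Section BlockDecomposition.
Context {R : realType} {k : scalar_kind}.
Notation K := (kfield R k).
Variables (p : \bar R) (p_gt1 : (1 < p)%E) (E : normedModType K).
Hypothesis mpE : mp_limit p E.
Hypothesis wcE : wcauchy_property E.
Variable S : nat -> bop E E.
Hypothesis kS : forall n, kop (S n).
Hypothesis S1 : forall n x, rnorm (S n x) <= rnorm x.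
Hypothesis Scv : forall x, cv (fun n => S n x) x.

Lemma block_decomposition (e : R) : 0 < e -> exists B : nat -> bop E E,
  [/\ forall j, kop (B j), forall x, cv (fun j => B j x) 0,
      forall x J, lp_norm p (fun j => rnorm (B j x)) J <= (1 + e) * rnorm x &
      forall x, exists J, (1 - e) * rnorm x <= lp_norm p (fun j => rnorm (B j x)) J].
Proof.
move=> e0; pose eps := Num.min e 1 / 4.
have m0 : 0 < Num.min e 1 by rewrite lt_min e0 ltr01.
have m1 : Num.min e 1 <= 1 by rewrite ge_min lexx orbT.
have me : Num.min e 1 <= e by rewrite ge_min lexx.
have eps0 : 0 < eps by rewrite divr_gt0.
have eps01 : 0 < eps <= 1 by rewrite eps0 /= /eps; lra.
have eps3 : 3 * eps <= e by rewrite /eps; lra.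
have [d dP] : exists d, 3 <= 2 ^+ d * eps.
  have [n Hn] := inv_lt (divr_gt0 eps0 (ltr0Sn R 2)).
  exists n.+1; rewrite -ler_pdivrMr//; have := Hn n (leqnn n).
  rewrite invf_plt ?posrE ?divr_gt0// invf_div => /ltW h; apply: le_trans h _.
  by rewrite -natrX ler_nat ltnW// ltn_expl.
pose eta i : R := eps / 2 * 2^-1 ^+ i / (2 * i.+1%:R).
have h0 i : 0 < (2^-1 : R) ^+ i by rewrite exprn_gt0// invr_gt0.
have eta0 i : 0 < eta i by rewrite divr_gt0 ?mulr_gt0// divr_gt0.
have etaE i : 2 * i.+1%:R * eta i <= eps / 2 * 2^-1 ^+ i.
  by rewrite /eta [leLHS]mulrC divfK// gt_eqF// mulr_gt0.
have [G cG gapG] := gap_chain p_gt1 mpE wcE kS S1 Scv eta0.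
have M0 : (0 < 2 ^ d)%N by rewrite expn_gt0.
(* Upper and lower bounds for the whole family of blocks both contain the factor [c]; dividing by it
   makes the map nearly isometric. *)
pose c := norm2 p 1 1 ^+ d; have c0 : 0 < c by rewrite exprn_gt0// norm2_11_gt0.
pose B j := kofR c^-1 *: block G (2 ^ d) j.
have nB j x : rnorm (B j x) = c^-1 * rnorm (block G (2 ^ d) j x).
  by rewrite bop_scaleE rnormZ rnorm_kofR ger0_norm// invr_ge0 ltW.
have nB1 x J : lp_norm p (fun j => rnorm (B j x)) J = c^-1 * lp_norm p (fun j => rnorm
  (block G (2 ^ d) j x)) J.
  by rewrite -lp_norm_scale ?invr_ge0 ?(ltW c0)//; apply: lp_norm_ext => i _.
have nB2 r x J : 0 <= r ->
    lp_norm p (fun j => rnorm (B j (kofR r *: x))) J = r * lp_norm p (fun j => rnorm (B j x)) J.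
  move=> r0; rewrite -lp_norm_scale//; apply: lp_norm_ext => i _.
  by rewrite bopZ rnormZ rnorm_kofR ger0_norm.
exists B; split=> [j|x|x J|x].
- by apply: kopZ; exact: (block_kop cG).
- by have := cvZ (kofR c^-1) (block_cv0 Scv cG (2 ^ d) x); rewrite scaler0.
- have [x' xE x'01] := normalized x; have r0 := rnorm_ge0 x.
  rewrite {1}xE nB2// mulrC; case: x'01 => [->|x1]; first by rewrite rnorm0 !mulr0.
  apply: ler_wpM2r => //; rewrite nB1 ler_pdivrMl// .
  apply: le_trans (lp_norm_block_le p_gt1 cG gapG eps01 (fun i => ltW (eta0 i)) etaE M0 J
    erefl _) _.
    by rewrite x1.
  by rewrite ler_pM2l// lerD2l.
- have [x' xE x'01] := normalized x; have r0 := rnorm_ge0 x.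
  case: x'01 => [->|x1]; first by exists 0%N; rewrite rnorm0 mulr0.
  have [J JP] := lp_norm_block_ge p_gt1 Scv cG gapG eps01 (fun i => ltW (eta0 i)) etaE M0
    erefl dP x1.
  exists J; rewrite {2}xE nB2// mulrC; apply: ler_wpM2l => //.
  rewrite nB1 ler_pdivlMl//; apply: le_trans JP; rewrite ler_pM2l//.
  by rewrite lerD2l lerN2.
Qed.

End BlockDecomposition.

Section Embedding.
Context {R : realType} {k : scalar_kind}.
Notation K := (kfield R k).
Notation dual E := (bop E (K^o : normedModType K)).
Variables (E : normedModType K) (B : nat -> bop E E) (e : R).
Hypothesis e0 : 0 < e.
Hypothesis kB : forall j, kop (B j).
Hypothesis B0 : forall x, cv (fun j => B j x) 0.

Lemma lp_norm_infty_le (a : nat -> R) J C : 0 <= C -> (forall j, (j < J)%N -> 0 <= a j <= C) ->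
  lp_norm +oo%E a J <= C.
Proof.
move=> C0; elim: J => //= J IH aC; rewrite ge_max; apply/andP; split.
  by rewrite ger0_norm ?lp_norm_ge0//; apply: IH => j jJ; apply: aC; rewrite ltnS ltnW.
by have /andP[h1 h2] := aC J (leqnn _); rewrite ger0_norm.
Qed.

Lemma lp_norm_ge (p : \bar R) (a : nat -> R) j : (1 < p)%E -> a j <= lp_norm p a j.+1.
Proof. by move=> p_gt1; apply: le_trans (ler_norm _) _; exact: norm2_ger. Qed.

(** The discretizing functionals of all the blocks, enumerated through codes of pairs, are the
    coordinates. They tend to 0 because the blocks of [x] do, and under a supremum the same accuracy
    [e] can be used for every block. *)
Lemma embed_c0 :
  (forall x J, lp_norm +oo%E (fun j => rnorm (B j x)) J <= (1 + e) * rnorm x) ->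
  (forall x, exists J, (1 - e) * rnorm x <= lp_norm +oo%E (fun j => rnorm (B j x)) J) ->
  exists T : bop E (Defs.czero R k), forall x,
    (1 - 2 * e) * rnorm x <= rnorm (T x) <= (1 + e) * rnorm x.
Proof.
move=> ub lb.
have /choice[mf mfP] (j : nat) : exists mf : nat * (nat -> dual E),
    (forall i x, rnorm (mf.2 i x) <= rnorm (B j x)) /\
    forall x, exists2 i, (i < mf.1)%N & rnorm (B j x) <= rnorm (mf.2 i x) + e * rnorm x.
  by have [m [f fP]] := discretize (kB j) e0; exists (m, f).
pose t x n : K^o := if (pickle_inv n : option (nat * nat)) is Some ji then
  (if (ji.2 < (mf ji.1).1)%N then (mf ji.1).2 ji.2 x else 0) else 0.
have tcv x : cv (t x) 0.
  move=> d d0; have [J HJ] := B0 x d0.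
  (* [N] exceeds the codes of the finitely many coordinates that belong to the first [J] blocks. *)
  pose N := \max_(j < J) \max_(i < (mf j).1) (pickle (j : nat, i : nat)).+1.
  exists N => n Nn; rewrite subr0 /t.
  have := @pickle_invK (nat * nat)%type n.
  case: (pickle_inv n) => [[j i] /= nE|]; last by rewrite rnorm0.
  case: ifP => im; last by rewrite rnorm0.
  have [jJ|Jj] := ltnP j J; last first.
    by apply: le_lt_trans ((mfP j).1 i x) _; have := HJ j Jj; rewrite subr0.
  suff : (n < N)%N by rewrite ltnNge Nn.
  rewrite -nE; apply: leq_trans (leq_bigmax (Ordinal jJ)).
  exact: leq_trans (leq_bigmax (Ordinal im)).
have /choice[T TE] (x : E) := mk_czero (tcv x).
have Tub x : rnorm (T x) <= (1 + e) * rnorm x.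
  apply: c0_norm_le => n; rewrite TE /t.
  have z0 : rnorm (0 : K^o) <= (1 + e) * rnorm x.
    by rewrite rnorm0 mulr_ge0 ?rnorm_ge0//; move: e0; lra.
  case: (pickle_inv n) => [[j i]/=|//]; case: ifP => // _.
  apply: le_trans ((mfP j).1 i x) _; apply: le_trans (ub x j.+1).
  exact: (lp_norm_ge (fun j => rnorm (B j x)) j (ltry 1)).
have [|//|T' T'E] := @mk_bop R k E (Defs.czero R k) T (1 + e).
  move=> a x y; apply: czero_ext => n; rewrite c0coordD c0coordZ !TE /t.
  case: (pickle_inv n) => [[j i]/=|]; last by rewrite scaler0 addr0.
  by case: ifP => _; [rewrite (bop_linear _)|rewrite scaler0 addr0].
exists T' => x; rewrite T'E Tub andbT.
have [J JP] := lb x.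
suff : lp_norm +oo%E (fun j => rnorm (B j x)) J <= rnorm (T x) + e * rnorm x.
  by move=> h; have := le_trans JP h; lra.
apply: lp_norm_infty_le => [|j _]; first by rewrite addr_ge0 ?rnorm_ge0// mulr_ge0 ?rnorm_ge0// ltW.
rewrite rnorm_ge0 /=; have [i im h] := (mfP j).2 x; apply: le_trans h _; rewrite lerD2r.
have := rnorm_c0coord (T x) (pickle (j, i)); rewrite TE /t pickleK_inv /= im.
exact.
Qed.

Lemma lp_norm_ell_sum (r : R) (a : nat -> R) J : 1 <= r -> lp_norm r%:E a J `^ r = ell_sum r a J.
Proof.
move=> r1; have r0 : 0 < r by exact: lt_le_trans r1.
elim: J => [|J IH]; first by rewrite /ell_sum big_ord0 /= powR0// gt_eqF.
rewrite /= /norm2 powRK ?addr_ge0 ?powR_ge0// ger0_norm ?lp_norm_ge0// IH.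
by rewrite /ell_sum big_ord_recr.
Qed.

(** The discretization errors now accumulate, so the [j]-th block is resolved up to
    [e / 2 ^ (j + 1)]. Its coordinates form a row vector with the supremum norm, which gives the
    finite-dimensional summand. *)
Lemma embed_lpsum (r : R) (r1 : 1 <= r) : 1 < r ->
  (forall x J, lp_norm r%:E (fun j => rnorm (B j x)) J <= (1 + e) * rnorm x) ->
  (forall x, exists J, (1 - e) * rnorm x <= lp_norm r%:E (fun j => rnorm (B j x)) J) ->
  exists (F : nat -> normedModType K) (T : bop E (lpsum r1 F)),
    (forall n, finite_dimensional (F n)) /\ forall x,
    (1 - 2 * e) * rnorm x <= rnorm (T x) <= (1 + e) * rnorm x.
Proof.
move=> r_gt1 ub lb.
have p_gt1 : (1 < r%:E)%E by rewrite lte_fin.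
pose d j : R := e * 2^-1 ^+ j.+1.
have d0 j : 0 < d j by rewrite mulr_gt0// exprn_gt0// invr_gt0.
have dsum J : \sum_(j < J) d j = e * (1 - 2^-1 ^+ J).
  elim: J => [|J IH]; first by rewrite big_ord0 expr0 subrr mulr0.
  by rewrite big_ord_recr /= IH /d exprS; lra.
have /choice[mf mfP] (j : nat) : exists mf : nat * (nat -> dual E),
    (forall i x, rnorm (mf.2 i x) <= rnorm (B j x)) /\
    forall x, exists2 i, (i < mf.1)%N & rnorm (B j x) <= rnorm (mf.2 i x) + d j * rnorm x.
  by have [m [f fP]] := discretize (kB j) (d0 j); exists (m, f).
pose F j := 'rV[K]_(mf j).1 : normedModType K.
pose t x : Defs.seqprod F := fun j => \row_i (mf j).2 i x.
have t_le x j : rnorm (t x j) <= rnorm (B j x).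
  by apply: rnorm_row_le => [|i]; [exact: rnorm_ge0|rewrite mxE; exact: (mfP j).1].
have B_le x j : rnorm (B j x) <= rnorm (t x j) + d j * rnorm x.
  have [i im h] := (mfP j).2 x; apply: le_trans h _; rewrite lerD2r.
  by have := rnorm_row_ge (t x j) (Ordinal im); rewrite mxE.
have C0 x : 0 <= (1 + e) * rnorm x by rewrite mulr_ge0 ?rnorm_ge0//; move: e0; lra.
have tsum x J : ell_sum r (fun j => rnorm (t x j)) J <= ((1 + e) * rnorm x) `^ r.
  rewrite -lp_norm_ell_sum//; rewrite ler_powRr ?lp_norm_ge0//.
  apply: le_trans (ub x J); elim: J => [//|J IH].
  by apply: (norm2_mono p_gt1); rewrite ?lp_norm_ge0 ?rnorm_ge0.
have /choice[T TE] (x : E) := mk_lpsum r1 (powR_ge0 _ _) (tsum x).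
have Tub x : rnorm (T x) <= (1 + e) * rnorm x.
  rewrite -(ler_powRr r1) ?rnorm_ge0//; apply: lpsum_sum_ub => [|L]; first exact: powR_ge0.
  by have := tsum x L; congr (_ <= _); apply: eq_bigr => j _; rewrite TE.
have [|//|T' T'E] := @mk_bop R k E (lpsum r1 F) T (1 + e).
  move=> a x y; apply: lpsum_ext => n; rewrite lpcoordD lpcoordZ !TE /t.
  by apply/rowP => i; rewrite !mxE (bop_linear _).
exists F, T'; split=> [n|x]; first exact: row_finite_dimensional.
rewrite T'E Tub andbT; have [J JP] := lb x.
have h1 := lp_norm_lip p_gt1 (fun j => rnorm (B j x)) (fun j => rnorm (t x j)) J.
have h2 : \sum_(j < J) `|rnorm (B j x) - rnorm (t x j)| <= e * rnorm x.
  apply: (@le_trans _ _ (\sum_(j < J) d j * rnorm x)).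
    apply: ler_sum => j _; rewrite ger0_norm ?subr_ge0 ?t_le//.
    by have := B_le x j; lra.
  rewrite -mulr_suml dsum ler_wpM2r ?rnorm_ge0//.
  have : 0 <= e * 2^-1 ^+ J by rewrite mulr_ge0 ?exprn_ge0// ltW.
  lra.
have h3 : lp_norm r%:E (fun j => rnorm (t x j)) J <= rnorm (T x).
  rewrite -(ler_powRr r1) ?lp_norm_ge0 ?rnorm_ge0// lp_norm_ell_sum//.
  have := lpsum_sum_le (T x) J; congr (_ <= _).
  by apply: eq_bigr => j _; rewrite TE.
by move: JP h1 h2 h3; lra.
Qed.

End Embedding.

Section ModelsOfProperty.
Context {R : realType} {k : scalar_kind}.
Notation K := (kfield R k).

Lemma banach_mazur_embedding (X : completeNormedModType K) (W : normedModType K)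
    (T : bop X W) (a b : R) : 0 < a -> 0 <= b ->
  (forall x, a * rnorm x <= rnorm (T x) <= b * rnorm x) ->
  exists U : closed_subspace W, (banach_mazur X (cssub U) <= (b / a)%:E)%E.
Proof.
move=> a0 b0 Tab.
have [|U [T' [S [TS ST nT nS]]]] := bounded_below_iso (complete_seq (X := X)) a0 (T := T).
  by move=> x; case/andP: (Tab x).
exists U; apply: le_trans (banach_mazur_le TS ST) _; rewrite lee_fin.
have hT : opnorm T' <= b by apply: opnorm_le => // x; rewrite nT; case/andP: (Tab x).
have hS : opnorm S <= a^-1.
  by apply: opnorm_le => [|y]; [rewrite invr_ge0 ltW|rewrite ler_pdivlMl].
by apply: ler_pM => //; exact: opnorm_ge0.
Qed.

Lemma models_of_property (p : \bar R) (X : completeNormedModType K) : (1 < p)%E ->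
  separable X -> metric_compact_approximation X -> property_mp p X ->
  ~ contains_ell1 X -> almost_isometric_to_member (lp_models p) X.
Proof.
move=> p_gt1 sX mX /mp_limit_of_property mpX /(rosenthal (complete_seq (X := X))) wX d d0.
have [S [kS S1 Scv]] := approximating_sequence sX mX.
pose e := Num.min d 1 / 10.
have m0 : 0 < Num.min d 1 by rewrite lt_min d0 ltr01.
have m1 : Num.min d 1 <= 1 by rewrite ge_min lexx orbT.
have md : Num.min d 1 <= d by rewrite ge_min lexx.
have e0 : 0 < e by rewrite divr_gt0.
have e1 : e <= 1 / 10 by rewrite /e; lra.
have ed : 10 * e <= d by rewrite /e; lra.
have a0 : 0 < 1 - 2 * e by lra.
have b0 : 0 <= 1 + e by lra.
have ba : ((1 + e) / (1 - 2 * e) < 1 + d).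
  rewrite ltr_pdivrMr//; have : d * e <= d * (1 / 10) by rewrite ler_wpM2l// ltW.
  lra.
have [B [kB B0 ub lb]] := block_decomposition p_gt1 mpX wX kS S1 Scv e0.
case: p p_gt1 mpX ub lb => [r||] p_gt1 mpX ub lb; last by [].
- have r_gt1 : 1 < r by rewrite -lte_fin.
  have [F [T [fF TP]]] := embed_lpsum e0 kB (ltW r_gt1) r_gt1 ub lb.
  have [U XU] := banach_mazur_embedding a0 b0 TP.
  exists (cssub U); first by exists (ltW r_gt1), F, U.
  by apply: le_lt_trans XU _; rewrite lte_fin.
- have [T TP] := embed_c0 e0 kB B0 ub lb.
  have [U XU] := banach_mazur_embedding a0 b0 TP.
  exists (cssub U); first by exists U.
  by apply: le_lt_trans XU _; rewrite lte_fin.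
Qed.

End ModelsOfProperty.

(** * Consequences of the M-ideal property *)

Section RankOne.
Context {R : realType} {k : scalar_kind}.
Notation K := (kfield R k).
Notation dual E := (bop E (K^o : normedModType K)).
Implicit Types E F : normedModType K.

Lemma rank_one_ex E F (f : dual E) (w : F) :
  exists T : bop E F, [/\ forall x, T x = f x *: w, kop T & opnorm T <= opnorm f * rnorm w].
Proof.
have bnd x : rnorm (f x *: w) <= opnorm f * rnorm w * rnorm x.
  by rewrite rnormZ mulrAC ler_wpM2r ?rnorm_ge0// opnormP.
have [|T TE] := @mk_bop R k E F (fun x => f x *: w) _ _ bnd.
  by move=> a x y; rewrite (bop_linear f) scalerDl scalerA.
exists T; split=> //; last first.
  by apply: opnorm_le => [|x]; rewrite ?TE// mulr_ge0 ?opnorm_ge0 ?rnorm_ge0.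
move=> u u1; have [|s [l [si fl]]] := @scalar_subseq R k (f \o u) (opnorm f).
  by move=> n; exact: dual_bound.
exists s, (l *: w); split=> // e e0.
have e1 : 0 < e / (rnorm w + 1) by rewrite divr_gt0// ltr_wpDl ?rnorm_ge0.
have [N HN] := fl _ e1; exists N => n /HN /=; rewrite TE -scalerBl rnormZ => h.
apply: (@le_lt_trans _ _ (rnorm (f (u (s n)) - l) * (rnorm w + 1))).
  by rewrite ler_wpM2l ?rnorm_ge0// lerDl.
by rewrite -ltr_pdivlMr// ltr_wpDl ?rnorm_ge0.
Qed.

Lemma opnorm_approx_unit E F (T : bop E F) (C : R) :
  (forall x, rnorm x <= 1 -> rnorm (T x) <= C) -> opnorm T <= C.
Proof.
move=> TC; apply/ler_addgt0Pr => e e0.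
have [x x1 xT] := opnorm_approx T e0; have := TC x x1; lra.
Qed.

End RankOne.

Section MIdealApproximation.
Context {R : realType} {k : scalar_kind}.
Notation K := (kfield R k).
Notation dual E := (bop E (K^o : normedModType K)).
Variable E : normedModType K.
Notation L := (bop E E : normedModType K).
Notation J := (compact_op : set L).
Variable V : set (dual L).
Hypothesis submodV : submod_closed (mem V : {pred dual L}).
Hypothesis decV : forall f : dual L, exists! jv : dual L * dual L,
  [/\ annihilator J jv.1, V jv.2 & f = jv.1 + jv.2].
Hypothesis addV : forall j v : dual L, annihilator J j -> V v -> `|j + v| = `|j| + `|v|.

Lemma ideal_addV j v : annihilator J j -> V v -> opnorm (j + v) = opnorm j + opnorm v.
Proof. by move=> jJ vV; apply: (@kofR_inj R k); rewrite kofRD; exact: addV. Qed.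

Lemma ideal_lin a u v : V u -> V v -> V (a *: u + v).
Proof. by move=> Vu Vv; case: submodV => _ h; apply/set_mem/h; exact/mem_set. Qed.

Lemma ideal0 : V 0.
Proof. by case: submodV => /set_mem. Qed.

Lemma ideal_opp v : V v -> V (- v).
Proof. by move=> Vv; rewrite -(addr0 (- v)) -scaleN1r; apply: ideal_lin => //; exact: ideal0. Qed.

Lemma ideal_sum n (v : 'I_n -> dual L) : (forall i, V (v i)) -> V (\sum_(i < n) v i).
Proof.
move=> Vv; apply: (big_ind V) => //; first exact: ideal0.
by move=> u w Vu Vw; rewrite -(scale1r u); exact: ideal_lin.
Qed.

(* The [J]-annihilating part of [f] vanishes, since the norm is additive. *)
Lemma ideal_norming (f : dual L) :
  (forall C, 0 <= C -> (forall A, kop A -> rnorm (f A) <= C * opnorm A) -> opnorm f <= C) -> V f.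
Proof.
move=> fC; have [[j v] [[/= jJ vV fjv] _]] := decV f.
suff j0 : j = 0 by rewrite fjv j0 add0r.
apply: opnorm_eq0; apply/le_anti; rewrite opnorm_ge0 andbT.
have : opnorm f <= opnorm v.
  apply: fC => [|A kA]; first exact: opnorm_ge0.
  rewrite fjv bop_addE jJ ?add0r; last exact/compact_opP.
  by have := opnormP v A; rewrite bop_normE.
by rewrite fjv ideal_addV//; lra.
Qed.

(** If no [A] works, a functional [F] separates [(S + T, Lam T')] from the graph of [Lam] over the
    compact operators. Its restriction [psi] to the first component is [j - v] with [j] annihilating
    the compact operators and [v] in [V]. Hence [F] takes at that point the value
    [j T + v (T' - T - S)], of norm at most [opnorm j + opnorm v = opnorm psi], which is less than
    1, although it should equal 1. *)
Lemma ideal_approximation (Y : lmodType K) (r : Y -> R) (Lam : L -> Y) (T T' S : L) (e : R) :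
  (forall x y, r (x + y) <= r x + r y) -> (forall (a : K) x, r (a *: x) = rnorm a * r x) ->
  linear Lam ->
  (forall (G : Y -> K^o) b, linear G -> (forall y, rnorm (G y) <= b * r y) ->
     exists2 f : dual L, V f & forall Q, f Q = G (Lam Q)) ->
  kop S -> opnorm T <= 1 -> opnorm (T' - T - S) <= 1 -> 0 < e ->
  exists A : L, [/\ kop A, opnorm (S + T - A) < 1 + e & r (Lam T' - Lam A) < e].
Proof.
move=> rD rZ lLam HV kS T1 T1' e0; apply: contrapT => noA.
have r0 y : 0 <= r y.
  have := rD y (- y); rewrite subrr -scaleN1r rZ.
  by rewrite rnormN rnorm1 mul1r; have := rZ 0 0; rewrite scaler0 rnorm0 mul0r => ->; lra.
have e1 : 0 < 1 + e by lra.
(* The weights are chosen so that [q < 1] at the difference implies both bounds required of [A]. *)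
pose q (x : L * Y) := (1 + e)^-1 * opnorm x.1 + e^-1 * r x.2.
have ai : 0 < (1 + e)^-1 by rewrite invr_gt0.
have bi : 0 < e^-1 by rewrite invr_gt0.
pose A0 : set (L * Y) := [set x | exists2 A, kop A & x = (A, Lam A)].
have [|a x|||_ [A kA ->]|F [lF Fq FA Fz]] := @seminorm_separation R k (L * Y)%type q A0 (S
  + T, Lam T').
- move=> x y; rewrite /q /=.
  have h1 := ler_wpM2l (ltW ai) (opnormD x.1 y.1); have h2 := ler_wpM2l (ltW bi) (rD x.2 y.2).
  by move: h1 h2; rewrite !mulrDr; lra.
- by rewrite /q /= opnormZ rZ mulrDr !(mulrCA (rnorm a)).
- by exists (0, Lam 0), 0 => //; exact: kop0.
- by move=> a _ _ [A kA ->] [B kB ->]; exists (a *: A + B); [exact: kop_lin|rewrite lLam].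
- rewrite leNgt; apply/negP; rewrite /q /= => q1; apply: noA; exists A.
  have h1 : 0 <= e^-1 * r (Lam T' - Lam A) by rewrite mulr_ge0// ltW.
  have h2 : 0 <= (1 + e)^-1 * opnorm (S + T - A) by rewrite mulr_ge0 ?opnorm_ge0// ltW.
  split=> //.
    have : (1 + e)^-1 * opnorm (S + T - A) < 1 by apply: le_lt_trans q1; rewrite lerDl.
    by rewrite ltr_pdivrMl// mulr1.
  have : e^-1 * r (Lam T' - Lam A) < 1 by apply: le_lt_trans q1; rewrite lerDr.
  by rewrite ltr_pdivrMl// mulr1.
have r00 : r 0 = 0 by have := rZ 0 0; rewrite scaler0 rnorm0 mul0r.
have o00 : opnorm (0 : L) = 0 by rewrite -bop_normE rnorm0.
have [|Q|psi psiE] := @mk_bop R k L (K^o : normedModType K) (fun Q => F (Q, 0)) (1 + e)^-1.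
- by move=> a x y; rewrite -lF; congr F; apply: injective_projections => //=; rewrite scaler0 addr0.
- by have := Fq (Q, 0); rewrite /q /= r00 mulr0 addr0 bop_normE.
have [|y|v vV vE] := HV (fun y => F (0, y)) e^-1.
- by move=> a x y; rewrite -lF; congr F; apply: injective_projections => //=; rewrite scaler0 addr0.
- by have := Fq (0, y); rewrite /q /= o00 mulr0 add0r.
have FE Q y : F (Q, y) = F (Q, 0) + F (0, y).
  by rewrite -(linD lF); congr F; apply: injective_projections => /=; rewrite ?addr0 ?add0r.
pose j := psi + v.
have jJ : annihilator J j.
  move=> A /compact_opP kA; rewrite /j bop_addE psiE vE -FE.
  by apply: FA; exists A.
have psi1 : opnorm psi <= (1 + e)^-1.
  apply: opnorm_le => [|Q]; first exact: ltW.
  by have := Fq (Q, 0); rewrite /q /= r00 mulr0 addr0 psiE bop_normE.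
have psij : psi = j + - v by rewrite /j addrK.
have := psi1; rewrite psij ideal_addV//; last exact: ideal_opp.
have -> : opnorm (- v) = opnorm v by rewrite -!bop_normE rnormN.
move=> jv.
have FzE : F (S + T, Lam T') = j T + v (T' - T - S).
  rewrite FE -psiE -vE psij bop_addE bop_oppE.
  rewrite (bopD j S T) jJ ?add0r; last exact/compact_opP.
  by rewrite (bopB v _ S) (bopB v T' T) (bopD v S T) -addrA; congr (_ + _); rewrite opprD;
    rewrite addrC addrA addrAC.
have : rnorm (j T + v (T' - T - S)) <= opnorm j + opnorm v.
  apply: le_trans (rnormD _ _) _; apply: lerD.
    by apply: le_trans (opnormP _ _) _; rewrite bop_normE ler_piMr ?opnorm_ge0.
  by apply: le_trans (opnormP _ _) _; rewrite bop_normE ler_piMr ?opnorm_ge0.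
have : (1 + e)^-1 < 1 by rewrite invf_lt1//; lra.
rewrite -FzE Fz rnorm1; lra.
Qed.

End MIdealApproximation.

Section MIdealInstances.
Context {R : realType} {k : scalar_kind}.
Notation K := (kfield R k).
Notation dual E := (bop E (K^o : normedModType K)).

Lemma opnorm_scale_le (E F : normedModType K) (T : bop E F) (a C : R) : 0 <= a -> 0 <= C ->
  (forall x, rnorm x <= 1 -> a * rnorm (T x) <= C) -> a * opnorm T <= C.
Proof.
rewrite le_eqVlt => /orP[/eqP<-|a0] C0 TC; first by rewrite mul0r.
rewrite -ler_pdivlMl//; apply: opnorm_approx_unit => x x1.
by rewrite ler_pdivlMl// TC.
Qed.

Variable E : normedModType K.
Notation L := (bop E E : normedModType K).
Notation J := (compact_op : set L).
Hypothesis mE : M_ideal J.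

(** Both kinds of functionals are already normed by operators of rank one, which puts them into [V]
    by [ideal_norming]. *)
Lemma ideal_predual : exists V : set (dual L),
  [/\ submod_closed (mem V : {pred dual L}),
      (forall f : dual L, exists! jv : dual L * dual L,
         [/\ annihilator J jv.1, V jv.2 & f = jv.1 + jv.2]),
      (forall j v : dual L, annihilator J j -> V v -> `|j + v| = `|j| + `|v|),
      (forall (z : E) (g : dual E), exists2 f : dual L, V f & forall Q, f Q = g (Q z)) &
      (forall (h : dual E) (G : dual (dual E : normedModType K)),
         exists2 f : dual L, V f & forall Q, f Q = G (bcomp h Q))].
Proof.
have [_ _ [V [sV dV aV]]] := mE; exists V; split=> // [z g|h G].
- have [|Q|f fE] := @mk_bop R k L (K^o : normedModType K) (fun Q => g (Q z)) (rnorm z * opnorm g).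
  + by move=> a x y; rewrite bop_addE bop_scaleE (bop_linear g).
  + rewrite bop_normE mulrAC; apply: le_trans (opnormP _ _) _; rewrite mulrC.
    by rewrite ler_wpM2r ?opnorm_ge0// mulrC opnormP.
  exists f => //; apply: (ideal_norming dV aV) => C C0 fC.
  apply: (@le_trans _ _ (rnorm z * opnorm g)).
    apply: opnorm_le => [|Q]; first by rewrite mulr_ge0 ?rnorm_ge0 ?opnorm_ge0.
    rewrite fE bop_normE mulrAC; apply: le_trans (opnormP _ _) _; rewrite mulrC.
    by rewrite ler_wpM2r ?opnorm_ge0// mulrC opnormP.
  apply: opnorm_scale_le => // [|w w1]; first exact: rnorm_ge0.
  have [phi [phi1 _ phiz]] := norming z; have [A [AE kA nA]] := rank_one_ex phi w.
  have := fC A kA; rewrite fE AE bopZ rnormZ phiz rnorm_kofR ger0_norm ?rnorm_ge0// => h.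
  apply: le_trans h _; rewrite ler_piMr//; apply: le_trans nA _.
  by rewrite mulr_ile1 ?opnorm_ge0 ?rnorm_ge0.
- have bnd (Q : L) : rnorm (G (bcomp h Q)) <= opnorm h * opnorm G * rnorm Q.
    apply: le_trans (opnormP _ _) _; rewrite mulrC mulrAC ler_wpM2r ?opnorm_ge0//.
    rewrite !bop_normE; apply: opnorm_le => [|x]; first by rewrite mulr_ge0 ?opnorm_ge0.
    by rewrite bcompE -mulrA; apply: le_trans (opnormP _ _) _; rewrite ler_wpM2l
      ?opnorm_ge0// opnormP.
  have [|Q|f fE] := @mk_bop R k L (K^o : normedModType K) (fun Q => G (bcomp h Q)) (opnorm
    h * opnorm G).
  + move=> a x y; rewrite -(bop_linear G); congr (G _); apply: bop_ext => v.
    by rewrite bop_addE bop_scaleE !bcompE bop_addE bop_scaleE (bop_linear h).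
  + exact: bnd.
  exists f => //; apply: (ideal_norming dV aV) => C C0 fC.
  apply: (@le_trans _ _ (opnorm h * opnorm G)).
    apply: opnorm_le => [|Q]; first by rewrite mulr_ge0 ?opnorm_ge0.
    by rewrite fE.
  apply: opnorm_scale_le => // [|g g1]; first exact: opnorm_ge0.
  rewrite mulrC; apply: opnorm_scale_le => // [|w w1]; first exact: rnorm_ge0.
  have [A [AE kA nA]] := rank_one_ex g w.
  have e : bcomp h A = h w *: g.
    by apply: bop_ext => x; rewrite bcompE AE bopZ bop_scaleE; exact: mulrC.
  have := fC A kA; rewrite fE e bopZ rnormZ mulrC => le; apply: le_trans le _.
  rewrite ler_piMr//; apply: le_trans nA _.
  by rewrite mulr_ile1 ?opnorm_ge0 ?rnorm_ge0// -bop_normE.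
Qed.

(** Here [Y] is the ell_1-sum of [n] copies of [E]; a bounded functional on it, composed with [Lam],
    is a finite sum of maps [Q |-> g (Q z)], which are in [V]. *)
Lemma approximation_at_points n (z : 'I_n -> E) (T T' S : L) (e : R) :
  kop S -> opnorm T <= 1 -> opnorm (T' - T - S) <= 1 -> 0 < e ->
  exists A : L, [/\ kop A, opnorm (S + T - A) < 1 + e &
    forall i, rnorm (T' (z i) - A (z i)) < e].
Proof.
move=> kS T1 T1' e0; have [V [sV dV aV Vpt _]] := ideal_predual.
pose r (y : {ffun 'I_n -> E}) := \sum_i rnorm (y i).
pose Lam (Q : L) := [ffun i => Q (z i)] : {ffun 'I_n -> E}.
pose io i (w : E) := [ffun j => if j == i then w else 0] : {ffun 'I_n -> E}.
have rio i w : r (io i w) = rnorm w.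
  rewrite /r (bigD1 i)//= ffunE eqxx big1 ?addr0// => j ji.
  by rewrite ffunE (negbTE ji) rnorm0.
have iolin i : linear (io i).
  by move=> a x y; apply/ffunP => j; rewrite !ffunE; case: eqP; rewrite ?scaler0 ?addr0.
have [| | |G b lG Gb|A [kA nA rA]] := @ideal_approximation R k E V sV aV _ r Lam T T' S e _
  _ _ _ kS T1 T1' e0.
- by move=> x y; rewrite /r -big_split; apply: ler_sum => i _; rewrite ffunE rnormD.
- by move=> a x; rewrite /r mulr_sumr; apply: eq_bigr => i _; rewrite ffunE rnormZ.
- by move=> a x y; apply/ffunP => i; rewrite !ffunE.
- have /choice[g gE] (i : 'I_n) : exists g : dual E, forall w, g w = G (io i w).
    apply: (@mk_bop R k E (K^o : normedModType K) _ b) => [a x y|w].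
      by rewrite iolin lG.
    by rewrite -(rio i w).
  have /choice[f fP] (i : 'I_n) : exists f : dual L, V f /\ forall Q, f Q = g i (Q (z i)).
    by have [f Vf fE] := Vpt (z i) (g i); exists f.
  exists (\sum_(i < n) f i); first by apply: (ideal_sum sV) => i; case: (fP i).
  move=> Q; rewrite bop_sumE; have -> : Lam Q = \sum_i io i (Q (z i)).
    apply/ffunP => j; rewrite sum_ffunE (bigD1 j)//= !ffunE eqxx big1 ?addr0// => i ij.
    by rewrite ffunE eq_sym (negbTE ij).
  by rewrite (lin_sum lG); apply: eq_bigr => i _; rewrite (fP i).2 gE.
exists A; split=> // i; apply: le_lt_trans rA; rewrite /r (bigD1 i)//= !ffunE lerDl.
by apply: sumr_ge0 => j _; exact: rnorm_ge0.
Qed.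

(** Here [Y] is the dual of [E] and [Lam Q] is [h] composed with [Q]; both [T] and [T'] are the
    identity. *)
Lemma approximation_at_functional (h : dual E) (S : L) (e : R) :
  kop S -> opnorm S <= 1 -> 0 < e ->
  exists A : L, [/\ kop A, opnorm (S + bid E - A) < 1 + e &
    forall x, rnorm (h x - h (A x)) <= e * rnorm x].
Proof.
move=> kS S1 e0; have [V [sV dV aV _ Vfun]] := ideal_predual.
have bE Q x : bcomp h Q x = h (Q x) by exact: bcompE.
have id1 : opnorm (bid E) <= 1 by apply: opnorm_le => // x; rewrite bidE mul1r.
have S1' : opnorm (bid E - bid E - S) <= 1 by rewrite subrr sub0r -bop_normE rnormN bop_normE.
have [| | |G b lG Gb|A [kA nA rA]] := @ideal_approximation R k E V sV aV (dual E)
  (fun f => rnorm f) (fun Q => bcomp h Q) (bid E) (bid E) S e _ _ _ _ kS id1 S1' e0.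
- exact: rnormD.
- exact: rnormZ.
- by move=> a x y; apply: bop_ext => v; rewrite bop_addE bop_scaleE !bE bop_addE bop_scaleE
  (bop_linear h).
- have [G' G'E] := @mk_bop R k (dual E : normedModType K) (K^o : normedModType K) G b lG Gb.
  have [f Vf fE] := Vfun h G'; exists f => // Q; by rewrite fE G'E.
exists A; split=> // x.
have -> : h x - h (A x) = (bcomp h (bid E) - bcomp h A) x by rewrite bop_subE !bE bidE.
by apply: opnormP1; rewrite -bop_normE ltW.
Qed.

End MIdealInstances.

Section MIdealProperties.
Context {R : realType} {k : scalar_kind}.
Notation K := (kfield R k).
Notation dual E := (bop E (K^o : normedModType K)).
Variable E : normedModType K.
Notation L := (bop E E : normedModType K).
Hypothesis mE : M_ideal (compact_op : set L).

Lemma rcvZ (a : R) (u : nat -> R) l : rcv u l -> rcv (fun n => a * u n) (a * l).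
Proof. by move=> /rcvP ul; apply/rcvP; exact: cvgMr. Qed.

Lemma regroup (W : zmodType) (z u w s a b : W) :
  z + u = (z + s + (w + u) - (a + b)) - (w - a) - (s - b).
Proof.
have -> : z + s + (w + u) - (a + b) = z + u + (s - b) + (w - a).
  by rewrite (addrC w u) (addrACA z s u w) -(addrA (z + u) (s + w)) (addrC a b) opprD
    (addrACA s w) addrA.
by rewrite !addrK.
Qed.

Lemma opnorm_bid : opnorm (bid E) <= 1.
Proof. by apply: opnorm_le => // x; rewrite bidE mul1r. Qed.

Lemma opnorm_cancel (T S : L) : opnorm S <= 1 -> opnorm (T - T - S) <= 1.
Proof. by move=> S1; rewrite subrr sub0r -bop_normE rnormN bop_normE. Qed.

(** Approximation at points with [S = 0], [T = 0] and [T'] the identity gives compact operators of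
    norm below [1 + 1 / (n + 1)] that nearly fix the first points of [d]; the scalars [c n] make
    them contractions. *)
Lemma ideal_approximating_sequence (d : nat -> E) :
  (forall x e, 0 < e -> exists n, rnorm (d n - x) < e) ->
  exists S : nat -> L, [/\ forall n, kop (S n),
    forall n x, rnorm (S n x) <= rnorm x & forall x, cv (fun n => S n x) x].
Proof.
move=> dd.
have /choice[A AP] (n : nat) : exists A : L, [/\ kop A, opnorm A < 1 + n.+1%:R^-1 &
    forall i, (i < n)%N -> rnorm (d i - A (d i)) < n.+1%:R^-1].
  have n0 : 0 < n.+1%:R^-1 :> R by rewrite invr_gt0.
  have [||A [kA nA dA]] := approximation_at_points mE (fun i : 'I_n => d i) (T := 0) (T' :=
    bid E) (@kop0 _ _ E E) _ _ n0.
  - by rewrite -bop_normE rnorm0.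
  - by rewrite !subr0 opnorm_bid.
  exists A; split=> //; first by move: nA; rewrite addr0 sub0r -bop_normE rnormN bop_normE.
  by move=> i il; have := dA (Ordinal il); rewrite bidE.
pose c n : R := (1 + n.+1%:R^-1)^-1.
have c0 n : 0 < 1 + n.+1%:R^-1 :> R by rewrite addr_gt0// invr_gt0.
have cc n : 0 < c n by rewrite invr_gt0.
have c1 n : 1 - c n <= n.+1%:R^-1.
  have : c n * (1 + n.+1%:R^-1) = 1 by rewrite /c mulVf// gt_eqF.
  have : c n <= 1 by rewrite /c invf_le1// lerDl invr_ge0.
  have : 0 <= n.+1%:R^-1 :> R by rewrite invr_ge0.
  move: (n.+1%:R^-1) (c n) => iv cn i0 h1.
  by have := ler_wpM2r i0 h1; lra.
exists (fun n => kofR (c n) *: A n).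
have contr n x : rnorm ((kofR (c n) *: A n) x) <= rnorm x.
  have [_ /ltW nA _] := AP n.
  rewrite bop_scaleE rnormZ rnorm_kofR ger0_norm ?(ltW (cc n))// /c ler_pdivrMl//.
  exact: opnormP1.
split=> [n||x e e0]; [by apply: kopZ; case: (AP n)|exact: contr|].
have e4 : 0 < e / 4 by rewrite divr_gt0.
have [i di] := dd x _ e4; have Ml : 0 < e / (4 * (rnorm (d i) + 1)).
  by rewrite divr_gt0// mulr_gt0// ltr_wpDl ?rnorm_ge0.
have [N1 HN1] := inv_lt e4; have [N2 HN2] := inv_lt Ml.
exists (maxn i.+1 (maxn N1 N2)) => n; rewrite !geq_max => /and3P[ni n1 n2].
have [_ _ /(_ i ni) h1] := AP n.
have h2 := contr n (x - d i); rewrite bopB in h2.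
have h3 : rnorm ((kofR (c n) *: A n) (d i) - d i) <= e / 4 + e / 4.
  rewrite bop_scaleE.
  have -> : kofR (c n) *: A n (d i) - d i = kofR (c n) *: (A n (d i) - d i) - kofR (1 - c n) *: d i.
    by rewrite scalerBr kofRD kofR1 kofRN scalerBl scale1r opprB addrA subrK.
  apply: le_trans (rnormB _ _) _; rewrite !rnormZ !rnorm_kofR.
  have c11 : c n <= 1 by rewrite /c invf_le1// lerDl invr_ge0.
  rewrite !ger0_norm ?subr_ge0 ?(ltW (cc n))//; apply: lerD.
    rewrite (rnormBC (A n (d i)) (d i)); apply: (@le_trans _ _ (1 * rnorm (d i - A n (d i)))).
      by rewrite ler_wpM2r ?rnorm_ge0.
    by rewrite mul1r ltW// (lt_trans h1)// HN1.
  apply: (@le_trans _ _ (e / (4 * (rnorm (d i) + 1)) * (rnorm (d i) + 1))); last first.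
    rewrite le_eqVlt; apply/orP; left; apply/eqP; field.
    by rewrite gt_eqF// ltr_wpDl ?rnorm_ge0.
  apply: ler_pM; rewrite ?subr_ge0 ?rnorm_ge0 ?lerDl//.
  by apply: le_trans (c1 n) _; apply/ltW/HN2.
move: h2 h3; set S := kofR (c n) *: A n => h2 h3.
have := rnorm_triangle (S x) (S (d i)) x; have := rnorm_triangle (S (d i)) (d i) x.
by rewrite (rnormBC x (d i)) in h2; lra.
Qed.

(** A contraction [S] of rank one sends [w] to [z], and [A] nearly fixes [w]. As [S] and [A] are
    compact, [S + I - A] moves [w + u n] close to [z + u n], and its norm is at most [1 + e]. *)
Lemma ideal_property_M (z w : E) (u : nat -> E) M c d : rnorm z <= rnorm w ->
  (forall n, rnorm (u n) <= M) -> (forall f : dual E, cv (f \o u) 0) ->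
  rcv (fun n => rnorm (z + u n)) c -> rcv (fun n => rnorm (w + u n)) d -> c <= d.
Proof.
move=> zw uM u0 zc wd.
have [S [kS S1 Sw]] : exists S : L, [/\ kop S, opnorm S <= 1 & S w = z].
  have [phi [phi1 _ phiw]] := norming w.
  have [A [AE kA nA]] := rank_one_ex phi (kofR (rnorm w)^-1 *: z).
  exists A; split=> //.
    apply: le_trans nA _; apply: mulr_ile1; rewrite ?opnorm_ge0 ?rnorm_ge0//.
    rewrite rnormZ rnorm_kofR ger0_norm ?invr_ge0 ?rnorm_ge0//.
    have [->|w0] := eqVneq (rnorm w) 0; first by rewrite invr0 mul0r.
    by rewrite ler_pdivrMl ?mulr1// lt_neqAle eq_sym w0 rnorm_ge0.
  rewrite AE phiw scalerA -kofRM.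
  have [w0|w0] := eqVneq (rnorm w) 0; last by rewrite mulfV// kofR1 scale1r.
  rewrite (_ : z = 0) ?scaler0//; apply: rnorm_eq0; apply/le_anti.
  by rewrite rnorm_ge0 andbT -w0.
have d0 : 0 <= d by apply: (rcv_le (u := fun=> 0)) wd => [n|]; [exact: rnorm_ge0|exact: rcv_cst].
have key e : 0 < e -> c <= (1 + e) * d + e.
  move=> e0.
  have [A [kA nA wA]] := approximation_at_points mE (fun i : 'I_1 => w) kS opnorm_bid
    (opnorm_cancel (bid E) S1) e0.
  have Su := cv_norm (kop_weak_norm kS uM u0); have Au := cv_norm (kop_weak_norm kA uM u0).
  rewrite rnorm0 in Su Au.
  have := rcvB0 (rcvZ (1 + e) wd) (rcvB0 (rcv_cst e) (rcvB0 Su Au)); rewrite !addr0.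
  apply: rcv_le zc => n /=.
  have h1 := opnormP1 (w + u n) (ltW nA).
  have := wA ord0; rewrite bidE => h2.
  have h3 : z + u n = (S + bid E - A) (w + u n) - (w - A w) - (S (u n) - A (u n)).
    rewrite bop_subE bop_addE bidE (bopD S) (bopD A) Sw.
    exact: regroup.
  rewrite h3.
  have h4 := rnormB ((S + bid E - A) (w + u n) - (w - A w)) (S (u n) - A (u n)).
  have h5 := rnormB ((S + bid E - A) (w + u n)) (w - A w).
  have h6 := rnormB (S (u n)) (A (u n)).
  by apply: le_trans h4 _; rewrite addrA lerD// (le_trans h5)// lerD// ltW.
rewrite leNgt; apply/negP => dc.
have e0 : 0 < (c - d) / (2 * (d + 1)) by rewrite divr_gt0 ?subr_gt0// mulr_gt0// ltr_wpDl.
have := key _ e0; have : (c - d) / (2 * (d + 1)) * (d + 1) = (c - d) / 2.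
  by field; rewrite gt_eqF// ltr_wpDl.
move: (_ / (2 * _)) => q; lra.
Qed.

End MIdealProperties.

(** * Property (M) in the dual and weakly Cauchy subsequences *)

Section DualProperties.
Context {R : realType} {k : scalar_kind}.
Notation K := (kfield R k).
Notation dual E := (bop E (K^o : normedModType K)).
Variable E : normedModType K.
Notation L := (bop E E : normedModType K).

Lemma regroup_dual (W : zmodType) (a b c d e f : W) :
  a + d = (a + b - c) + (e + d - f) - (b - c) - (e - f).
Proof.
rewrite -(addrA a) (addrC e) -(addrA d) (addrACA a) addrA.
by rewrite (addrAC (a + d + (b - c))) !addrK.
Qed.

(** A bounded, pointwise null sequence of functionals is uniformly small on relatively compact
    sets. *)
Lemma pointwise_null_kop (A : L) (h : nat -> dual E) M (e : R) : kop A ->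
  (forall n, opnorm (h n) <= M) -> (forall x, cv (fun n => h n x) 0) -> 0 < e ->
  exists N, forall n, (N <= n)%N -> forall x, rnorm (h n (A x)) <= e * rnorm x.
Proof.
move=> kA hM h0 e0; have M0 : 0 <= M := le_trans (opnorm_ge0 _) (hM 0%N).
suff [N HN] : exists N, forall n, (N <= n)%N -> forall x, rnorm x <= 1 -> rnorm (h n (A x)) <= e.
  exists N => n /HN Hn x.
  have := @opnorm_unit _ _ E (K^o : normedModType K) (bcomp (h n) A) e _ x; rewrite bcompE; apply.
  by move=> y y1; rewrite bcompE; exact: Hn.
apply: contrapT => /forallNP Hn.
have [|s si] := @subseq_of_frequently (fun n => exists2 x, rnorm x <= 1 & e < rnorm (h n (A x))).
  move=> N; have /existsNP[n /not_implyP[Nn /existsNP[x /not_implyP[x1 /negP]]]] := Hn N.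
  by rewrite -ltNge => lt; exists n => //; exists x.
move=> hs.
have /choice[x xP] (n : nat) : exists x, rnorm x <= 1 /\ e < rnorm (h (s n) (A x)).
  by have [x x1 xe] := hs n; exists x.
have [t [y [ti Ay]]] := kA x (fun n => (xP n).1).
have e2 : 0 < e / (2 * (M + 1)) by rewrite divr_gt0// mulr_gt0// ltr_wpDl.
have e2' : 0 < e / 2 by rewrite divr_gt0.
have [N1 H1] := Ay _ e2; have [N2 H2] := cv_sub (incr_comp si ti) (h0 y) e2'.
pose n := maxn N1 N2; have := H1 n (leq_maxl _ _); have := H2 n (leq_maxr _ _) => /=.
have [_] := xP (t n); rewrite subr0; move: (h (s (t n))) (hM (s (t n))) => g gM h1 h2 h3.
have h4 : rnorm (g (A (x (t n)) - y)) <= M * (e / (2 * (M + 1))).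
  apply: le_trans (opnormP _ _) _; apply: ler_pM; rewrite ?opnorm_ge0 ?rnorm_ge0//.
  exact: ltW.
have h5 : M * (e / (2 * (M + 1))) <= e / 2.
  rewrite (_ : M * _ = e / 2 * (M / (M + 1))); last by field; rewrite gt_eqF// ltr_wpDl.
  by rewrite ler_piMr ?(ltW e2')// ler_pdivrMr ?ltr_wpDl// mul1r lerDl.
rewrite bopB in h4; have := rnorm_sub_le (g (A (x (t n)))) (g y); lra.
Qed.

Hypothesis mE : M_ideal (compact_op : set L).

(** The strict inequality leaves room for a contraction [S] of rank one with [g \o S = f], even if
    [g] does not attain its norm. Then [f + h n] is close to [(g + h n) \o (S + I - A)], because
    [h n] is small on the ranges of [S] and [A]. *)
Lemma ideal_property_M_dual (f g : dual E) (h : nat -> dual E) D (e : R) :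
  opnorm f < opnorm g -> (forall n, opnorm (g + h n) <= D) ->
  (forall x, cv (fun n => h n x) 0) -> 0 < e ->
  exists N, forall n, (N <= n)%N -> opnorm (f + h n) <= D + e.
Proof.
move=> fg gD h0 e0; have D0 : 0 <= D := le_trans (opnorm_ge0 _) (gD 0%N).
have hM n : opnorm (h n) <= D + opnorm g.
  have -> : h n = (g + h n) - g by rewrite addrAC subrr add0r.
  by apply: le_trans (opnormD _ _) _; rewrite -[opnorm (- g)]bop_normE rnormN bop_normE lerD2r.
have [S [kS S1 gS]] : exists S : L, [/\ kop S, opnorm S <= 1 & forall x, g (S x) = f x].
  have [|w0 w1 gw] := opnorm_approx g (_ : 0 < opnorm g - opnorm f); first by rewrite subr_gt0.
  rewrite subKr in gw; have gw0 : 0 < rnorm (g w0) := le_lt_trans (opnorm_ge0 f) gw.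
  have gn0 : g w0 != 0 by apply/eqP => g0; rewrite g0 rnorm0 ltxx in gw0.
  have [A [AE kA nA]] := rank_one_ex f ((g w0)^-1 *: w0); exists A; split=> //.
    apply: le_trans nA _; rewrite rnormZ.
    have -> : rnorm ((g w0)^-1 : K) = (rnorm (g w0))^-1.
      apply: (mulfI (lt0r_neq0 gw0)); rewrite mulfV ?gt_eqF//.
      by rewrite -[LHS](rnormZ (g w0) ((g w0)^-1 : K^o)) -[_ *: _]/(_ * _) mulfV// rnorm1.
    rewrite mulrA -[leRHS]mulr1; apply: ler_pM; rewrite ?rnorm_ge0 ?mulr_ge0 ?invr_ge0
      ?opnorm_ge0 ?rnorm_ge0//.
    by rewrite ler_pdivrMr// mul1r ltW.
  by move=> x; rewrite AE !bopZ -![_ *: _]/(_ * _) mulVf// mulr1.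
pose d := e / (D + 3); have d0 : 0 < d by rewrite divr_gt0// ltr_wpDl.
have [A [kA nA gA]] := approximation_at_functional mE g kS S1 d0.
have [N1 H1] := pointwise_null_kop kS hM h0 d0.
have [N2 H2] := pointwise_null_kop kA hM h0 d0.
exists (maxn N1 N2) => n; rewrite geq_max => /andP[/H1 h1 /H2 h2].
apply: opnorm_le => [|x]; first by rewrite addr_ge0// ltW.
have -> : (f + h n) x = (g + h n) ((S + bid E - A) x) - (g x - g (A x)) - (h n (S x) - h n (A x)).
  rewrite !bop_addE bop_oppE bidE -gS !bopB !bopD; exact: regroup_dual.
have h3 : rnorm ((g + h n) ((S + bid E - A) x)) <= D * ((1 + d) * rnorm x).
  apply: le_trans (opnormP _ _) _; apply: ler_pM; rewrite ?opnorm_ge0 ?rnorm_ge0//.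
  by apply: opnormP1; exact: ltW.
have h4 := gA x; have h5 := h1 x; have h6 := h2 x.
have h7 : (D + e) * rnorm x = D * ((1 + d) * rnorm x) + d * rnorm x + (d * rnorm x + d * rnorm x).
  by rewrite /d; field; rewrite gt_eqF// ltr_wpDl.
rewrite h7; apply: le_trans (rnormB _ _) _; apply: lerD.
  by apply: le_trans (rnormB _ _) _; apply: lerD.
by apply: le_trans (rnormB _ _) _; apply: lerD.
Qed.

End DualProperties.

Section DualWeakConvergence.
Context {R : realType} {k : scalar_kind}.
Notation K := (kfield R k).
Notation dual E := (bop E (K^o : normedModType K)).
Variable E : normedModType K.
Notation L := (bop E E : normedModType K).
Hypothesis mE : M_ideal (compact_op : set L).
Variable S : nat -> L.
Hypothesis kS : forall n, kop (S n).
Hypothesis S1 : forall n x, rnorm (S n x) <= rnorm x.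
Hypothesis Scv : forall x, cv (fun n => S n x) x.

(* A functional [G] with [G (f \o S n - f)] away from [0] would exceed its norm on
   [psi + (f \o S n - f)] when [psi] almost norms [G] and has norm less than [f]. *)
Lemma compact_approximation_weak (f : dual E) (G : dual (dual E : normedModType K)) :
  cv (fun n => G (bcomp f (S n))) (G f).
Proof.
pose h n : dual E := bcomp f (S n) - f.
have hx x : cv (fun n => h n x) 0.
  have := cvB (bop_cv f (Scv x)) (cv_cst (f x)); rewrite subrr.
  by congr cv; apply/funext => n; rewrite /h bop_subE bcompE.
have fh n : opnorm (f + h n) <= opnorm f.
  rewrite /h addrC subrK; apply: opnorm_le => [|x]; first exact: opnorm_ge0.
  by rewrite bcompE; apply: le_trans (opnormP _ _) _; rewrite ler_wpM2l ?opnorm_ge0.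
suff Gh : cv (fun n => G (h n)) 0.
  have := cvD Gh (cv_cst (G f)); rewrite add0r; congr cv; apply/funext => n.
  by rewrite -bopD /h subrK.
have hM n : rnorm (h n) <= 2 * opnorm f.
  have -> : h n = (f + h n) - f by rewrite addrAC subrr add0r.
  apply: le_trans (rnormB _ _) _; rewrite !bop_normE mulr_natl mulr2n.
  by rewrite lerD2r.
apply: contrapT => nGh.
have [d d0 hd] : exists2 d : R, 0 < d & forall N, exists2 n, (N <= n)%N & d <= rnorm (G (h n)).
  apply: contrapT => H; apply: nGh => d d0; apply: contrapT => /forallNP H'.
  apply: H; exists d => // N; have /existsNP[n /not_implyP[Nn hn]] := H' N; exists n => //.
  by rewrite leNgt -[G (h n)]subr0; exact/negP.
have [t ti td] := subseq_of_frequently hd.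
have [|t' [c [ti' Gc]]] := @scalar_subseq R k (fun n => G (h (t n))) (opnorm G * (2 * opnorm f)).
  by move=> n; apply: le_trans (opnormP _ _) _; rewrite ler_wpM2l ?opnorm_ge0.
have c0 : 0 < rnorm c.
  apply: lt_le_trans d0 _; apply: (rcv_le (u := fun=> d) (v := fun n => rnorm (G (h (t (t' n)))))).
  - by move=> n; exact: td.
  - exact: rcv_cst.
  - exact: cv_norm Gc.
pose g := opnorm G; pose F := opnorm f.
have g0 : 0 <= g := opnorm_ge0 G. have F0 : 0 <= F := opnorm_ge0 f.
have Fgt0 : 0 < F.
  rewrite lt_neqAle F0 andbT; apply/eqP => /esym f0.
  have z n : h n = 0.
    by apply: rnorm_eq0; apply/le_anti; rewrite rnorm_ge0 andbT; have := hM n; rewrite -/F f0 mulr0.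
  by have := td 0%N; rewrite z bop0 rnorm0 leNgt d0.
(* Comparing the two estimates of [rnorm (c + G psi)] will give [rnorm c <= e * (g + F * g + F)];
   this [e] makes the right side at most half of [rnorm c]. *)
pose e := Num.min 1 (rnorm c / (2 * (g + F * g + F + 1))).
have D0 : 0 < g + F * g + F + 1 by rewrite ltr_wpDl// !addr_ge0// mulr_ge0.
have e0 : 0 < e by rewrite lt_min ltr01 divr_gt0// mulr_gt0.
have e1 : e <= 1 by rewrite ge_min lexx.
have ec : e * (g + F * g + F + 1) <= rnorm c / 2.
  apply: (@le_trans _ _ (rnorm c / (2 * (g + F * g + F + 1)) * (g + F * g + F + 1))).
    by apply: ler_wpM2r; [exact: ltW|rewrite ge_min lexx orbT].
  by rewrite le_eqVlt; apply/orP; left; apply/eqP; field; rewrite gt_eqF.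
have [psi0 psi01 Gpsi0] := opnorm_approx G e0; rewrite -/g in Gpsi0.
have [s s1 sP] := phase2 c (G (kofR ((1 - e) * F) *: psi0)).
pose psi := s *: (kofR ((1 - e) * F) *: psi0).
have a0 : 0 <= (1 - e) * F by rewrite mulr_ge0// subr_ge0.
have psif : opnorm psi < opnorm f.
  rewrite /psi !opnormZ s1 mul1r rnorm_kofR ger0_norm//; rewrite bop_normE in psi01.
  apply: (@le_lt_trans _ _ ((1 - e) * F * 1)); first by rewrite ler_wpM2l.
  by rewrite mulr1 mulrBl mul1r -/F gtrDl oppr_lt0 mulr_gt0.
have [N HN] := ideal_property_M_dual mE psif fh hx e0.
have h1 : rnorm (c + G psi) = rnorm c + (1 - e) * F * rnorm (G psi0).
  by rewrite /psi bopZ sP bopZ rnormZ rnorm_kofR ger0_norm.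
have h2 : rnorm (c + G psi) <= g * (F + e).
  have ii : incr (fun n => (n + N)%N) by move=> n; rewrite addSn.
  have := cv_norm (cv_sub ii (cvD Gc (cv_cst (G psi)))) => /rcv_le.
  move=> /(_ (fun=> g * (F + e)) (g * (F + e))); apply; last exact: rcv_cst.
  move=> n /=; rewrite addrC -bopD; apply: le_trans (opnormP _ _) _.
  rewrite bop_normE ler_wpM2l//; apply: HN.
  apply: leq_trans (leq_addl n N) _; apply: leq_trans (incr_ge ti' _) _; exact: incr_ge.
have h3 : (1 - e) * F * (g - e) <= (1 - e) * F * rnorm (G psi0) by rewrite ler_wpM2l// ltW.
have h4 : 0 <= e * e * F by rewrite !mulr_ge0// ltW.
rewrite h1 in h2.
move: h2 h3 h4 ec c0 e0; move: (rnorm c) (rnorm (G psi0)) => rc rg.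
clear -g F e R; nra.
Qed.

(** On a diagonal subsequence every [S j (u n)] converges, so all the functionals [f \o S j] are
    Cauchy there. If [f] kept a positive distance from the space [A] of functionals with this
    property, a separating [G] would vanish at each [f \o S j] but not at [f], against
    [compact_approximation_weak]. *)
Lemma ideal_wcauchy : wcauchy_property E.
Proof.
move=> u M uM; have M0 : 0 <= M := le_trans (rnorm_ge0 _) (uM 0%N).
have [||j s si|s si Hs] := @diagonal_subseq (fun j s => exists l, cv (S j \o u \o s) l).
- by move=> j s t ti [l Hl]; exists l; exact: cv_sub ti Hl.
- by move=> j s n [l Hl]; exists l; exact: cv_tail Hl.
- have [t [l [ti Hl]]] := kop_bounded (kS j) (fun n => uM (s n)).
  by exists t => //; exists l.
exists s => // f; apply: contrapT => nf.
pose A : set (dual E) := [set g : dual E | cauchyseq (fun n => g (u (s n)))].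
have [d d0 dA] : exists2 d : R, 0 < d & forall g, A g -> d <= opnorm (f - g).
  apply: contrapT => H; apply: nf => e e0.
  have e3 : 0 < e / (3 * (M + 1)) by rewrite divr_gt0// mulr_gt0// ltr_wpDl.
  have [g Ag fg] : exists2 g, A g & opnorm (f - g) < e / (3 * (M + 1)).
    apply: contrapT => H'; apply: H; exists (e / (3 * (M + 1))) => // g Ag.
    by rewrite leNgt; apply/negP => lt; apply: H'; exists g.
  have bnd n : rnorm (f (u n) - g (u n)) <= e / 3.
    rewrite -bop_subE; apply: le_trans (opnormP _ _) _.
    apply: (@le_trans _ _ (e / (3 * (M + 1)) * (M + 1))).
      apply: ler_pM; rewrite ?opnorm_ge0 ?rnorm_ge0 ?ltW//.
      by apply: le_lt_trans (uM n) _; rewrite ltrDl.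
    by rewrite le_eqVlt; apply/orP; left; apply/eqP; field; rewrite gt_eqF// ltr_wpDl.
  have [N HN] := Ag _ (divr_gt0 e0 (ltr0Sn R 2)); exists N => m n Nm Nn.
  have := HN m n Nm Nn => /=; have := bnd (s m); have := bnd (s n).
  move: (u (s m)) (u (s n)) => x y.
  have := rnorm_triangle (f x) (g x) (f y); have := rnorm_triangle (g x) (g y) (f y).
  by rewrite (rnormBC (g y) (f y)); lra.
have [| | | |g Ag|G0 [lG Gq GA Gf]] := @seminorm_separation R k (dual E) (fun g => d^-1 *
  opnorm g) A f.
- by move=> x y; rewrite -mulrDr ler_wpM2l ?opnormD// invr_ge0 ltW.
- by move=> a x; rewrite opnormZ mulrCA.
- by exists 0; rewrite /A /=; apply: (@cv_cauchy _ _ _ _ 0); exact: (cv_cst 0).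
- move=> a x y; rewrite /A /= => /scalar_complete[l xl] /scalar_complete[l' yl'].
  exact: cv_cauchy (cvD (cvZ a xl) yl').
- by rewrite ler_pdivlMl// mulr1 dA.
have [|G GE] := @mk_bop R k (dual E : normedModType K) (K^o : normedModType K) G0 d^-1 lG.
  by move=> x; rewrite bop_normE.
have := compact_approximation_weak f G.
have -> : (fun n => G (bcomp f (S n))) = fun=> 0.
  apply/funext => n; rewrite GE GA// /A /=; have [l Hl] := Hs n.
  have := cv_cauchy (bop_cv f Hl); congr cauchyseq; apply/funext => m /=.
  by rewrite bcompE.
move=> /cv_unique/(_ (cv_cst _)); rewrite GE Gf => /eqP.
by rewrite (oner_eq0 K).
Qed.

End DualWeakConvergence.

(** * Boundedness of weakly null sequences *)

Section WeakBoundedness.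
Context {R : realType} {k : scalar_kind}.
Notation K := (kfield R k).
Notation dual E := (bop E (K^o : normedModType K)).
Implicit Types E : normedModType K.
Notation h := (3^-1 : R).

(** With ratio [1 / 3] all the corrections after the [n]-th amount together to at most half of it,
    which is what keeps the gliding hump visible. *)
Lemma dual_geometric_limit E (g : nat -> dual E) :
  (forall n, opnorm (g n.+1 - g n) <= h ^+ n.+1) ->
  exists f : dual E, forall n, opnorm (f - g n) <= h ^+ n / 2.
Proof.
move=> gh.
have h0 n : 0 < h ^+ n by rewrite exprn_gt0// invr_gt0.
have step n m x : rnorm (g (n + m)%N x - g n x) <= h ^+ n / 2 * rnorm x.
  apply: (@le_trans _ _ ((h ^+ n - h ^+ (n + m)) / 2 * rnorm x)); last first.
    by rewrite ler_wpM2r ?rnorm_ge0// ler_pM2r// gerBl ltW.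
  elim: m => [|m IH]; first by rewrite addn0 !subrr rnorm0 mul0r mul0r.
  rewrite addnS; apply: le_trans (rnorm_triangle _ (g (n + m)%N x) _) _.
  have := opnormP1 x (gh (n + m)%N); rewrite bop_subE exprS.
  move: IH; move: (h ^+ (n + m)) (h ^+ n) (rnorm x) => a b c; lra.
have /choice[f fP] (x : E) : exists l, cv (fun n => g n x) l.
  apply: scalar_complete => e e0.
  have c0 : 0 < e / (2 * (rnorm x + 1)) by rewrite divr_gt0// mulr_gt0// ltr_wpDl ?rnorm_ge0.
  have [N HN] : exists N, h ^+ N < e / (2 * (rnorm x + 1)).
    have [N HN] := inv_lt c0; exists N; apply: le_lt_trans (HN N (leqnn _)).
    rewrite exprVn lef_pV2 ?posrE ?exprn_gt0//.
    by rewrite -natrX ler_nat ltn_expl.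
  exists N => m n /subnKC<- /subnKC<-.
  have h1 := step N (m - N)%N x; have h2 := step N (n - N)%N x.
  have := rnorm_triangle (g (N + (m - N))%N x) (g N x) (g (N + (n - N))%N x).
  rewrite (rnormBC (g N x)) => h3; apply: le_lt_trans h3 _.
  have h4 : h ^+ N * rnorm x <= e / (2 * (rnorm x + 1)) * (rnorm x + 1).
    by apply: ler_pM; rewrite ?rnorm_ge0 ?ltW// ltrDl.
  have h5 : e / (2 * (rnorm x + 1)) * (rnorm x + 1) = e / 2.
    by field; rewrite gt_eqF// ltr_wpDl ?rnorm_ge0.
  by move: h1 h2 h4; rewrite h5; lra.
have fg x n : rnorm (f x - g n x) <= h ^+ n / 2 * rnorm x.
  have ii : incr (fun m => (n + m)%N) by move=> m; rewrite addnS.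
  apply: rcv_le (step n ^~ x) (cv_norm (cvB (cv_sub ii (fP x)) (cv_cst (g n x)))) (rcv_cst _).
have [|x|F FE] := @mk_bop R k E (K^o : normedModType K) f (opnorm (g 0%N) + 1).
- move=> a x y; apply: cv_unique (fP _) _.
  have := cvD (cvZ a (fP x)) (fP y); congr cv; apply/funext => n.
  by rewrite (bop_linear (g n)).
- have := fg x 0%N; rewrite expr0; have := rnorm_triangle (f x) (g 0%N x) 0; rewrite !subr0.
  have := opnormP (g 0%N) x; rewrite mulrDl; have := rnorm_ge0 x; lra.
exists F => n; apply: opnorm_le => [|x]; first by rewrite divr_ge0// ltW.
by rewrite bop_subE FE.
Qed.

(* Gliding hump: [f] is built so that [|f (u (s j))|] exceeds [j]. *)
Lemma weakly_null_bounded E (u : nat -> E) : weakly_null u ->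
  exists M, forall n, rnorm (u n) <= M.
Proof.
move=> /weakly_nullP u0; apply: contrapT => nb.
have h0 n : 0 < h ^+ n by rewrite exprn_gt0// invr_gt0.
(* Half of [h ^+ j.+1 * rnorm (u n)] may be lost to later corrections; the factor 2 leaves more than
   [j.+1]. *)
have /choice[s sP] (j : nat) : exists n, 2 * j.+1%:R / h ^+ j.+1 < rnorm (u n).
  apply: contrapT => H; apply: nb; exists (2 * j.+1%:R / h ^+ j.+1) => n.
  by rewrite leNgt; apply/negP => lt; apply: H; exists n.
have /choice[t tP] (fj : dual E * nat) : exists f' : dual E,
    opnorm (f' - fj.1) <= h ^+ fj.2.+1 /\
    h ^+ fj.2.+1 * rnorm (u (s fj.2)) <= rnorm (f' (u (s fj.2))).
  case: fj => f j /=; have [g [g1 _ gu]] := norming (u (s j)).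
  have [c c1 cP] := phase2 (f (u (s j))) (kofR (h ^+ j.+1) *: g (u (s j))).
  exists (f + c *: (kofR (h ^+ j.+1) *: g)); split.
    rewrite addrAC subrr add0r !opnormZ c1 mul1r rnorm_kofR ger0_norm ?(ltW (h0 _))//.
    by rewrite ler_piMr// ltW.
  rewrite bop_addE !bop_scaleE cP gu rnormZ !rnorm_kofR !ger0_norm ?rnorm_ge0 ?(ltW (h0 _))//.
  by rewrite lerDr rnorm_ge0.
pose g := fix g n := if n is m.+1 then t (g m, m) else 0.
have [|f fP] := @dual_geometric_limit E g; first by move=> n; case: (tP (g n, n)).
have [B fB] := cauchy_bounded (cv_cauchy (u0 f)).
have [N HN] : exists N : nat, B < N.+1%:R.
  have B1 : 0 < (`|B| + 1)^-1 by rewrite invr_gt0 ltr_wpDl.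
  have [N HN] := inv_lt B1; exists N; have := HN N (leqnn _).
  rewrite ltf_pV2 ?posrE ?ltr_wpDl// => lt; apply: le_lt_trans (ler_norm B) _.
  by apply: lt_trans lt; rewrite ltrDl.
have := fB (s N); rewrite /= leNgt => /negP; apply; apply: lt_trans HN _.
have [_ /= h1] := tP (g N, N).
have h2 := opnormP1 (u (s N)) (fP N.+1); rewrite bop_subE /= in h2.
have h3 := sP N; rewrite ltr_pdivrMr// in h3.
have := rnorm_sub_le (t (g N, N) (u (s N))) (f (u (s N))).
rewrite (rnormBC (t (g N, N) (u (s N)))); move: h1 h2 h3.
move: (h ^+ N.+1) (rnorm (u (s N))) => a b; lra.
Qed.

End WeakBoundedness.

Section NoEllOne.
Context {R : realType} {k : scalar_kind}.
Notation K := (kfield R k).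
Notation dual E := (bop E (K^o : normedModType K)).
Implicit Types E : normedModType K.

Lemma delta_sum_le m L : \sum_(i < L) rnorm ((if i == m :> nat then 1 else 0) : K^o) <= 1.
Proof.
have [mL|Lm] := ltnP m L; last first.
  rewrite big1 ?ler01// => i _; rewrite ltn_eqF ?rnorm0//.
  exact: leq_trans (ltn_ord i) Lm.
rewrite (bigD1 (Ordinal mL))//= eqxx rnorm1 big1 ?addr0// => i im.
by rewrite ifF ?rnorm0//; apply: contraNF im => /eqP im; apply/eqP/val_inj.
Qed.

Lemma l1_unit_ex (m : nat) : exists w : ell1 (R := R) (k := k),
  forall n, l1coord w n = if n == m then 1 else 0.
Proof.
apply: (@mk_l1 R k (fun n => if n == m then 1 else 0) 1 ler01) => L.
exact: delta_sum_le.
Qed.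

Lemma cssub_extension E (U : closed_subspace E) (f : dual (cssub U : normedModType K)) :
  exists F : dual E, forall u : cssub U, F (cssub_val u) = f u.
Proof.
have /choice[g gP] (x : E) : exists v, forall u : cssub U, cssub_val u = x -> v = f u.
  have [[u ux]|H] := pselect (exists u : cssub U, cssub_val u = x).
    by exists (f u) => v vx; congr (f _); apply: val_inj; rewrite /= ux vx.
  by exists 0 => u ux; exfalso; apply: H; exists u.
have gE (u : cssub U) : g (cssub_val u) = f u by exact: gP.
pose A := [set cssub_val u | u in [set: cssub U]].
have [| | | |F [_ _ FE]] := @bop_extension R k E A g (opnorm f) (opnorm_ge0 f).
- by exists (cssub_val (0 : cssub U)), 0.
- by move=> a _ _ [x _ <-] [y _ <-]; exists (a *: x + y).
- move=> a _ _ [x _ <-] [y _ <-]; rewrite !gE -(bop_linear f) -gE; congr (g _).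
- by move=> _ [x _ <-]; rewrite gE; exact: opnormP.
by exists F => u; rewrite FE ?gE//; exists u.
Qed.

(** The unit vectors of [ell1] have no weakly Cauchy subsequence: on any subsequence a bounded
    functional can take alternating signs. It is transported to the copy and extended to [E]. *)
Lemma wcauchy_no_ell1 E : wcauchy_property E -> ~ contains_ell1 E.
Proof.
move=> wE [U [T [S [TS ST]]]].
have /choice[ev evE] := l1_unit_ex.
pose x m : E := cssub_val (S (ev m)).
have xM m : rnorm (x m) <= opnorm S.
  apply: (@le_trans _ _ (opnorm S * rnorm (ev m))); first exact: (opnormP S).
  rewrite ler_piMr ?opnorm_ge0//; apply: l1_norm_le => // L.
  by under eq_bigr => i _ do rewrite evE; exact: delta_sum_le.
have [s si ws] := wE x (opnorm S) xM.
have /choice[y yP] (n : nat) : exists v : K^o, rnorm v <= 1 /\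
    forall j, n = s j -> v = kofR ((-1) ^+ j).
  have [[j ->]|H] := pselect (exists j, n = s j); last first.
    by exists 0; split=> [|j nj]; [rewrite rnorm0|exfalso; apply: H; exists j].
  exists (kofR ((-1) ^+ j)); split=> [|i sij]; first by rewrite rnorm_kofR normrX normrN1 expr1n.
  have [ij|ij|->//] := ltngtP i j; have := incr_lt si ij; rewrite sij ltnn; done.
have [f fP] := l1_operator (scalar_complete (k := k)) (fun n => (yP n).1).
have fev m : f (ev m) = y m.
  apply: cv_unique (fP _) _ => e e0; exists m.+1 => n mn.
  rewrite (bigD1 (Ordinal mn))//= evE eqxx scale1r big1 ?addr0 ?subrr ?rnorm0// => i im.
  rewrite evE ifF ?scale0r//; apply: contraNF im => /eqP im; exact/eqP/val_inj.
have [F FE] := cssub_extension (bcomp f T).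
have Fx j : F (x (s j)) = kofR ((-1) ^+ j).
  by rewrite /x FE bcompE ST fev; exact: (yP _).2.
have [N HN] := ws F 1 ltr01.
have := HN N N.+1 (leqnn _) (leqnSn _); rewrite /= !Fx -kofRN -kofRD rnorm_kofR.
rewrite exprS mulN1r opprK -mulr2n normrMn normrX normrN1 expr1n; lra.
Qed.

End NoEllOne.

Section PropertyOfMIdeal.
Context {R : realType} {k : scalar_kind}.
Notation K := (kfield R k).
Notation dual E := (bop E (K^o : normedModType K)).

Lemma property_of_M_ideal (p : \bar R) (p_gt1 : (1 < p)%E) (X : normedModType K) :
  separable X ->
  let Z : normedModType K := psum (ltW p_gt1) X X in
  M_ideal (compact_op : set (bop Z Z)) ->
  [/\ metric_compact_approximation X, property_mp p X & ~ contains_ell1 X].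
Proof.
move=> sX Z mZ.
have [d dP] := separable_seq sX.
pose dZ n : Z := let ij := odflt (0, 0)%N (unpickle n : option (nat * nat)) in (d ij.1, d ij.2).
have dZP (z : Z) e : 0 < e -> exists n, rnorm (dZ n - z) < e.
  move=> e0; have e2 : 0 < e / 2 by rewrite divr_gt0.
  have [i hi] := dP z.1 _ e2; have [j hj] := dP z.2 _ e2.
  exists (pickle (i, j)); rewrite /dZ pickleK /= rnorm_psum.
  apply: le_lt_trans (norm2_add_le p_gt1 _ _) _.
  by rewrite !ger0_norm ?rnorm_ge0//=; lra.
have [S [kS S1 Scv]] := ideal_approximating_sequence mZ dZP.
have [P1 P1E] := proj1_ex p_gt1 X; have [I1 I1E] := inj1_ex p_gt1 X.
have nZ (a b : X) : rnorm ((a, b) : Z) = norm2 p (rnorm a) (rnorm b) by rewrite rnorm_psum.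
have nI x : rnorm (I1 x) = rnorm x.
  by rewrite I1E nZ rnorm0 norm2x0// ger0_norm// rnorm_ge0.
have nP z : rnorm (P1 z) <= rnorm z.
  rewrite P1E rnorm_psum; apply: le_trans (norm2_gel p_gt1 _ _).
  by rewrite ger0_norm// rnorm_ge0.
have P1I1 x : P1 (I1 x) = x by rewrite P1E I1E.
split.
- exists nat, leq, (fun n => bcomp P1 (bcomp (S n) I1)); split.
  + split=> [|i|i j l ij jl|i j]; [exact: (inhabits 0%N)|exact: leqnn|exact: leq_trans jl|].
    by exists (maxn i j); split; [exact: leq_maxl|exact: leq_maxr].
  + by move=> n; apply/compact_opP; apply: kop_comp_l; exact: kop_comp_r (kS n).
  + move=> n; apply: opnorm_le => // x; rewrite mul1r !bcompE.
    by rewrite (le_trans (nP _))// (le_trans (S1 _ _))// nI.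
  + move=> x e e0; have [N HN] := bop_cv P1 (Scv (I1 x)) e0; exists N => n Nn.
    by have := HN n Nn; rewrite /= !bcompE P1I1.
- apply: property_of_mp_limit => //; first exact: weakly_null_bounded.
  move=> x u M b c uM u0 ub uc.
  have zu n : ((x, 0) : Z) + I1 (u n) = (x + u n, 0).
    by rewrite I1E; apply: injective_projections; rewrite /= ?addr0.
  have wu n : ((0, x) : Z) + I1 (u n) = (u n, x).
    by rewrite I1E; apply: injective_projections; rewrite /= ?addr0 ?add0r.
  have Iu0 (f : dual Z) : cv (f \o (I1 \o u)) 0.
    by have := u0 (bcomp f I1); congr cv; apply/funext => n /=; rewrite bcompE.
  have IuM n : rnorm ((I1 \o u) n) <= M by rewrite /= nI.
  have zc : rcv (fun n => rnorm (((x, 0) : Z) + (I1 \o u) n)) c.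
    move: uc; congr rcv; apply/funext => n /=.
    by rewrite zu nZ rnorm0 norm2x0// ger0_norm// rnorm_ge0.
  have wc : rcv (fun n => rnorm (((0, x) : Z) + (I1 \o u) n)) (norm2 p (rnorm x) b).
    have := norm2_cv p_gt1 (rcv_cst (rnorm x)) ub; congr rcv; apply/funext => n /=.
    by rewrite wu nZ norm2C.
  (* Equality of these norms allows property (M) to be used in both directions. It identifies the
     limits after adding [(u n, 0)]: one is the limit of [rnorm (x + u n)], the other is [N] of
     [rnorm x] and [b]. *)
  have n12 : rnorm ((x, 0) : Z) = rnorm ((0, x) : Z) by rewrite !nZ norm2C.
  apply/le_anti/andP; split.
    by apply: (ideal_property_M mZ _ IuM Iu0 zc wc); rewrite n12.
  by apply: (ideal_property_M mZ _ IuM Iu0 wc zc); rewrite n12.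
- apply: wcauchy_no_ell1 => u M uM.
  have IuM n : rnorm ((I1 \o u) n) <= M by rewrite /= nI.
  have [s si ws] := ideal_wcauchy mZ kS S1 Scv IuM.
  exists s => // f; have := ws (bcomp f P1); congr cauchyseq; apply/funext => n /=.
  by rewrite bcompE P1I1.
Qed.

End PropertyOfMIdeal.

Theorem corollary4p6 (R : realType) (k : scalar_kind) (p : \bar R)
    (p_gt1 : (1 < p)%E) (X : completeNormedModType (kfield R k))
    (sepX : separable X) :
  let Z : normedModType (kfield R k) := psum (ltW p_gt1) X X in
  [<-> (* (i) *)
       M_ideal (compact_op : set (bop Z Z));
       (* (ii) *)
       [/\ metric_compact_approximation X, property_mp p X &
           ~ contains_ell1 X];
       (* (iii) *)
       metric_compact_approximation X /\
       almost_isometric_to_member (lp_models p) X].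
Proof.
move=> Z; tfae.
- exact: property_of_M_ideal.
- by move=> [mX mpX nX]; split=> //; exact: models_of_property.
- by move=> [mX aX]; exact: compact_M_ideal_of_models.
Qed.
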